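(* Let $\{A_m\}_{m\in\mathbb{Z}\setminus\{0\}}$ be complex numbers such that the two $L$-series $L_\epsilon(s)=\sum_{m=1}^\infty\frac{A_m+(-1)^\epsilon A_{-m}}{m^s}$, $\epsilon=0,1$, converge in some right half-plane $\{\Re(s)>\alpha\}$, $\alpha\ge0$, and the completed $L$-functions $\Lambda_\epsilon(s)=\gamma(s+\epsilon)L_\epsilon(s)$, with $\gamma(s)=\frac{1}{4\pi^s}\Gamma(s/2)^2$, are entire of finite order and satisfy $\Lambda_\epsilon(1-s)=(-1)^\epsilon\Lambda_\epsilon(s)$. Let $f:\mathbb{C}\setminus\mathbb{R}\to\mathbb{C}$ be $f(y)=\sum_{m>0}A_me^{2\pi i m y}$ for $\Im(y)>0$ and $f(y)=-\sum_{m<0}A_me^{2\pi imy}$ for $\Im(y)<0$. Then the restriction of $f$ to the upper half-plane $\mathbb{H}$, and likewise its restriction to the lower half-plane $\mathbb{H}_-$, is a weight-$1$ holomorphic quantum modular form for $\mathsf{SL}_2(\mathbb{Z})$.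
   Context: For $\gamma=\begin{pmatrix}a&b\\c&d\end{pmatrix}\in\mathsf{SL}_2(\mathbb{Z})$ and weight $w$, the cocycle of $f$ is $h_\gamma[f](y)=(cy+d)^{-w}f\!\left(\frac{ay+b}{cy+d}\right)-f(y)$. An analytic function $f:\mathbb{H}\to\mathbb{C}$ is a weight-$w$ holomorphic quantum modular form for a subgroup $\Gamma\subseteq\mathsf{SL}_2(\mathbb{Z})$ if for every $\gamma\in\Gamma$ the cocycle $h_\gamma[f]:\mathbb{H}\to\mathbb{C}$ extends holomorphically to $\mathbb{C}_\gamma=\{y\in\mathbb{C}: cy+d\in\mathbb{C}\setminus\mathbb{R}_{\le0}\}$. The analogous definition is used for analytic functions on the lower half-plane $\mathbb{H}_-$ (with $h_\gamma[f]:\mathbb{H}_-\to\mathbb{C}$ required to extend holomorphically to $\mathbb{C}_\gamma$). *)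

(* Defs.v *)
From Stdlib Require Import Reals ZArith.
From Coquelicot Require Import Coquelicot.

Local Open Scope R_scope.

Definition Cexp (z : C) : C :=
  (exp (Re z) * cos (Im z), exp (Re z) * sin (Im z)).

Definition Cpow_pos (x : R) (s : C) : C := Cexp (Cmult s (RtoC (ln x))).

Fixpoint Cpown (z : C) (n : nat) : C :=
  match n with O => RtoC 1 | S n => Cmult z (Cpown z n) end.
Definition Cpowz (z : C) (w : Z) : C :=
  match w with
  | Z0 => RtoC 1
  | Zpos p => Cpown z (Pos.to_nat p)
  | Zneg p => Cinv (Cpown z (Pos.to_nat p))
  end.

Definition CGamma (s : C) : C :=
  @RInt_gen C_R_CompleteNormedModule
    (fun t => Cmult (Cpow_pos t (Cminus s (RtoC 1))) (RtoC (exp (- t))))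
    (at_right 0) (Rbar_locally p_infty).

Definition gammaFactor (s : C) : C :=
  Cmult (Cinv (Cmult (RtoC 4) (Cpow_pos PI s)))
        (Cpown (CGamma (Cdiv s (RtoC 2))) 2).

Definition e2pi (z : C) : C := Cexp (Cmult (0, 2 * PI) z).

Definition holo_on (U : C -> Prop) (g : C -> C) : Prop :=
  forall z, U z -> @ex_derive C_AbsRing C_NormedModule g z.

Definition entire (g : C -> C) : Prop := holo_on (fun _ => True) g.

Definition finite_order (g : C -> C) : Prop :=
  exists rho R0 : R, forall s, Cmod s > R0 -> Cmod (g s) <= exp (Rpower (Cmod s) rho).

Definition CSeries (a : nat -> C) : C :=
  (Series (fun n => Re (a n)), Series (fun n => Im (a n))).

Definition ex_Cseries (a : nat -> C) : Prop := @ex_series C_AbsRing C_NormedModule a.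

Definition UHP (y : C) : Prop := Im y > 0.
Definition LHP (y : C) : Prop := Im y < 0.

Definition SL2Z (a b c d : Z) : Prop := (a * d - b * c = 1)%Z.

Definition Cgamma (c d : Z) (y : C) : Prop :=
  let u := Cplus (Cmult (RtoC (IZR c)) y) (RtoC (IZR d)) in
  ~ (Im u = 0 /\ Re u <= 0).

Definition cocycle (w : Z) (a b c d : Z) (f : C -> C) (y : C) : C :=
  let u := Cplus (Cmult (RtoC (IZR c)) y) (RtoC (IZR d)) in
  Cminus (Cmult (Cpowz u (- w)) (f (Cdiv (Cplus (Cmult (RtoC (IZR a)) y) (RtoC (IZR b))) u)))
         (f y).

Definition holQMF (D : C -> Prop) (w : Z) (Gam : Z -> Z -> Z -> Z -> Prop)
  (f : C -> C) : Prop :=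
  holo_on D f /\
  forall a b c d, Gam a b c d ->
    exists g : C -> C, holo_on (Cgamma c d) g /\
      (forall y, D y -> Cgamma c d y -> g y = cocycle w a b c d f y).

Definition epsC (eps : bool) : C := RtoC (if eps then 1 else 0).
Definition epsSign (eps : bool) : C := RtoC (if eps then -1 else 1).

Definition Lterm (A : Z -> C) (eps : bool) (s : C) (n : nat) : C :=
  let m := Z.of_nat (S n) in
  Cmult (Cplus (A m) (Cmult (epsSign eps) (A (- m)%Z)))
        (Cpow_pos (INR (S n)) (Copp s)).

Definition upTerm (A : Z -> C) (y : C) (n : nat) : C :=
  Cmult (A (Z.of_nat (S n))) (e2pi (Cmult (RtoC (INR (S n))) y)).
Definition lowTerm (A : Z -> C) (y : C) (n : nat) : C :=
  Cmult (A (- Z.of_nat (S n))%Z) (e2pi (Cmult (RtoC (- INR (S n))) y)).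

Definition fA (A : Z -> C) (y : C) : C :=
  if Rlt_dec 0 (Im y) then CSeries (upTerm A y) else Copp (CSeries (lowTerm A y)).

(* Main.v *)
Require Import Defs.
From Stdlib Require Import Reals ZArith Lra Lia Psatz Classical IndefiniteDescription.
From Coquelicot Require Import Coquelicot.

(** By Hecke's converse theorem the functional equations of the two L-series are
equivalent to [g_0 (1/v) = v g_0 v] and [g_1 (1/v) = - v g_1 v] for the Bessel series
[g_0 v = sum a_n K_0 (2 pi n v)] and [g_1 v = sum b_n n v K_0 (2 pi n v)], with
[a_n = A_n + A_(-n)] and [b_n = A_n - A_(-n)].  Since the integrals over the real line of
[w cosh b K_0 (w cosh b)] and [w K_1 (w cosh b)] are multiples of [exp (-w)], the parts
of [f] even and odd under [y -> -y] are integrals of [g_1 (w cosh b)] and of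
[w g_0' (w cosh b)], with [w = -iy] for [Im y > 0] and [w = iy] for [Im y < 0].
The integrals of [g_1 (y sinh a)] and of [y g_0' (y sinh a)] over [a > 0] are
holomorphic for [Re y > 0], and rotating the path to the lines [a -+ i pi/2] shows that
they equal multiples of [f y - f (-1/y) / y] for the two parts, in both quadrants.
Hence the cocycle of [S] extends to the slit plane; since [f] is periodic, the Euclidean
algorithm on the lower row gives all other cocycles. *)

Local Open Scope R_scope.

(** * Complex derivatives and integrals along the line *)

(** The hypotheses give finite order only and no decay of the completed L-functions on vertical
    lines, so the Mellin transform is not inverted. Instead, for every angle, the Mellin integrals
    over t > 1 are subtracted from the rotated transform. The remainder is entire, it is a Laplace
    transform of the failure of modularity when Re s is large, and it is small on both edges of wide
    strips. Phragmen-Lindelof makes it vanish, and a uniqueness theorem for moments gives the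
    inversion formula at complex points of the half-plane, not just on the positive axis. That
    generality is essential: a Bessel series is a priori only bounded by a power of 1/Re v near the
    imaginary axis, and the inversion turns its decay at infinity into decay at 0 in sectors. This
    makes the integrals over a > 0 converge for complex y and lets the path turn by a right angle
    with its corner at the singular point 0. The direction of the turn follows the sign of Im y, so
    one holomorphic integral serves both quadrants. A second period function, that of f(-y), is
    prepared for matrices whose lower left entry is negative. *)

Definition CI (q : R -> C) (a b : R) : C := @RInt C_R_CompleteNormedModule q a b.

Notation exI := (@ex_RInt C_R_NormedModule).

Notation isCI := (@is_RInt C_R_NormedModule).

Notation ccont := (@continuous R_UniformSpace C_UniformSpace).

Lemma Cmod_minus_sym (x y : C) : Cmod (x - y)%C = Cmod (y - x)%C.
Proof. rewrite <- Cmod_opp. f_equal. ring. Qed.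

Lemma Cmod_tri_minus (x y : C) : Cmod (x - y)%C <= Cmod x + Cmod y.
Proof. unfold Cminus. rewrite <- (Cmod_opp y). apply Cmod_triangle. Qed.

Lemma Cmod_tri_rev (x y : C) : Cmod x - Cmod y <= Cmod (x - y)%C.
Proof.
  replace x with ((x - y) + y)%C at 1 by ring.
  generalize (Cmod_triangle (x - y)%C y). lra.
Qed.

Lemma Cmod_tri_plus_rev (x y : C) : Cmod x - Cmod y <= Cmod (x + y)%C.
Proof.
  replace (x + y)%C with (x - (- y))%C by ring.
  rewrite <- (Cmod_opp y). apply Cmod_tri_rev.
Qed.

Lemma im_le_Cmod (c : C) : Rabs (Im c) <= Cmod c.
Proof. eapply Rle_trans; [ apply Rmax_r | apply Rmax_Cmod ]. Qed.

Lemma Cmod_le_ReIm (c : C) : Cmod c <= Rabs (Re c) + Rabs (Im c).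
Proof.
  destruct c as [x y]. simpl.
  replace (x, y) with (RtoC x + RtoC y * Ci)%C.
  - eapply Rle_trans; [ apply Cmod_triangle |].
    rewrite Cmod_mult, Cmod_Ci, !Cmod_R. lra.
  - unfold RtoC, Ci, Cplus, Cmult. simpl. f_equal; ring.
Qed.

Lemma Cmod_RtoC_pos (x : R) : 0 <= x -> Cmod (RtoC x) = x.
Proof. intros. rewrite Cmod_R. now apply Rabs_pos_eq. Qed.

Lemma Cmod_neq0 (z : C) : z <> 0 -> 0 < Cmod z.
Proof. intros. now apply Cmod_gt_0. Qed.

Lemma Cmod_le_eps_eq (x y : C) : (forall eps, 0 < eps -> Cmod (x - y)%C <= eps) -> x = y.
Proof.
  intros H. assert (x - y = 0)%C.
  { apply Cmod_eq_0. apply Rle_antisym; [| apply Cmod_ge_0 ].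
    apply le_epsilon. intros e He. rewrite Rplus_0_l. auto. }
  replace x with ((x - y) + y)%C by ring. rewrite H0. ring.
Qed.

Lemma RtoC_neq0 (x : R) : x <> 0 -> RtoC x <> 0.
Proof. intros H E. apply H. now injection E. Qed.

Lemma Re_neq0 (z : C) : Re z <> 0 -> z <> 0.
Proof. intros H E. apply H. rewrite E. reflexivity. Qed.

Lemma Im_neq0 (z : C) : Im z <> 0 -> z <> 0.
Proof. intros H E. apply H. rewrite E. reflexivity. Qed.

Lemma Ceq (z w : C) : Re z = Re w -> Im z = Im w -> z = w.
Proof. destruct z, w. simpl. congruence. Qed.

Lemma Re_plus (z w : C) : Re (z + w)%C = Re z + Re w.
Proof. reflexivity. Qed.

Lemma Im_plus (z w : C) : Im (z + w)%C = Im z + Im w.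
Proof. reflexivity. Qed.

Lemma Re_opp (z : C) : Re (- z)%C = - Re z.
Proof. reflexivity. Qed.

Lemma Im_opp (z : C) : Im (- z)%C = - Im z.
Proof. reflexivity. Qed.

Lemma Re_minus (z w : C) : Re (z - w)%C = Re z - Re w.
Proof. reflexivity. Qed.

Lemma Im_minus (z w : C) : Im (z - w)%C = Im z - Im w.
Proof. reflexivity. Qed.

Lemma Re_mult (z w : C) : Re (z * w)%C = Re z * Re w - Im z * Im w.
Proof. reflexivity. Qed.

Lemma Im_mult (z w : C) : Im (z * w)%C = Re z * Im w + Im z * Re w.
Proof. reflexivity. Qed.

Lemma Re_RtoC (x : R) : Re (RtoC x) = x.
Proof. reflexivity. Qed.

Lemma Im_RtoC (x : R) : Im (RtoC x) = 0.
Proof. reflexivity. Qed.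

Lemma Re_Ci : Re Ci = 0.
Proof. reflexivity. Qed.

Lemma Im_Ci : Im Ci = 1.
Proof. reflexivity. Qed.

Lemma Re_pair (x y : R) : Re (x, y) = x.
Proof. reflexivity. Qed.

Lemma Im_pair (x y : R) : Im (x, y) = y.
Proof. reflexivity. Qed.

Create HintDb reim.
Global Hint Rewrite Re_plus Im_plus Re_opp Im_opp Re_minus Im_minus Re_mult Im_mult
  Re_RtoC Im_RtoC Re_Ci Im_Ci Re_pair Im_pair : reim.

Ltac reim := autorewrite with reim.

Ltac Csolve := apply Ceq; reim; try ring.

Lemma Re_inv (z : C) : z <> 0 -> Re (/ z)%C = Re z / Cmod z ^ 2.
Proof. intros. rewrite Cmod2_alt. destruct z. reflexivity. Qed.

Lemma Im_inv (z : C) : z <> 0 -> Im (/ z)%C = - Im z / Cmod z ^ 2.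
Proof. intros. rewrite Cmod2_alt. destruct z. reflexivity. Qed.

Lemma Cexp_add (z w : C) : Cexp (z + w) = (Cexp z * Cexp w)%C.
Proof.
  unfold Cexp. apply Ceq; reim; rewrite exp_plus; [ rewrite cos_plus | rewrite sin_plus ]; ring.
Qed.

Lemma Cexp_0 : Cexp 0 = 1.
Proof. unfold Cexp. apply Ceq; reim; rewrite exp_0, ?cos_0, ?sin_0; ring. Qed.

Lemma Cexp_RtoC (x : R) : Cexp (RtoC x) = RtoC (exp x).
Proof. unfold Cexp. apply Ceq; reim; rewrite ?cos_0, ?sin_0; ring. Qed.

Lemma Cmod_Cexp (z : C) : Cmod (Cexp z) = exp (Re z).
Proof.
  unfold Cmod, Cexp. simpl.
  replace (_ + _) with (Rsqr (exp (Re z))).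
  - apply sqrt_Rsqr. left. apply exp_pos.
  - generalize (sin2_cos2 (Im z)). unfold Rsqr. intros H.
    transitivity (exp (Re z) * exp (Re z) * (sin (Im z) * sin (Im z) + cos (Im z) * cos (Im z))).
    + rewrite H. ring.
    + ring.
Qed.

Lemma Cexp_neq0 (z : C) : Cexp z <> 0.
Proof. apply Cmod_gt_0. rewrite Cmod_Cexp. apply exp_pos. Qed.

Lemma Cexp_opp (z : C) : Cexp (- z) = (/ Cexp z)%C.
Proof.
  assert (H : (Cexp z * Cexp (- z) = 1)%C).
  { rewrite <- Cexp_add. replace (z + - z)%C with (RtoC 0) by ring. apply Cexp_0. }
  generalize (Cexp_neq0 z). intros Hz.
  transitivity (/ Cexp z * (Cexp z * Cexp (- z)))%C.
  - field. auto.
  - rewrite H. ring.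
Qed.

Lemma Cexp_Im (t : R) : Cexp (Ci * RtoC t) = (cos t, sin t).
Proof.
  unfold Cexp. apply Ceq; reim; replace (0 * t - 1 * 0) with 0 by ring; rewrite exp_0;
  replace (0 * 0 + 1 * t) with t by ring; ring.
Qed.

(** The bound is non-strict and covers [h = 0], so that estimates compose without dividing by [h];
    [cder_is_derive] identifies this with the derivative used in the statement. *)
Definition cder (f : C -> C) (z l : C) : Prop :=
  forall eps, 0 < eps -> exists delta, 0 < delta /\
    forall h, Cmod h < delta -> Cmod (f (z + h)%C - f z - l * h)%C <= eps * Cmod h.

Lemma cder_is_derive (f : C -> C) (z l : C) :
  cder f z l <-> @is_derive C_AbsRing C_NormedModule f z l.
Proof.
  split; intros H.
  - split; [ apply is_linear_scal_l |].
    intros x Hx eps.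
    replace x with z by now apply (@is_filter_lim_locally_unique C_AbsRing (AbsRing_NormedModule C_AbsRing)).
    destruct (H eps (cond_pos eps)) as [d [Hd Hh]].
    assert (aux : forall y : C, Cmod (y - z)%C < d ->
      Cmod (f y - f z - (y - z) * l)%C <= eps * Cmod (y - z)%C).
    { intros y E. specialize (Hh _ E). replace (z + (y - z))%C with y in Hh by ring.
      now replace ((y - z) * l)%C with (l * (y - z))%C by ring. }
    exists (mkposreal d Hd). intros y Hy. apply aux, Hy.
  - intros eps Heps. destruct H as [_ H].
    assert (Hz : is_filter_lim (@locally (AbsRing_UniformSpace C_AbsRing) z) z) by (intros P HP; exact HP).
    destruct (H z Hz (mkposreal eps Heps)) as [d Hd].
    exists d. split; [ apply cond_pos |]. intros h Hh.
    assert (E : @ball (AbsRing_UniformSpace C_AbsRing) z d (z + h)%C).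
    { change (Cmod (z + h - z)%C < d). now replace (z + h - z)%C with h by ring. }
    specialize (Hd _ E).
    change (Cmod (f (z + h) - f z - (z + h - z) * l)%C <= eps * Cmod (z + h - z)%C) in Hd.
    replace (z + h - z)%C with h in Hd by ring.
    now replace (l * h)%C with (h * l)%C by ring.
Qed.

Definition cdiff (f : C -> C) (z : C) : Prop := exists l, cder f z l.

Lemma cdiff_ex_derive (f : C -> C) (z : C) :
  cdiff f z <-> @ex_derive C_AbsRing C_NormedModule f z.
Proof. split; intros [l H]; exists l; now apply cder_is_derive. Qed.

Lemma cder_ext_loc (f g : C -> C) (z l : C) (r : R) : 0 < r ->
  (forall u, Cmod (u - z)%C < r -> f u = g u) -> cder f z l -> cder g z l.
Proof.
  intros Hr E H eps Heps. destruct (H eps Heps) as [d [Hd Hh]].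
  exists (Rmin d r). split; [ now apply Rmin_pos |]. intros h Hm.
  rewrite <- !E.
  - apply Hh. eapply Rlt_le_trans; [ apply Hm | apply Rmin_l ].
  - replace (z - z)%C with (RtoC 0) by ring. now rewrite Cmod_0.
  - replace (z + h - z)%C with h by ring. eapply Rlt_le_trans; [ apply Hm | apply Rmin_r ].
Qed.

Lemma cder_ext (f g : C -> C) (z l : C) : (forall u, f u = g u) -> cder f z l -> cder g z l.
Proof. intros E. apply (cder_ext_loc f g z l 1); auto. lra. Qed.

Lemma cdiff_ext_loc (f g : C -> C) (z : C) (r : R) : 0 < r ->
  (forall u, Cmod (u - z)%C < r -> f u = g u) -> cdiff f z -> cdiff g z.
Proof. intros Hr E [l H]. exists l. eapply cder_ext_loc; eauto. Qed.

Lemma cdiff_ext (f g : C -> C) (z : C) : (forall u, f u = g u) -> cdiff f z -> cdiff g z.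
Proof. intros E [l H]. exists l. eapply cder_ext; eauto. Qed.

Lemma cder_const (c z : C) : cder (fun _ => c) z 0.
Proof.
  intros eps H. exists 1. split; [ lra |]. intros h _.
  replace (c - c - 0 * h)%C with (RtoC 0) by ring. rewrite Cmod_0.
  apply Rmult_le_pos; [ lra | apply Cmod_ge_0 ].
Qed.

Lemma cder_id (z : C) : cder (fun u => u) z 1.
Proof.
  intros eps H. exists 1. split; [ lra |]. intros h _.
  replace (z + h - z - 1 * h)%C with (RtoC 0) by ring. rewrite Cmod_0.
  apply Rmult_le_pos; [ lra | apply Cmod_ge_0 ].
Qed.

Lemma cder_plus f g z a b : cder f z a -> cder g z b -> cder (fun u => f u + g u)%C z (a + b)%C.
Proof.
  intros Hf Hg eps He.
  destruct (Hf (eps / 2)) as [d1 [H1 K1]]; [ lra |].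
  destruct (Hg (eps / 2)) as [d2 [H2 K2]]; [ lra |].
  exists (Rmin d1 d2). split; [ now apply Rmin_pos |]. intros h Hh.
  assert (Cmod h < d1 /\ Cmod h < d2) as [E1 E2].
  { split; (eapply Rlt_le_trans; [ apply Hh |]); [ apply Rmin_l | apply Rmin_r ]. }
  specialize (K1 h E1). specialize (K2 h E2).
  replace (f (z + h) + g (z + h) - (f z + g z) - (a + b) * h)%C
    with ((f (z + h) - f z - a * h) + (g (z + h) - g z - b * h))%C by ring.
  eapply Rle_trans; [ apply Cmod_triangle |]. lra.
Qed.

Lemma cder_cont f z l : cder f z l ->
  forall eps, 0 < eps -> exists delta, 0 < delta /\
    forall u, Cmod (u - z)%C < delta -> Cmod (f u - f z)%C < eps.
Proof.
  intros H eps He. destruct (H 1) as [d [Hd K]]; [ lra |].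
  assert (P : 0 < 1 + Cmod l) by (generalize (Cmod_ge_0 l); lra).
  exists (Rmin d (eps / (1 + Cmod l) / 2)).
  split.
  - apply Rmin_pos; auto. apply Rdiv_lt_0_compat; [| lra ]. now apply Rdiv_lt_0_compat.
  - intros u Hu.
    assert (E1 : Cmod (u - z)%C < d) by (eapply Rlt_le_trans; [ apply Hu | apply Rmin_l ]).
    assert (E2 : Cmod (u - z)%C < eps / (1 + Cmod l) / 2) by (eapply Rlt_le_trans; [ apply Hu | apply Rmin_r ]).
    specialize (K _ E1). replace (z + (u - z))%C with u in K by ring.
    replace (f u - f z)%C with ((f u - f z - l * (u - z)) + l * (u - z))%C by ring.
    eapply Rle_lt_trans; [ apply Cmod_triangle |]. rewrite Cmod_mult.
    apply Rle_lt_trans with ((1 + Cmod l) * Cmod (u - z)%C); [ lra |].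
    apply Rle_lt_trans with ((1 + Cmod l) * (eps / (1 + Cmod l) / 2)).
    + apply Rmult_le_compat_l; lra.
    + replace ((1 + Cmod l) * (eps / (1 + Cmod l) / 2)) with (eps / 2) by (field; lra). lra.
Qed.

Lemma cder_mult f g z a b : cder f z a -> cder g z b ->
  cder (fun u => f u * g u)%C z (a * g z + f z * b)%C.
Proof.
  intros Hf Hg eps He.
  set (A := Cmod (f z) + Cmod (g z) + Cmod a + 2).
  assert (PA : 0 < A).
  { unfold A. generalize (Cmod_ge_0 (f z)) (Cmod_ge_0 (g z)) (Cmod_ge_0 a). lra. }
  assert (Q : 0 < eps / (4 * A)) by (apply Rdiv_lt_0_compat; lra).
  destruct (Hf (Rmin 1 (eps / (4 * A)))) as [d1 [H1 K1]]; [ apply Rmin_pos; lra |].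
  destruct (Hg (eps / (4 * A))) as [d2 [H2 K2]]; [ lra |].
  destruct (cder_cont g z b Hg (Rmin 1 (eps / (4 * A)))) as [d3 [H3 K3]]; [ apply Rmin_pos; lra |].
  exists (Rmin d1 (Rmin d2 d3)). split; [ repeat apply Rmin_pos; auto |]. intros h Hh.
  assert (E1 : Cmod h < d1) by (eapply Rlt_le_trans; [ apply Hh | apply Rmin_l ]).
  assert (E2 : Cmod h < d2).
  { eapply Rlt_le_trans; [ apply Hh |]. eapply Rle_trans; [ apply Rmin_r | apply Rmin_l ]. }
  assert (E3 : Cmod (z + h - z)%C < d3).
  { replace (z + h - z)%C with h by ring.
    eapply Rlt_le_trans; [ apply Hh |]. eapply Rle_trans; [ apply Rmin_r | apply Rmin_r ]. }
  specialize (K1 _ E1). specialize (K2 _ E2). specialize (K3 _ E3).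
  set (u := (f (z + h) - f z - a * h)%C) in *.
  set (v := (g (z + h) - g z - b * h)%C) in *.
  set (w := (g (z + h) - g z)%C) in *.
  replace (f (z + h) * g (z + h) - f z * g z - (a * g z + f z * b) * h)%C
    with (u * (g z + w) + a * h * w + f z * v)%C by (unfold u, v, w; ring).
  generalize (Rmin_l 1 (eps / (4 * A))) (Rmin_r 1 (eps / (4 * A))). intros M1 M2.
  set (m := Rmin 1 (eps / (4 * A))) in *. set (q := eps / (4 * A)) in *.
  eapply Rle_trans; [ apply Cmod_triangle |].
  eapply Rle_trans; [ apply Rplus_le_compat_r, Cmod_triangle |].
  rewrite !Cmod_mult.
  assert (T : Cmod (g z + w)%C <= Cmod (g z) + 1).
  { eapply Rle_trans; [ apply Cmod_triangle |]. lra. }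
  generalize (Cmod_ge_0 u) (Cmod_ge_0 v) (Cmod_ge_0 w) (Cmod_ge_0 h) (Cmod_ge_0 (g z + w)%C)
    (Cmod_ge_0 (f z)) (Cmod_ge_0 (g z)) (Cmod_ge_0 a). intros.
  assert (S1 : Cmod u * Cmod (g z + w)%C <= q * Cmod h * A).
  { apply Rmult_le_compat; auto; [| unfold A; lra ].
    eapply Rle_trans; [ apply K1 |]. now apply Rmult_le_compat_r. }
  assert (S2 : Cmod a * Cmod h * Cmod w <= A * Cmod h * q).
  { apply Rmult_le_compat; auto.
    - now apply Rmult_le_pos.
    - apply Rmult_le_compat_r; auto. unfold A; lra.
    - lra. }
  assert (S3 : Cmod (f z) * Cmod v <= A * (q * Cmod h)).
  { apply Rmult_le_compat; auto. unfold A; lra. }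
  apply Rle_trans with (3 * (q * A) * Cmod h); [ lra |].
  apply Rmult_le_compat_r; auto. unfold q. replace (eps / (4 * A) * A) with (eps / 4) by (field; lra). lra.
Qed.

Lemma cder_comp f g z a b : cder g z a -> cder f (g z) b -> cder (fun u => f (g u)) z (b * a)%C.
Proof.
  intros Hg Hf eps He.
  set (A := Cmod a + Cmod b + 2).
  assert (PA : 0 < A) by (unfold A; generalize (Cmod_ge_0 a) (Cmod_ge_0 b); lra).
  assert (Q : 0 < eps / (2 * A)) by (apply Rdiv_lt_0_compat; lra).
  destruct (Hf (eps / (2 * A)) Q) as [d1 [H1 K1]].
  destruct (Hg (Rmin 1 (eps / (2 * A)))) as [d2 [H2 K2]]; [ apply Rmin_pos; lra |].
  destruct (cder_cont g z a Hg d1 H1) as [d3 [H3 K3]].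
  exists (Rmin d2 d3). split; [ now apply Rmin_pos |]. intros h Hh.
  assert (E2 : Cmod h < d2) by (eapply Rlt_le_trans; [ apply Hh | apply Rmin_l ]).
  assert (E3 : Cmod (z + h - z)%C < d3).
  { replace (z + h - z)%C with h by ring. eapply Rlt_le_trans; [ apply Hh | apply Rmin_r ]. }
  specialize (K2 _ E2). specialize (K3 _ E3).
  set (k := (g (z + h) - g z)%C) in *.
  specialize (K1 k K3). replace (g z + k)%C with (g (z + h)%C) in K1 by (unfold k; ring).
  set (q := eps / (2 * A)) in *.
  generalize (Rmin_l 1 q) (Rmin_r 1 q). intros M1 M2.
  set (u := (k - a * h)%C) in *. set (v := (f (g (z + h)) - f (g z) - b * k)%C) in *.
  assert (Ek : k = (u + a * h)%C) by (unfold u; ring).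
  replace (f (g (z + h)) - f (g z) - b * a * h)%C with (v + b * u)%C by (unfold v, u; ring).
  generalize (Cmod_ge_0 u) (Cmod_ge_0 v) (Cmod_ge_0 h) (Cmod_ge_0 k) (Cmod_ge_0 a) (Cmod_ge_0 b). intros.
  assert (Hk : Cmod k <= (1 + Cmod a) * Cmod h).
  { rewrite Ek. eapply Rle_trans; [ apply Cmod_triangle |]. rewrite Cmod_mult.
    assert (Rmin 1 q * Cmod h <= 1 * Cmod h) by now apply Rmult_le_compat_r.
    lra. }
  eapply Rle_trans; [ apply Cmod_triangle |]. rewrite Cmod_mult.
  assert (S1 : Cmod v <= q * (A * Cmod h)).
  { eapply Rle_trans; [ apply K1 |]. apply Rmult_le_compat_l; [ lra |].
    eapply Rle_trans; [ apply Hk |]. apply Rmult_le_compat_r; auto. unfold A; lra. }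
  assert (S2 : Cmod b * Cmod u <= A * (q * Cmod h)).
  { apply Rmult_le_compat; auto; [ unfold A; lra |].
    eapply Rle_trans; [ apply K2 |]. now apply Rmult_le_compat_r. }
  apply Rle_trans with (2 * (q * A) * Cmod h); [ lra |].
  apply Rmult_le_compat_r; auto. unfold q. replace (eps / (2 * A) * A) with (eps / 2) by (field; lra). lra.
Qed.

Lemma cder_inv (z : C) : z <> 0 -> cder Cinv z (- / (z * z))%C.
Proof.
  intros Hz eps He.
  assert (P : 0 < Cmod z) by now apply Cmod_gt_0.
  assert (P3 : 0 < Cmod z ^ 3) by now apply pow_lt.
  exists (Rmin (Cmod z / 2) (eps * Cmod z ^ 3 / 2)). split.
  - apply Rmin_pos; [ lra |]. apply Rdiv_lt_0_compat; [| lra ]. now apply Rmult_lt_0_compat.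
  - intros h Hh.
    assert (E1 : Cmod h < Cmod z / 2) by (eapply Rlt_le_trans; [ apply Hh | apply Rmin_l ]).
    assert (E2 : Cmod h < eps * Cmod z ^ 3 / 2) by (eapply Rlt_le_trans; [ apply Hh | apply Rmin_r ]).
    assert (Q : Cmod z / 2 <= Cmod (z + h)%C) by (generalize (Cmod_tri_plus_rev z h); lra).
    assert (Hzh : (z + h)%C <> 0) by (apply Cmod_gt_0; lra).
    (* The error is exactly h^2 / ((z + h) z^2), and [Cmod (z + h)] is at least [Cmod z / 2] on the
       chosen ball. *)
    replace (/ (z + h) - / z - (- / (z * z)) * h)%C with (h * h * / ((z + h) * z * z))%C.
    2:{ field. split; auto. }
    assert (D : ((z + h) * z * z)%C <> 0) by (repeat apply Cmult_neq_0; auto).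
    rewrite !Cmod_mult, Cmod_inv by auto. rewrite !Cmod_mult.
    rewrite Rmult_assoc. rewrite (Rmult_comm eps). apply Rmult_le_compat_l; [ apply Cmod_ge_0 |].
    apply (Rmult_le_reg_r (Cmod (z + h)%C * Cmod z * Cmod z)).
    { repeat apply Rmult_lt_0_compat; lra. }
    rewrite Rmult_assoc, Rinv_l, Rmult_1_r.
    2:{ apply Rgt_not_eq. repeat apply Rmult_lt_0_compat; lra. }
    apply Rle_trans with (eps * (Cmod z / 2 * Cmod z * Cmod z)).
    + left. simpl in E2. lra.
    + apply Rmult_le_compat_l; [ lra |]. repeat apply Rmult_le_compat_r; lra.
Qed.

Lemma real_small_error (f : R -> R) l : derivable_pt_lim f 0 l -> forall eps, 0 < eps ->
  exists d, 0 < d /\ forall h, Rabs h < d -> Rabs (f h - f 0 - l * h) <= eps * Rabs h.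
Proof.
  intros H eps He. destruct (H eps He) as [d Hd]. exists d. split; [ apply cond_pos |].
  intros h Hh. destruct (Req_dec h 0) as [-> | N].
  - replace (f 0 - f 0 - l * 0) with 0 by ring. rewrite Rabs_R0. lra.
  - specialize (Hd h N Hh). rewrite Rplus_0_l in Hd.
    replace (f h - f 0 - l * h) with (((f h - f 0) / h - l) * h) by (field; auto).
    rewrite Rabs_mult. apply Rmult_le_compat_r; [ apply Rabs_pos | lra ].
Qed.

(** Real derivatives of exp, sin and cos are used at the origin alone; the addition formula moves
    the result to every other point in [cder_Cexp]. *)
Lemma cder_Cexp_0 : cder Cexp 0 1.
Proof.
  intros eps He.
  set (e := Rmin 1 (eps / 8)).
  assert (Pe : 0 < e) by (apply Rmin_pos; lra).
  assert (e <= 1 /\ e <= eps / 8) as [L1 L2] by (split; [ apply Rmin_l | apply Rmin_r ]).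
  destruct (real_small_error exp 1) with (eps := e) as [d1 [H1 K1]]; auto.
  { rewrite <- exp_0. apply derivable_pt_lim_exp. }
  destruct (real_small_error sin 1) with (eps := e) as [d2 [H2 K2]]; auto.
  { rewrite <- cos_0. apply derivable_pt_lim_sin. }
  destruct (real_small_error cos 0) with (eps := e) as [d3 [H3 K3]]; auto.
  { replace 0 with (- sin 0) at 2 by (rewrite sin_0; ring). apply derivable_pt_lim_cos. }
  exists (Rmin (Rmin d1 (eps / 8)) (Rmin d2 (Rmin d3 (/ 4)))).
  split; [ repeat apply Rmin_pos; lra |].
  intros [a b] Hh.
  assert (Cmod (a, b) < d1 /\ Cmod (a, b) < eps / 8 /\ Cmod (a,b) < d2 /\ Cmod (a,b) < d3 /\ Cmod (a,b) < / 4)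
    as (E1 & E2 & E3 & E4 & E5).
  { repeat split; (eapply Rlt_le_trans; [ apply Hh |]).
    - eapply Rle_trans; apply Rmin_l.
    - eapply Rle_trans; [ apply Rmin_l | apply Rmin_r ].
    - eapply Rle_trans; [ apply Rmin_r | apply Rmin_l ].
    - eapply Rle_trans; [ apply Rmin_r |]. eapply Rle_trans; [ apply Rmin_r | apply Rmin_l ].
    - eapply Rle_trans; [ apply Rmin_r |]. eapply Rle_trans; [ apply Rmin_r | apply Rmin_r ]. }
  generalize (re_le_Cmod (a, b)) (im_le_Cmod (a, b)). simpl Re. simpl Im. intros Ra Rb.
  set (m := Cmod (a, b)) in *.
  assert (Ka := K1 a ltac:(lra)). assert (Kb := K2 b ltac:(lra)). assert (Kc := K3 b ltac:(lra)).
  rewrite exp_0 in Ka. rewrite sin_0 in Kb. rewrite cos_0 in Kc.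
  replace (0 + (a, b))%C with (a, b) by (apply Ceq; reim; ring). rewrite Cexp_0.
  eapply Rle_trans; [ apply Cmod_le_ReIm |].
  unfold Cexp. reim.
  set (ea := exp a - 1 - 1 * a) in *. set (sb := sin b - 0 - 1 * b) in *. set (cb := cos b - 1 - 0 * b) in *.
  replace (exp a * cos b - 1 - (1 * a - 0 * b)) with ((1 + a + ea) * cb + ea) by (unfold ea, cb; ring).
  replace (exp a * sin b - 0 - (1 * b + 0 * a)) with ((1 + a + ea) * sb + b * (a + ea)) by (unfold ea, sb; ring).
  assert (Pm : 0 <= m) by apply Cmod_ge_0.
  assert (Qa : Rabs ea <= e * m).
  { eapply Rle_trans; [ apply Ka |]. apply Rmult_le_compat_l; lra. }
  assert (Qb : Rabs sb <= e * m).
  { eapply Rle_trans; [ apply Kb |]. apply Rmult_le_compat_l; lra. }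
  assert (Qc : Rabs cb <= e * m).
  { eapply Rle_trans; [ apply Kc |]. apply Rmult_le_compat_l; lra. }
  assert (em : e * m <= m) by nra.
  assert (Qx : Rabs (1 + a + ea) <= 2).
  { eapply Rle_trans; [ apply Rabs_triang |]. generalize (Rabs_triang 1 a). rewrite Rabs_R1. lra. }
  assert (Qy : Rabs (a + ea) <= 2 * m).
  { eapply Rle_trans; [ apply Rabs_triang |]. lra. }
  assert (S1 : Rabs ((1 + a + ea) * cb + ea) <= 2 * (e * m) + e * m).
  { eapply Rle_trans; [ apply Rabs_triang |]. rewrite Rabs_mult.
    apply Rplus_le_compat; auto. apply Rmult_le_compat; auto using Rabs_pos. }
  assert (S2 : Rabs ((1 + a + ea) * sb + b * (a + ea)) <= 2 * (e * m) + m * (2 * m)).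
  { eapply Rle_trans; [ apply Rabs_triang |]. rewrite !Rabs_mult.
    apply Rplus_le_compat; apply Rmult_le_compat; auto using Rabs_pos. }
  nra.
Qed.

Lemma cder_Cexp z : cder Cexp z (Cexp z).
Proof.
  assert (H : cder (fun u => Cexp z * Cexp (u + - z))%C z (0 * Cexp (z + - z) + Cexp z * (1 * (1 + 0)))%C).
  { apply (cder_mult (fun _ => Cexp z) (fun u => Cexp (u + - z)%C)).
    - apply cder_const.
    - apply (cder_comp Cexp (fun u => (u + - z)%C)).
      + apply (cder_plus (fun u => u) (fun _ => (- z)%C)); [ apply cder_id | apply cder_const ].
      + replace (z + - z)%C with (RtoC 0) by ring. apply cder_Cexp_0. }
  replace (0 * Cexp (z + - z) + Cexp z * (1 * (1 + 0)))%C with (Cexp z) in H by ring.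
  eapply cder_ext; [| apply H ]. intros u. simpl. rewrite <- Cexp_add. f_equal. ring.
Qed.

Lemma cdiff_const (c z : C) : cdiff (fun _ => c) z.
Proof. eexists; apply cder_const. Qed.

Lemma cdiff_id (z : C) : cdiff (fun u => u) z.
Proof. eexists; apply cder_id. Qed.

Lemma cdiff_plus f g z : cdiff f z -> cdiff g z -> cdiff (fun u => f u + g u)%C z.
Proof. intros [a A] [b B]. eexists. eapply cder_plus; eauto. Qed.

Lemma cdiff_mult f g z : cdiff f z -> cdiff g z -> cdiff (fun u => f u * g u)%C z.
Proof. intros [a A] [b B]. eexists. eapply cder_mult; eauto. Qed.

Lemma cdiff_comp f g z : cdiff g z -> cdiff f (g z) -> cdiff (fun u => f (g u)) z.
Proof. intros [a A] [b B]. eexists. eapply cder_comp; eauto. Qed.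

Lemma cdiff_Cexp g z : cdiff g z -> cdiff (fun u => Cexp (g u)) z.
Proof. intros. apply cdiff_comp; auto. eexists; apply cder_Cexp. Qed.

Lemma cdiff_inv g z : cdiff g z -> g z <> 0 -> cdiff (fun u => / g u)%C z.
Proof. intros. apply (cdiff_comp Cinv); auto. eexists; now apply cder_inv. Qed.

Lemma cdiff_opp f z : cdiff f z -> cdiff (fun u => - f u)%C z.
Proof.
  intros. apply (cdiff_ext (fun u => (- (1)) * f u)%C); [ intros; ring |].
  apply cdiff_mult; auto. apply cdiff_const.
Qed.

Lemma cdiff_minus f g z : cdiff f z -> cdiff g z -> cdiff (fun u => f u - g u)%C z.
Proof. intros. apply cdiff_plus; auto. now apply cdiff_opp. Qed.

Lemma cdiff_div f g z : cdiff f z -> cdiff g z -> g z <> 0 -> cdiff (fun u => f u / g u)%C z.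
Proof. intros. apply cdiff_mult; auto. now apply cdiff_inv. Qed.

Ltac cd_step :=
  match goal with
  | H : ?G |- ?G => exact H
  | |- cdiff (fun _ => ?c) _ => apply cdiff_const
  | |- cdiff (fun u => u) _ => apply cdiff_id
  | |- cdiff (fun u => Cplus (@?f u) (@?g u)) ?z => apply (cdiff_plus f g z)
  | |- cdiff (fun u => Cminus (@?f u) (@?g u)) ?z => apply (cdiff_minus f g z)
  | |- cdiff (fun u => Copp (@?f u)) ?z => apply (cdiff_opp f z)
  | |- cdiff (fun u => Cdiv (@?f u) (@?g u)) ?z => apply (cdiff_div f g z)
  | |- cdiff (fun u => Cmult (@?f u) (@?g u)) ?z => apply (cdiff_mult f g z)
  | |- cdiff (fun u => Cinv (@?f u)) ?z => apply (cdiff_inv f z)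
  | |- cdiff (fun u => Cexp (@?f u)) ?z => apply (cdiff_Cexp f z)
  end.

Ltac cd := repeat cd_step.

(** * Continuity of complex functions of a real variable *)

Lemma ccont_eps (q : R -> C) (x : R) :
  (forall eps, 0 < eps -> exists d, 0 < d /\ forall t, Rabs (t - x) < d -> Cmod (q t - q x)%C < eps) ->
  ccont q x.
Proof.
  intros H P [e He].
  destruct (H e (cond_pos e)) as [d [Hd K]].
  exists (mkposreal d Hd). intros t Ht. apply He. apply C_NormedModule_mixin_compat1. apply K. apply Ht.
Qed.

Lemma ccont_elim (q : R -> C) (x : R) : ccont q x ->
  forall eps, 0 < eps -> exists d, 0 < d /\ forall t, Rabs (t - x) < d -> Cmod (q t - q x)%C < eps.
Proof.
  intros H eps He.
  (* Balls of [C] are those of a product: radius [eps / 2] only gives [Cmod] below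
     [sqrt 2 * (eps / 2)], which is at most [eps]. *)
  assert (P2 : 0 < eps / 2) by lra.
  destruct (H (fun y => ball (q x) (mkposreal _ P2) y)) as [d Hd].
  { exists (mkposreal _ P2). auto. }
  exists d. split; [ apply cond_pos |]. intros t Ht.
  specialize (Hd t Ht). apply C_NormedModule_mixin_compat2 in Hd.
  eapply Rlt_le_trans; [ apply Hd |]. simpl.
  assert (sqrt 2 <= 2).
  { rewrite <- (sqrt_Rsqr 2) at 2 by lra. apply sqrt_le_1; unfold Rsqr; lra. }
  nra.
Qed.

Lemma ccont_comp_cdiff (f : C -> C) (q : R -> C) (x : R) : ccont q x -> cdiff f (q x) -> ccont (fun t => f (q t)) x.
Proof.
  intros H [l D]. apply ccont_eps. intros eps He.
  destruct (cder_cont f _ l D eps He) as [d [Hd K]].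
  destruct (ccont_elim q x H d Hd) as [d' [Hd' K']].
  exists d'. split; auto.
Qed.

Lemma ccont_plus (q r : R -> C) (x : R) : ccont q x -> ccont r x -> ccont (fun t => q t + r t)%C x.
Proof. intros. apply (continuous_plus (K := R_AbsRing) (V := C_R_NormedModule) q r); auto. Qed.

Lemma ccont_const (c : C) (x : R) : ccont (fun _ => c) x.
Proof. apply continuous_const. Qed.

Lemma ccont_mult (q r : R -> C) (x : R) : ccont q x -> ccont r x -> ccont (fun t => q t * r t)%C x.
Proof.
  intros Hq Hr. apply ccont_eps. intros eps He.
  set (A := Cmod (q x) + Cmod (r x) + 1).
  assert (PA : 0 < A) by (unfold A; generalize (Cmod_ge_0 (q x)) (Cmod_ge_0 (r x)); lra).
  assert (Q : 0 < Rmin 1 (eps / (2 * A))) by (apply Rmin_pos; [ lra | apply Rdiv_lt_0_compat; lra ]).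
  destruct (ccont_elim q x Hq _ Q) as [d1 [H1 K1]].
  destruct (ccont_elim r x Hr _ Q) as [d2 [H2 K2]].
  exists (Rmin d1 d2). split; [ now apply Rmin_pos |]. intros t Ht.
  specialize (K1 t (Rlt_le_trans _ _ _ Ht (Rmin_l _ _))).
  specialize (K2 t (Rlt_le_trans _ _ _ Ht (Rmin_r _ _))).
  generalize (Rmin_l 1 (eps / (2 * A))) (Rmin_r 1 (eps / (2 * A))). intros M1 M2.
  set (m := Rmin 1 (eps / (2 * A))) in *.
  replace (q t * r t - q x * r x)%C with ((q t - q x) * (r x + (r t - r x)) + q x * (r t - r x))%C by ring.
  eapply Rle_lt_trans; [ apply Cmod_triangle |]. rewrite !Cmod_mult.
  assert (T : Cmod (r x + (r t - r x))%C <= Cmod (r x) + 1).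
  { eapply Rle_trans; [ apply Cmod_triangle |]. lra. }
  generalize (Cmod_ge_0 (q t - q x)%C) (Cmod_ge_0 (r t - r x)%C) (Cmod_ge_0 (q x)) (Cmod_ge_0 (r x))
    (Cmod_ge_0 (r x + (r t - r x))%C). intros.
  apply Rle_lt_trans with (Cmod (q t - q x)%C * (Cmod (r x) + 1) + Cmod (q x) * Cmod (r t - r x)%C).
  { apply Rplus_le_compat_r. now apply Rmult_le_compat_l. }
  apply Rlt_le_trans with (m * (Cmod (r x) + 1) + (Cmod (q x) + 0) * m + m * 0 + m * Cmod (q x)).
  { assert (Cmod (q t - q x)%C * (Cmod (r x) + 1) < m * (Cmod (r x) + 1)).
    { apply Rmult_lt_compat_r; lra. }
    assert (Cmod (q x) * Cmod (r t - r x)%C <= Cmod (q x) * m) by (apply Rmult_le_compat_l; lra).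
    nra. }
  apply Rle_trans with (2 * A * m).
  - unfold A. nra.
  - apply Rle_trans with (2 * A * (eps / (2 * A))).
    + apply Rmult_le_compat_l; lra.
    + right. field. lra.
Qed.

Lemma ccont_RtoC (u : R -> R) x : continuous u x -> ccont (fun t => RtoC (u t)) x.
Proof.
  intros H. apply ccont_eps. intros eps He.
  destruct (proj1 (filterlim_locally u (u x)) H (mkposreal eps He)) as [d Hd].
  exists d. split; [ apply cond_pos |]. intros t Ht.
  rewrite <- RtoC_minus, Cmod_R. apply (Hd t Ht).
Qed.

Lemma ccont_Cexp (q : R -> C) (x : R) : ccont q x -> ccont (fun t => Cexp (q t)) x.
Proof. intros. apply ccont_comp_cdiff; auto. eexists; apply cder_Cexp. Qed.

Lemma ccont_opp (q : R -> C) (x : R) : ccont q x -> ccont (fun t => - q t)%C x.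
Proof. intros. apply (continuous_opp (K := R_AbsRing) (V := C_R_NormedModule) q); auto. Qed.

Lemma ccont_minus (q r : R -> C) (x : R) : ccont q x -> ccont r x -> ccont (fun t => q t - r t)%C x.
Proof. intros. apply ccont_plus; auto. now apply ccont_opp. Qed.

Lemma ccont_ext_loc (q r : R -> C) x d : 0 < d -> (forall t, Rabs (t - x) < d -> q t = r t) -> ccont q x -> ccont r x.
Proof.
  intros Hd E H. apply ccont_eps. intros eps He. destruct (ccont_elim q x H eps He) as [d' [Hd' K]].
  exists (Rmin d d'). split; [ now apply Rmin_pos |]. intros t Ht.
  rewrite <- !E.
  - apply K. eapply Rlt_le_trans; [ apply Ht | apply Rmin_r ].
  - replace (x - x) with 0 by ring. now rewrite Rabs_R0.
  - eapply Rlt_le_trans; [ apply Ht | apply Rmin_l ].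
Qed.

Lemma ccont_ext (q r : R -> C) x : (forall t, q t = r t) -> ccont q x -> ccont r x.
Proof. intros E. apply (ccont_ext_loc q r x 1); auto; lra. Qed.

Ltac rcont := apply @ex_derive_continuous; auto_derive; auto.

Ltac cc_step :=
  match goal with
  | H : ?G |- ?G => exact H
  | |- continuous (fun _ => ?c) _ => apply ccont_const
  | |- continuous (fun u => Cplus (@?f u) (@?g u)) ?z => apply (ccont_plus f g z)
  | |- continuous (fun u => Cminus (@?f u) (@?g u)) ?z => apply (ccont_minus f g z)
  | |- continuous (fun u => Copp (@?f u)) ?z => apply (ccont_opp f z)
  | |- continuous (fun u => Cmult (@?f u) (@?g u)) ?z => apply (ccont_mult f g z)
  | |- continuous (fun u => Cexp (@?f u)) ?z => apply (ccont_Cexp f z)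
  | |- continuous (fun u => RtoC (@?f u)) ?z => apply (ccont_RtoC f z); try (rcont; fail)
  end.

Ltac cc := repeat cc_step.

(** * Integrals of complex functions over a segment *)

Lemma ccont_exI (q : R -> C) a b : (forall x, Rmin a b <= x <= Rmax a b -> ccont q x) -> exI q a b.
Proof. intros H. apply (@ex_RInt_continuous C_R_CompleteNormedModule). apply H. Qed.

Lemma ccont_exI_all (q : R -> C) a b : (forall x, ccont q x) -> exI q a b.
Proof. intros H. apply ccont_exI. auto. Qed.

Lemma CI_correct (q : R -> C) (a b : R) : exI q a b -> isCI q a b (CI q a b).
Proof. apply (@RInt_correct C_R_CompleteNormedModule). Qed.

Lemma CI_unique (q : R -> C) (a b : R) l : isCI q a b l -> CI q a b = l.
Proof. apply (@is_RInt_unique C_R_CompleteNormedModule). Qed.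

Lemma CI_bound (q : R -> C) (a b : R) M : a <= b -> exI q a b -> (forall x, a <= x <= b -> Cmod (q x) <= M) ->
  Cmod (CI q a b) <= (b - a) * M.
Proof.
  intros Hab Hq HM. rewrite Cmod_norm.
  apply (@norm_RInt_le_const C_R_NormedModule q a b (CI q a b) M Hab).
  - intros x Hx. generalize (HM x Hx). now rewrite Cmod_norm.
  - now apply CI_correct.
Qed.

Lemma CI_dom (q : R -> C) (p : R -> R) (a b P : R) : a <= b -> exI q a b -> (forall x, a <= x <= b -> Cmod (q x) <= p x) ->
  is_RInt p a b P -> Cmod (CI q a b) <= P.
Proof.
  intros Hab Hq Hp HP. rewrite Cmod_norm.
  apply (@norm_RInt_le C_R_NormedModule q p a b (CI q a b) P Hab); auto.
  - intros x Hx. generalize (Hp x Hx). now rewrite Cmod_norm.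
  - now apply CI_correct.
Qed.

Lemma CI_swap (q : R -> C) (a b : R) : exI q a b -> CI q b a = (- CI q a b)%C.
Proof.
  intros. apply CI_unique.
  apply (@is_RInt_swap C_R_NormedModule). now apply CI_correct.
Qed.

Lemma CI_bound_abs (q : R -> C) (a b : R) M : exI q a b -> (forall x, Rmin a b <= x <= Rmax a b -> Cmod (q x) <= M) ->
  Cmod (CI q a b) <= Rabs (b - a) * M.
Proof.
  intros Hq HM. destruct (Rle_dec a b) as [L | L].
  - rewrite Rabs_pos_eq by lra. apply CI_bound; auto. intros. apply HM.
    rewrite Rmin_left, Rmax_right; lra.
  - rewrite Rabs_left by lra. apply ex_RInt_swap in Hq. rewrite CI_swap by auto. rewrite Cmod_opp.
    replace (- (b - a)) with (a - b) by ring. apply CI_bound; auto; [ lra |].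
    intros. apply HM. rewrite Rmin_right, Rmax_left; lra.
Qed.

Lemma CI_plus (q r : R -> C) (a b : R) : exI q a b -> exI r a b -> CI (fun t => q t + r t)%C a b = (CI q a b + CI r a b)%C.
Proof. apply (@RInt_plus C_R_CompleteNormedModule). Qed.

Lemma CI_minus (q r : R -> C) (a b : R) : exI q a b -> exI r a b -> CI (fun t => q t - r t)%C a b = (CI q a b - CI r a b)%C.
Proof. apply (@RInt_minus C_R_CompleteNormedModule). Qed.

Lemma exI_plus (q r : R -> C) (a b : R) : exI q a b -> exI r a b -> exI (fun t => q t + r t)%C a b.
Proof. apply (@ex_RInt_plus C_R_NormedModule). Qed.

Lemma exI_minus (q r : R -> C) (a b : R) : exI q a b -> exI r a b -> exI (fun t => q t - r t)%C a b.
Proof. apply (@ex_RInt_minus C_R_NormedModule). Qed.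

Lemma isCI_cmult (c : C) (q : R -> C) (a b : R) (l : C) : isCI q a b l -> isCI (fun t => c * q t)%C a b (c * l)%C.
Proof.
  intros H. destruct c as [u v].
  assert (H1 : is_RInt (fun t => Re (q t)) a b (Re l))
    by apply (@is_RInt_fct_extend_fst R_NormedModule R_NormedModule q a b l H).
  assert (H2 : is_RInt (fun t => Im (q t)) a b (Im l))
    by apply (@is_RInt_fct_extend_snd R_NormedModule R_NormedModule q a b l H).
  apply (@is_RInt_fct_extend_pair R_NormedModule R_NormedModule).
  - apply (@is_RInt_minus R_NormedModule (fun t => u * Re (q t)) (fun t => v * Im (q t))).
    + now apply (@is_RInt_scal R_NormedModule).
    + now apply (@is_RInt_scal R_NormedModule).
  - apply (@is_RInt_plus R_NormedModule (fun t => u * Im (q t)) (fun t => v * Re (q t))).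
    + now apply (@is_RInt_scal R_NormedModule).
    + now apply (@is_RInt_scal R_NormedModule).
Qed.

Lemma exI_cmult (c : C) (q : R -> C) (a b : R) : exI q a b -> exI (fun t => c * q t)%C a b.
Proof. intros [l H]. eexists. eapply isCI_cmult, H. Qed.

Lemma CI_cmult (c : C) (q : R -> C) (a b : R) : exI q a b -> CI (fun t => c * q t)%C a b = (c * CI q a b)%C.
Proof. intros H. apply CI_unique, isCI_cmult, CI_correct, H. Qed.

Lemma CI_Chasles (q : R -> C) (a b : R) c : exI q a b -> exI q b c -> (CI q a b + CI q b c)%C = CI q a c.
Proof. apply (@RInt_Chasles C_R_CompleteNormedModule). Qed.

Lemma CI_ext (q r : R -> C) (a b : R) : (forall x, Rmin a b <= x <= Rmax a b -> q x = r x) -> CI q a b = CI r a b.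
Proof. intros H. apply (@RInt_ext C_R_CompleteNormedModule). intros. apply H. lra. Qed.

Lemma CI_const (c : C) a b : CI (fun _ => c) a b = (RtoC (b - a) * c)%C.
Proof.
  apply CI_unique. rewrite <- scal_R_Cmult. apply (@is_RInt_const C_R_NormedModule).
Qed.

Lemma CI_point (q : R -> C) (a : R) : CI q a a = 0.
Proof. apply (@RInt_point C_R_CompleteNormedModule). Qed.

Lemma CI_lin (f : R -> C) (u v a b : R) : exI f (u * a + v) (u * b + v) ->
  (RtoC u * CI (fun y => f (u * y + v)%R) a b)%C = CI f (u * a + v) (u * b + v).
Proof.
  intros H.
  transitivity (CI (fun y => @scal _ C_R_NormedModule u (f (u * y + v)%R)) a b);
    [| exact (@RInt_comp_lin C_R_CompleteNormedModule f u v a b H) ].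
  destruct (Req_dec u 0) as [-> | N].
  - rewrite Cmult_0_l. symmetry.
    transitivity (CI (fun _ => 0) a b).
    + apply CI_ext. intros. rewrite scal_R_Cmult. apply Cmult_0_l.
    + rewrite CI_const. apply Cmult_0_r.
  - assert (E : exI (fun y => f (u * y + v)) a b).
    { apply (ex_RInt_ext (fun y => RtoC (/ u) * (@scal _ C_R_NormedModule u (f (u * y + v)%R)))%C).
      - intros t _. rewrite scal_R_Cmult, RtoC_inv by auto. generalize (f (u * t + v)). intros w.
        change ((/ RtoC u * (RtoC u * w))%C = w). field. now apply RtoC_neq0.
      - apply exI_cmult. now apply (@ex_RInt_comp_lin C_R_NormedModule). }
    rewrite <- CI_cmult by auto. apply CI_ext. intros. now rewrite scal_R_Cmult.
Qed.

Definition rder (q : R -> C) (x : R) (l : C) : Prop :=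
  forall eps, 0 < eps -> exists d, 0 < d /\
    forall h, Rabs h < d -> Cmod (q (x + h)%R - q x - RtoC h * l)%C <= eps * Rabs h.

Lemma rder_is_derive (q : R -> C) (x : R) (l : C) : rder q x l -> @is_derive R_AbsRing C_R_NormedModule q x l.
Proof.
  intros H. split; [ apply is_linear_scal_l |].
  intros y Hy eps.
  replace y with x by now apply (@is_filter_lim_locally_unique R_AbsRing R_NormedModule).
  destruct (H eps (cond_pos eps)) as [d [Hd Hh]].
  assert (aux : forall t : R, Rabs (t - x) < d ->
      Cmod (q t - q x - RtoC (t - x) * l)%C <= eps * Rabs (t - x)).
  { intros t E. specialize (Hh _ E). now replace (x + (t - x)) with t in Hh by ring. }
  exists (mkposreal d Hd). intros t Ht. specialize (aux t Ht).
  rewrite Cmod_norm in aux. rewrite <- scal_R_Cmult in aux. exact aux.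
Qed.

Lemma rder_comp_line f u w l : cder f u l -> rder (fun t => f (u + RtoC t * w)%C) 0 (l * w)%C.
Proof.
  intros H eps He.
  assert (P : 0 < 1 + Cmod w) by (generalize (Cmod_ge_0 w); lra).
  destruct (H (eps / (1 + Cmod w))) as [d [Hd K]]; [ now apply Rdiv_lt_0_compat |].
  exists (d / (1 + Cmod w)). split; [ now apply Rdiv_lt_0_compat |]. intros h Hh.
  assert (E : Cmod (RtoC h * w)%C < d).
  { rewrite Cmod_mult, Cmod_R. apply Rle_lt_trans with (Rabs h * (1 + Cmod w)).
    - apply Rmult_le_compat_l; [ apply Rabs_pos | lra ].
    - apply (Rmult_lt_compat_r (1 + Cmod w)) in Hh; auto.
      replace (d / (1 + Cmod w) * (1 + Cmod w)) with d in Hh by (field; lra). lra. }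
  specialize (K _ E). rewrite Rplus_0_l.
  replace (u + RtoC 0 * w)%C with u by ring.
  replace (RtoC h * (l * w))%C with (l * (RtoC h * w))%C by ring.
  eapply Rle_trans; [ apply K |]. rewrite Cmod_mult, Cmod_R.
  replace (eps / (1 + Cmod w) * (Rabs h * Cmod w)) with (Rabs h * (eps / (1 + Cmod w) * Cmod w)) by ring.
  rewrite (Rmult_comm eps). apply Rmult_le_compat_l; [ apply Rabs_pos |].
  apply (Rmult_le_reg_r (1 + Cmod w)); auto.
  replace (eps / (1 + Cmod w) * Cmod w * (1 + Cmod w)) with (eps * Cmod w) by (field; lra).
  apply Rmult_le_compat_l; lra.
Qed.

Lemma CI_FTC (q dq : R -> C) a b :
  (forall x, Rmin a b <= x <= Rmax a b -> rder q x (dq x)) ->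
  (forall x, Rmin a b <= x <= Rmax a b -> ccont dq x) ->
  CI dq a b = (q b - q a)%C.
Proof.
  intros H1 H2. apply CI_unique.
  apply (@is_RInt_derive C_R_CompleteNormedModule q dq a b).
  - intros. now apply rder_is_derive, H1.
  - auto.
Qed.

(** * Goursat's theorem on rectangles *)

Lemma ccont_hor (c x : R) : ccont (fun t => (t, c)) x.
Proof.
  apply (ccont_ext (fun t => RtoC t + (0, c))%C).
  - intros. Csolve.
  - cc.
Qed.

Lemma ccont_ver (a y : R) : ccont (fun t => (a, t)) y.
Proof.
  apply (ccont_ext (fun t => RtoC a + Ci * RtoC t)%C).
  - intros. Csolve.
  - cc.
Qed.

Lemma rder_hor f (x c : R) l : cder f (x, c) l -> rder (fun t => f (t, c)) x l.
Proof.
  intros H eps He. destruct (H eps He) as [d [Hd K]]. exists d. split; auto. intros h Hh.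
  specialize (K (RtoC h)). rewrite !Cmod_R in K. specialize (K Hh).
  replace ((x, c) + RtoC h)%C with ((x + h, c) : C) in K by Csolve.
  now replace (RtoC h * l)%C with (l * RtoC h)%C by ring.
Qed.

Lemma rder_ver f (a y : R) l : cder f (a, y) l -> rder (fun t => f (a, t)) y (Ci * l)%C.
Proof.
  intros H eps He. destruct (H eps He) as [d [Hd K]]. exists d. split; auto. intros h Hh.
  specialize (K (Ci * RtoC h)%C). rewrite !Cmod_mult, !Cmod_Ci, !Rmult_1_l, !Cmod_R in K. specialize (K Hh).
  replace ((a, y) + Ci * RtoC h)%C with ((a, y + h) : C) in K by Csolve.
  now replace (RtoC h * (Ci * l))%C with (l * (Ci * RtoC h))%C by ring.
Qed.

(** The integral along the boundary, counterclockwise when [a <= b] and [c <= d]; on the vertical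
    sides dz = i dy. *)
Definition Rct (f : C -> C) (a b c d : R) : C :=
  (CI (fun x => f (x, c)) a b + Ci * CI (fun y => f (b, y)) c d
   - CI (fun x => f (x, d)) a b - Ci * CI (fun y => f (a, y)) c d)%C.

Definition on_rect (P : C -> Prop) (a b c d : R) : Prop :=
  forall x y, Rmin a b <= x <= Rmax a b -> Rmin c d <= y <= Rmax c d -> P (x, y).

Definition seg_int (f : C -> C) (a b c d : R) : Prop :=
  (forall y, Rmin c d <= y <= Rmax c d -> exI (fun x => f (x, y)) a b) /\
  (forall x, Rmin a b <= x <= Rmax a b -> exI (fun y => f (x, y)) c d).

Lemma seg_int_cdiff f a b c d : on_rect (cdiff f) a b c d -> seg_int f a b c d.
Proof.
  intros H. split; intros u Hu; apply ccont_exI; intros t Ht.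
  - apply (ccont_comp_cdiff f (fun t => (t, u))); [ apply ccont_hor | auto ].
  - apply (ccont_comp_cdiff f (fun t => (u, t))); [ apply ccont_ver | auto ].
Qed.

Lemma minmax_bounds a b : Rmin a b <= a <= Rmax a b /\ Rmin a b <= b <= Rmax a b.
Proof. unfold Rmin, Rmax. destruct (Rle_dec a b); lra. Qed.

Lemma Rct_minus f g a b c d : seg_int f a b c d -> seg_int g a b c d ->
  Rct (fun z => f z - g z)%C a b c d = (Rct f a b c d - Rct g a b c d)%C.
Proof.
  intros [F1 F2] [G1 G2].
  destruct (minmax_bounds a b) as [A B]. destruct (minmax_bounds c d) as [E D].
  unfold Rct. rewrite !CI_minus by auto. ring.
Qed.

Lemma Rct_bound f a b c d M : seg_int f a b c d -> on_rect (fun z => Cmod (f z) <= M) a b c d ->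
  Cmod (Rct f a b c d) <= 2 * (Rabs (b - a) + Rabs (d - c)) * M.
Proof.
  intros [F1 F2] HM.
  destruct (minmax_bounds a b) as [A B]. destruct (minmax_bounds c d) as [E D].
  unfold Rct.
  assert (H1 := CI_bound_abs (fun x => f (x, c)) a b M (F1 c E) (fun x Hx => HM x c Hx E)).
  assert (H2 := CI_bound_abs (fun x => f (x, d)) a b M (F1 d D) (fun x Hx => HM x d Hx D)).
  assert (H3 := CI_bound_abs (fun y => f (a, y)) c d M (F2 a A) (fun y Hy => HM a y A Hy)).
  assert (H4 := CI_bound_abs (fun y => f (b, y)) c d M (F2 b B) (fun y Hy => HM b y B Hy)).
  eapply Rle_trans; [ apply Cmod_tri_minus |].
  eapply Rle_trans; [ apply Rplus_le_compat_r, Cmod_tri_minus |].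
  eapply Rle_trans; [ apply Rplus_le_compat_r, Rplus_le_compat_r, Cmod_triangle |].
  rewrite !Cmod_mult, Cmod_Ci. lra.
Qed.

Lemma Rct_primitive f F a b c d :
  on_rect (fun z => cder F z (f z)) a b c d -> on_rect (cdiff f) a b c d -> Rct f a b c d = 0.
Proof.
  intros HF Hf.
  destruct (minmax_bounds a b) as [A B]. destruct (minmax_bounds c d) as [E D].
  destruct (seg_int_cdiff _ _ _ _ _ Hf) as [F1 F2].
  unfold Rct. rewrite <- !CI_cmult by auto.
  rewrite (CI_FTC (fun t => F (t, c)) (fun t => f (t, c))).
  rewrite (CI_FTC (fun t => F (t, d)) (fun t => f (t, d))).
  rewrite (CI_FTC (fun t => F (a, t)) (fun t => Ci * f (a, t))%C).
  rewrite (CI_FTC (fun t => F (b, t)) (fun t => Ci * f (b, t))%C).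
  - ring.
  - intros. apply rder_ver. auto.
  - intros. cc. apply (ccont_comp_cdiff f (fun t => (b, t))); [ apply ccont_ver | auto ].
  - intros. apply rder_ver. auto.
  - intros. cc. apply (ccont_comp_cdiff f (fun t => (a, t))); [ apply ccont_ver | auto ].
  - intros. apply rder_hor. auto.
  - intros. apply (ccont_comp_cdiff f (fun t => (t, d))); [ apply ccont_hor | auto ].
  - intros. apply rder_hor. auto.
  - intros. apply (ccont_comp_cdiff f (fun t => (t, c))); [ apply ccont_hor | auto ].
Qed.

Lemma Rct_affine (u v z0 : C) a b c d : Rct (fun z => u + v * (z - z0))%C a b c d = 0.
Proof.
  apply (Rct_primitive _ (fun z => (u - v * z0) * z + / RtoC 2 * v * (z * z))%C).
  - intros x y _ _.
    replace (u + v * ((x, y) - z0))%C with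
      ((0 * (x, y) + (u - v * z0) * 1) + (0 * ((x, y) * (x, y)) + / RtoC 2 * v * (1 * (x, y) + (x, y) * 1)))%C.
    + apply (cder_plus (fun z => (u - v * z0) * z)%C (fun z => / RtoC 2 * v * (z * z))%C).
      * apply (cder_mult (fun _ => u - v * z0)%C (fun z => z)); [ apply cder_const | apply cder_id ].
      * apply (cder_mult (fun _ => / RtoC 2 * v)%C (fun z => z * z)%C); [ apply cder_const |].
        apply (cder_mult (fun z => z) (fun z => z)); apply cder_id.
    + generalize ((x, y) : C). intros z. field.
  - intros x y _ _. cd.
Qed.

Definition valid_quad (f : C -> C) (q : R * R * R * R) : Prop :=
  let '(a, b, c, d) := q in a <= b /\ c <= d /\ on_rect (cdiff f) a b c d.

Definition Rctq (f : C -> C) (q : R * R * R * R) : C := let '(a, b, c, d) := q in Rct f a b c d.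

Definition half_quad (q q' : R * R * R * R) : Prop :=
  let '(a, b, c, d) := q in let '(a', b', c', d') := q' in
  a <= a' /\ b' <= b /\ c <= c' /\ d' <= d /\ b' - a' = (b - a) / 2 /\ d' - c' = (d - c) / 2.

Lemma on_rect_sub P a b c d a' b' c' d' : a <= a' -> a' <= b' -> b' <= b -> c <= c' -> c' <= d' -> d' <= d ->
  on_rect P a b c d -> on_rect P a' b' c' d'.
Proof.
  intros H1 H2 H3 H4 H5 H6 H x y Hx Hy.
  rewrite Rmin_left, Rmax_right in Hx by lra. rewrite Rmin_left, Rmax_right in Hy by lra.
  apply H; rewrite Rmin_left, Rmax_right; lra.
Qed.

Definition rect_ccont (f : C -> C) (a b c d : R) : Prop := forall x y, a <= x <= b -> c <= y <= d ->
  ccont (fun x => f (x, y)) x /\ ccont (fun y => f (x, y)) y.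

Lemma rect_ccont_cdiff f a b c d : a <= b -> c <= d -> on_rect (cdiff f) a b c d -> rect_ccont f a b c d.
Proof.
  intros Ha Hc H x y Hx Hy. assert (D : cdiff f (x, y)) by (apply H; rewrite Rmin_left, Rmax_right; lra).
  split; [ apply (ccont_comp_cdiff f (fun t => (t, y))); [ apply ccont_hor | auto ]
         | apply (ccont_comp_cdiff f (fun t => (x, t))); [ apply ccont_ver | auto ] ].
Qed.

(** The inner sides cancel. Continuity along horizontals and verticals is all that is asked, so the
    splitting also serves [goursat_corner], where differentiability may fail at one vertex. *)
Lemma Rct_split f a b c d m n : a <= m <= b -> c <= n <= d -> rect_ccont f a b c d ->
  Rct f a b c d = (Rct f a m c n + Rct f m b c n + (Rct f a m n d + Rct f m b n d))%C.
Proof.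
  intros Hm Hn H.
  assert (X : forall y u v, c <= y <= d -> a <= u <= v -> v <= b -> exI (fun x => f (x, y)) u v).
  { intros y u v Hy Hu Hv. apply ccont_exI. intros x Hx. rewrite Rmin_left, Rmax_right in Hx by lra. apply H; lra. }
  assert (Y : forall x u v, a <= x <= b -> c <= u <= v -> v <= d -> exI (fun y => f (x, y)) u v).
  { intros x u v Hy Hu Hv. apply ccont_exI. intros y Hx. rewrite Rmin_left, Rmax_right in Hx by lra. apply H; lra. }
  unfold Rct.
  rewrite <- (CI_Chasles (fun x => f (x, c)) a m b) by (apply X; lra).
  rewrite <- (CI_Chasles (fun x => f (x, d)) a m b) by (apply X; lra).
  rewrite <- (CI_Chasles (fun y => f (a, y)) c n d) by (apply Y; lra).
  rewrite <- (CI_Chasles (fun y => f (b, y)) c n d) by (apply Y; lra).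
  ring.
Qed.

(** Pigeonhole: if every quarter carried less than a fourth of the integral, the triangle inequality
    applied to [Rct_split] would be violated. *)
Lemma half_step f q : valid_quad f q ->
  exists q', valid_quad f q' /\ half_quad q q' /\ Cmod (Rctq f q) <= 4 * Cmod (Rctq f q').
Proof.
  destruct q as [[[a b] c] d]. intros (Hab & Hcd & H).
  set (m := (a + b) / 2). set (n := (c + d) / 2).
  assert (E := Rct_split f a b c d m n ltac:(unfold m; lra) ltac:(unfold n; lra) (rect_ccont_cdiff _ _ _ _ _ Hab Hcd H)).
  assert (V : forall a' b' c' d', a <= a' -> a' <= b' -> b' <= b -> c <= c' -> c' <= d' -> d' <= d ->
    valid_quad f (a', b', c', d')).
  { intros. split; [ auto | split; [ auto |] ]. apply (on_rect_sub _ a b c d); auto. }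
  assert (T : Cmod (Rct f a b c d) <= Cmod (Rct f a m c n) + Cmod (Rct f m b c n)
     + (Cmod (Rct f a m n d) + Cmod (Rct f m b n d))).
  { rewrite E. eapply Rle_trans; [ apply Cmod_triangle |].
    apply Rplus_le_compat; apply Cmod_triangle. }
  destruct (Rle_dec (Cmod (Rct f a b c d)) (4 * Cmod (Rct f a m c n))) as [L | L1].
  { exists (a, m, c, n). split; [ apply V; unfold m, n; lra |]. split; [| exact L ].
    unfold half_quad, m, n. repeat split; lra. }
  destruct (Rle_dec (Cmod (Rct f a b c d)) (4 * Cmod (Rct f m b c n))) as [L | L2].
  { exists (m, b, c, n). split; [ apply V; unfold m, n; lra |]. split; [| exact L ].
    unfold half_quad, m, n. repeat split; lra. }
  destruct (Rle_dec (Cmod (Rct f a b c d)) (4 * Cmod (Rct f a m n d))) as [L | L3].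
  { exists (a, m, n, d). split; [ apply V; unfold m, n; lra |]. split; [| exact L ].
    unfold half_quad, m, n. repeat split; lra. }
  exists (m, b, n, d). split; [ apply V; unfold m, n; lra |]. split.
  - unfold half_quad, m, n. repeat split; lra.
  - simpl. lra.
Qed.

Lemma nested_point (a b : nat -> R) : (forall n, a n <= a (S n)) -> (forall n, b (S n) <= b n) ->
  (forall n, a n <= b n) -> exists x, forall n, a n <= x <= b n.
Proof.
  intros Ha Hb Hab.
  assert (Ma : forall n m, (n <= m)%nat -> a n <= a m).
  { intros n m L. induction L; [ lra |]. specialize (Ha m). lra. }
  assert (Mb : forall n m, (n <= m)%nat -> b m <= b n).
  { intros n m L. induction L; [ lra |]. specialize (Hb m). lra. }
  assert (U : forall n m, a n <= b m).
  { intros n m. destruct (Nat.le_ge_cases n m) as [L | L].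
    - specialize (Ma _ _ L). specialize (Hab m). lra.
    - specialize (Mb _ _ L). specialize (Hab n). lra. }
  destruct (completeness (fun x => exists n, x = a n)) as [x [X1 X2]].
  - exists (b O). intros y [n ->]. auto.
  - exists (a O). now exists O.
  - exists x. intros n. split.
    + apply X1. now exists n.
    + apply X2. intros y [m ->]. auto.
Qed.

Lemma pow2_archi (M : R) eps : 0 < eps -> exists n : nat, M / 2 ^ n < eps.
Proof.
  intros He. destruct (Rle_dec M 0) as [L | L].
  - exists O. simpl. lra.
  - destruct (INR_unbounded (M / eps)) as [n Hn]. exists n.
    assert (P : 0 < 2 ^ n) by (apply pow_lt; lra).
    assert (Q : INR n < 2 ^ n).
    { clear. induction n as [| n IH]; [ simpl; lra |]. rewrite S_INR. simpl.
      assert (1 <= 2 ^ n) by (apply pow_R1_Rle; lra). lra. }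
    apply (Rmult_lt_reg_r (2 ^ n)); auto. replace (M / 2 ^ n * 2 ^ n) with M by (field; lra).
    apply (Rmult_lt_compat_r eps) in Hn; auto. replace (M / eps * eps) with M in Hn by (field; lra). nra.
Qed.

Lemma goursat_le f a b c d : a <= b -> c <= d -> on_rect (cdiff f) a b c d -> Rct f a b c d = 0.
Proof.
  intros Hab Hcd Hf.
  (* Bisection as a total function [st], unconstrained on rectangles that are not valid; its
     iterates give the nested sequence. *)
  destruct (functional_choice (fun q q' => valid_quad f q ->
    valid_quad f q' /\ half_quad q q' /\ Cmod (Rctq f q) <= 4 * Cmod (Rctq f q'))) as [st Hst].
  { intros q. destruct (classic (valid_quad f q)) as [V | V].
    - destruct (half_step f q V) as [q' K]. now exists q'.
    - exists q. intros; contradiction. }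
  set (s := fun n => Nat.iter n st (a, b, c, d)).
  assert (V : forall n, valid_quad f (s n)).
  { induction n; [ now repeat split |]. now apply Hst. }
  set (an := fun n => fst (fst (fst (s n)))). set (bn := fun n => snd (fst (fst (s n)))).
  set (cn := fun n => snd (fst (s n))). set (dn := fun n => snd (s n)).
  assert (Es : forall n, s n = (an n, bn n, cn n, dn n)).
  { intros n. unfold an, bn, cn, dn. now destruct (s n) as [[[? ?] ?] ?]. }
  assert (Hs : forall n, half_quad (s n) (s (S n)) /\ Cmod (Rctq f (s n)) <= 4 * Cmod (Rctq f (s (S n)))).
  { intros n. apply (Hst (s n) (V n)). }
  assert (K : forall n, an n <= an (S n) /\ bn (S n) <= bn n /\ cn n <= cn (S n) /\ dn (S n) <= dn n /\
     bn (S n) - an (S n) = (bn n - an n) / 2 /\ dn (S n) - cn (S n) = (dn n - cn n) / 2).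
  { intros n. destruct (Hs n) as [K _]. rewrite !Es in K. exact K. }
  assert (W : forall n, an n <= bn n /\ cn n <= dn n /\ on_rect (cdiff f) (an n) (bn n) (cn n) (dn n)).
  { intros n. specialize (V n). rewrite Es in V. exact V. }
  destruct (nested_point an bn) as [x Hx]; try (intros n; apply K || apply W).
  destruct (nested_point cn dn) as [y Hy]; try (intros n; apply K || apply W).
  assert (Len : forall n, bn n - an n = (b - a) / 2 ^ n /\ dn n - cn n = (d - c) / 2 ^ n).
  { induction n; [ unfold an, bn, cn, dn; simpl; lra |].
    destruct (K n) as (_ & _ & _ & _ & K1 & K2). destruct IHn as [I1 I2].
    assert (2 ^ n <> 0) by (apply pow_nonzero; lra).
    rewrite K1, K2, I1, I2. simpl. split; field; auto. }
  assert (G : forall n, Cmod (Rct f a b c d) <= 4 ^ n * Cmod (Rctq f (s n))).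
  { induction n; [ simpl; lra |].
    destruct (Hs n) as [_ L]. eapply Rle_trans; [ apply IHn |]. change (4 ^ S n) with (4 * 4 ^ n).
    assert (0 < 4 ^ n) by (apply pow_lt; lra).
    rewrite (Rmult_comm 4), Rmult_assoc. apply Rmult_le_compat_l; lra. }
  set (L := (b - a) + (d - c)).
  assert (PL : 0 <= L) by (unfold L; lra).
  destruct (Hf x y) as [l Hl].
  { specialize (Hx O). change (a <= x <= b) in Hx. rewrite Rmin_left, Rmax_right; lra. }
  { specialize (Hy O). change (c <= y <= d) in Hy. rewrite Rmin_left, Rmax_right; lra. }
  apply Cmod_eq_0. apply Rle_antisym; [| apply Cmod_ge_0 ].
  apply le_epsilon. intros eps He. rewrite Rplus_0_l.
  assert (P2 : 0 < 2 * (L * L) + 1) by nra.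
  (* With [L] the half perimeter, the final estimate is 4^n * 2 (L / 2^n) * e (L / 2^n) = 2 L^2 e,
     which dictates this tolerance. *)
  destruct (Hl (eps / (2 * (L * L) + 1))) as [del [Hdel Kd]]; [ now apply Rdiv_lt_0_compat |].
  set (e := eps / (2 * (L * L) + 1)) in *.
  assert (Pe : 0 < e) by now apply Rdiv_lt_0_compat.
  destruct (pow2_archi L del Hdel) as [n Hn].
  destruct (W n) as (Wa & Wc & Wf). destruct (Len n) as [La Lc].
  assert (P2n : 0 < 2 ^ n) by (apply pow_lt; lra).
  specialize (G n). rewrite Es in G. simpl in G.
  set (z0 := (x, y) : C) in *.
  assert (B : Cmod (Rct f (an n) (bn n) (cn n) (dn n)) <= 2 * (L / 2 ^ n) * (e * (L / 2 ^ n))).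
  (* The first-order Taylor polynomial at the limit point has zero boundary integral, so only the
     remainder, at most [e * Cmod (z - z0)], contributes. *)
  { replace (Rct f (an n) (bn n) (cn n) (dn n)) with
      (Rct (fun z => f z - (f z0 + l * (z - z0)))%C (an n) (bn n) (cn n) (dn n)).
    2:{ rewrite Rct_minus, Rct_affine; [ ring | now apply seg_int_cdiff |].
        apply seg_int_cdiff. intros ? ? _ _. cd. }
    replace (L / 2 ^ n) with (Rabs (bn n - an n) + Rabs (dn n - cn n)) at 1.
    2:{ rewrite !Rabs_pos_eq by lra. rewrite La, Lc. unfold L. field. lra. }
    apply Rct_bound.
    - apply seg_int_cdiff. intros u v Hu Hv. apply cdiff_minus; [ now apply Wf |]. cd.
    - intros u v Hu Hv.
      rewrite Rmin_left, Rmax_right in Hu by lra. rewrite Rmin_left, Rmax_right in Hv by lra.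
      set (z := (u, v) : C).
      assert (Q : Cmod (z - z0)%C <= L / 2 ^ n).
      { eapply Rle_trans; [ apply Cmod_le_ReIm |]. unfold z, z0. reim.
        specialize (Hx n). specialize (Hy n).
        replace (L / 2 ^ n) with ((bn n - an n) + (dn n - cn n)).
        2:{ rewrite La, Lc. unfold L. field. lra. }
        apply Rplus_le_compat; apply Rabs_le; lra. }
      replace (f z - (f z0 + l * (z - z0)))%C with (f (z0 + (z - z0)) - f z0 - l * (z - z0))%C.
      2:{ replace (z0 + (z - z0))%C with z by ring. ring. }
      eapply Rle_trans; [ apply Kd; lra |]. apply Rmult_le_compat_l; lra. }
  eapply Rle_trans; [ apply G |].
  apply Rle_trans with (4 ^ n * (2 * (L / 2 ^ n) * (e * (L / 2 ^ n)))).
  - apply Rmult_le_compat_l; auto. apply pow_le; lra.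
  - replace (4 ^ n) with (2 ^ n * 2 ^ n) by (rewrite <- Rpow_mult_distr; f_equal; ring).
    replace (2 ^ n * 2 ^ n * (2 * (L / 2 ^ n) * (e * (L / 2 ^ n)))) with (2 * (L * L) * e) by (field; lra).
    assert (e * (2 * (L * L) + 1) = eps) by (unfold e; field; lra). nra.
Qed.

Lemma goursat f a b c d : on_rect (cdiff f) a b c d -> Rct f a b c d = 0.
Proof.
  intros H.
  assert (H' : on_rect (cdiff f) (Rmin a b) (Rmax a b) (Rmin c d) (Rmax c d)).
  { intros x y Hx Hy. apply H.
    - rewrite Rmin_left, Rmax_right in Hx; auto; apply Rminmax.
    - rewrite Rmin_left, Rmax_right in Hy; auto; apply Rminmax. }
  apply goursat_le in H'; try apply Rminmax.
  destruct (seg_int_cdiff _ _ _ _ _ H) as [F1 F2].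
  destruct (minmax_bounds a b) as [A B]. destruct (minmax_bounds c d) as [E D].
  unfold Rct in *.
  unfold Rmin, Rmax in H'. destruct (Rle_dec a b); destruct (Rle_dec c d); auto.
  - rewrite (CI_swap (fun y => f (a, y)) c d), (CI_swap (fun y => f (b, y)) c d) in H' by auto.
    rewrite <- Copp_0, <- H'. ring.
  - rewrite (CI_swap (fun y => f (y, c)) a b), (CI_swap (fun y => f (y, d)) a b) in H' by auto.
    rewrite <- Copp_0, <- H'. ring.
  - rewrite (CI_swap (fun y => f (a, y)) c d), (CI_swap (fun y => f (b, y)) c d) in H' by auto.
    rewrite (CI_swap (fun y => f (y, c)) a b), (CI_swap (fun y => f (y, d)) a b) in H' by auto.
    rewrite <- H'. ring.
Qed.

(** * Mean value property and Cauchy estimates *)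

Definition cis (t : R) : C := Cexp (Ci * RtoC t).

Lemma Cmod_cis t : Cmod (cis t) = 1.
Proof.
  unfold cis. rewrite Cmod_Cexp. reim. replace (0 * t - 1 * 0) with 0 by ring. apply exp_0.
Qed.

Lemma cis_eq t : cis t = (cos t, sin t).
Proof. apply Cexp_Im. Qed.

Lemma Cexp_pair (x y : R) : Cexp (x, y) = (RtoC (exp x) * cis y)%C.
Proof.
  unfold cis. rewrite <- Cexp_RtoC, <- Cexp_add. f_equal. Csolve.
Qed.

Lemma cis_2PI : cis (2 * PI) = 1.
Proof. rewrite cis_eq, cos_2PI, sin_2PI. reflexivity. Qed.

Lemma cis_0 : cis 0 = 1.
Proof. rewrite cis_eq, cos_0, sin_0. reflexivity. Qed.

Lemma ccont_cis (u : R -> R) x : continuous u x -> ccont (fun t => cis (u t)) x.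
Proof. intros. unfold cis. cc. Qed.

Lemma PI2_pos : 0 < 2 * PI.
Proof. generalize PI_RGT_0. lra. Qed.

(* Goursat in logarithmic coordinates: the two horizontal sides cancel by periodicity. *)
Lemma polar_mean (q : C -> C) (L : C) (x0 : R) :
  (forall z, Re z <= x0 -> cdiff q z) ->
  (forall x, q (x, 2 * PI) = q (x, 0)) ->
  (forall eps, 0 < eps -> exists X, forall x y, x <= X -> Cmod (q (x, y) - L)%C <= eps) ->
  CI (fun y => q (x0, y)) 0 (2 * PI) = (RtoC (2 * PI) * L)%C.
Proof.
  intros Hq Hper HL. generalize PI2_pos. intros PP.
  apply Cmod_le_eps_eq. intros eps He.
  destruct (HL (eps / (2 * PI))) as [X HX]; [ now apply Rdiv_lt_0_compat |].
  (* The vertical segment is pushed to the left until [q] is uniformly close to its limit [L]; in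
     polar terms the circle shrinks to its centre. *)
  set (x := Rmin X x0).
  assert (E : CI (fun y => q (x0, y)) 0 (2 * PI) = CI (fun y => q (x, y)) 0 (2 * PI)).
  { assert (G : Rct q x x0 0 (2 * PI) = 0).
    { apply goursat. intros u v Hu Hv. apply Hq. simpl.
      rewrite Rmax_right in Hu; [ lra | apply Rmin_r ]. }
    unfold Rct in G.
    rewrite (CI_ext (fun x => q (x, 2 * PI)) (fun x => q (x, 0))) in G by (intros; apply Hper).
    set (a := CI (fun y => q (x0, y)) 0 (2 * PI)) in *. set (b := CI (fun y => q (x, y)) 0 (2 * PI)) in *.
    set (e := CI (fun x => q (x, 0)) x x0) in *.
    assert (Ci * (a - b) = 0)%C by (rewrite <- G; ring).
    replace a with (b + (- Ci) * (Ci * (a - b)))%C.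
    - rewrite H. ring.
    - replace (- Ci * (Ci * (a - b)))%C with (- (Ci * Ci) * (a - b))%C by ring.
      replace (Ci * Ci)%C with (RtoC (-1)) by Csolve. ring. }
  rewrite E.
  assert (I : exI (fun y => q (x, y)) 0 (2 * PI)).
  { apply ccont_exI_all. intros y. apply (ccont_comp_cdiff q (fun t => (x, t))); [ apply ccont_ver |].
    apply Hq. simpl. apply Rmin_r. }
  replace (RtoC (2 * PI) * L)%C with (CI (fun _ => L) 0 (2 * PI)) by (rewrite CI_const; do 2 f_equal; ring).
  rewrite <- CI_minus; auto. 2: apply ccont_exI_all; intros; apply ccont_const.
  eapply Rle_trans; [ apply (CI_bound _ _ _ (eps / (2 * PI))) |].
  - lra.
  - apply exI_minus; auto. apply ccont_exI_all; intros; apply ccont_const.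
  - intros y _. apply HX. apply Rmin_l.
  - right. field. generalize PI_neq0. lra.
Qed.

Lemma Cmod_circle z r t : 0 <= r -> Cmod (z + RtoC r * cis t - z)%C = r.
Proof.
  intros. replace (z + RtoC r * cis t - z)%C with (RtoC r * cis t)%C by ring.
  rewrite Cmod_mult, Cmod_cis, Cmod_RtoC_pos; lra.
Qed.

Lemma ccont_circle f z r t : cdiff f (z + RtoC r * cis t)%C -> ccont (fun t => f (z + RtoC r * cis t)%C) t.
Proof.
  intros. apply (ccont_comp_cdiff f (fun t => (z + RtoC r * cis t)%C)); auto. unfold cis. cc.
Qed.

Lemma exp_small_at_minf d : 0 < d -> exists X, forall x, x <= X -> exp x < d.
Proof.
  intros Hd. exists (ln d - 1). intros x Hx. rewrite <- (exp_ln d) by auto. apply exp_increasing. lra.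
Qed.

Lemma disc_exp rho x (y : R) z : 0 < rho -> x <= ln rho -> Cmod (z + Cexp (x, y) - z)%C <= rho.
Proof.
  intros Hr Hx. replace (z + Cexp (x, y) - z)%C with (Cexp (x, y)) by ring. rewrite Cmod_Cexp. simpl.
  rewrite <- (exp_ln rho) by auto. destruct Hx as [Hx | ->]; [ left; now apply exp_increasing | right; auto ].
Qed.

(** This is [polar_mean] for w -> f(z + e^w): the line Re w = ln rho is the circle, and the limit as
    Re w tends to minus infinity is [f z]. *)
Lemma mean_value f z rho : 0 < rho -> (forall u, Cmod (u - z)%C <= rho -> cdiff f u) ->
  CI (fun t => f (z + RtoC rho * cis t)%C) 0 (2 * PI) = (RtoC (2 * PI) * f z)%C.
Proof.
  intros Hr Hf.
  rewrite <- (polar_mean (fun w => f (z + Cexp w)%C) (f z) (ln rho)).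
  - apply CI_ext. intros t _. now rewrite Cexp_pair, exp_ln.
  - intros [x y] Hx. apply (cdiff_comp f (fun w => z + Cexp w)%C); [ cd |].
    apply Hf. now apply disc_exp.
  - intros x. now rewrite !Cexp_pair, cis_2PI, cis_0.
  - intros eps He. destruct (Hf z) as [l Hl].
    { replace (z - z)%C with (RtoC 0) by ring. rewrite Cmod_0. lra. }
    destruct (cder_cont f z l Hl eps He) as [d [Hd K]].
    destruct (exp_small_at_minf d Hd) as [X HX]. exists X. intros x y Hx.
    left. apply K. replace (z + Cexp (x, y) - z)%C with (Cexp (x, y)) by ring. rewrite Cmod_Cexp. now apply HX.
Qed.

(** Again [polar_mean], for the difference quotient (f(z + e^w) - f z) e^(-w), whose limit at the
    centre is the derivative. *)
Lemma cauchy_deriv f z l rho : 0 < rho -> (forall u, Cmod (u - z)%C <= rho -> cdiff f u) -> cder f z l ->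
  CI (fun t => (f (z + RtoC rho * cis t) - f z) * (cis (- t) * RtoC (/ rho)))%C 0 (2 * PI)
    = (RtoC (2 * PI) * l)%C.
Proof.
  intros Hr Hf Hl.
  rewrite <- (polar_mean (fun w => (f (z + Cexp w) - f z) * Cexp (- w))%C l (ln rho)).
  - apply CI_ext. intros t _. replace (- (ln rho, t))%C with ((- ln rho, - t) : C) by reflexivity.
    rewrite !Cexp_pair, exp_Ropp, exp_ln by auto. ring.
  - intros [x y] Hx. cd. apply (cdiff_comp f (fun w => z + Cexp w)%C); [ cd |].
    apply Hf. now apply disc_exp.
  - intros x. f_equal.
    + now rewrite !Cexp_pair, cis_2PI, cis_0.
    + now rewrite !Cexp_opp, !Cexp_pair, cis_2PI, cis_0.
  - intros eps He.
    destruct (Hl eps He) as [d [Hd K]].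
    destruct (exp_small_at_minf d Hd) as [X HX]. exists X. intros x y Hx.
    set (w := (x, y) : C). rewrite Cexp_opp.
    assert (N := Cexp_neq0 w).
    replace ((f (z + Cexp w) - f z) * / Cexp w - l)%C with ((f (z + Cexp w) - f z - l * Cexp w) * / Cexp w)%C.
    2:{ field. auto. }
    rewrite Cmod_mult, Cmod_inv by auto.
    assert (P : 0 < Cmod (Cexp w)) by now apply Cmod_neq0.
    apply (Rmult_le_reg_r (Cmod (Cexp w))); auto. rewrite Rmult_assoc, Rinv_l, Rmult_1_r by lra.
    apply K. rewrite Cmod_Cexp. now apply HX.
Qed.

(** The factor 2 comes from the integrand of [cauchy_deriv], where [f - f z] is bounded by
    [2 * M]. *)
Lemma cauchy_deriv_bound f z l rho M : 0 < rho -> (forall u, Cmod (u - z)%C <= rho -> cdiff f u) ->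
  (forall u, Cmod (u - z)%C <= rho -> Cmod (f u) <= M) -> cder f z l -> Cmod l <= 2 * M / rho.
Proof.
  intros Hr Hf HM Hl. generalize PI2_pos. intros PP.
  assert (E := cauchy_deriv f z l rho Hr Hf Hl).
  assert (B : Cmod (RtoC (2 * PI) * l)%C <= (2 * PI - 0) * (2 * M / rho)).
  { rewrite <- E. apply CI_bound; [ lra | |].
    - apply ccont_exI_all. intros t. cc.
      + apply ccont_circle. apply Hf. rewrite Cmod_circle; lra.
      + apply ccont_cis. rcont.
    - intros t _. rewrite !Cmod_mult, Cmod_cis, Cmod_RtoC_pos by (left; now apply Rinv_0_lt_compat).
      unfold Rdiv. rewrite Rmult_1_l. apply Rmult_le_compat_r; [ left; now apply Rinv_0_lt_compat |].
      eapply Rle_trans; [ apply Cmod_tri_minus |].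
      assert (Cmod (f (z + RtoC rho * cis t)%C) <= M) by (apply HM; rewrite Cmod_circle; lra).
      assert (Cmod (f z) <= M).
      { apply HM. replace (z - z)%C with (RtoC 0) by ring. rewrite Cmod_0. lra. }
      lra. }
  rewrite Cmod_mult, Cmod_RtoC_pos in B by lra.
  rewrite Rminus_0_r in B. now apply Rmult_le_reg_l in B.
Qed.

(** Projecting on the direction of the increment reduces to the real mean value theorem: with k =
    f(u + h) - f u, the real function Re (conj k * f(u + t h)) grows by exactly |k|^2 between t = 0
    and t = 1. *)
Lemma mean_value_ineq f u h L :
  (forall t, 0 <= t <= 1 -> exists l, cder f (u + RtoC t * h)%C l /\ Cmod l <= L) ->
  Cmod (f (u + h) - f u)%C <= L * Cmod h.
Proof.
  intros H.
  set (k := (f (u + h) - f u)%C).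
  destruct (functional_choice (fun t l => 0 <= t <= 1 -> cder f (u + RtoC t * h)%C l /\ Cmod l <= L)) as [dl Hdl].
  { intros t. destruct (classic (0 <= t <= 1)) as [Ht | Ht].
    - destruct (H t Ht) as [l Hl]. now exists l.
    - exists 0. tauto. }
  set (phi := fun t => Re (Cconj k * f (u + RtoC t * h))%C).
  assert (D : forall t, 0 <= t <= 1 -> derivable_pt_lim phi t (Re (Cconj k * (dl t * h))%C)).
  { intros t Ht eps He.
    destruct (Hdl t Ht) as [Hc _].
    assert (R := rder_comp_line f (u + RtoC t * h)%C h (dl t) Hc).
    assert (P : 0 < Cmod k + 1) by (generalize (Cmod_ge_0 k); lra).
    destruct (R (eps / 2 / (Cmod k + 1))) as [d [Hd K]].
    { apply Rdiv_lt_0_compat; lra. }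
    exists (mkposreal d Hd). intros s Hs Hs2. specialize (K s Hs2).
    rewrite Rplus_0_l in K.
    replace (u + RtoC t * h + RtoC s * h)%C with (u + RtoC (t + s) * h)%C in K by (rewrite RtoC_plus; ring).
    replace (u + RtoC t * h + RtoC 0 * h)%C with (u + RtoC t * h)%C in K by ring.
    unfold phi.
    set (X := f (u + RtoC (t + s) * h)%C) in *. set (Y := f (u + RtoC t * h)%C) in *.
    set (W := (dl t * h)%C) in *.
    replace ((Re (Cconj k * X)%C - Re (Cconj k * Y)%C) / s - Re (Cconj k * W)%C)
      with (Re (Cconj k * (X - Y - RtoC s * W))%C / s).
    2:{ reim. field. auto. }
    assert (Ps : 0 < Rabs s) by now apply Rabs_pos_lt.
    unfold Rdiv. rewrite Rabs_mult, Rabs_inv.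
    apply (Rmult_lt_reg_r (Rabs s)); auto. rewrite Rmult_assoc, Rinv_l, Rmult_1_r by lra.
    eapply Rle_lt_trans; [ apply re_le_Cmod |]. rewrite Cmod_mult, Cmod_conj.
    apply Rle_lt_trans with (Cmod k * (eps / 2 / (Cmod k + 1) * Rabs s)).
    - apply Rmult_le_compat_l; auto. apply Cmod_ge_0.
    - rewrite <- Rmult_assoc. apply Rmult_lt_compat_r; auto.
      apply (Rmult_lt_reg_r (Cmod k + 1)); auto.
      replace (Cmod k * (eps / 2 / (Cmod k + 1)) * (Cmod k + 1)) with (Cmod k * (eps / 2)) by (field; lra).
      generalize (Cmod_ge_0 k). nra. }
  destruct (MVT_gen phi 0 1 (fun t => Re (Cconj k * (dl t * h))%C)) as [c [Hc E]].
  { rewrite Rmin_left, Rmax_right by lra. intros x Hx. apply is_derive_Reals. apply D. lra. }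
  { rewrite Rmin_left, Rmax_right by lra. intros x Hx. apply derivable_continuous_pt.
    eexists. apply D. lra. }
  rewrite Rmin_left, Rmax_right in Hc by lra.
  assert (E2 : phi 1 - phi 0 = Cmod k * Cmod k).
  { unfold phi. replace (u + RtoC 1 * h)%C with (u + h)%C by ring.
    replace (u + RtoC 0 * h)%C with u by ring.
    transitivity (Re (Cconj k * k)%C).
    - transitivity (Re (Cconj k * (f (u + h) - f u))%C); [ rewrite !Re_mult, Re_minus, Im_minus; ring | reflexivity ].
    - rewrite Cmult_comm, <- Cmod2_conj. rewrite Re_RtoC. ring. }
  rewrite E in E2.
  destruct (Req_dec (Cmod k) 0) as [Z | NZ].
  { rewrite Z. destruct (Hdl 0) as [_ B]; [ lra |].
    apply Rmult_le_pos; [| apply Cmod_ge_0 ]. eapply Rle_trans; [ apply Cmod_ge_0 | apply B ]. }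
  assert (0 < Cmod k) by (generalize (Cmod_ge_0 k); lra).
  apply (Rmult_le_reg_l (Cmod k)); auto. rewrite <- E2.
  replace (1 - 0) with 1 by ring. rewrite Rmult_1_r.
  eapply Rle_trans; [ apply Rle_abs |]. eapply Rle_trans; [ apply re_le_Cmod |].
  rewrite !Cmod_mult, Cmod_conj. apply Rmult_le_compat_l; [ lra |].
  apply Rmult_le_compat_r; [ apply Cmod_ge_0 |]. now apply Hdl.
Qed.

(** A second-order estimate that never forms a second derivative: Cauchy formulas on circles of
    radius [rho / 2] about [z] and [z + k] are subtracted to bound the oscillation of f', and
    [mean_value_ineq] is applied to f u - l u. The constant depends on [M] and [rho] alone, which
    makes the estimate uniform under integrals and sums. *)
Lemma cauchy_remainder f z l rho M h : 0 < rho -> (forall u, Cmod (u - z)%C <= rho -> cdiff f u) ->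
  (forall u, Cmod (u - z)%C <= rho -> Cmod (f u) <= M) -> cder f z l -> Cmod h <= rho / 4 ->
  Cmod (f (z + h) - f z - l * h)%C <= 32 * M / (rho * rho) * (Cmod h * Cmod h).
Proof.
  intros Hr Hf HM Hl Hh. generalize PI2_pos. intros PP.
  assert (Tri : forall u v w : C, Cmod (u - w)%C <= Cmod (u - v)%C + Cmod (v - w)%C).
  { intros u v w. replace (u - w)%C with ((u - v) + (v - w))%C by ring. apply Cmod_triangle. }
  assert (B1 : forall u lu, Cmod (u - z)%C <= 3 * rho / 4 -> cder f u lu -> Cmod lu <= 8 * M / rho).
  { intros u lu Hu Hlu.
    replace (8 * M / rho) with (2 * M / (rho / 4)) by (field; lra).
    apply (cauchy_deriv_bound f u lu); auto; try lra.
    - intros v Hv. apply Hf. specialize (Tri v u z). lra.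
    - intros v Hv. apply HM. specialize (Tri v u z). lra. }
  assert (B2 : forall k lk, Cmod k <= rho / 4 -> cder f (z + k)%C lk ->
     Cmod (lk - l)%C <= 32 * M / (rho * rho) * Cmod k).
  { intros k lk Hk Hlk.
    assert (Hzk : Cmod (z + k - z)%C <= rho / 4) by (replace (z + k - z)%C with k by ring; auto).
    assert (E1 := cauchy_deriv f (z + k)%C lk (rho / 2) ltac:(lra)
      ltac:(intros u Hu; apply Hf; specialize (Tri u (z + k)%C z); lra) Hlk).
    assert (E2 := cauchy_deriv f z l (rho / 2) ltac:(lra) ltac:(intros u Hu; apply Hf; lra) Hl).
    assert (Inc : forall v, Cmod (v - z)%C <= rho / 2 -> Cmod (f (v + k) - f v)%C <= 8 * M / rho * Cmod k).
    { intros v Hv. apply mean_value_ineq. intros t Ht.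
      assert (Hvt : Cmod (v + RtoC t * k - z)%C <= 3 * rho / 4).
      { specialize (Tri (v + RtoC t * k)%C v z).
        replace (v + RtoC t * k - v)%C with (RtoC t * k)%C in Tri by ring.
        rewrite Cmod_mult, Cmod_RtoC_pos in Tri by lra.
        assert (t * Cmod k <= 1 * Cmod k) by (apply Rmult_le_compat_r; [ apply Cmod_ge_0 | lra ]). lra. }
      destruct (Hf (v + RtoC t * k)%C) as [lv Hlv]; [ lra |].
      exists lv. split; auto. eapply B1; eauto. }
    assert (B : Cmod (RtoC (2 * PI) * lk - RtoC (2 * PI) * l)%C <= (2 * PI - 0) * (32 * M / (rho * rho) * Cmod k)).
    { rewrite <- E1, <- E2. 
      assert (I1 : exI (fun t => (f (z + k + RtoC (rho / 2) * cis t) - f (z + k)) * (cis (- t) * RtoC (/ (rho / 2))))%C 0 (2 * PI)).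
      { apply ccont_exI_all. intros t. cc.
        - apply ccont_circle. apply Hf. specialize (Tri (z + k + RtoC (rho / 2) * cis t)%C (z + k)%C z).
          rewrite Cmod_circle in Tri; lra.
        - apply ccont_cis. rcont. }
      assert (I2 : exI (fun t => (f (z + RtoC (rho / 2) * cis t) - f z) * (cis (- t) * RtoC (/ (rho / 2))))%C 0 (2 * PI)).
      { apply ccont_exI_all. intros t. cc.
        - apply ccont_circle. apply Hf. rewrite Cmod_circle; lra.
        - apply ccont_cis. rcont. }
      rewrite <- CI_minus by auto. apply CI_bound; [ lra | now apply exI_minus |].
      intros t _.
      match goal with |- Cmod ?X <= _ => replace X with
        (((f (z + RtoC (rho / 2) * cis t + k) - f (z + RtoC (rho / 2) * cis t)) - (f (z + k) - f z))
          * (cis (- t) * RtoC (/ (rho / 2))))%C end.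
      2:{ replace (z + k + RtoC (rho / 2) * cis t)%C with (z + RtoC (rho / 2) * cis t + k)%C by ring. ring. }
      rewrite !Cmod_mult, Cmod_cis, Cmod_RtoC_pos.
      2:{ left. apply Rinv_0_lt_compat. lra. }
      replace (32 * M / (rho * rho) * Cmod k) with (2 * (8 * M / rho * Cmod k) * (1 * / (rho / 2))) by (field; lra).
      apply Rmult_le_compat_r.
      { rewrite Rmult_1_l. left. apply Rinv_0_lt_compat. lra. }
      eapply Rle_trans; [ apply Cmod_tri_minus |].
      assert (Cmod (f (z + RtoC (rho / 2) * cis t + k) - f (z + RtoC (rho / 2) * cis t))%C <= 8 * M / rho * Cmod k).
      { apply Inc. rewrite Cmod_circle; lra. }
      assert (Cmod (f (z + k) - f z)%C <= 8 * M / rho * Cmod k).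
      { apply Inc. replace (z - z)%C with (RtoC 0) by ring. rewrite Cmod_0. lra. }
      lra. }
    replace (RtoC (2 * PI) * lk - RtoC (2 * PI) * l)%C with (RtoC (2 * PI) * (lk - l))%C in B by ring.
    rewrite Cmod_mult, Cmod_RtoC_pos, Rminus_0_r in B by lra. now apply Rmult_le_reg_l in B. }
  assert (PM : 0 <= 32 * M / (rho * rho)).
  { apply Rmult_le_pos; [| left; apply Rinv_0_lt_compat; nra ].
    assert (Cmod (f z) <= M).
    { apply HM. replace (z - z)%C with (RtoC 0) by ring. rewrite Cmod_0. lra. }
    generalize (Cmod_ge_0 (f z)). lra. }
  rewrite <- Rmult_assoc.
  replace (f (z + h) - f z - l * h)%C with ((f (z + h) - l * (z + h)) - (f z - l * z))%C by ring.
  apply (mean_value_ineq (fun u => f u - l * u)%C z h).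
  intros t Ht.
  assert (Hth : Cmod (RtoC t * h)%C <= Cmod h).
  { rewrite Cmod_mult, Cmod_RtoC_pos by lra.
    assert (t * Cmod h <= 1 * Cmod h) by (apply Rmult_le_compat_r; [ apply Cmod_ge_0 | lra ]). lra. }
  destruct (Hf (z + RtoC t * h)%C) as [lt Hlt].
  { replace (z + RtoC t * h - z)%C with (RtoC t * h)%C by ring. lra. }
  exists (lt - l)%C. split.
  - apply (cder_ext (fun u => f u + (- l) * u)%C); [ intros; ring |].
    replace (lt - l)%C with (lt + (0 * (z + RtoC t * h) + (- l) * 1))%C by ring.
    apply (cder_plus f (fun u => - l * u)%C); auto.
    apply (cder_mult (fun _ => - l)%C (fun u => u)); [ apply cder_const | apply cder_id ].
  - eapply Rle_trans; [ apply B2; [| apply Hlt ]; lra |]. now apply Rmult_le_compat_l.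
Qed.

(** * Maximum modulus and Phragmen-Lindelof *)

Lemma Cmod_pair_lt x y u v d : Rabs (x - u) < d -> Rabs (y - v) < d -> Cmod ((x, y) - (u, v))%C < 2 * d.
Proof.
  intros H1 H2. eapply Rle_lt_trans; [ apply Cmod_le_ReIm |]. reim. lra.
Qed.

Lemma rect_bounded (f : C -> C) a b c d : (forall z, cdiff f z) -> exists M, forall x y,
  a <= x <= b -> c <= y <= d -> Cmod (f (x, y)) <= M.
Proof.
  intros Hf.
  (* The gauge plays two roles: it is a radius on which |f| stays below |f p| + 1, and it is at most
     the inverse of that number. Hence a uniform lower bound [e] of the gauge near every point gives
     the bound [/ e] for |f|. *)
  destruct (functional_choice (fun (p : R * R) (e : posreal) =>
    (forall x y, Rabs (x - fst p) < e -> Rabs (y - snd p) < e -> Cmod (f (x, y)) <= Cmod (f p) + 1)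
    /\ Cmod (f p) + 1 <= / e)) as [del Hdel].
  { intros [u v]. destruct (Hf (u, v)) as [l Hl].
    destruct (cder_cont f _ l Hl 1) as [e [He K]]; [ lra |].
    assert (P : 0 < / (Cmod (f (u, v)) + 1)).
    { apply Rinv_0_lt_compat. generalize (Cmod_ge_0 (f (u, v))). lra. }
    assert (Q : 0 < Rmin (e / 2) (/ (Cmod (f (u, v)) + 1))) by (apply Rmin_pos; lra).
    exists (mkposreal _ Q). simpl. split.
    - intros x y Hx Hy.
      assert (T : Cmod ((x, y) - (u, v))%C < e).
      { replace e with (2 * (e / 2)) by field.
        apply Cmod_pair_lt; (eapply Rlt_le_trans; [ eassumption | apply Rmin_l ]). }
      generalize (K _ T) (Cmod_tri_rev (f (x, y)) (f (u, v))). lra.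
    - apply Rle_trans with (/ / (Cmod (f (u, v)) + 1)); [ rewrite Rinv_inv; lra |].
      apply Rinv_le_contravar; auto. apply Rmin_r. }
  destruct (compactness_value_2d a b c d (fun u v => del (u, v))) as [e He].
  exists (/ e). intros x y Hx Hy. apply NNPP. intros N. apply (He x y Hx Hy). intros (u & v & _ & _ & H1 & H2 & H3).
  apply N. destruct (Hdel (u, v)) as [K1 K2]. eapply Rle_trans; [ apply K1; auto |].
  eapply Rle_trans; [ apply K2 |]. apply Rinv_le_contravar; auto. apply cond_pos.
Qed.

Lemma rect_max (f : C -> C) a b c d : a <= b -> c <= d -> (forall z, cdiff f z) ->
  exists u v, a <= u <= b /\ c <= v <= d /\ forall x y,
    a <= x <= b -> c <= y <= d -> Cmod (f (x, y)) <= Cmod (f (u, v)).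
Proof.
  intros Hab Hcd Hf.
  destruct (rect_bounded f a b c d Hf) as [M HM].
  destruct (completeness (fun r => exists x y, a <= x <= b /\ c <= y <= d /\ r = Cmod (f (x, y)))) as [S [S1 S2]].
  { exists M. intros r (x & y & Hx & Hy & ->). auto. }
  { exists (Cmod (f (a, c))), a, c. repeat split; lra. }
  apply NNPP. intros N.
  assert (L : forall u v, a <= u <= b -> c <= v <= d -> Cmod (f (u, v)) < S).
  { intros u v Hu Hv. destruct (Rle_lt_or_eq_dec (Cmod (f (u, v))) S) as [L | E]; auto.
    - apply S1. exists u, v. auto.
    - exfalso. apply N. exists u, v. repeat split; try lra. intros x y Hx Hy. rewrite E.
      apply S1. exists x, y. auto. }
  (* If the supremum [S] is not attained, the gauge can also measure how far |f| stays below [S]; a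
     uniform lower bound [e] then gives |f| <= S - e everywhere, against the choice of [S]. *)
  destruct (functional_choice (fun (p : R * R) (e : posreal) => a <= fst p <= b -> c <= snd p <= d ->
    forall x y, Rabs (x - fst p) < e -> Rabs (y - snd p) < e -> Cmod (f (x, y)) <= S - e)) as [del Hdel].
  { intros [u v]. simpl.
    destruct (classic (a <= u <= b /\ c <= v <= d)) as [[Hu Hv] | O].
    2:{ exists (mkposreal 1 Rlt_0_1). tauto. }
    specialize (L u v Hu Hv). destruct (Hf (u, v)) as [l Hl].
    destruct (cder_cont f _ l Hl ((S - Cmod (f (u, v))) / 2)) as [e [He K]]; [ lra |].
    assert (Q : 0 < Rmin (e / 2) ((S - Cmod (f (u, v))) / 2)) by (apply Rmin_pos; lra).
    exists (mkposreal _ Q). simpl. intros _ _ x y Hx Hy.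
    assert (T : Cmod ((x, y) - (u, v))%C < e).
    { replace e with (2 * (e / 2)) by field.
      apply Cmod_pair_lt; (eapply Rlt_le_trans; [ eassumption | apply Rmin_l ]). }
    generalize (K _ T) (Cmod_tri_rev (f (x, y)) (f (u, v))) (Rmin_r (e / 2) ((S - Cmod (f (u, v))) / 2)). lra. }
  destruct (compactness_value_2d a b c d (fun u v => del (u, v))) as [e He].
  assert (S <= S - e).
  { apply S2. intros r (x & y & Hx & Hy & ->). apply NNPP. intros N2.
    apply (He x y Hx Hy). intros (u & v & Hu & Hv & H1 & H2 & H3). apply N2.
    specialize (Hdel (u, v) Hu Hv x y H1 H2). lra. }
  generalize (cond_pos e). lra.
Qed.

(** By continuity |f| stays below S - g on an arc starting at [t0], which lowers the average over
    the circle strictly below [S]. The condition t0 < 2 PI leaves room for the arc on the right. *)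
Lemma mean_value_strict f z rho S t0 : 0 < rho -> (forall u, cdiff f u) ->
  (forall t, Cmod (f (z + RtoC rho * cis t)%C) <= S) -> 0 <= t0 < 2 * PI ->
  Cmod (f (z + RtoC rho * cis t0)%C) < S -> Cmod (f z) < S.
Proof.
  intros Hr Hf HS Ht0 Hlt. generalize PI2_pos. intros PP.
  set (q := fun t => f (z + RtoC rho * cis t)%C) in *.
  assert (Hc : forall t, ccont q t) by (intros; apply ccont_circle; auto).
  set (g := (S - Cmod (q t0)) / 2). assert (Pg : 0 < g) by (unfold g, q; lra).
  destruct (ccont_elim q t0 (Hc t0) g Pg) as [d [Hd K]].
  set (t1 := Rmin (2 * PI) (t0 + d / 2)).
  assert (T1 : t0 < t1 <= 2 * PI /\ t1 <= t0 + d / 2).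
  { unfold t1. repeat split; [ apply Rmin_glb_lt; lra | apply Rmin_l | apply Rmin_r ]. }
  assert (I : forall u v, exI q u v) by (intros; now apply ccont_exI_all).
  assert (E := mean_value f z rho Hr (fun u _ => Hf u)). fold q in E.
  rewrite <- (CI_Chasles q 0 t0), <- (CI_Chasles q t0 t1) in E by auto.
  assert (B1 := CI_bound q 0 t0 S ltac:(lra) (I _ _) (fun t _ => HS t)).
  assert (B3 := CI_bound q t1 (2 * PI) S ltac:(lra) (I _ _) (fun t _ => HS t)).
  assert (B2 : Cmod (CI q t0 t1) <= (t1 - t0) * (S - g)).
  { apply CI_bound; [ lra | auto |]. intros t Ht.
    assert (Rabs (t - t0) < d) by (rewrite Rabs_pos_eq; lra).
    specialize (K t H). generalize (Cmod_tri_rev (q t) (q t0)). unfold g in *. lra. }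
  assert (B : 2 * PI * Cmod (f z) <= (t0 - 0) * S + ((t1 - t0) * (S - g) + (2 * PI - t1) * S)).
  { rewrite <- (Cmod_RtoC_pos (2 * PI)) at 1 by lra. rewrite <- Cmod_mult, <- E.
    eapply Rle_trans; [ apply Cmod_triangle |]. apply Rplus_le_compat; auto.
    eapply Rle_trans; [ apply Cmod_triangle |]. now apply Rplus_le_compat. }
  apply (Rmult_lt_reg_l (2 * PI)); auto.
  assert (0 < (t1 - t0) * g) by (apply Rmult_lt_0_compat; lra). lra.
Qed.

(** At an interior maximum exceeding [m], the largest circle that fits in the rectangle touches a
    side, where |f| is at most [m]; this contradicts [mean_value_strict] at once, without any
    propagation of the maximum. *)
Lemma max_modulus f a b c d m : (forall z, cdiff f z) -> a <= b -> c <= d ->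
  (forall y, c <= y <= d -> Cmod (f (a, y)) <= m /\ Cmod (f (b, y)) <= m) ->
  (forall x, a <= x <= b -> Cmod (f (x, c)) <= m /\ Cmod (f (x, d)) <= m) ->
  forall x y, a <= x <= b -> c <= y <= d -> Cmod (f (x, y)) <= m.
Proof.
  intros Hf Hab Hcd Hv Hh.
  destruct (rect_max f a b c d Hab Hcd Hf) as (u & v & Hu & Hv0 & Hmax).
  destruct (Rle_dec (Cmod (f (u, v))) m) as [L | L].
  { intros x y Hx Hy. eapply Rle_trans; [ apply Hmax | ]; auto. }
  exfalso. apply Rnot_le_lt in L.
  assert (a < u < b).
  { destruct (Hv v Hv0). split; apply Rnot_le_lt; intros N.
    - assert (E : u = a) by lra. rewrite E in L. lra.
    - assert (E : u = b) by lra. rewrite E in L. lra. }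
  assert (c < v < d).
  { destruct (Hh u Hu). split; apply Rnot_le_lt; intros N.
    - assert (E : v = c) by lra. rewrite E in L. lra.
    - assert (E : v = d) by lra. rewrite E in L. lra. }
  set (rho := Rmin (Rmin (u - a) (b - u)) (Rmin (v - c) (d - v))).
  assert (Hr : 0 < rho) by (repeat apply Rmin_pos; lra).
  assert (R1 : rho <= u - a) by (eapply Rle_trans; apply Rmin_l).
  assert (R2 : rho <= b - u) by (eapply Rle_trans; [ apply Rmin_l | apply Rmin_r ]).
  assert (R3 : rho <= v - c) by (eapply Rle_trans; [ apply Rmin_r | apply Rmin_l ]).
  assert (R4 : rho <= d - v) by (eapply Rle_trans; [ apply Rmin_r | apply Rmin_r ]).
  assert (P : forall t, ((u, v) + RtoC rho * cis t)%C = (u + rho * cos t, v + rho * sin t)).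
  { intros t. rewrite cis_eq. Csolve. }
  assert (In : forall t, Cmod (f ((u, v) + RtoC rho * cis t)%C) <= Cmod (f (u, v))).
  { intros t. rewrite P. generalize (COS_bound t) (SIN_bound t). intros. apply Hmax; nra. }
  assert (Key : forall t, 0 <= t < 2 * PI -> m < Cmod (f ((u, v) + RtoC rho * cis t)%C)).
  { intros t Ht. apply Rnot_le_lt. intros N.
    apply (Rlt_irrefl (Cmod (f (u, v)))).
    apply (mean_value_strict f (u, v) rho _ t); auto. lra. }
  generalize PI_RGT_0. intros PP.
  assert (O : rho = u - a \/ rho = b - u \/ rho = v - c \/ rho = d - v).
  { unfold rho, Rmin. repeat destruct (Rle_dec _ _); auto. }
  destruct O as [O | [O | [O | O]]].
  - specialize (Key PI ltac:(lra)). rewrite P, cos_PI, sin_PI in Key.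
    replace (u + rho * -1, v + rho * 0) with (a, v) in Key by (f_equal; lra).
    destruct (Hv v Hv0). lra.
  - specialize (Key 0 ltac:(lra)). rewrite P, cos_0, sin_0 in Key.
    replace (u + rho * 1, v + rho * 0) with (b, v) in Key by (f_equal; lra).
    destruct (Hv v Hv0). lra.
  - specialize (Key (3 * (PI / 2)) ltac:(lra)). rewrite P, cos_3PI2, sin_3PI2 in Key.
    replace (u + rho * 0, v + rho * -1) with (u, c) in Key by (f_equal; lra).
    destruct (Hh u Hu). lra.
  - specialize (Key (PI / 2) ltac:(lra)). rewrite P, cos_PI2, sin_PI2 in Key.
    replace (u + rho * 0, v + rho * 1) with (u, d) in Key by (f_equal; lra).
    destruct (Hh u Hu). lra.
Qed.

Lemma exp_pow_le x n : 0 <= x -> (1 + x / INR (S n)) ^ S n <= exp x.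
Proof.
  intros Hx.
  assert (P : 0 < INR (S n)) by (apply lt_0_INR; lia).
  replace (exp x) with (exp (x / INR (S n)) ^ S n).
  - apply pow_incr. split.
    + assert (0 <= x / INR (S n)) by (apply Rmult_le_pos; [ auto | left; now apply Rinv_0_lt_compat ]). lra.
    + apply exp_ineq1_le.
  - rewrite <- Rpower_pow by apply exp_pos. unfold Rpower. rewrite ln_exp. f_equal. field. lra.
Qed.

(** The exponential beats a power one degree higher: [th] is chosen so that th (1 + T) <= 1 + kap T
    / (n + 1), hence exp(kap T) is at least (th (1 + T))^(n + 1) by [exp_pow_le]. *)
Lemma growth_killed A B n kap eps delta T0 : 0 <= A -> 0 <= B -> 0 < kap -> 0 < eps -> 0 < delta ->
  exists T, T0 <= T /\ 0 <= T /\ A * exp (B * (1 + T) ^ n - eps * exp (kap * T)) <= delta.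
Proof.
  intros HA HB Hk He Hd.
  assert (P : 0 < INR (S n)) by (apply lt_0_INR; lia).
  set (th := Rmin 1 (kap / INR (S n))).
  assert (Pth : 0 < th) by (apply Rmin_pos; [ lra | now apply Rdiv_lt_0_compat ]).
  assert (th <= 1 /\ th <= kap / INR (S n)) as [T1 T2] by (split; [ apply Rmin_l | apply Rmin_r ]).
  set (G := eps * th ^ S n).
  assert (PG : 0 < G) by (apply Rmult_lt_0_compat; auto; now apply pow_lt).
  set (L := Rabs (ln (delta / (A + 1)))).
  assert (PL : 0 <= L) by apply Rabs_pos.
  exists (Rmax (Rmax T0 0) ((B + L) / G)).
  set (T := Rmax (Rmax T0 0) ((B + L) / G)).
  assert (T0 <= T /\ 0 <= T /\ (B + L) / G <= T) as (H1 & H2 & H3).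
  { unfold T. repeat split; try apply Rmax_r.
    - eapply Rle_trans; [ apply Rmax_l | apply Rmax_l ].
    - eapply Rle_trans; [ apply Rmax_r | apply Rmax_l ]. }
  repeat split; auto.
  assert (E1 : (th * (1 + T)) ^ S n <= exp (kap * T)).
  { eapply Rle_trans; [| apply exp_pow_le; now apply Rmult_le_pos; [ left |] ].
    apply pow_incr. split; [ apply Rmult_le_pos; lra |].
    replace (kap * T / INR (S n)) with (kap / INR (S n) * T) by (field; lra). nra. }
  assert (E2 : B * (1 + T) ^ n - eps * exp (kap * T) <= - L).
  { apply Rle_trans with (B * (1 + T) ^ n - eps * (th * (1 + T)) ^ S n).
    - apply Rplus_le_compat_l, Ropp_le_contravar. apply Rmult_le_compat_l; lra.
    - rewrite Rpow_mult_distr. replace (eps * (th ^ S n * (1 + T) ^ S n)) with (G * (1 + T) * (1 + T) ^ n).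
      2:{ unfold G. simpl. ring. }
      assert (1 <= (1 + T) ^ n) by (apply pow_R1_Rle; lra).
      assert (B + L <= G * (1 + T)).
      { apply (Rmult_le_compat_l G) in H3; [| lra ]. replace (G * ((B + L) / G)) with (B + L) in H3 by (field; lra). lra. }
      nra. }
  apply Rle_trans with ((A + 1) * exp (- L)).
  - apply Rmult_le_compat; auto; [ left; apply exp_pos | lra |].
    destruct E2 as [E2 | E2]; [ left; now apply exp_increasing | rewrite E2; lra ].
  - assert (Q : 0 < delta / (A + 1)) by (apply Rdiv_lt_0_compat; lra).
    assert (exp (- L) <= delta / (A + 1)).
    { rewrite <- (exp_ln (delta / (A + 1))) by auto.
      assert (- L <= ln (delta / (A + 1))).
      { unfold L. generalize (Rle_abs (- ln (delta / (A + 1)))). rewrite Rabs_Ropp. lra. }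
      destruct H as [H | H]; [ left; now apply exp_increasing | rewrite H; lra ]. }
    apply Rle_trans with ((A + 1) * (delta / (A + 1))).
    + apply Rmult_le_compat_l; lra.
    + right. field. lra.
Qed.

Lemma exp_le x y : x <= y -> exp x <= exp y.
Proof. intros [H | ->]; [ left; now apply exp_increasing | lra ]. Qed.

(** The comparison function is exp(-eps K) with K z = 2 cos(kap (z - x0)), x0 being the middle of
    the strip. As kap times the half width is PI / 3, the cosine of the real part is at least 1/2 in
    the strip, so Re K >= exp(kap |y|) / 2; this doubly exponential decay outweighs the assumed
    growth, and eps tends to 0 at the end. *)
Lemma phragmen_lindelof f a b m A B n T0 : (forall z, cdiff f z) -> a < b -> 0 <= m -> 0 <= A -> 0 <= B ->
  (forall x y, a <= x <= b -> T0 <= Rabs y -> Cmod (f (x, y)) <= A * exp (B * (1 + Rabs y) ^ n)) ->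
  (forall y, Cmod (f (a, y)) <= m /\ Cmod (f (b, y)) <= m) ->
  forall x y, a <= x <= b -> Cmod (f (x, y)) <= m.
Proof.
  intros Hf Hab Hm HA HB Hgr Hbd x y Hx.
  generalize PI_RGT_0. intros PP.
  set (x0 := (a + b) / 2). set (w := (b - a) / 2). assert (Pw : 0 < w) by (unfold w; lra).
  set (kap := PI / 3 / w). assert (Pk : 0 < kap) by (apply Rdiv_lt_0_compat; lra).
  set (K := fun z => (Cexp (Ci * RtoC kap * (z - RtoC x0)) + Cexp (- (Ci * RtoC kap * (z - RtoC x0))))%C).
  assert (ReK : forall u v, Re (K (u, v)) = cos (kap * (u - x0)) * (exp (kap * v) + exp (- (kap * v)))).
  { intros u v. unfold K, Cexp. reim.
    replace ((0 * kap - 1 * 0) * (u - x0) - (0 * 0 + 1 * kap) * (v - 0)) with (- (kap * v)) by ring.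
    replace ((0 * kap - 1 * 0) * (v - 0) + (0 * 0 + 1 * kap) * (u - x0)) with (kap * (u - x0)) by ring.
    rewrite Ropp_involutive, cos_neg. ring. }
  assert (Cos : forall u, a <= u <= b -> / 2 <= cos (kap * (u - x0))).
  { intros u Hu.
    replace (/ 2) with (cos (PI / 3)) by (rewrite cos_PI3; lra).
    assert (Q : Rabs (kap * (u - x0)) <= PI / 3).
    { rewrite Rabs_mult, (Rabs_pos_eq kap) by lra. replace (PI / 3) with (kap * w) by (unfold kap; field; lra).
      apply Rmult_le_compat_l; [ lra |]. apply Rabs_le. unfold x0, w. lra. }
    assert (E : cos (kap * (u - x0)) = cos (Rabs (kap * (u - x0)))).
    { unfold Rabs. destruct (Rcase_abs _); auto. now rewrite cos_neg. }
    rewrite E. apply cos_decr_1; try lra; apply Rabs_pos. }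
  assert (LK : forall u v, a <= u <= b -> exp (kap * Rabs v) / 2 <= Re (K (u, v))).
  { intros u v Hu. rewrite ReK. specialize (Cos u Hu).
    assert (exp (kap * Rabs v) <= exp (kap * v) + exp (- (kap * v))).
    { generalize (exp_pos (kap * v)) (exp_pos (- (kap * v))). unfold Rabs. destruct (Rcase_abs v).
      - replace (kap * - v) with (- (kap * v)) by ring. lra.
      - lra. }
    generalize (exp_pos (kap * Rabs v)). nra. }
  assert (Hk : forall z, cdiff K z) by (intros; unfold K; cd).
  apply le_epsilon. intros e He.
  set (B0 := Rabs (Re (K (x, y)))).
  assert (PB0 : 0 <= B0) by apply Rabs_pos.
  assert (Step : forall eps, 0 < eps -> Cmod (f (x, y)) <= (m + eps) * exp (eps * B0)).
  { intros eps Heps.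
    set (g := fun z => (f z * Cexp (- (RtoC eps * K z)))%C).
    assert (Hg : forall z, cdiff g z) by (intros; unfold g; cd; auto).
    assert (Mg : forall z, Cmod (g z) = Cmod (f z) * exp (- eps * Re (K z))).
    { intros z. unfold g. rewrite Cmod_mult, Cmod_Cexp. do 2 f_equal. reim. ring. }
    (* The height [T] exceeds |y|, so that the rectangle contains the point, and [T0], so that the
       growth hypothesis applies on its horizontal sides. The rate [eps / 2] comes from the lower
       bound of Re K. *)
    destruct (growth_killed A B n kap (eps / 2) (m + eps) (Rmax T0 (Rabs y))) as (T & HT & HT0 & HTg); auto; try lra.
    assert (HTy : Rabs y <= T) by (eapply Rle_trans; [ apply Rmax_r | apply HT ]).
    assert (HTT : T0 <= T) by (eapply Rle_trans; [ apply Rmax_l | apply HT ]).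
    assert (Side : forall u v, a <= u <= b -> Cmod (f (u, v)) <= m -> Cmod (g (u, v)) <= m + eps).
    { intros u v Hu Hfm. rewrite Mg.
      assert (exp (- eps * Re (K (u, v))) <= 1).
      { rewrite <- exp_0. apply exp_le. specialize (LK u v Hu). generalize (exp_pos (kap * Rabs v)). nra. }
      generalize (Cmod_ge_0 (f (u, v))) (exp_pos (- eps * Re (K (u, v)))). nra. }
    assert (Top : forall u v, a <= u <= b -> Rabs v = T -> Cmod (g (u, v)) <= m + eps).
    { intros u v Hu Hv. rewrite Mg. eapply Rle_trans; [| apply HTg ].
      assert (G := Hgr u v Hu ltac:(rewrite Hv; lra)). rewrite Hv in G.
      unfold Rminus. rewrite exp_plus, <- Rmult_assoc.
      apply Rmult_le_compat; auto; [ apply Cmod_ge_0 | left; apply exp_pos |].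
      apply exp_le. specialize (LK u v Hu). rewrite Hv in LK. nra. }
    assert (Hxy : - T <= y <= T).
    { apply Rabs_le_between. auto. }
    assert (G : Cmod (g (x, y)) <= m + eps).
    { apply (max_modulus g a b (- T) T); auto; try lra.
      - intros v Hv. destruct (Hbd v). split; apply Side; auto; lra.
      - intros u Hu. split; apply Top; auto.
        + rewrite Rabs_Ropp. now apply Rabs_pos_eq.
        + now apply Rabs_pos_eq. }
    rewrite Mg in G.
    assert (Q : exp (- eps * Re (K (x, y))) * exp (eps * B0) >= 1).
    { rewrite <- exp_plus, <- exp_0. apply Rle_ge, exp_le.
      assert (Re (K (x, y)) <= B0) by apply Rle_abs. nra. }
    apply Rle_trans with (Cmod (f (x, y)) * exp (- eps * Re (K (x, y))) * exp (eps * B0)).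
    - rewrite Rmult_assoc. generalize (Cmod_ge_0 (f (x, y))). nra.
    - apply Rmult_le_compat_r; auto. left; apply exp_pos. }
  destruct (real_small_error exp 1) with (eps := 1) as [d [Hd K1]]; [| lra |].
  { rewrite <- exp_0. apply derivable_pt_lim_exp. }
  (* The limit in [eps] made explicit: for [eps <= 1], the product (m + eps)(1 + 2 eps B0) exceeds m
     by at most [eps * M]. *)
  set (M := 2 * (m + 1) * B0 + 2).
  assert (PM : 0 < M) by (unfold M; nra).
  set (eps := Rmin 1 (Rmin (d / (B0 + 1) / 2) (e / M))).
  assert (Pe : 0 < eps).
  { repeat apply Rmin_pos; try lra; repeat apply Rdiv_lt_0_compat; lra. }
  assert (eps <= 1 /\ eps <= d / (B0 + 1) / 2 /\ eps <= e / M) as (Q1 & Q2 & Q3).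
  { repeat split; [ apply Rmin_l | |].
    - eapply Rle_trans; [ apply Rmin_r | apply Rmin_l ].
    - eapply Rle_trans; [ apply Rmin_r | apply Rmin_r ]. }
  specialize (Step eps Pe).
  assert (Q4 : eps * B0 < d).
  { apply Rle_lt_trans with (d / (B0 + 1) / 2 * (B0 + 1)).
    - apply Rmult_le_compat; lra.
    - replace (d / (B0 + 1) / 2 * (B0 + 1)) with (d / 2) by (field; lra). lra. }
  specialize (K1 (eps * B0)). rewrite Rabs_pos_eq in K1 by nra. specialize (K1 Q4).
  rewrite exp_0 in K1. apply Rabs_le_between in K1.
  assert (Q5 : eps * M <= e).
  { apply (Rmult_le_compat_r M) in Q3; [| lra ]. replace (e / M * M) with e in Q3 by (field; lra). lra. }
  unfold M in Q5.
  assert (exp (eps * B0) <= 1 + 2 * (eps * B0)) by lra.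
  assert ((m + eps) * exp (eps * B0) <= (m + eps) * (1 + 2 * (eps * B0))) by (apply Rmult_le_compat_l; lra).
  assert (0 <= eps * B0) by nra.
  nra.
Qed.

(** * Improper integrals *)

Lemma C_cauchy (u : nat -> C) :
  (forall eps, 0 < eps -> exists N, forall n m, (N <= n)%nat -> (N <= m)%nat -> Cmod (u n - u m)%C <= eps) ->
  exists l, forall eps, 0 < eps -> exists N, forall n, (N <= n)%nat -> Cmod (u n - l)%C <= eps.
Proof.
  intros H.
  assert (H1 : Cauchy_crit (fun n => Re (u n))).
  { intros e He. destruct (H (e / 2)) as [N K]; [ lra |]. exists N. intros n m Hn Hm.
    unfold Rdist. rewrite <- Re_minus. eapply Rle_lt_trans; [ apply re_le_Cmod |].
    specialize (K n m Hn Hm). lra. }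
  assert (H2 : Cauchy_crit (fun n => Im (u n))).
  { intros e He. destruct (H (e / 2)) as [N K]; [ lra |]. exists N. intros n m Hn Hm.
    unfold Rdist. rewrite <- Im_minus. eapply Rle_lt_trans; [ apply im_le_Cmod |].
    specialize (K n m Hn Hm). lra. }
  destruct (Rcomplete.R_complete _ H1) as [x Hx]. destruct (Rcomplete.R_complete _ H2) as [y Hy].
  exists (x, y). intros eps He.
  destruct (Hx (eps / 2)) as [N1 K1]; [ lra |]. destruct (Hy (eps / 2)) as [N2 K2]; [ lra |].
  exists (Nat.max N1 N2). intros n Hn.
  specialize (K1 n ltac:(lia)). specialize (K2 n ltac:(lia)). unfold Rdist in *.
  eapply Rle_trans; [ apply Cmod_le_ReIm |]. reim. lra.
Qed.

(** The two ends go to infinity independently, so the value is not a principal value and survives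
    shifts, dilations and reflections. *)
Definition isI (q : R -> C) (l : C) : Prop :=
  (forall a b, exI q a b) /\
  forall eps, 0 < eps -> exists X, forall a b, a <= - X -> X <= b -> Cmod (CI q a b - l)%C <= eps.

(** The total mass [P] is part of the data because truncation errors are measured by
    [P - RInt p a b]. *)
Definition dominator (p : R -> R) (P : R) : Prop :=
  (forall x, 0 <= p x) /\ (forall a b, ex_RInt p a b) /\
  forall eps, 0 < eps -> exists X, forall a b, a <= - X -> X <= b -> Rabs (RInt p a b - P) <= eps.

Lemma dominator_mono p P a b a' b' : dominator p P -> a' <= a -> a <= b -> b <= b' ->
  RInt p a' a + RInt p b b' = RInt p a' b' - RInt p a b.
Proof.
  intros (_ & E & _) H1 H2 H3.
  assert (C1 := RInt_Chasles p a' a b (E _ _) (E _ _)).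
  assert (C2 := RInt_Chasles p a' b b' (E _ _) (E _ _)).
  unfold plus in *. simpl in *. lra.
Qed.

Lemma dominator_le p P a b : dominator p P -> a <= b -> RInt p a b <= P.
Proof.
  intros D Hab. apply le_epsilon. intros e He.
  destruct D as (N & E & L). destruct (L e He) as [X HX].
  specialize (HX (Rmin a (- X)) (Rmax b X) (Rmin_r _ _) (Rmax_r _ _)).
  assert (M := dominator_mono p P a b (Rmin a (- X)) (Rmax b X) (conj N (conj E L)) (Rmin_l _ _) Hab (Rmax_l _ _)).
  assert (0 <= RInt p (Rmin a (- X)) a) by (apply RInt_ge_0; auto; apply Rmin_l).
  assert (0 <= RInt p b (Rmax b X)) by (apply RInt_ge_0; auto; apply Rmax_l).
  apply Rabs_le_between in HX. lra.
Qed.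

Lemma CI_dom_p q p P a b : dominator p P -> (forall a b, exI q a b) -> (forall x, Cmod (q x) <= p x) -> a <= b ->
  Cmod (CI q a b) <= RInt p a b.
Proof.
  intros (N & E & _) Hq Hp Hab. apply (CI_dom q p); auto. apply (@RInt_correct R_CompleteNormedModule). auto.
Qed.

Lemma CI_tail q p P a b a' b' : dominator p P -> (forall a b, exI q a b) -> (forall x, Cmod (q x) <= p x) ->
  a' <= a -> a <= b -> b <= b' -> Cmod (CI q a' b' - CI q a b)%C <= RInt p a' b' - RInt p a b.
Proof.
  intros D Hq Hp H1 H2 H3.
  rewrite <- (dominator_mono p P a b a' b') by auto.
  rewrite <- (CI_Chasles q a' a b'), <- (CI_Chasles q a b b') by auto.
  replace (CI q a' a + (CI q a b + CI q b b') - CI q a b)%C with (CI q a' a + CI q b b')%C by ring.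
  eapply Rle_trans; [ apply Cmod_triangle |].
  apply Rplus_le_compat; eapply CI_dom_p; eauto.
Qed.

Lemma isI_unique q l l' : isI q l -> isI q l' -> l = l'.
Proof.
  intros [_ H] [_ H']. apply Cmod_le_eps_eq. intros eps He.
  destruct (H (eps / 2)) as [X HX]; [ lra |]. destruct (H' (eps / 2)) as [X' HX']; [ lra |].
  set (Y := Rmax (Rmax X X') 0).
  assert (X <= Y /\ X' <= Y) as [Y1 Y2].
  { unfold Y. split; (eapply Rle_trans; [| apply Rmax_l ]); [ apply Rmax_l | apply Rmax_r ]. }
  specialize (HX (- Y) Y ltac:(lra) ltac:(lra)). specialize (HX' (- Y) Y ltac:(lra) ltac:(lra)).
  replace (l - l')%C with ((CI q (- Y) Y - l') - (CI q (- Y) Y - l))%C by ring.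
  eapply Rle_trans; [ apply Cmod_tri_minus |]. lra.
Qed.

Lemma isI_tail q l p P a b : isI q l -> dominator p P -> (forall x, Cmod (q x) <= p x) -> a <= b ->
  Cmod (l - CI q a b)%C <= P - RInt p a b.
Proof.
  intros [Hq H] D Hp Hab. apply le_epsilon. intros eps He.
  destruct (H eps He) as [X HX].
  specialize (HX (Rmin a (- X)) (Rmax b X) (Rmin_r _ _) (Rmax_r _ _)).
  assert (T := CI_tail q p P a b (Rmin a (- X)) (Rmax b X) D Hq Hp (Rmin_l _ _) Hab (Rmax_l _ _)).
  assert (Q : Rmin a (- X) <= Rmax b X).
  { eapply Rle_trans; [ apply Rmin_l |]. eapply Rle_trans; [ apply Hab | apply Rmax_l ]. }
  assert (B := dominator_le p P _ _ D Q).
  set (c := CI q (Rmin a (- X)) (Rmax b X)) in *.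
  replace (l - CI q a b)%C with ((c - CI q a b) - (c - l))%C by ring.
  eapply Rle_trans; [ apply Cmod_tri_minus |]. lra.
Qed.

Lemma isI_bound q l p P : isI q l -> dominator p P -> (forall x, Cmod (q x) <= p x) -> Cmod l <= P.
Proof.
  intros H D Hp. assert (T := isI_tail q l p P 0 0 H D Hp (Rle_refl 0)).
  rewrite CI_point, RInt_point in T. replace (l - 0)%C with l in T by ring. unfold zero in T. simpl in T. lra.
Qed.

Lemma isI_exists q p P : (forall a b, exI q a b) -> dominator p P -> (forall x, Cmod (q x) <= p x) ->
  exists l, isI q l.
Proof.
  intros Hq D Hp.
  assert (Cau : forall eps, 0 < eps -> exists X, 0 <= X /\ forall a b, a <= - X -> X <= b ->
     Cmod (CI q a b - CI q (- X) X)%C <= eps).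
  { intros eps He. destruct D as (N & E & L). destruct (L (eps / 2)) as [X HX]; [ lra |].
    assert (X <= Rmax X 0 /\ 0 <= Rmax X 0) as [M1 M2] by (split; [ apply Rmax_l | apply Rmax_r ]).
    exists (Rmax X 0). split; auto. intros a b Ha Hb.
    eapply Rle_trans; [ apply (CI_tail q p P (- Rmax X 0) (Rmax X 0)) |]; auto; try lra.
    { now split. }
    assert (H1 := HX a b ltac:(lra) ltac:(lra)).
    assert (H2 := HX (- Rmax X 0) (Rmax X 0) ltac:(lra) ltac:(lra)).
    apply Rabs_le_between in H1. apply Rabs_le_between in H2. lra. }
  destruct (C_cauchy (fun n => CI q (- INR n) (INR n))) as [l Hl].
  { intros eps He. destruct (Cau (eps / 2)) as (X & PX & HX); [ lra |].
    destruct (INR_unbounded X) as [N HN]. exists N. intros n m Hn Hm.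
    apply le_INR in Hn. apply le_INR in Hm.
    assert (H1 := HX (- INR n) (INR n) ltac:(lra) ltac:(lra)).
    assert (H2 := HX (- INR m) (INR m) ltac:(lra) ltac:(lra)).
    replace (CI q (- INR n) (INR n) - CI q (- INR m) (INR m))%C with
     ((CI q (- INR n) (INR n) - CI q (- X) X) - (CI q (- INR m) (INR m) - CI q (- X) X))%C by ring.
    eapply Rle_trans; [ apply Cmod_tri_minus |]. lra. }
  exists l. split; auto. intros eps He.
  destruct (Cau (eps / 3)) as (X & PX & HX); [ lra |].
  destruct (Hl (eps / 3)) as [N HN]; [ lra |].
  destruct (INR_unbounded X) as [N' HN'].
  exists X. intros a b Ha Hb.
  set (n := Nat.max N N'). specialize (HN n ltac:(lia)).
  assert (INR N' <= INR n) by (apply le_INR; lia).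
  assert (H1 := HX a b Ha Hb). assert (H2 := HX (- INR n) (INR n) ltac:(lra) ltac:(lra)).
  replace (CI q a b - l)%C with
     ((CI q a b - CI q (- X) X) - (CI q (- INR n) (INR n) - CI q (- X) X) + (CI q (- INR n) (INR n) - l))%C by ring.
  eapply Rle_trans; [ apply Cmod_triangle |].
  eapply Rle_trans; [ apply Rplus_le_compat_r, Cmod_tri_minus |]. lra.
Qed.

(** A total function that needs no convergence proof in its definition; it acquires its meaning
    through [Int_eq] once some [isI] holds. *)
Definition IntR (q : R -> C) : C :=
  (real (Lim_seq (fun n => Re (CI q (- INR n) (INR n)))), real (Lim_seq (fun n => Im (CI q (- INR n) (INR n))))).

Lemma Int_eq q l : isI q l -> IntR q = l.
Proof.
  intros [_ H].
  assert (K : forall eps : posreal, exists N, forall n, (N <= n)%nat -> Cmod (CI q (- INR n) (INR n) - l)%C < eps).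
  { intros eps. destruct (H (eps / 2)) as [X HX]; [ apply is_pos_div_2 |].
    destruct (INR_unbounded X) as [N HN]. exists N. intros n Hn. apply le_INR in Hn.
    specialize (HX (- INR n) (INR n) ltac:(lra) ltac:(lra)). generalize (cond_pos eps). lra. }
  unfold IntR. apply Ceq; reim.
  - rewrite (is_lim_seq_unique _ (Re l)); auto.
    apply is_lim_seq_Reals. intros e He. destruct (K (mkposreal e He)) as [N HN]. exists N. intros n Hn.
    unfold Rdist. rewrite <- Re_minus. eapply Rle_lt_trans; [ apply re_le_Cmod | apply HN; auto ].
  - rewrite (is_lim_seq_unique _ (Im l)); auto.
    apply is_lim_seq_Reals. intros e He. destruct (K (mkposreal e He)) as [N HN]. exists N. intros n Hn.
    unfold Rdist. rewrite <- Im_minus. eapply Rle_lt_trans; [ apply im_le_Cmod | apply HN; auto ].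
Qed.

Lemma isI_Int q p P : (forall a b, exI q a b) -> dominator p P -> (forall x, Cmod (q x) <= p x) -> isI q (IntR q).
Proof. intros. destruct (isI_exists q p P) as [l Hl]; auto. now rewrite (Int_eq q l). Qed.

Lemma exI_ext (q r : R -> C) a b : (forall x, q x = r x) -> exI q a b -> exI r a b.
Proof. intros E. apply ex_RInt_ext. auto. Qed.

Lemma isI_ext q r l : (forall x, q x = r x) -> isI q l -> isI r l.
Proof.
  intros E [H1 H2]. split.
  - intros a b. now apply (exI_ext q).
  - intros eps He. destruct (H2 eps He) as [X HX]. exists X. intros a b Ha Hb.
    rewrite <- (CI_ext q r); auto.
Qed.

Lemma isI_plus q r l m : isI q l -> isI r m -> isI (fun x => q x + r x)%C (l + m)%C.
Proof.
  intros [H1 H2] [K1 K2]. split.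
  - intros a b. apply exI_plus; auto.
  - intros eps He. destruct (H2 (eps / 2)) as [X HX]; [ lra |]. destruct (K2 (eps / 2)) as [Y HY]; [ lra |].
    exists (Rmax X Y). intros a b Ha Hb.
    generalize (Rmax_l X Y) (Rmax_r X Y). intros.
    specialize (HX a b ltac:(lra) ltac:(lra)). specialize (HY a b ltac:(lra) ltac:(lra)).
    rewrite CI_plus by auto. replace (CI q a b + CI r a b - (l + m))%C with ((CI q a b - l) + (CI r a b - m))%C by ring.
    eapply Rle_trans; [ apply Cmod_triangle |]. lra.
Qed.

Lemma isI_cmult c q l : isI q l -> isI (fun x => c * q x)%C (c * l)%C.
Proof.
  intros [H1 H2]. split.
  - intros a b. apply exI_cmult; auto.
  - intros eps He. assert (P : 0 < Cmod c + 1) by (generalize (Cmod_ge_0 c); lra).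
    destruct (H2 (eps / (Cmod c + 1))) as [X HX]; [ now apply Rdiv_lt_0_compat |].
    exists X. intros a b Ha Hb. specialize (HX a b Ha Hb).
    rewrite CI_cmult by auto. replace (c * CI q a b - c * l)%C with (c * (CI q a b - l))%C by ring.
    rewrite Cmod_mult. apply Rle_trans with ((Cmod c + 1) * (eps / (Cmod c + 1))).
    + apply Rmult_le_compat; auto using Cmod_ge_0. lra.
    + right. field. lra.
Qed.

Lemma isI_minus q r l m : isI q l -> isI r m -> isI (fun x => q x - r x)%C (l - m)%C.
Proof.
  intros H K. replace (l - m)%C with (l + (- (1)) * m)%C by ring.
  apply (isI_ext (fun x => q x + (- (1)) * r x)%C); [ intros; ring |].
  apply isI_plus; auto. now apply isI_cmult.
Qed.

Lemma exI_lin (q : R -> C) k c a b : k <> 0 -> (forall a b, exI q a b) -> exI (fun x => q (k * x + c)) a b.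
Proof.
  intros Hk Hq.
  apply (exI_ext (fun y => RtoC (/ k) * (@scal _ C_R_NormedModule k (q (k * y + c)%R)))%C).
  - intros t. rewrite scal_R_Cmult, RtoC_inv by auto. generalize (q (k * t + c)). intros w.
    field. now apply RtoC_neq0.
  - apply exI_cmult. now apply (@ex_RInt_comp_lin C_R_NormedModule).
Qed.

Lemma isI_lin q l k c : 0 < k -> isI q l -> isI (fun x => RtoC k * q (k * x + c)%R)%C l.
Proof.
  intros Hk [H1 H2]. split.
  - intros a b. apply exI_cmult, exI_lin; auto. lra.
  - intros eps He. destruct (H2 eps He) as [X HX]. exists ((Rabs X + Rabs c) / k).
    intros a b Ha Hb. rewrite CI_cmult, CI_lin by (auto; apply exI_lin; auto; lra).
    assert (E : k * ((Rabs X + Rabs c) / k) = Rabs X + Rabs c) by (field; lra).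
    generalize (Rle_abs X) (Rle_abs c) (Rle_abs (- c)). rewrite Rabs_Ropp. intros.
    apply HX; nra.
Qed.

Lemma isI_shift q l c : isI q l -> isI (fun x => q (x + c)) l.
Proof.
  intros H. apply (isI_ext (fun x => RtoC 1 * q (1 * x + c)%R)%C).
  - intros. rewrite Rmult_1_l. ring.
  - apply isI_lin; auto. lra.
Qed.

Lemma isI_reflect q l : isI q l -> isI (fun x => q (- x)) l.
Proof.
  intros [H1 H2].
  assert (E : forall a b, exI (fun x => q (- x)) a b).
  { intros. apply (exI_ext (fun x => q (-1 * x + 0))); [ intros; f_equal; ring |]. apply exI_lin; auto. lra. }
  split; auto.
  intros eps He. destruct (H2 eps He) as [X HX]. exists X. intros a b Ha Hb.
  replace (CI (fun x => q (- x)) a b) with (CI q (- b) (- a)); [ apply HX; lra |].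
  rewrite CI_swap by auto.
  assert (K := CI_lin q (-1) 0 a b (H1 _ _)).
  rewrite (CI_ext _ (fun x => q (- x))) in K by (intros; f_equal; ring).
  replace (-1 * a + 0) with (- a) in K by ring. replace (-1 * b + 0) with (- b) in K by ring.
  rewrite <- K. ring.
Qed.

Lemma isI_FTC (q dq : R -> C) : (forall x, rder q x (dq x)) -> (forall x, ccont dq x) ->
  (forall eps, 0 < eps -> exists X, forall x, X <= Rabs x -> Cmod (q x) <= eps) -> isI dq 0.
Proof.
  intros Hd Hc Hl. split.
  - intros. now apply ccont_exI_all.
  - intros eps He. destruct (Hl (eps / 2)) as [X HX]; [ lra |].
    exists (Rmax X 0). intros a b Ha Hb. rewrite (CI_FTC q dq) by auto.
    generalize (Rmax_l X 0) (Rmax_r X 0). intros.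
    assert (H1 := HX a ltac:(rewrite Rabs_left1; lra)).
    assert (H2 := HX b ltac:(rewrite Rabs_pos_eq; lra)).
    replace (q b - q a - 0)%C with (q b - q a)%C by ring.
    eapply Rle_trans; [ apply Cmod_tri_minus |]. lra.
Qed.

Lemma RInt_cauchy_density M a b : is_RInt (fun x => M / (1 + x ^ 2)) a b (M * (atan b - atan a)).
Proof.
  replace (M * (atan b - atan a)) with (minus (M * atan b) (M * atan a)) by (unfold minus, plus, opp; simpl; ring).
  apply (@is_RInt_derive R_CompleteNormedModule (fun x => M * atan x)).
  - intros x _. auto_derive; auto. field. nra.
  - intros x _. apply @ex_derive_continuous. auto_derive. nra.
Qed.

Lemma dominator_cauchy M : 0 <= M -> dominator (fun x => M / (1 + x ^ 2)) (M * PI).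
Proof.
  intros HM. split; [| split ].
  - intros x. apply Rmult_le_pos; auto. left. apply Rinv_0_lt_compat. nra.
  - intros a b. eexists. apply RInt_cauchy_density.
  - intros eps He.
    assert (Pe : 0 < eps / (2 * (M + 1))) by (apply Rdiv_lt_0_compat; lra).
    set (e := Rmin 1 (eps / (2 * (M + 1)))).
    assert (0 < e) by (apply Rmin_pos; lra).
    assert (e <= 1 /\ e <= eps / (2 * (M + 1))) as [e1 e2] by (split; [ apply Rmin_l | apply Rmin_r ]).
    exists (tan (PI / 2 - e)). intros a b Ha Hb.
    generalize PI2_1. intros P1.
    rewrite (is_RInt_unique _ _ _ _ (RInt_cauchy_density M a b)).
    assert (T : atan (tan (PI / 2 - e)) = PI / 2 - e) by (apply atan_tan; lra).
    assert (Mon : forall x y, x <= y -> atan x <= atan y).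
    { intros x y [L | ->]; [ left; now apply atan_increasing | lra ]. }
    assert (B1 := Mon _ _ Hb). assert (B2 := Mon _ _ Ha). rewrite atan_opp, T in B2. rewrite T in B1.
    generalize (atan_bound a) (atan_bound b). intros.
    rewrite Rabs_left1 by nra.
    assert (M * (PI - (atan b - atan a)) <= M * (2 * e)) by (apply Rmult_le_compat_l; lra).
    assert ((M + 1) * (2 * e) <= (M + 1) * (2 * (eps / (2 * (M + 1))))) by (apply Rmult_le_compat_l; lra).
    replace ((M + 1) * (2 * (eps / (2 * (M + 1))))) with eps in * by (field; lra). lra.
Qed.

(** In the logarithmic coordinate x = log t the cut integrals are integrals over t > 1. *)
Definition cut (q : R -> C) (x : R) : C := if Rlt_dec x 0 then 0 else q x.

Lemma cut_neg (q : R -> C) x : x < 0 -> cut q x = 0.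
Proof. intros. unfold cut. destruct (Rlt_dec x 0); auto; lra. Qed.

Lemma cut_pos (q : R -> C) x : 0 <= x -> cut q x = q x.
Proof. intros. unfold cut. destruct (Rlt_dec x 0); auto; lra. Qed.

Lemma exI_cut (q : R -> C) : (forall a b, 0 <= a -> 0 <= b -> exI q a b) -> forall a b, exI (cut q) a b.
Proof.
  intros H.
  assert (N : forall x, exI (cut q) 0 x).
  { intros x. destruct (Rle_dec 0 x).
    - apply (ex_RInt_ext q); [| apply H; lra ].
      intros t Ht. rewrite Rmin_left in Ht by lra. symmetry. apply cut_pos. lra.
    - apply (ex_RInt_ext (fun _ => RtoC 0 : C_R_NormedModule)).
      + intros t Ht. rewrite Rmax_left in Ht by lra. symmetry. apply cut_neg. lra.
      + apply ccont_exI_all. intros. apply ccont_const. }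
  intros a b. apply (@ex_RInt_Chasles C_R_NormedModule _ a 0 b); auto. now apply ex_RInt_swap.
Qed.

Lemma CI_cut (q : R -> C) a b : (forall a b, 0 <= a -> 0 <= b -> exI q a b) -> a <= 0 -> 0 <= b -> CI (cut q) a b = CI q 0 b.
Proof.
  intros H Ha Hb. assert (E := exI_cut q H).
  rewrite <- (CI_Chasles (cut q) a 0 b) by auto.
  rewrite (CI_unique (cut q) a 0 (RtoC 0)).
  - rewrite Cplus_0_l. apply (@RInt_ext C_R_CompleteNormedModule). intros x Hx. rewrite Rmin_left in Hx by lra. apply cut_pos. lra.
  - apply (@is_RInt_ext C_R_NormedModule (fun _ => RtoC 0)).
    + intros t Ht. rewrite Rmax_right in Ht by lra. symmetry. apply cut_neg. lra.
    + assert (K := CI_correct (fun _ => 0) a 0). rewrite CI_const, Cmult_0_r in K. apply K.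
      apply ccont_exI_all. intros. apply ccont_const.
Qed.

Lemma dominator_exp_cut B k : 0 <= B -> 0 < k ->
  dominator (fun x => if Rlt_dec x 0 then 0 else B * exp (- (k * x))) (B / k).
Proof.
  intros HB Hk.
  set (p := fun x => if Rlt_dec x 0 then 0 else B * exp (- (k * x))).
  assert (I1 : forall b, 0 <= b -> is_RInt p 0 b (B / k * (1 - exp (- (k * b))))).
  { intros b Hb. apply (is_RInt_ext (fun x => B * exp (- (k * x)))).
    - intros x Hx. rewrite Rmin_left in Hx by lra. unfold p. destruct (Rlt_dec x 0); auto; lra.
    - replace (B / k * (1 - exp (- (k * b)))) with
        (minus ((fun x => - (B / k) * exp (- (k * x))) b) ((fun x => - (B / k) * exp (- (k * x))) 0)).
      2:{ unfold minus, plus, opp. simpl. rewrite Rmult_0_r, Ropp_0, exp_0. ring. }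
      apply (@is_RInt_derive R_CompleteNormedModule (fun x => - (B / k) * exp (- (k * x)))).
      + intros x _. auto_derive; auto. field. lra.
      + intros x _. apply @ex_derive_continuous. auto_derive. auto. }
  assert (I2 : forall a, a <= 0 -> is_RInt p a 0 0).
  { intros a Ha. apply (is_RInt_ext (fun _ => 0)).
    - intros x Hx. rewrite Rmax_right in Hx by lra. unfold p. destruct (Rlt_dec x 0); auto; lra.
    - replace 0 with (scal (0 - a) 0) at 2 by (unfold scal; simpl; unfold mult; simpl; ring).
      apply (@is_RInt_const R_NormedModule). }
  assert (Ex : forall x, ex_RInt p 0 x).
  { intros x. destruct (Rle_dec 0 x); [ eexists; apply I1; auto |].
    apply ex_RInt_swap. eexists. apply I2. lra. }
  assert (Q : 0 <= B / k) by (apply Rmult_le_pos; auto; left; now apply Rinv_0_lt_compat).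
  split; [| split ].
  - intros x. unfold p. destruct (Rlt_dec x 0); [ lra |]. apply Rmult_le_pos; auto. left; apply exp_pos.
  - intros a b. apply (ex_RInt_Chasles p a 0 b); auto. now apply ex_RInt_swap.
  - intros eps He.
    assert (Pe : 0 < eps / (B / k + 1)) by (apply Rdiv_lt_0_compat; lra).
    destruct (exp_small_at_minf _ Pe) as [Y HY].
    exists (Rmax 0 (- Y / k)). intros a b Ha Hb.
    generalize (Rmax_l 0 (- Y / k)) (Rmax_r 0 (- Y / k)). intros.
    rewrite (is_RInt_unique p a b (plus 0 (B / k * (1 - exp (- (k * b)))))).
    + unfold plus. simpl. rewrite Rplus_0_l.
      replace (B / k * (1 - exp (- (k * b))) - B / k) with (- (B / k * exp (- (k * b)))) by ring.
      rewrite Rabs_Ropp, Rabs_pos_eq by (apply Rmult_le_pos; auto; left; apply exp_pos).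
      assert (exp (- (k * b)) < eps / (B / k + 1)).
      { apply HY. assert (- Y / k <= b) by lra. apply (Rmult_le_compat_l k) in H1; [| lra ].
        replace (k * (- Y / k)) with (- Y) in H1 by (field; lra). lra. }
      apply Rle_trans with ((B / k + 1) * (eps / (B / k + 1))).
      * apply Rmult_le_compat; auto; try lra. left; apply exp_pos.
      * right. field. split; [ lra |]. generalize Q. intros.
        apply Rgt_not_eq. replace (B + k) with (k * (B / k + 1)) by (field; lra). apply Rmult_lt_0_compat; lra.
    + apply (@is_RInt_Chasles R_NormedModule p a 0 b); [ apply I2 | apply I1 ]; lra.
Qed.

(** * Holomorphic dependence of integrals and series on a parameter *)

Lemma cder_quadratic (Q : C -> C) z l r K : 0 < r ->
  (forall h, Cmod h <= r -> Cmod (Q (z + h) - Q z - l * h)%C <= K * (Cmod h * Cmod h)) -> cder Q z l.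
Proof.
  intros Hr H eps He.
  assert (P : 0 < Rabs K + 1) by (generalize (Rabs_pos K); lra).
  exists (Rmin r (eps / (Rabs K + 1))). split.
  - apply Rmin_pos; auto. now apply Rdiv_lt_0_compat.
  - intros h Hh.
    assert (E1 : Cmod h <= r) by (left; eapply Rlt_le_trans; [ apply Hh | apply Rmin_l ]).
    assert (E2 : Cmod h <= eps / (Rabs K + 1)) by (left; eapply Rlt_le_trans; [ apply Hh | apply Rmin_r ]).
    eapply Rle_trans; [ now apply H |]. rewrite <- Rmult_assoc. apply Rmult_le_compat_r; [ apply Cmod_ge_0 |].
    apply Rle_trans with ((Rabs K + 1) * Cmod h).
    + apply Rmult_le_compat_r; [ apply Cmod_ge_0 |]. generalize (Rle_abs K). lra.
    + apply (Rmult_le_compat_l (Rabs K + 1)) in E2; [| lra ].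
      replace ((Rabs K + 1) * (eps / (Rabs K + 1))) with eps in E2 by (field; lra). lra.
Qed.

Lemma INR_inv_small (B : R) eps : 0 <= B -> 0 < eps -> exists N, forall n, (N <= n)%nat -> B / INR (S n) <= eps.
Proof.
  intros HB He. destruct (INR_unbounded (B / eps)) as [N HN]. exists N. intros n Hn.
  apply le_INR in Hn. assert (P : 0 < INR (S n)) by (apply lt_0_INR; lia).
  rewrite S_INR in *.
  apply (Rmult_le_reg_r (INR n + 1)); auto. replace (B / (INR n + 1) * (INR n + 1)) with B by (field; lra).
  apply (Rmult_lt_compat_r eps) in HN; auto. replace (B / eps * eps) with B in HN by (field; lra). nra.
Qed.

(** A derivative is produced without a candidate: it is the Cauchy limit of the difference quotients
    along the real increments r / (n + 1), and the hypothesis controls all other increments. *)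
Lemma cdiff_quotient_cauchy (Q : C -> C) z r K : 0 < r -> 0 <= K ->
  (forall h k : C, h <> 0 -> k <> 0 -> Cmod h <= r -> Cmod k <= r ->
     Cmod ((Q (z + h) - Q z) / h - (Q (z + k) - Q z) / k)%C <= K * (Cmod h + Cmod k)) -> cdiff Q z.
Proof.
  intros Hr HK H.
  set (F := fun h => ((Q (z + h) - Q z) / h)%C).
  set (hn := fun n : nat => RtoC (r / INR (S n))).
  assert (Pn : forall n, 0 < r / INR (S n)).
  { intros n. apply Rdiv_lt_0_compat; auto. apply lt_0_INR; lia. }
  assert (Hn0 : forall n, hn n <> 0) by (intros; apply RtoC_neq0, Rgt_not_eq, Pn).
  assert (Mn : forall n, Cmod (hn n) = r / INR (S n)).
  { intros n. apply Cmod_RtoC_pos. left. apply Pn. }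
  assert (Mr : forall n, Cmod (hn n) <= r).
  { intros n. rewrite Mn. apply (Rmult_le_reg_r (INR (S n))); [ apply lt_0_INR; lia |].
    replace (r / INR (S n) * INR (S n)) with r by (field; apply not_0_INR; lia).
    rewrite S_INR. generalize (pos_INR n). nra. }
  assert (Sm : forall eps, 0 < eps -> exists N, forall n, (N <= n)%nat -> K * Cmod (hn n) <= eps).
  { intros eps He. destruct (INR_inv_small (K * r) eps) as [N HN]; auto; [ nra |].
    exists N. intros n Hn. specialize (HN n Hn). rewrite Mn. unfold Rdiv in *. lra. }
  destruct (C_cauchy (fun n => F (hn n))) as [l Hl].
  { intros eps He. destruct (Sm (eps / 2)) as [N HN]; [ lra |]. exists N. intros n m Hn Hm.
    eapply Rle_trans; [ apply H; auto |].
    generalize (HN n Hn) (HN m Hm). lra. }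
  assert (B : forall h : C, h <> 0 -> Cmod h <= r -> Cmod (F h - l)%C <= K * Cmod h).
  { intros h Hh Hhr. apply le_epsilon. intros e He.
    destruct (Hl (e / 2)) as [N1 HN1]; [ lra |]. destruct (Sm (e / 2)) as [N2 HN2]; [ lra |].
    set (n := Nat.max N1 N2). specialize (HN1 n ltac:(lia)). specialize (HN2 n ltac:(lia)).
    replace (F h - l)%C with ((F h - F (hn n)) + (F (hn n) - l))%C by ring.
    eapply Rle_trans; [ apply Cmod_triangle |].
    assert (G := H h (hn n) Hh (Hn0 n) Hhr (Mr n)). fold (F h) in G. fold (F (hn n)) in G. lra. }
  exists l. apply (cder_quadratic Q z l r K Hr). intros h Hhr.
  destruct (classic (h = 0)) as [-> | Hh].
  - replace (Q (z + 0) - Q z - l * 0)%C with (RtoC 0).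
    + rewrite Cmod_0. lra.
    + replace (z + 0)%C with z by ring. ring.
  - replace (Q (z + h) - Q z - l * h)%C with ((F h - l) * h)%C by (unfold F; field; auto).
    rewrite Cmod_mult, <- Rmult_assoc. apply Rmult_le_compat_r; [ apply Cmod_ge_0 | auto ].
Qed.

Lemma dominator_scal p P K : 0 <= K -> dominator p P -> dominator (fun x => K * p x) (K * P).
Proof.
  intros HK D. destruct D as (D1 & D2 & D3). split; [| split ].
  - intros x. apply Rmult_le_pos; auto.
  - intros a b. apply (ex_RInt_scal (V := R_NormedModule) p a b K). auto.
  - intros eps He. destruct (D3 (eps / (K + 1))) as [X HX]; [ apply Rdiv_lt_0_compat; lra |].
    exists X. intros a b Ha Hb. specialize (HX a b Ha Hb).
    assert (E : RInt (fun x => K * p x) a b = K * RInt p a b)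
      by exact (RInt_scal (V := R_CompleteNormedModule) p a b K (D2 a b)).
    rewrite E, <- Rmult_minus_distr_l, Rabs_mult, (Rabs_pos_eq K) by auto.
    apply Rle_trans with ((K + 1) * (eps / (K + 1))).
    + apply Rmult_le_compat; auto using Rabs_pos. lra.
    + right. field. lra.
Qed.

(** The pointwise derivatives [dl x] come from choice, and nothing is known about their
    integrability in [x]. They are therefore never integrated: two difference quotients of [Q] are
    compared, and [dl x] cancels under the integral. When the derivative is known to be integrable,
    [isI_cder] gives its value. *)
Lemma isI_cdiff (q : R -> C -> C) (Q : C -> C) z rho p P : 0 < rho -> dominator p P ->
  (forall x u, Cmod (u - z)%C <= rho -> cdiff (q x) u /\ Cmod (q x u) <= p x) ->
  (forall u, Cmod (u - z)%C <= rho -> isI (fun x => q x u) (Q u)) -> cdiff Q z.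
Proof.
  intros Hr D Hq HQ.
  assert (Hz : Cmod (z - z)%C <= rho) by (replace (z - z)%C with (RtoC 0) by ring; rewrite Cmod_0; lra).
  destruct (functional_choice (fun x l => cder (q x) z l)) as [dl Hdl].
  { intros x. destruct (Hq x z Hz) as [[l Hl] _]. now exists l. }
  assert (PP : 0 <= P).
  { assert (B := dominator_le p P 0 0 D (Rle_refl 0)). rewrite RInt_point in B. exact B. }
  assert (Pr2 : 0 < rho * rho) by nra.
  set (K := 32 / (rho * rho)). assert (HK : 0 <= K) by (left; apply Rdiv_lt_0_compat; lra).
  apply (cdiff_quotient_cauchy Q z (rho / 4) (K * P)); [ lra | nra |].
  intros h k Hh Hk Hhr Hkr.
  assert (Hzh : Cmod (z + h - z)%C <= rho) by (replace (z + h - z)%C with h by ring; lra).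
  assert (Hzk : Cmod (z + k - z)%C <= rho) by (replace (z + k - z)%C with k by ring; lra).
  assert (J : isI (fun x => / h * (q x (z + h) - q x z) - / k * (q x (z + k) - q x z))%C
      (/ h * (Q (z + h) - Q z) - / k * (Q (z + k) - Q z))%C).
  { apply isI_minus; apply isI_cmult, isI_minus; auto. }
  replace ((Q (z + h) - Q z) / h - (Q (z + k) - Q z) / k)%C with
   (/ h * (Q (z + h) - Q z) - / k * (Q (z + k) - Q z))%C by (unfold Cdiv; ring).
  replace (K * P * (Cmod h + Cmod k)) with (K * (Cmod h + Cmod k) * P) by ring.
  assert (HKK : 0 <= K * (Cmod h + Cmod k)).
  { generalize (Cmod_ge_0 h) (Cmod_ge_0 k). nra. }
  apply (isI_bound _ _ _ _ J (dominator_scal p P _ HKK D)).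
  intros x.
  assert (B : forall s : C, s <> 0 -> Cmod s <= rho / 4 -> Cmod (/ s * (q x (z + s) - q x z) - dl x)%C <= K * p x * Cmod s).
  { intros s Hs Hsr.
    assert (R := cauchy_remainder (q x) z (dl x) rho (p x) s Hr (fun u Hu => proj1 (Hq x u Hu)) (fun u Hu => proj2 (Hq x u Hu)) (Hdl x) Hsr).
    replace (/ s * (q x (z + s) - q x z) - dl x)%C with (/ s * (q x (z + s) - q x z - dl x * s))%C by (field; auto).
    assert (Ps := Cmod_neq0 s Hs).
    rewrite Cmod_mult, Cmod_inv by auto. apply (Rmult_le_reg_l (Cmod s)); auto.
    rewrite <- Rmult_assoc, Rinv_r, Rmult_1_l by lra.
    eapply Rle_trans; [ apply R |]. right. unfold K. field. lra. }
  replace (/ h * (q x (z + h) - q x z) - / k * (q x (z + k) - q x z))%C with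
    ((/ h * (q x (z + h) - q x z) - dl x) - (/ k * (q x (z + k) - q x z) - dl x))%C by ring.
  eapply Rle_trans; [ apply Cmod_tri_minus |].
  generalize (B h Hh Hhr) (B k Hk Hkr). lra.
Qed.

Lemma isI_cder (q : R -> C -> C) (dq : R -> C) (Q : C -> C) z L rho p P : 0 < rho -> dominator p P ->
  (forall x u, Cmod (u - z)%C <= rho -> cdiff (q x) u /\ Cmod (q x u) <= p x) ->
  (forall u, Cmod (u - z)%C <= rho -> isI (fun x => q x u) (Q u)) ->
  (forall x, cder (q x) z (dq x)) -> isI dq L -> cder Q z L.
Proof.
  intros Hr D Hq HQ Hd HL.
  assert (Hz : Cmod (z - z)%C <= rho) by (replace (z - z)%C with (RtoC 0) by ring; rewrite Cmod_0; lra).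
  assert (Pr2 : 0 < rho * rho) by nra.
  set (K := 32 / (rho * rho)). assert (HK : 0 <= K) by (left; apply Rdiv_lt_0_compat; lra).
  apply (cder_quadratic Q z L (rho / 4) (K * P)); [ lra |].
  intros h Hhr.
  assert (Hzh : Cmod (z + h - z)%C <= rho) by (replace (z + h - z)%C with h by ring; lra).
  assert (J : isI (fun x => q x (z + h) - q x z - h * dq x)%C (Q (z + h) - Q z - h * L)%C).
  { apply isI_minus; [ apply isI_minus; auto |]. now apply isI_cmult. }
  replace (L * h)%C with (h * L)%C by ring.
  replace (K * P * (Cmod h * Cmod h)) with (K * (Cmod h * Cmod h) * P) by ring.
  assert (HKK : 0 <= K * (Cmod h * Cmod h)).
  { generalize (Cmod_ge_0 h). intros. apply Rmult_le_pos; nra. }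
  apply (isI_bound _ _ _ _ J (dominator_scal p P _ HKK D)).
  intros x. rewrite (Cmult_comm h).
  eapply Rle_trans; [ apply (cauchy_remainder (q x) z (dq x) rho (p x)); auto; intros u Hu; now apply Hq |].
  right. unfold K. field. lra.
Qed.

(** * Series of complex numbers and of holomorphic functions *)

Definition isS (u : nat -> C) (l : C) : Prop := @is_series C_AbsRing C_NormedModule u l.

Lemma isS_eps (u : nat -> C) (l : C) : isS u l <->
  forall eps, 0 < eps -> exists N, forall n, (N <= n)%nat -> Cmod (sum_n (G := C_NormedModule) u n - l)%C <= eps.
Proof.
  split.
  - intros H eps He.
    assert (K := proj1 (@filterlim_locally_ball_norm C_AbsRing nat C_NormedModule eventually _ (sum_n (G := C_NormedModule) u) l) H (mkposreal eps He)).
    destruct K as [N HN]. exists N. intros n Hn. left. apply (HN n Hn).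
  - intros H. apply (@filterlim_locally_ball_norm C_AbsRing nat C_NormedModule eventually _ (sum_n (G := C_NormedModule) u) l).
    intros eps. destruct (H (eps / 2)) as [N HN]; [ apply is_pos_div_2 |]. exists N. intros n Hn.
    specialize (HN n Hn). change (Cmod (sum_n (G := C_NormedModule) u n - l)%C < eps).
    generalize (cond_pos eps). lra.
Qed.

Fixpoint psum (u : nat -> C) (n : nat) : C := match n with O => 0 | S n => (psum u n + u n)%C end.

Lemma psum_sum_n u n : sum_n (G := C_NormedModule) u n = psum u (S n).
Proof.
  induction n.
  - rewrite sum_O. symmetry. apply Cplus_0_l.
  - rewrite sum_Sn, IHn. reflexivity.
Qed.

Lemma isS_psum (u : nat -> C) (l : C) : isS u l <->
  forall eps, 0 < eps -> exists N, forall n, (N <= n)%nat -> Cmod (psum u n - l)%C <= eps.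
Proof.
  rewrite isS_eps. split; intros H eps He; destruct (H eps He) as [N HN].
  - exists (S N). intros n Hn. destruct n; [ lia |]. rewrite <- psum_sum_n. apply HN. lia.
  - exists N. intros n Hn. rewrite psum_sum_n. apply HN. lia.
Qed.

Lemma isS_unique u l l' : isS u l -> isS u l' -> l = l'.
Proof.
  rewrite !isS_psum. intros H H'. apply Cmod_le_eps_eq. intros eps He.
  destruct (H (eps / 2)) as [N HN]; [ lra |]. destruct (H' (eps / 2)) as [N' HN']; [ lra |].
  specialize (HN (Nat.max N N') ltac:(lia)). specialize (HN' (Nat.max N N') ltac:(lia)).
  set (s := psum u (Nat.max N N')) in *.
  replace (l - l')%C with ((s - l') - (s - l))%C by ring.
  eapply Rle_trans; [ apply Cmod_tri_minus |]. lra.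
Qed.

Fixpoint psumR (u : nat -> R) (n : nat) : R := match n with O => 0 | S n => psumR u n + u n end.

Definition summable (p : nat -> R) (P : R) : Prop :=
  (forall n, 0 <= p n) /\ forall eps, 0 < eps -> exists N, forall n, (N <= n)%nat -> Rabs (psumR p n - P) <= eps.

Lemma psumR_incr p n m : (forall n, 0 <= p n) -> (n <= m)%nat -> psumR p n <= psumR p m.
Proof. intros H L. induction L; [ lra |]. simpl. specialize (H m). lra. Qed.

Lemma summable_le p P n : summable p P -> psumR p n <= P.
Proof.
  intros [H1 H2]. apply le_epsilon. intros e He. destruct (H2 e He) as [N HN].
  specialize (HN (Nat.max n N) ltac:(lia)). apply Rabs_le_between in HN.
  assert (psumR p n <= psumR p (Nat.max n N)) by (apply psumR_incr; auto; lia). lra.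
Qed.

Lemma psum_tail u p n m : (forall n, Cmod (u n) <= p n) -> (n <= m)%nat ->
  Cmod (psum u m - psum u n)%C <= psumR p m - psumR p n.
Proof.
  intros H L. induction L.
  - replace (psum u n - psum u n)%C with (RtoC 0) by ring. rewrite Cmod_0. lra.
  - simpl. replace (psum u m + u m - psum u n)%C with ((psum u m - psum u n) + u m)%C by ring.
    eapply Rle_trans; [ apply Cmod_triangle |]. specialize (H m). lra.
Qed.

Lemma isS_exists u p P : summable p P -> (forall n, Cmod (u n) <= p n) -> exists l, isS u l.
Proof.
  intros Hp Hu.
  destruct (C_cauchy (psum u)) as [l Hl].
  - intros eps He. destruct Hp as [P1 P2]. destruct (P2 (eps / 2)) as [N HN]; [ lra |]. exists N.
    assert (W : forall n m, (N <= n)%nat -> (n <= m)%nat -> Cmod (psum u m - psum u n)%C <= eps).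
    { intros n m Hn Hm. eapply Rle_trans; [ apply (psum_tail u p); auto |].
      assert (H1 := HN n ltac:(lia)). assert (H2 := HN m ltac:(lia)).
      apply Rabs_le_between in H1. apply Rabs_le_between in H2. lra. }
    intros n m Hn Hm. destruct (Nat.le_ge_cases n m); auto. rewrite Cmod_minus_sym. auto.
  - exists l. now apply isS_psum.
Qed.

Lemma isS_tail u l p P n : isS u l -> summable p P -> (forall n, Cmod (u n) <= p n) ->
  Cmod (l - psum u n)%C <= P - psumR p n.
Proof.
  intros Hl Hp Hu. apply le_epsilon. intros e He.
  rewrite isS_psum in Hl. destruct (Hl e He) as [N HN]. specialize (HN (Nat.max n N) ltac:(lia)).
  assert (T := psum_tail u p n (Nat.max n N) Hu ltac:(lia)).
  assert (B := summable_le p P (Nat.max n N) Hp).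
  set (s := psum u (Nat.max n N)) in *.
  replace (l - psum u n)%C with ((s - psum u n) - (s - l))%C by ring.
  eapply Rle_trans; [ apply Cmod_tri_minus |]. lra.
Qed.

Lemma isS_bound u l p P : isS u l -> summable p P -> (forall n, Cmod (u n) <= p n) -> Cmod l <= P.
Proof.
  intros H1 H2 H3. generalize (isS_tail u l p P 0 H1 H2 H3). simpl. replace (l - 0)%C with l by ring. lra.
Qed.

Lemma isS_plus u v l m : isS u l -> isS v m -> isS (fun n => u n + v n)%C (l + m)%C.
Proof. apply (@is_series_plus C_AbsRing C_NormedModule). Qed.

Lemma isS_cmult c u l : isS u l -> isS (fun n => c * u n)%C (c * l)%C.
Proof. apply (@is_series_scal C_AbsRing C_NormedModule). Qed.

Lemma isS_ext u v l : (forall n, u n = v n) -> isS u l -> isS v l.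
Proof. intros. now apply (@is_series_ext C_AbsRing C_NormedModule u). Qed.

Lemma isS_minus u v l m : isS u l -> isS v m -> isS (fun n => u n - v n)%C (l - m)%C.
Proof.
  intros H K. replace (l - m)%C with (l + (- (1)) * m)%C by ring.
  apply (isS_ext (fun x => u x + (- (1)) * v x)%C); [ intros; ring |].
  apply isS_plus; auto. now apply isS_cmult.
Qed.

Lemma summable_scal p P K : 0 <= K -> summable p P -> summable (fun n => K * p n) (K * P).
Proof.
  intros HK [H1 H2]. split; [ intros; now apply Rmult_le_pos |].
  assert (E : forall n, psumR (fun n => K * p n) n = K * psumR p n).
  { induction n; simpl; [ ring |]. rewrite IHn. ring. }
  intros eps He. destruct (H2 (eps / (K + 1))) as [N HN]; [ apply Rdiv_lt_0_compat; lra |].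
  exists N. intros n Hn. specialize (HN n Hn). rewrite E.
  rewrite <- Rmult_minus_distr_l, Rabs_mult, (Rabs_pos_eq K) by auto.
  apply Rle_trans with ((K + 1) * (eps / (K + 1))).
  - apply Rmult_le_compat; auto using Rabs_pos. lra.
  - right. field. lra.
Qed.

Lemma isS_cder (q : nat -> C -> C) (d : nat -> C) (Q : C -> C) z rho p P : 0 < rho -> summable p P ->
  (forall n u, Cmod (u - z)%C <= rho -> cdiff (q n) u /\ Cmod (q n u) <= p n) ->
  (forall u, Cmod (u - z)%C <= rho -> isS (fun n => q n u) (Q u)) ->
  (forall n, cder (q n) z (d n)) -> exists L, isS d L /\ cder Q z L.
Proof.
  intros Hr D Hq HQ Hd.
  assert (Hz : Cmod (z - z)%C <= rho) by (replace (z - z)%C with (RtoC 0) by ring; rewrite Cmod_0; lra).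
  assert (Pr2 : 0 < rho * rho) by nra.
  destruct (isS_exists d (fun n => 2 / rho * p n) (2 / rho * P)) as [L HL].
  { apply summable_scal; auto. left. apply Rdiv_lt_0_compat; lra. }
  { intros n. replace (2 / rho * p n) with (2 * p n / rho) by (field; lra).
    apply (cauchy_deriv_bound (q n) z (d n) rho (p n)); auto; intros u Hu; now apply Hq. }
  exists L. split; auto.
  set (K := 32 / (rho * rho)). assert (HK : 0 <= K) by (left; apply Rdiv_lt_0_compat; lra).
  apply (cder_quadratic Q z L (rho / 4) (K * P)); [ lra |].
  intros h Hhr.
  assert (Hzh : Cmod (z + h - z)%C <= rho) by (replace (z + h - z)%C with h by ring; lra).
  assert (J : isS (fun x => q x (z + h) - q x z - h * d x)%C (Q (z + h) - Q z - h * L)%C).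
  { apply isS_minus; [ apply isS_minus; auto |]. now apply isS_cmult. }
  replace (L * h)%C with (h * L)%C by ring.
  replace (K * P * (Cmod h * Cmod h)) with (K * (Cmod h * Cmod h) * P) by ring.
  assert (HKK : 0 <= K * (Cmod h * Cmod h)).
  { generalize (Cmod_ge_0 h). intros. apply Rmult_le_pos; nra. }
  apply (isS_bound _ _ _ _ J (summable_scal p P _ HKK D)).
  intros x. rewrite (Cmult_comm h).
  eapply Rle_trans; [ apply (cauchy_remainder (q x) z (d x) rho (p x)); auto; intros u Hu; now apply Hq |].
  right. unfold K. field. lra.
Qed.

(** The majorant separates the index from the variable, so the tail of the series after [n] terms
    integrates to at most [(M - psumR m n) * P]. *)
Lemma isI_series (q : nat -> R -> C) (l : nat -> C) (Qs : R -> C) m M p P :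
  (forall n, isI (q n) (l n)) -> summable m M -> dominator p P ->
  (forall n x, Cmod (q n x) <= m n * p x) -> (forall x, isS (fun n => q n x) (Qs x)) ->
  (forall a b, exI Qs a b) -> exists L, isS l L /\ isI Qs L.
Proof.
  intros Hq Hm Hp Hb HS Hex.
  assert (PP : 0 <= P).
  { assert (B := dominator_le p P 0 0 Hp (Rle_refl 0)). rewrite RInt_point in B. exact B. }
  assert (px : forall x, 0 <= p x) by apply Hp.
  assert (PM : 0 <= M) by apply (summable_le m M 0 Hm).
  assert (SQ : forall x, summable (fun n => p x * m n) (p x * M)) by (intros; now apply summable_scal).
  destruct (isI_exists Qs (fun x => M * p x) (M * P)) as [L HL]; auto.
  { now apply dominator_scal. }
  { intros x. rewrite Rmult_comm. apply (isS_bound _ _ _ _ (HS x) (SQ x)). intros n. rewrite Rmult_comm. auto. }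
  exists L. split; auto.
  apply isS_psum. intros eps He. destruct Hm as [M1 M2].
  destruct (M2 (eps / (P + 1))) as [N HN]; [ apply Rdiv_lt_0_compat; lra |].
  exists N. intros n Hn. specialize (HN n Hn).
  assert (J : isI (fun x => Qs x - psum (fun k => q k x) n)%C (L - psum l n)%C).
  { apply isI_minus; auto. clear - Hq. induction n; simpl.
    - replace (RtoC 0) with (0 * l O)%C by ring. apply (isI_ext (fun x => 0 * q O x)%C); [ intros; ring | now apply isI_cmult ].
    - now apply isI_plus. }
  rewrite Cmod_minus_sym.
  assert (G : 0 <= M - psumR m n) by (generalize (summable_le m M n (conj M1 M2)); lra).
  apply Rle_trans with ((M - psumR m n) * P).
  - apply (isI_bound _ _ _ _ J (dominator_scal p P _ G Hp)). intros x.
    eapply Rle_trans; [ apply (isS_tail _ _ _ _ n (HS x) (SQ x)) |].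
    + intros k. rewrite Rmult_comm. auto.
    + right. assert (E : psumR (fun k => p x * m k) n = p x * psumR m n).
      { clear. induction n; simpl; [ ring |]. rewrite IHn. ring. }
      rewrite E. ring.
  - apply Rabs_le_between in HN. apply Rle_trans with (eps / (P + 1) * (P + 1)).
    + apply Rmult_le_compat; lra.
    + right. field. lra.
Qed.

(** * Interchanging two improper integrals *)

(** Joint Lipschitz bounds on squares form a class closed under sums, products and exponentials; it
    contains all the double kernels below and makes the exchange of integrals on a rectangle
    quantitative. *)
Definition Lip2 (q : R -> R -> C) : Prop := forall X, 0 <= X -> exists L, 0 <= L /\
  forall x x' y y', Rabs x <= X -> Rabs x' <= X -> Rabs y <= X -> Rabs y' <= X ->
    Cmod (q x y - q x' y')%C <= L * (Rabs (x - x') + Rabs (y - y')).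

Lemma Lip2_flip q : Lip2 q -> Lip2 (fun x y => q y x).
Proof.
  intros H X HX. destruct (H X HX) as (L & HL & K). exists L. split; auto.
  intros. rewrite Rplus_comm. auto.
Qed.

Lemma Lip2_bounded q X : Lip2 q -> 0 <= X -> exists M, 0 <= M /\ forall x y, Rabs x <= X -> Rabs y <= X -> Cmod (q x y) <= M.
Proof.
  intros H HX. destruct (H X HX) as (L & HL & K). exists (Cmod (q 0 0) + L * (X + X)). split.
  - generalize (Cmod_ge_0 (q 0 0)). nra.
  - intros x y Hx Hy. assert (R0 : Rabs 0 <= X) by (rewrite Rabs_R0; auto).
    specialize (K x 0 y 0 Hx R0 Hy R0). rewrite !Rminus_0_r in K.
    generalize (Cmod_tri_rev (q x y) (q 0 0)). intros.
    assert (L * (Rabs x + Rabs y) <= L * (X + X)) by (apply Rmult_le_compat_l; lra). lra.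
Qed.

Lemma Lip2_const c : Lip2 (fun _ _ => c).
Proof.
  intros X HX. exists 0. split; [ lra |]. intros. replace (c - c)%C with (RtoC 0) by ring. rewrite Cmod_0. lra.
Qed.

Lemma Lip2_lin k m : Lip2 (fun x y => RtoC (k * x + m * y)).
Proof.
  intros X HX. exists (Rabs k + Rabs m). generalize (Rabs_pos k) (Rabs_pos m). intros. split; [ lra |]. intros.
  rewrite <- RtoC_minus, Cmod_R.
  replace (k * x + m * y - (k * x' + m * y')) with (k * (x - x') + m * (y - y')) by ring.
  eapply Rle_trans; [ apply Rabs_triang |]. rewrite !Rabs_mult.
  generalize (Rabs_pos (x - x')) (Rabs_pos (y - y')). nra.
Qed.

Lemma Lip2_plus q r : Lip2 q -> Lip2 r -> Lip2 (fun x y => q x y + r x y)%C.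
Proof.
  intros H K X HX. destruct (H X HX) as (L & HL & B). destruct (K X HX) as (L' & HL' & B').
  exists (L + L'). split; [ lra |]. intros.
  replace (q x y + r x y - (q x' y' + r x' y'))%C with ((q x y - q x' y') + (r x y - r x' y'))%C by ring.
  eapply Rle_trans; [ apply Cmod_triangle |]. rewrite Rmult_plus_distr_r. apply Rplus_le_compat; auto.
Qed.

Lemma Lip2_mult q r : Lip2 q -> Lip2 r -> Lip2 (fun x y => q x y * r x y)%C.
Proof.
  intros H K X HX. destruct (Lip2_bounded q X H HX) as (M & HM & BM). destruct (Lip2_bounded r X K HX) as (M' & HM' & BM').
  destruct (H X HX) as (L & HL & B). destruct (K X HX) as (L' & HL' & B').
  exists (L * M' + M * L'). split; [ nra |]. intros.
  replace (q x y * r x y - q x' y' * r x' y')%C with ((q x y - q x' y') * r x y + q x' y' * (r x y - r x' y'))%C by ring.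
  eapply Rle_trans; [ apply Cmod_triangle |]. rewrite !Cmod_mult, Rmult_plus_distr_r.
  set (d := Rabs (x - x') + Rabs (y - y')) in *.
  apply Rplus_le_compat.
  - replace (L * M' * d) with ((L * d) * M') by ring.
    apply Rmult_le_compat; auto using Cmod_ge_0.
  - rewrite Rmult_assoc. apply Rmult_le_compat; auto using Cmod_ge_0.
Qed.

Lemma Cexp_lipschitz u v M : Re u <= M -> Re v <= M -> Cmod (Cexp u - Cexp v)%C <= exp M * Cmod (u - v)%C.
Proof.
  intros Hu Hv. replace u with (v + (u - v))%C at 1 by ring.
  apply mean_value_ineq. intros t Ht. exists (Cexp (v + RtoC t * (u - v))). split; [ apply cder_Cexp |].
  rewrite Cmod_Cexp. apply exp_le. reim. nra.
Qed.

Lemma Lip2_Cexp q : Lip2 q -> Lip2 (fun x y => Cexp (q x y)).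
Proof.
  intros H X HX. destruct (Lip2_bounded q X H HX) as (M & HM & BM). destruct (H X HX) as (L & HL & B).
  exists (exp M * L). generalize (exp_pos M). intros. split; [ nra |]. intros.
  rewrite Rmult_assoc. eapply Rle_trans; [ apply (Cexp_lipschitz _ _ M) |].
  - eapply Rle_trans; [ apply Rle_abs |]. eapply Rle_trans; [ apply re_le_Cmod | auto ].
  - eapply Rle_trans; [ apply Rle_abs |]. eapply Rle_trans; [ apply re_le_Cmod | auto ].
  - apply Rmult_le_compat_l; [ lra | auto ].
Qed.

Lemma ccont_lipschitz (q : R -> C) x L : 0 <= L -> (forall t, Rabs (t - x) < 1 -> Cmod (q t - q x)%C <= L * Rabs (t - x)) -> ccont q x.
Proof.
  intros HL H. apply ccont_eps. intros eps He.
  assert (P : 0 < eps / (L + 1)) by (apply Rdiv_lt_0_compat; lra).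
  exists (Rmin 1 (eps / (L + 1))). split; [ apply Rmin_pos; lra |]. intros t Ht.
  assert (T1 : Rabs (t - x) < 1) by (eapply Rlt_le_trans; [ apply Ht | apply Rmin_l ]).
  assert (T2 : Rabs (t - x) < eps / (L + 1)) by (eapply Rlt_le_trans; [ apply Ht | apply Rmin_r ]).
  eapply Rle_lt_trans; [ now apply H |].
  apply Rle_lt_trans with ((L + 1) * Rabs (t - x)).
  - generalize (Rabs_pos (t - x)). nra.
  - apply (Rmult_lt_compat_l (L + 1)) in T2; [| lra ].
    replace ((L + 1) * (eps / (L + 1))) with eps in T2 by (field; lra). lra.
Qed.

Lemma Lip2_ccont_2 q x y : Lip2 q -> ccont (q x) y.
Proof.
  intros H. destruct (H (Rabs x + Rabs y + 1)) as (L & HL & B).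
  { generalize (Rabs_pos x) (Rabs_pos y). lra. }
  apply (ccont_lipschitz _ _ L HL). intros t Ht.
  specialize (B x x t y). replace (x - x) with 0 in B by ring. rewrite Rabs_R0, Rplus_0_l in B.
  generalize (Rabs_pos x) (Rabs_pos y) (Rabs_triang y (t - y)). replace (y + (t - y)) with t by ring. intros.
  apply B; lra.
Qed.

Lemma Lip2_exI q x c d : Lip2 q -> exI (q x) c d.
Proof. intros. apply ccont_exI_all. intros. now apply Lip2_ccont_2. Qed.

Lemma Rabs_between a b t : Rmin a b <= t <= Rmax a b -> Rabs t <= Rabs a + Rabs b.
Proof.
  unfold Rmin, Rmax. destruct (Rle_dec a b); intros; unfold Rabs; repeat destruct (Rcase_abs _); lra.
Qed.

Lemma Lip2_CI_diff q c d L X : 0 <= L -> Lip2 q -> Rabs c + Rabs d <= X ->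
  (forall x x' y y', Rabs x <= X -> Rabs x' <= X -> Rabs y <= X -> Rabs y' <= X ->
    Cmod (q x y - q x' y')%C <= L * (Rabs (x - x') + Rabs (y - y'))) ->
  forall x x', Rabs x <= X -> Rabs x' <= X -> Cmod (CI (q x) c d - CI (q x') c d)%C <= Rabs (d - c) * (L * Rabs (x - x')).
Proof.
  intros HL Hq HX B x x' Hx Hx'.
  rewrite <- CI_minus by now apply Lip2_exI.
  apply CI_bound_abs; [ apply exI_minus; now apply Lip2_exI |].
  intros y Hy. apply Rabs_between in Hy.
  specialize (B x x' y y Hx Hx' ltac:(lra) ltac:(lra)).
  replace (y - y) with 0 in B by ring. now rewrite Rabs_R0, Rplus_0_r in B.
Qed.

Lemma Lip2_CI_ccont q c d x : Lip2 q -> ccont (fun x => CI (q x) c d) x.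
Proof.
  intros H. set (X := Rabs c + Rabs d + Rabs x + 1).
  generalize (Rabs_pos c) (Rabs_pos d) (Rabs_pos x). intros.
  destruct (H X) as (L & HL & B); [ unfold X; lra |].
  apply (ccont_lipschitz _ _ (Rabs (d - c) * L)).
  - generalize (Rabs_pos (d - c)). nra.
  - intros t Ht. rewrite Rmult_assoc. apply (Lip2_CI_diff q c d L X); auto; unfold X; try lra.
    generalize (Rabs_triang x (t - x)). replace (x + (t - x)) with t by ring. lra.
Qed.

(** On a slab of width h both orders of integration agree with h * J t, [t] being its left end, up
    to O(h^2). Cutting into n + 1 slabs leaves a total error O(1 / (n + 1)). *)
Lemma fubini_rect q a b c d : Lip2 q -> a <= b -> c <= d ->
  CI (fun x => CI (q x) c d) a b = CI (fun y => CI (fun x => q x y) a b) c d.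
Proof.
  intros Hq Hab Hcd.
  assert (Hf := Lip2_flip q Hq).
  set (X := Rabs a + Rabs b + (Rabs c + Rabs d)).
  generalize (Rabs_pos a) (Rabs_pos b) (Rabs_pos c) (Rabs_pos d). intros.
  destruct (Hq X) as (L & HL & B); [ unfold X; lra |].
  set (J := fun x => CI (q x) c d).
  assert (IJ : forall u v, exI J u v) by (intros; apply ccont_exI_all; intros; now apply Lip2_CI_ccont).
  assert (IQ : forall u v, exI (fun y => CI (fun x => q x y) u v) c d).
  { intros. apply ccont_exI_all. intros y. apply (Lip2_CI_ccont (fun y x => q x y)). auto. }
  assert (Ix : forall y u v, exI (fun x => q x y) u v) by (intros; now apply (Lip2_exI (fun y x => q x y))).
  assert (In : forall t, a <= t <= b -> Rabs t <= X).
  { intros t Ht. assert (Q := Rabs_between a b t). rewrite Rmin_left, Rmax_right in Q by lra. specialize (Q Ht). unfold X. lra. }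
  assert (In' : forall t, c <= t <= d -> Rabs t <= X).
  { intros t Ht. assert (Q := Rabs_between c d t). rewrite Rmin_left, Rmax_right in Q by lra. specialize (Q Ht). unfold X. lra. }
  assert (Step : forall t t', a <= t -> t <= t' -> t' <= b ->
     Cmod (CI J t t' - CI (fun y => CI (fun x => q x y) t t') c d)%C <= 2 * ((d - c) * L) * ((t' - t) * (t' - t))).
  { intros t t' H3 H4 H5.
    assert (S1 : Cmod (CI J t t' - CI (fun _ => J t) t t')%C <= (t' - t) * ((d - c) * (L * (t' - t)))).
    { assert (Ic : exI (fun _ => J t) t t') by (apply ccont_exI_all; intros; apply ccont_const).
      rewrite <- CI_minus by auto. apply CI_bound; auto; [ now apply exI_minus |].
      intros x Hx. unfold J. eapply Rle_trans; [ apply (Lip2_CI_diff q c d L X) |]; auto.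
      - unfold X; lra.
      - apply In; lra.
      - apply In; lra.
      - rewrite !Rabs_pos_eq by lra. repeat apply Rmult_le_compat_l; lra. }
    assert (S2 : Cmod (CI (fun y => CI (fun x => q x y) t t') c d - CI (fun y => RtoC (t' - t) * q t y)%C c d)%C
       <= (d - c) * ((t' - t) * (L * (t' - t)))).
    { assert (I2 : exI (fun y => RtoC (t' - t) * q t y)%C c d) by (apply exI_cmult; now apply Lip2_exI).
      rewrite <- CI_minus by auto. apply CI_bound; auto; [ now apply exI_minus |].
      intros y Hy. rewrite <- CI_const.
      assert (Ic : exI (fun _ => q t y) t t') by (apply ccont_exI_all; intros; apply ccont_const).
      rewrite <- CI_minus by auto. apply CI_bound; auto; [ now apply exI_minus |].
      intros x Hx. eapply Rle_trans; [ apply B; try (apply In; lra); apply In'; lra |].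
      replace (y - y) with 0 by ring. rewrite Rabs_R0, Rabs_pos_eq by lra. apply Rmult_le_compat_l; lra. }
    rewrite CI_cmult in S2 by now apply Lip2_exI. rewrite CI_const in S1. fold (J t) in S2.
    set (u := CI J t t') in *. set (v := CI (fun y => CI (fun x => q x y) t t') c d) in *.
    set (w := (RtoC (t' - t) * J t)%C) in *.
    replace (u - v)%C with ((u - w) - (v - w))%C by ring.
    eapply Rle_trans; [ apply Cmod_tri_minus |]. lra. }
  apply Cmod_le_eps_eq. intros eps He.
  set (G := 2 * ((d - c) * L) * ((b - a) * (b - a))).
  assert (PG : 0 <= G).
  { unfold G. repeat apply Rmult_le_pos; lra. }
  assert (exists n : nat, G / INR (S n) <= eps) as [n Hn].
  { destruct (INR_unbounded (G / eps)) as [n Hn]. exists n.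
    assert (P : 0 < INR (S n)) by (apply lt_0_INR; lia). rewrite S_INR in *.
    apply (Rmult_le_reg_r (INR n + 1)); auto. replace (G / (INR n + 1) * (INR n + 1)) with G by (field; lra).
    apply (Rmult_lt_compat_r eps) in Hn; auto. replace (G / eps * eps) with G in Hn by (field; lra). nra. }
  set (N := INR (S n)) in *. assert (PN : 0 < N) by (apply lt_0_INR; lia).
  set (tk := fun k => a + INR k * ((b - a) / N)).
  assert (Pstep : 0 <= (b - a) / N) by (apply Rmult_le_pos; [ lra | left; now apply Rinv_0_lt_compat ]).
  assert (Ind : forall k, (k <= S n)%nat ->
     Cmod (CI J a (tk k) - CI (fun y => CI (fun x => q x y) a (tk k)) c d)%C <= INR k * (2 * ((d - c) * L) * ((b - a) / N * ((b - a) / N)))).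
  { induction k; intros Hk.
    - unfold tk. simpl INR. rewrite !Rmult_0_l, Rplus_0_r, CI_point.
      rewrite (CI_ext _ (fun _ => 0)) by (intros; apply CI_point). rewrite CI_const, Cmult_0_r.
      replace (0 - 0)%C with (RtoC 0) by ring. rewrite Cmod_0. lra.
    - specialize (IHk ltac:(lia)).
      assert (Et : tk (S k) - tk k = (b - a) / N) by (unfold tk; rewrite S_INR; ring).
      assert (a <= tk k) by (unfold tk; generalize (pos_INR k); nra).
      assert (tk (S k) <= b).
      { unfold tk. assert (INR (S k) <= N) by (apply le_INR; lia).
        assert (INR (S k) * ((b - a) / N) <= N * ((b - a) / N)) by (apply Rmult_le_compat_r; auto).
        replace (N * ((b - a) / N)) with (b - a) in H5 by (field; lra). lra. }
      specialize (Step (tk k) (tk (S k)) ltac:(auto) ltac:(lra) ltac:(auto)). rewrite Et in Step.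
      rewrite <- (CI_Chasles J a (tk k) (tk (S k))) by auto.
      rewrite (CI_ext (fun y => CI (fun x => q x y) a (tk (S k))) (fun y => CI (fun x => q x y) a (tk k) + CI (fun x => q x y) (tk k) (tk (S k)))%C)
        by (intros; now rewrite CI_Chasles).
      rewrite CI_plus by auto.
      set (u1 := CI J a (tk k)) in *. set (u2 := CI J (tk k) (tk (S k))) in *.
      match goal with |- Cmod (_ - (?v1 + ?v2))%C <= _ => replace (u1 + u2 - (v1 + v2))%C with ((u1 - v1) + (u2 - v2))%C by ring end.
      eapply Rle_trans; [ apply Cmod_triangle |]. rewrite S_INR. lra. }
  specialize (Ind (S n) (Nat.le_refl _)). fold N in Ind.
  replace (tk (S n)) with b in Ind by (unfold tk; fold N; field; lra).
  eapply Rle_trans; [ apply Ind |]. eapply Rle_trans; [| apply Hn ].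
  right. unfold G. field. lra.
Qed.

Lemma fubini q A B M : Lip2 q -> 0 <= M ->
  (forall x y, Cmod (q x y) <= M / (1 + x ^ 2) * / (1 + y ^ 2)) ->
  (forall x, isI (q x) (A x)) -> (forall y, isI (fun x => q x y) (B y)) ->
  exists l, isI A l /\ isI B l.
Proof.
  (* both iterated integrals are approximated by the one over the square [-n, n]^2 *)
  intros Hq HM Hb HA HB.
  assert (Key : forall q A, Lip2 q -> (forall x y, Cmod (q x y) <= M / (1 + x ^ 2) * / (1 + y ^ 2)) ->
     (forall x, isI (q x) (A x)) ->
     (forall a b, exI A a b) /\ (forall x, Cmod (A x) <= M * PI / (1 + x ^ 2)) /\
     forall eps, 0 < eps -> exists X, 0 <= X /\ forall n, X <= n ->
        Cmod (CI A (- n) n - CI (fun x => CI (q x) (- n) n) (- n) n)%C <= eps).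
  { clear - HM. intros q A Hq Hb HA. generalize PI_RGT_0. intros PP.
    assert (Px : forall x, 0 < / (1 + x ^ 2)) by (intros; apply Rinv_0_lt_compat; nra).
    assert (Hd : forall x, dominator (fun y => (M / (1 + x ^ 2)) / (1 + y ^ 2)) (M / (1 + x ^ 2) * PI)).
    { intros x. apply dominator_cauchy. apply Rmult_le_pos; auto. left; apply Px. }
    assert (Tail : forall n x, 0 <= n -> Cmod (A x - CI (q x) (- n) n)%C <= M / (1 + x ^ 2) * (PI - 2 * atan n)).
    { intros n x Hn. eapply Rle_trans; [ apply (isI_tail (q x) (A x) _ _ (- n) n (HA x) (Hd x)) |].
      - intros y. apply Hb.
      - lra.
      - rewrite (is_RInt_unique _ _ _ _ (RInt_cauchy_density _ (- n) n)), atan_opp. lra. }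
    assert (At : forall eps, 0 < eps -> exists X, 0 <= X /\ forall n, X <= n -> PI - 2 * atan n <= eps).
    { intros eps He. set (e := Rmin 1 (eps / 2)). assert (0 < e) by (apply Rmin_pos; lra).
      assert (e <= 1 /\ e <= eps / 2) as [e1 e2] by (split; [ apply Rmin_l | apply Rmin_r ]).
      generalize PI2_1. intros P1.
      assert (T : atan (tan (PI / 2 - e)) = PI / 2 - e) by (apply atan_tan; lra).
      exists (Rmax 0 (tan (PI / 2 - e))). split; [ apply Rmax_l |]. intros n Hn.
      assert (H3 : tan (PI / 2 - e) <= n) by (eapply Rle_trans; [ apply Rmax_r | apply Hn ]).
      assert (atan (tan (PI / 2 - e)) <= atan n).
      { destruct H3 as [H3 | ->]; [ left; now apply atan_increasing | lra ]. }
      lra. }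
    assert (Bd : forall x, M / (1 + x ^ 2) <= M).
    { intros x. assert (/ (1 + x ^ 2) <= / 1) by (apply Rinv_le_contravar; nra). rewrite Rinv_1 in H.
      unfold Rdiv. nra. }
    (* [A] is a uniform limit of integrals over [-X, X], each continuous in the parameter. *)
    assert (Hc : forall x, ccont A x).
    { intros x. apply ccont_eps. intros eps He.
      destruct (At (eps / (4 * (M + 1)))) as (X & HX & Hat); [ apply Rdiv_lt_0_compat; lra |].
      specialize (Hat X (Rle_refl X)).
      destruct (ccont_elim _ x (Lip2_CI_ccont q (- X) X x Hq) (eps / 2)) as [d [Hd' K]]; [ lra |].
      exists d. split; auto. intros t Ht. specialize (K t Ht).
      assert (E : forall s, Cmod (A s - CI (q s) (- X) X)%C <= eps / 4).
      { intros s. eapply Rle_trans; [ now apply Tail |].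
        apply Rle_trans with ((M + 1) * (eps / (4 * (M + 1)))); [| right; field; lra ].
        assert (A1 := atan_bound X). apply Rmult_le_compat; try lra.
        - apply Rmult_le_pos; auto. left; apply Px.
        - specialize (Bd s). lra. }
      assert (E1 := E t). assert (E2 := E x).
      replace (A t - A x)%C with ((A t - CI (q t) (- X) X) - (A x - CI (q x) (- X) X) + (CI (q t) (- X) X - CI (q x) (- X) X))%C by ring.
      eapply Rle_lt_trans; [ apply Cmod_triangle |].
      eapply Rle_lt_trans; [ apply Rplus_le_compat_r, Cmod_tri_minus |]. lra. }
    assert (Ie : forall a b, exI A a b) by (intros; now apply ccont_exI_all).
    split; [ auto | split ].
    - intros x. replace (M * PI / (1 + x ^ 2)) with (M / (1 + x ^ 2) * PI) by (field; nra).
      apply (isI_bound _ _ _ _ (HA x) (Hd x)). intros. apply Hb.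
    - intros eps He.
      destruct (At (eps / (M * PI + 1))) as (X & HX & Hat); [ apply Rdiv_lt_0_compat; [ auto | nra ] |].
      exists X. split; auto. intros n Hn. specialize (Hat n Hn).
      assert (I2 : exI (fun x => CI (q x) (- n) n) (- n) n) by (apply ccont_exI_all; intros; now apply Lip2_CI_ccont).
      rewrite <- CI_minus by auto.
      assert (A1 := atan_bound n). set (w := PI - 2 * atan n) in *.
      assert (Pw : 0 <= w) by (unfold w; lra).
      apply Rle_trans with ((M * w) * (atan n - atan (- n))).
      + apply (CI_dom _ (fun x => (M * w) / (1 + x ^ 2))); [ lra | now apply exI_minus | |].
        * intros x _. replace (M * w / (1 + x ^ 2)) with (M / (1 + x ^ 2) * w) by (field; nra). apply Tail. lra.
        * apply RInt_cauchy_density.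
      + rewrite atan_opp. apply Rle_trans with ((M * PI + 1) * (eps / (M * PI + 1))).
        * assert (M * w * (atan n - - atan n) <= M * w * PI) by (apply Rmult_le_compat_l; [ nra | lra ]).
          assert ((M * PI + 1) * w <= (M * PI + 1) * (eps / (M * PI + 1))) by (apply Rmult_le_compat_l; [ nra | lra ]).
          nra.
        * right. field. nra. }
  destruct (Key q A Hq Hb HA) as (IA & BA & CA).
  destruct (Key (fun y x => q x y) B (Lip2_flip q Hq)) as (IB & BB & CB); auto.
  { intros y x. eapply Rle_trans; [ apply Hb |]. right. field. split; nra. }
  assert (D : dominator (fun x => M * PI / (1 + x ^ 2)) (M * PI * PI)).
  { apply dominator_cauchy. generalize PI_RGT_0. nra. }
  destruct (isI_exists A _ _ IA D BA) as [l Hl]. destruct (isI_exists B _ _ IB D BB) as [l' Hl'].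
  exists l. split; auto. replace l with l'; auto.
  apply Cmod_le_eps_eq. intros eps He.
  destruct (CA (eps / 4)) as (X1 & P1 & H1); [ lra |]. destruct (CB (eps / 4)) as (X2 & P2 & H2); [ lra |].
  destruct (proj2 Hl (eps / 4)) as [X3 H3]; [ lra |]. destruct (proj2 Hl' (eps / 4)) as [X4 H4]; [ lra |].
  set (n := Rmax (Rmax X1 X2) (Rmax X3 X4)).
  assert (X1 <= n /\ X2 <= n /\ X3 <= n /\ X4 <= n) as (L1 & L2 & L3 & L4).
  { unfold n. repeat split.
    - eapply Rle_trans; [ apply Rmax_l | apply Rmax_l ].
    - eapply Rle_trans; [ apply Rmax_r | apply Rmax_l ].
    - eapply Rle_trans; [ apply Rmax_l | apply Rmax_r ].
    - eapply Rle_trans; [ apply Rmax_r | apply Rmax_r ]. }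
  specialize (H1 n L1). specialize (H2 n L2). specialize (H3 (- n) n ltac:(lra) L3). specialize (H4 (- n) n ltac:(lra) L4).
  rewrite <- fubini_rect in H2 by (auto; lra).
  set (u := CI (fun x => CI (q x) (- n) n) (- n) n) in *.
  replace (l' - l)%C with ((CI A (- n) n - l) - (CI A (- n) n - u) + ((CI B (- n) n - u) - (CI B (- n) n - l')))%C by ring.
  eapply Rle_trans; [ apply Cmod_triangle |].
  generalize (Cmod_tri_minus (CI A (- n) n - l)%C (CI A (- n) n - u)%C).
  generalize (Cmod_tri_minus (CI B (- n) n - u)%C (CI B (- n) n - l')%C). lra.
Qed.

(** * Lerch's theorem *)

Lemma exI_ext0 (q r : R -> C) : (forall x, x <> 0 -> q x = r x) -> (forall a b, exI q a b) -> forall a b, exI r a b.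
Proof.
  intros E H.
  assert (N : forall x, exI r 0 x).
  { intros x. apply (ex_RInt_ext q); auto. intros t Ht. apply E. unfold Rmin, Rmax in Ht. destruct (Rle_dec 0 x); lra. }
  intros a b. apply (@ex_RInt_Chasles C_R_NormedModule _ a 0 b); auto. now apply ex_RInt_swap.
Qed.

Lemma CI_ext0 (q r : R -> C) a b : (forall x, x <> 0 -> q x = r x) -> (forall a b, exI q a b) -> CI q a b = CI r a b.
Proof.
  intros E H. assert (H' := exI_ext0 q r E H).
  assert (N : forall x, CI q 0 x = CI r 0 x).
  { intros x. apply (@RInt_ext C_R_CompleteNormedModule). intros t Ht. apply E. unfold Rmin, Rmax in Ht. destruct (Rle_dec 0 x); lra. }
  rewrite <- (CI_Chasles q a 0 b), <- (CI_Chasles r a 0 b) by auto.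
  rewrite (CI_swap q 0 a), (CI_swap r 0 a) by auto. now rewrite !N.
Qed.

(** A function cut at 0 and its reflection both keep the point 0; the exception at that single point
    lets two half-lines be joined in [defect_right]. *)
Lemma isI_ext0 (q r : R -> C) l : (forall x, x <> 0 -> q x = r x) -> isI q l -> isI r l.
Proof.
  intros E [H1 H2]. split.
  - now apply (exI_ext0 q).
  - intros eps He. destruct (H2 eps He) as [X HX]. exists X. intros a b Ha Hb.
    rewrite <- (CI_ext0 q r); auto.
Qed.

Lemma Re_CI (q : R -> C) a b : exI q a b -> is_RInt (fun x => Re (q x)) a b (Re (CI q a b)).
Proof.
  intros H. apply (@is_RInt_fct_extend_fst R_NormedModule R_NormedModule q a b (CI q a b)). now apply CI_correct.
Qed.

Lemma RInt_lower (f : R -> R) a b u v m : a <= u -> u <= v -> v <= b -> (forall s t, ex_RInt f s t) ->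
  (forall x, a <= x <= b -> 0 <= f x) -> (forall x, u <= x <= v -> m <= f x) -> m * (v - u) <= RInt f a b.
Proof.
  intros H1 H2 H3 Hf H0 Hm.
  assert (C1 := RInt_Chasles f a u b (Hf _ _) (Hf _ _)).
  assert (C2 := RInt_Chasles f u v b (Hf _ _) (Hf _ _)). unfold plus in *. simpl in *.
  assert (0 <= RInt f a u) by (apply RInt_ge_0; auto; intros; apply H0; lra).
  assert (0 <= RInt f v b) by (apply RInt_ge_0; auto; intros; apply H0; lra).
  assert (m * (v - u) <= RInt f u v).
  { replace (m * (v - u)) with (RInt (fun _ => m) u v).
    - apply RInt_le; auto; [ apply ex_RInt_const |]. intros. apply Hm. lra.
    - rewrite RInt_const. unfold scal. simpl. unfold mult. simpl. ring. }
  lra.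
Qed.

Lemma pow_ratio_unbounded A B r s : 0 < A -> 0 <= B -> 0 < s -> s < r -> exists n : nat, B * s ^ n < A * r ^ n.
Proof.
  intros HA HB Hs Hsr.
  assert (Pr : 0 < (r - s) / s) by (apply Rdiv_lt_0_compat; lra).
  destruct (INR_unbounded (B / A / ((r - s) / s))) as [n Hn]. exists n.
  assert (Psn : 0 < s ^ n) by now apply pow_lt.
  assert (Q : (1 + INR n * ((r - s) / s)) * s ^ n <= r ^ n).
  { replace r with ((1 + (r - s) / s) * s) at 2 by (field; lra). rewrite Rpow_mult_distr.
    apply Rmult_le_compat_r; [ lra |]. now apply poly. }
  assert (B < A * (INR n * ((r - s) / s))).
  { apply (Rmult_lt_compat_r ((r - s) / s)) in Hn; auto.
    replace (B / A / ((r - s) / s) * ((r - s) / s)) with (B / A) in Hn by (field; lra).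
    apply (Rmult_lt_compat_l A) in Hn; auto. replace (A * (B / A)) with B in Hn by (field; lra). lra. }
  assert (A * ((1 + INR n * ((r - s) / s)) * s ^ n) <= A * r ^ n) by (apply Rmult_le_compat_l; lra).
  nra.
Qed.

Lemma ccont_Re (q : R -> C) x eps : ccont q x -> 0 < eps -> exists d, 0 < d /\ forall t, Rabs (t - x) < d -> Re (q x) - eps < Re (q t).
Proof.
  intros H He. destruct (ccont_elim q x H eps He) as [d [Hd K]]. exists d. split; auto. intros t Ht.
  specialize (K t Ht). generalize (re_le_Cmod (q t - q x)%C). rewrite Re_minus. intros B.
  apply Rabs_le_between in B. lra.
Qed.

(* Lerch: moments against powers of e^{-y}; the polynomials (1-(u-u0)^2)^n concentrate at u0 = e^{-y0}. *)
Lemma lerch (p : R -> C) B : (forall y, ccont p y) -> 0 <= B -> (forall y, 0 <= y -> Cmod (p y) <= B * exp (- y)) ->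
  (forall k : nat, isI (cut (fun y => p y * RtoC (exp (- (INR k * y))))%C) 0) -> forall y0, 0 <= y0 -> p y0 = 0.
Proof.
  intros Hc HB Hp Hk y0 Hy0.
  apply NNPP. intros N.
  set (u0 := exp (- y0)). assert (Pu0 : 0 < u0) by apply exp_pos.
  assert (u0 <= 1) by (unfold u0; rewrite <- exp_0; apply exp_le; lra).
  set (ker := fun y => 1 - (exp (- y) - u0) ^ 2).
  (* Every polynomial in e^(-y) is orthogonal to [p], and [ker] is one: (1 - u0^2) + 2 u0 e^(-y) -
     e^(-2y). The extra index [k] makes the induction on [n] go through. *)
  assert (Z : forall n k, isI (cut (fun y => p y * RtoC (ker y ^ n) * RtoC (exp (- (INR k * y))))%C) 0).
  { induction n; intros k.
    - apply (isI_ext (cut (fun y => p y * RtoC (exp (- (INR k * y))))%C)); auto.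
      intros x. unfold cut. destruct (Rlt_dec x 0); auto. simpl. ring.
    - replace (RtoC 0) with (RtoC (1 - u0 ^ 2) * 0 + (RtoC (2 * u0) * 0 - 0))%C by ring.
      eapply isI_ext; [| apply isI_plus; [ apply isI_cmult, (IHn k) | apply isI_minus; [ apply isI_cmult, (IHn (S k)) | apply (IHn (S (S k))) ] ] ].
      intros x. cbv beta. unfold cut. destruct (Rlt_dec x 0); [ ring |].
      assert (E1 : exp (- (INR (S k) * x)) = exp (- (INR k * x)) * exp (- x)).
      { rewrite <- exp_plus. f_equal. rewrite S_INR. ring. }
      assert (E2 : exp (- (INR (S (S k)) * x)) = exp (- (INR k * x)) * exp (- x) * exp (- x)).
      { rewrite <- !exp_plus. f_equal. rewrite !S_INR. ring. }
      rewrite E1, E2. change (ker x ^ S n) with (ker x * ker x ^ n).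
      set (kn := ker x ^ n).
      assert (Ek : ker x = (1 - u0 ^ 2) + 2 * u0 * exp (- x) - exp (- x) * exp (- x)) by (unfold ker; ring).
      rewrite Ek.
      repeat (rewrite ?RtoC_mult, ?RtoC_minus, ?RtoC_plus). ring. }
  set (w := Cconj (p y0)). set (a := Cmod (p y0) ^ 2).
  assert (Pp : 0 < Cmod (p y0)) by now apply Cmod_neq0.
  assert (Pa : 0 < a) by (unfold a; nra).
  assert (Ea : Re (w * p y0)%C = a).
  { unfold w, a. rewrite Cmult_comm, <- Cmod2_conj. reflexivity. }
  assert (Hwc : forall y, ccont (fun y => w * p y)%C y).
  { intros y. apply ccont_mult; auto. apply ccont_const. }
  destruct (ccont_Re (fun y => w * p y)%C y0 (a / 2) (Hwc y0)) as [d [Hd Kd]]; [ lra |].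
  rewrite Ea in Kd.
  (* [tau] bounds |e^(-y) - u0| from below as soon as |y - y0| >= d, on either side of [y0]. *)
  set (tau := u0 * (1 - exp (- d))).
  assert (exp (- d) < 1) by (rewrite <- exp_0; apply exp_increasing; lra).
  assert (Ped := exp_pos (- d)).
  assert (Pt : 0 < tau) by (apply Rmult_lt_0_compat; lra).
  assert (Pt1 : tau < 1) by (unfold tau; nra).
  (* The peak is measured on [y0, y0 + d'] only, to the right of [y0], since [y0] may be 0; there
     |e^(-y) - u0| is at most [tau / 2]. *)
  set (d' := Rmin (d / 2) (tau / 2)).
  assert (Pd' : 0 < d') by (apply Rmin_pos; lra).
  assert (d' <= d / 2 /\ d' <= tau / 2) as [D1 D2] by (split; [ apply Rmin_l | apply Rmin_r ]).
  assert (U : forall y, 0 <= y -> 0 < exp (- y) <= 1).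
  { intros y Hy. split; [ apply exp_pos |]. rewrite <- exp_0. apply exp_le. lra. }
  assert (Far : forall y, 0 <= y -> d <= Rabs (y - y0) -> 0 <= ker y <= 1 - tau ^ 2).
  { intros y Hy Hfar. specialize (U y Hy). unfold ker.
    assert (tau <= Rabs (exp (- y) - u0)).
    { destruct (Rle_dec y y0) as [L | L].
      - rewrite Rabs_left1 in Hfar by lra.
        assert (exp (- y) >= u0 * exp d).
        { unfold u0. rewrite <- exp_plus. apply Rle_ge, exp_le. lra. }
        assert (E : exp d = / exp (- d)) by (rewrite exp_Ropp, Rinv_inv; auto).
        assert (1 - exp (- d) <= exp d - 1).
        { assert (exp d * exp (- d) = 1) by (rewrite <- exp_plus; replace (d + - d) with 0 by ring; apply exp_0). nra. }
        unfold tau. rewrite Rabs_pos_eq by nra. nra.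
      - rewrite Rabs_pos_eq in Hfar by lra.
        assert (exp (- y) <= u0 * exp (- d)).
        { unfold u0. rewrite <- exp_plus. apply exp_le. lra. }
        rewrite Rabs_left1 by nra. unfold tau. nra. }
    assert (Rabs (exp (- y) - u0) <= 1) by (apply Rabs_le; lra).
    rewrite <- (pow2_abs (exp (- y) - u0)). split; nra. }
  assert (Near : forall y, y0 <= y <= y0 + d' -> 1 - tau ^ 2 / 4 <= ker y).
  { intros y Hy. unfold ker.
    assert (u0 * (1 - d') <= exp (- y) <= u0).
    { split.
      - apply Rle_trans with (u0 * exp (- d')).
        + apply Rmult_le_compat_l; [ lra |]. generalize (exp_ineq1_le (- d')). lra.
        + unfold u0. rewrite <- exp_plus. apply exp_le. lra.
      - apply exp_le. lra. }
    assert (- (tau / 2) <= exp (- y) - u0 <= 0) by nra. nra. }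
  assert (Kpos : forall y, 0 <= y -> 0 <= ker y).
  { intros y Hy. specialize (U y Hy). unfold ker. nra. }
  (* The peak contributes at least a/2 * d' * (1 - tau^2/4)^n, while away from [y0] the modulus is
     at most a constant times (1 - tau^2)^n; for large [n] the first wins. *)
  destruct (pow_ratio_unbounded (a / 2 * d') (Cmod w * B + 1) (1 - tau ^ 2 / 4) (1 - tau ^ 2)) as [n Hn].
  { apply Rmult_lt_0_compat; lra. }
  { generalize (Cmod_ge_0 w). nra. }
  { nra. }
  { nra. }
  set (q := fun y => (w * (p y * RtoC (ker y ^ n)))%C).
  assert (Hq : forall y, ccont q y).
  { intros y. unfold q, ker. cc; auto. }
  assert (Iq : forall s t, exI q s t) by (intros; now apply ccont_exI_all).
  assert (Zq : isI (cut q) 0).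
  { replace (RtoC 0) with (w * 0)%C by ring.
    eapply isI_ext; [| apply isI_cmult, (Z n O) ]. intros x. unfold cut. destruct (Rlt_dec x 0); [ ring |].
    unfold q. simpl INR. rewrite Rmult_0_l, Ropp_0, exp_0. ring. }
  set (gap := a / 2 * d' * (1 - tau ^ 2 / 4) ^ n - (Cmod w * B + 1) * (1 - tau ^ 2) ^ n).
  assert (Pgap : 0 < gap) by (unfold gap; lra).
  destruct (proj2 Zq (gap / 2)) as [X HX]; [ lra |].
  set (b := Rmax (Rmax X (y0 + d')) 0).
  assert (X <= b /\ y0 + d' <= b /\ 0 <= b) as (Q1 & Q2 & Q3).
  { unfold b. repeat split; [ eapply Rle_trans; [ apply Rmax_l | apply Rmax_l ] | eapply Rle_trans; [ apply Rmax_r | apply Rmax_l ] | apply Rmax_r ]. }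
  specialize (HX (Rmin 0 (- X)) b (Rmin_r _ _) Q1). rewrite CI_cut in HX by (auto || apply Rmin_l).
  replace (CI q 0 b - 0)%C with (CI q 0 b) in HX by ring.
  assert (HRe : Re (CI q 0 b) <= gap / 2).
  { eapply Rle_trans; [ apply Rle_abs |]. eapply Rle_trans; [ apply re_le_Cmod | apply HX ]. }
  (* Adding this bound of the far contribution makes the integrand nonnegative, so [RInt_lower] can
     keep the peak alone. *)
  set (E := fun y => Cmod w * B * (1 - tau ^ 2) ^ n * exp (- y)).
  assert (IE : is_RInt E 0 b (Cmod w * B * (1 - tau ^ 2) ^ n * (1 - exp (- b)))).
  { unfold E. generalize (Cmod w * B * (1 - tau ^ 2) ^ n). intros K.
    replace (K * (1 - exp (- b))) with (minus ((fun y => - K * exp (- y)) b) ((fun y => - K * exp (- y)) 0)).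
    2:{ unfold minus, plus, opp. simpl. rewrite Ropp_0, exp_0. ring. }
    apply (@is_RInt_derive R_CompleteNormedModule (fun y => - K * exp (- y))).
    - intros x _. auto_derive; auto. ring.
    - intros x _. apply @ex_derive_continuous. auto_derive. auto. }
  assert (Pw := Cmod_ge_0 w).
  assert (Ptn : 0 <= (1 - tau ^ 2) ^ n) by (apply pow_le; nra).
  assert (PC : 0 <= Cmod w * B * (1 - tau ^ 2) ^ n) by (repeat apply Rmult_le_pos; auto).
  assert (Rq : forall y, Re (q y) = Re (w * p y)%C * ker y ^ n).
  { intros y. unfold q. replace (w * (p y * RtoC (ker y ^ n)))%C with (w * p y * RtoC (ker y ^ n))%C by ring.
    rewrite (Re_mult _ (RtoC _)), Re_RtoC, Im_RtoC. ring. }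
  assert (L := RInt_lower (fun y => Re (q y) + E y) 0 b y0 (y0 + d') (a / 2 * (1 - tau ^ 2 / 4) ^ n)).
  replace (y0 + d' - y0) with d' in L by ring.
  assert (EL : RInt (fun y => Re (q y) + E y) 0 b = Re (CI q 0 b) + Cmod w * B * (1 - tau ^ 2) ^ n * (1 - exp (- b)))
    by exact (is_RInt_unique _ _ _ _ (is_RInt_plus _ _ _ _ _ _ (Re_CI q 0 b (Iq _ _)) IE)).
  rewrite EL in L. clear EL.
  assert (Fin : a / 2 * (1 - tau ^ 2 / 4) ^ n * d' <= Re (CI q 0 b) + Cmod w * B * (1 - tau ^ 2) ^ n * (1 - exp (- b))).
  { apply L; try lra.
    - intros s t. apply (@ex_RInt_continuous R_CompleteNormedModule). intros z _.
      apply (continuous_plus (K := R_AbsRing) (V := R_NormedModule) (fun y => Re (q y)) E).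
      + apply (continuous_comp q (fun c => fst c)); [ apply Hq | apply continuous_fst ].
      + unfold E. apply @ex_derive_continuous. auto_derive. auto.
    - intros y Hy. rewrite Rq. destruct (Rlt_dec (Rabs (y - y0)) d) as [Ln | Lf].
      + specialize (Kd y Ln). cbv beta in Kd. generalize (pow_le (ker y) n (Kpos y ltac:(lra))). intros.
        assert (0 <= E y) by (unfold E; apply Rmult_le_pos; [ auto | left; apply exp_pos ]). 
        assert (0 <= Re (w * p y)%C * ker y ^ n) by (apply Rmult_le_pos; lra). lra.
      + specialize (Far y ltac:(lra) ltac:(lra)).
        assert (Bk : ker y ^ n <= (1 - tau ^ 2) ^ n) by (apply pow_incr; lra).
        generalize (pow_le (ker y) n (Kpos y ltac:(lra))). intros.
        assert (Bw : Rabs (Re (w * p y)%C) <= Cmod w * B * exp (- y)).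
        { eapply Rle_trans; [ apply re_le_Cmod |]. rewrite Cmod_mult, Rmult_assoc. apply Rmult_le_compat_l; auto. apply Hp; lra. }
        assert (Rabs (Re (w * p y)%C * ker y ^ n) <= E y).
        { rewrite Rabs_mult, (Rabs_pos_eq (ker y ^ n)) by auto. unfold E.
          replace (Cmod w * B * (1 - tau ^ 2) ^ n * exp (- y)) with (Cmod w * B * exp (- y) * (1 - tau ^ 2) ^ n) by ring.
          apply Rmult_le_compat; auto using Rabs_pos. }
        generalize (Rle_abs (- (Re (w * p y)%C * ker y ^ n))). rewrite Rabs_Ropp. lra.
    - intros y Hy. rewrite Rq.
      assert (0 <= E y) by (unfold E; apply Rmult_le_pos; [ auto | left; apply exp_pos ]).
      assert (Hyd : Rabs (y - y0) < d) by (rewrite Rabs_pos_eq; lra).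
      specialize (Kd y Hyd). cbv beta in Kd.
      assert (Q : (1 - tau ^ 2 / 4) ^ n <= ker y ^ n) by (apply pow_incr; specialize (Near y Hy); nra).
      assert (0 <= (1 - tau ^ 2 / 4) ^ n) by (apply pow_le; nra).
      assert (a / 2 * (1 - tau ^ 2 / 4) ^ n <= Re (w * p y)%C * ker y ^ n) by (apply Rmult_le_compat; lra).
      lra. }
  generalize (exp_pos (- b)). intros Pb.
  unfold gap in *.
  assert (Cmod w * B * (1 - tau ^ 2) ^ n * (1 - exp (- b)) <= Cmod w * B * (1 - tau ^ 2) ^ n * 1).
  { apply Rmult_le_compat_l; lra. }
  nra.
Qed.

(** * Hecke's converse theorem *)

Definition rhp_holo (g : C -> C) : Prop := forall v, 0 < Re v -> cdiff g v.

(** The shape of a bound for a sum of kernels k(2 PI n v) with coefficients of polynomial growth: a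
    power of 1 / Re v at the imaginary axis and exponential decay at infinity. *)
Definition rhp_bounded (g : C -> C) (K : R) (N : nat) : Prop :=
  forall v, 0 < Re v -> Cmod (g v) <= K * (1 + / Re v) ^ N * (1 + Cmod v) * exp (- Re v).

Definition rayc (K : R) (N : nat) (c : R) : R := K * (1 + / c) ^ N * (2 + 2 / c).

Lemma rayc_pos K N c : 0 <= K -> 0 < c -> 0 <= rayc K N c.
Proof.
  intros HK Hc. assert (0 < / c) by now apply Rinv_0_lt_compat.
  unfold rayc, Rdiv. repeat apply Rmult_le_pos; auto; [ apply pow_le; lra | lra ].
Qed.

(** Mellin integrand along the ray of argument [y], with t = e^x and dt / t = dx; the constant
    factor e^(i y s) is left out and reappears in [mel_rotate]. *)
Definition mel (g : C -> C) (y : R) (s : C) (x : R) : C := (g (Cexp (x, y)) * Cexp (s * RtoC x))%C.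

Lemma Re_Cexp_pair x y : Re (Cexp (x, y)) = exp x * cos y.
Proof. reflexivity. Qed.

Lemma exp_pow_nat x n : exp x ^ n = exp (INR n * x).
Proof.
  induction n; [ simpl; rewrite Rmult_0_l, exp_0; auto |].
  rewrite S_INR. simpl. rewrite IHn, <- exp_plus. f_equal. ring.
Qed.

Lemma exp_neg_le_inv x : 0 <= x -> exp (- x) <= 4 / (1 + x ^ 2).
Proof.
  intros Hx. rewrite exp_Ropp.
  assert (P : (1 + x ^ 2) / 4 <= exp x).
  { replace x with (x / 2 + x / 2) at 2 by field. rewrite exp_plus. generalize (exp_ineq1_le (x / 2)). nra. }
  assert (0 < (1 + x ^ 2) / 4) by nra.
  replace (4 / (1 + x ^ 2)) with (/ ((1 + x ^ 2) / 4)) by (field; nra).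
  now apply Rinv_le_contravar.
Qed.

Lemma double_exp_decay c sig : 0 < c -> exists M, 0 <= M /\
  forall x, 0 <= x -> exp (- (c * exp x)) * exp (sig * x) <= M * exp (- x).
Proof.
  intros Hc.
  destruct (INR_unbounded (sig + 1)) as [n Hn].
  set (b := c / INR (S n)).
  assert (PS : 0 < INR (S n)) by (apply lt_0_INR; lia).
  assert (Pb : 0 < b) by (now apply Rdiv_lt_0_compat).
  exists (/ b ^ S n).
  assert (Pbn : 0 < b ^ S n) by (now apply pow_lt).
  split; [ left; now apply Rinv_0_lt_compat |].
  intros x Hx.
  assert (E : b ^ S n * exp (INR (S n) * x) <= exp (c * exp x)).
  { rewrite <- exp_pow_nat, <- Rpow_mult_distr.
    eapply Rle_trans; [| apply exp_pow_le ].
    - apply pow_incr. generalize (exp_pos x). unfold b. intros. split.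
      + apply Rmult_le_pos; [ left; auto | lra ].
      + replace (c * exp x / INR (S n)) with (c / INR (S n) * exp x) by (field; lra). lra.
    - apply Rmult_le_pos; [ lra | left; apply exp_pos ]. }
  rewrite exp_Ropp.
  assert (P1 := exp_pos (c * exp x)).
  apply (Rmult_le_reg_l (exp (c * exp x))); auto.
  rewrite <- Rmult_assoc, Rinv_r, Rmult_1_l by lra.
  apply Rle_trans with ((b ^ S n * exp (INR (S n) * x)) * (/ b ^ S n * exp (- x))).
  - replace (b ^ S n * exp (INR (S n) * x) * (/ b ^ S n * exp (- x))) with (exp (INR (S n) * x) * exp (- x)) by (field; lra).
    rewrite <- exp_plus. apply exp_le. rewrite S_INR. nra.
  - apply Rmult_le_compat_r; auto. apply Rmult_le_pos; left; [ now apply Rinv_0_lt_compat | apply exp_pos ].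
Qed.

Lemma mul_exp_le1 u : 0 <= u -> u * exp (- u) <= 1.
Proof.
  intros Hu. rewrite exp_Ropp. generalize (exp_pos u) (exp_ineq1_le u). intros.
  apply (Rmult_le_reg_r (exp u)); auto. rewrite Rmult_assoc, Rinv_l by lra. lra.
Qed.

Lemma ray_bound g K N c x y : 0 <= K -> rhp_bounded g K N -> 0 < c -> c <= cos y ->
  (x <= 0 -> Cmod (g (Cexp (x, y))) <= rayc K N c * exp (- (INR N * x))) /\
  (0 <= x -> Cmod (g (Cexp (x, y))) <= rayc K N c * exp (- (c / 2 * exp x))).
Proof.
  intros HK Hg Hc Hcy.
  assert (Px := exp_pos x). assert (Pc : 0 < / c) by now apply Rinv_0_lt_compat.
  assert (PR : 0 < Re (Cexp (x, y))) by (rewrite Re_Cexp_pair; apply Rmult_lt_0_compat; lra).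
  assert (B := Hg _ PR). rewrite Re_Cexp_pair, Cmod_Cexp in *. simpl Re in B.
  assert (I : / (exp x * cos y) <= / c * exp (- x)).
  { rewrite exp_Ropp, <- Rinv_mult. apply Rinv_le_contravar; [ apply Rmult_lt_0_compat; auto | nra ]. }
  assert (I0 : 0 < / (exp x * cos y)) by now apply Rinv_0_lt_compat.
  unfold rayc.
  split; intros Hx.
  - assert (1 <= exp (- x)) by (rewrite <- exp_0; apply exp_le; lra).
    assert (exp x <= 1) by (rewrite <- exp_0; apply exp_le; lra).
    assert (exp (- (exp x * cos y)) <= 1) by (rewrite <- exp_0; apply exp_le; lra).
    assert (Q : (1 + / (exp x * cos y)) ^ N <= (1 + / c) ^ N * exp (- (INR N * x))).
    { replace (- (INR N * x)) with (INR N * - x) by ring. rewrite <- exp_pow_nat, <- Rpow_mult_distr. apply pow_incr. nra. }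
    eapply Rle_trans; [ apply B |].
    apply Rle_trans with (K * ((1 + / c) ^ N * exp (- (INR N * x))) * (2 + 2 / c) * 1).
    + assert (0 <= (1 + / (exp x * cos y)) ^ N) by (apply pow_le; lra).
      apply Rmult_le_compat; auto; [| left; apply exp_pos |].
      * repeat apply Rmult_le_pos; lra.
      * apply Rmult_le_compat; try lra; [ now apply Rmult_le_pos | now apply Rmult_le_compat_l ].
    + right. ring.
  - assert (exp (- x) <= 1) by (rewrite <- exp_0; apply exp_le; lra).
    assert (Q : (1 + / (exp x * cos y)) ^ N <= (1 + / c) ^ N) by (apply pow_incr; split; [ lra | nra ]).
    assert (1 <= exp x) by (rewrite <- exp_0; apply exp_le; lra).
    (* Half of the exponential absorbs the linear factor 1 + e^x; the other half is the decay that
       is kept. *)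
    assert (U := mul_exp_le1 (c / 2 * exp x) ltac:(nra)).
    set (e := exp (- (c / 2 * exp x))) in *.
    assert (Pe : 0 < e <= 1) by (unfold e; split; [ apply exp_pos | rewrite <- exp_0; apply exp_le; nra ]).
    assert (E : exp (- (exp x * cos y)) <= e * e) by (unfold e; rewrite <- exp_plus; apply exp_le; nra).
    assert (U2 : (1 + exp x) * e <= 2 + 2 / c).
    { assert (exp x * e <= 2 / c).
      { apply (Rmult_le_reg_l (c / 2)); [ lra |]. replace (c / 2 * (2 / c)) with 1 by (field; lra). lra. }
      lra. }
    assert (0 <= (1 + / (exp x * cos y)) ^ N) by (apply pow_le; lra).
    eapply Rle_trans; [ apply B |].
    apply Rle_trans with (K * (1 + / c) ^ N * (1 + exp x) * (e * e)).
    + apply Rmult_le_compat; auto; [ repeat apply Rmult_le_pos; lra | left; apply exp_pos |].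
      apply Rmult_le_compat_r; [ lra |]. now apply Rmult_le_compat_l.
    + replace (K * (1 + / c) ^ N * (1 + exp x) * (e * e)) with (K * (1 + / c) ^ N * ((1 + exp x) * e) * e) by ring.
      apply Rmult_le_compat_r; [ lra |]. apply Rmult_le_compat_l; auto.
      apply Rmult_le_pos; auto. apply pow_le; lra.
Qed.

Lemma Cmod_Cexp_sx s x : Cmod (Cexp (s * RtoC x)) = exp (Re s * x).
Proof. rewrite Cmod_Cexp. reim. f_equal. ring. Qed.

Lemma mel_bound_pos_unif K N c sig : 0 <= K -> 0 < c -> exists M, 0 <= M /\
  forall g x y s, rhp_bounded g K N -> 0 <= x -> c <= cos y -> Re s <= sig -> Cmod (mel g y s x) <= M * exp (- x).
Proof.
  intros HK Hc. destruct (double_exp_decay (c / 2) sig ltac:(lra)) as (M & HM & B).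
  set (K' := rayc K N c).
  assert (PK : 0 <= K') by now apply rayc_pos.
  exists (K' * M). split; [ nra |]. intros g x y s Hg Hx Hy Hs.
  unfold mel. rewrite Cmod_mult, Cmod_Cexp_sx.
  destruct (ray_bound g K N c x y HK Hg Hc Hy) as [_ R]. specialize (R Hx). fold K' in R.
  rewrite Rmult_assoc. apply Rle_trans with (K' * (exp (- (c / 2 * exp x)) * exp (sig * x))).
  - rewrite <- Rmult_assoc. apply Rmult_le_compat; auto using Cmod_ge_0; [ left; apply exp_pos |].
    apply exp_le. nra.
  - apply Rmult_le_compat_l; auto.
Qed.

Lemma mel_bound_pos g K N c sig : 0 <= K -> rhp_bounded g K N -> 0 < c -> exists M, 0 <= M /\
  forall x y s, 0 <= x -> c <= cos y -> Re s <= sig -> Cmod (mel g y s x) <= M * exp (- x).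
Proof.
  intros HK Hg Hc. destruct (mel_bound_pos_unif K N c sig HK Hc) as (M & HM & B). exists M. auto.
Qed.

Lemma exp_abs_le_cauchy M x : 0 <= M -> M * exp (- Rabs x) <= (4 * M) / (1 + x ^ 2).
Proof.
  intros HM. generalize (exp_neg_le_inv (Rabs x) (Rabs_pos x)). rewrite pow2_abs. intros.
  replace (4 * M / (1 + x ^ 2)) with (M * (4 / (1 + x ^ 2))) by (field; nra). now apply Rmult_le_compat_l.
Qed.

(** The constant is chosen before [g], so that in [mel_series] a single majorant dominates all the
    rescaled terms of the series. *)
Lemma mel_bound_unif K N c sig : 0 <= K -> 0 < c -> exists M, 0 <= M /\
  forall g x y s, rhp_bounded g K N -> c <= cos y -> INR N + 1 <= Re s <= sig -> Cmod (mel g y s x) <= M / (1 + x ^ 2).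
Proof.
  intros HK Hc. destruct (mel_bound_pos_unif K N c sig HK Hc) as (M & HM & B).
  set (K' := rayc K N c).
  assert (PK : 0 <= K') by now apply rayc_pos.
  exists (4 * (M + K')). split; [ lra |]. intros g x y s Hg Hy Hs.
  eapply Rle_trans; [| apply exp_abs_le_cauchy; lra ].
  assert (Pe := exp_pos (- Rabs x)).
  destruct (Rle_dec 0 x) as [L | L].
  - rewrite (Rabs_pos_eq x) in * by auto. eapply Rle_trans; [ apply B; auto; lra |]. nra.
  - rewrite (Rabs_left x) in * by lra. rewrite Ropp_involutive in *.
    unfold mel. rewrite Cmod_mult, Cmod_Cexp_sx.
    destruct (ray_bound g K N c x y HK Hg Hc Hy) as [R _]. specialize (R ltac:(lra)). fold K' in R.
    apply Rle_trans with (K' * exp (- (INR N * x)) * exp (Re s * x)).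
    + apply Rmult_le_compat_r; auto. left; apply exp_pos.
    + rewrite Rmult_assoc, <- exp_plus.
      assert (exp (- (INR N * x) + Re s * x) <= exp x) by (apply exp_le; nra). nra.
Qed.

Lemma mel_bound g K N c sig : 0 <= K -> rhp_bounded g K N -> 0 < c -> exists M, 0 <= M /\
  forall x y s, c <= cos y -> INR N + 1 <= Re s <= sig -> Cmod (mel g y s x) <= M / (1 + x ^ 2).
Proof.
  intros HK Hg Hc. destruct (mel_bound_unif K N c sig HK Hc) as (M & HM & B). exists M. auto.
Qed.

Lemma ccont_mel g y s x : rhp_holo g -> 0 < cos y -> ccont (mel g y s) x.
Proof.
  intros Hg Hy. unfold mel. cc.
  apply (ccont_comp_cdiff g (fun t => Cexp (t, y))).
  - apply ccont_Cexp. apply ccont_hor.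
  - apply Hg. rewrite Re_Cexp_pair. apply Rmult_lt_0_compat; auto. apply exp_pos.
Qed.

Lemma cos_pos_between phi y : Rabs phi < PI / 2 -> Rmin 0 phi <= y <= Rmax 0 phi -> cos phi <= cos y /\ 0 < cos phi.
Proof.
  intros Hp Hy. generalize PI_RGT_0. intros PP.
  assert (E : forall t, cos t = cos (Rabs t)).
  { intros t. unfold Rabs. destruct (Rcase_abs t); auto. now rewrite cos_neg. }
  assert (Rabs y <= Rabs phi).
  { generalize (Rabs_between 0 phi y Hy). rewrite Rabs_R0. lra. }
  split.
  - rewrite (E phi), (E y). apply cos_decr_1; try lra; apply Rabs_pos.
  - rewrite E. apply cos_gt_0; generalize (Rabs_pos phi); lra.
Qed.

(** In the logarithmic coordinate the rotation is a rectangle between the heights 0 and [phi]; its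
    vertical sides at abscissas X and -X are O(1 / X). *)
Lemma mel_rotate g K N phi s l : 0 <= K -> rhp_holo g -> rhp_bounded g K N -> Rabs phi < PI / 2 -> INR N + 1 <= Re s ->
  isI (mel g 0 s) l -> isI (mel g phi s) (Cexp (- (Ci * RtoC phi * s)) * l)%C.
Proof.
  intros HK Hh Hg Hphi Hs Hl.
  generalize PI_RGT_0. intros PP.
  assert (Hc := cos_pos_between phi phi Hphi (proj2 (minmax_bounds 0 phi))). destruct Hc as [_ Hc].
  destruct (mel_bound g K N (cos phi) (Re s) HK Hg Hc) as (M & HM & B).
  set (q := fun z => (g (Cexp z) * Cexp (s * z))%C).
  assert (Eq : forall x y, q (x, y) = (Cexp (Ci * RtoC y * s) * mel g y s x)%C).
  { intros x y. unfold q, mel. replace (s * (x, y))%C with (Ci * RtoC y * s + s * RtoC x)%C by Csolve.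
    rewrite Cexp_add. ring. }
  set (W := exp (Rabs phi * Cmod s)).
  assert (PW : 0 < W) by apply exp_pos.
  assert (BW : forall y, Rmin 0 phi <= y <= Rmax 0 phi -> Cmod (Cexp (Ci * RtoC y * s)) <= W).
  { intros y Hy. rewrite Cmod_Cexp. apply exp_le. reim.
    replace ((0 * y - 1 * 0) * Re s - (0 * 0 + 1 * y) * Im s) with (- (y * Im s)) by ring.
    eapply Rle_trans; [ apply Rle_abs |]. rewrite Rabs_Ropp, Rabs_mult.
    apply Rmult_le_compat; try apply Rabs_pos; [| apply im_le_Cmod ].
    generalize (Rabs_between 0 phi y Hy). rewrite Rabs_R0. lra. }
  assert (Bq : forall x y, Rmin 0 phi <= y <= Rmax 0 phi -> Cmod (q (x, y)) <= W * (M / (1 + x ^ 2))).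
  { intros x y Hy. rewrite Eq, Cmod_mult. apply Rmult_le_compat; auto using Cmod_ge_0.
    apply B; [| lra ]. now apply cos_pos_between. }
  assert (Hol : forall x y, Rmin 0 phi <= y <= Rmax 0 phi -> cdiff q (x, y)).
  { intros x y Hy. unfold q. cd. apply (cdiff_comp g Cexp); [ eexists; apply cder_Cexp |].
    apply Hh. rewrite Re_Cexp_pair. apply Rmult_lt_0_compat; [ apply exp_pos |].
    destruct (cos_pos_between phi y Hphi Hy). lra. }
  assert (Cm : forall y, Rmin 0 phi <= y <= Rmax 0 phi -> forall a b, exI (fun x => q (x, y)) a b).
  { intros y Hy a b. apply ccont_exI_all. intros x. apply (ccont_comp_cdiff q (fun t => (t, y))); auto. apply ccont_hor. }
  destruct (minmax_bounds 0 phi) as [Z0 Zp].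
  assert (D : dominator (fun x => W * M / (1 + x ^ 2)) (W * M * PI)) by (apply dominator_cauchy; nra).
  assert (Bq' : forall x y, Rmin 0 phi <= y <= Rmax 0 phi -> Cmod (q (x, y)) <= W * M / (1 + x ^ 2)).
  { intros x y Hy. eapply Rle_trans; [ now apply Bq |]. right. field. nra. }
  destruct (isI_exists (fun x => q (x, phi)) _ _ (Cm phi Zp) D (fun x => Bq' x phi Zp)) as [l' Hl'].
  assert (H0 : isI (fun x => q (x, 0)) l).
  { eapply isI_ext; [| apply Hl ]. intros x. rewrite Eq.
    replace (Ci * RtoC 0 * s)%C with (RtoC 0) by ring. rewrite Cexp_0. ring. }
  assert (El : l' = l).
  { apply Cmod_le_eps_eq. intros eps He.
    destruct (proj2 H0 (eps / 4)) as [X1 H1]; [ lra |]. destruct (proj2 Hl' (eps / 4)) as [X2 H2]; [ lra |].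
    set (G := Rabs phi * (W * M)).
    assert (PG : 0 <= G) by (unfold G; repeat apply Rmult_le_pos; try lra; apply Rabs_pos).
    set (X := Rmax (Rmax X1 X2) (Rmax 1 (4 * G / eps))).
    assert (X1 <= X /\ X2 <= X /\ 1 <= X /\ 4 * G / eps <= X) as (L1 & L2 & L3 & L4).
    { unfold X. repeat split.
      - eapply Rle_trans; [ apply Rmax_l | apply Rmax_l ].
      - eapply Rle_trans; [ apply Rmax_r | apply Rmax_l ].
      - eapply Rle_trans; [ apply Rmax_l | apply Rmax_r ].
      - eapply Rle_trans; [ apply Rmax_r | apply Rmax_r ]. }
    specialize (H1 (- X) X ltac:(lra) L1). specialize (H2 (- X) X ltac:(lra) L2).
    assert (GR : Rct q (- X) X 0 phi = 0) by (apply goursat; intros x y _ Hy; auto).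
    unfold Rct in GR.
    assert (Side : forall x, Rabs x = X -> Cmod (CI (fun y => q (x, y)) 0 phi) <= eps / 4).
    { intros x Hx.
      assert (Ix : exI (fun y => q (x, y)) 0 phi).
      { apply ccont_exI. intros y Hy. apply (ccont_comp_cdiff q (fun t => (x, t))); auto. apply ccont_ver. }
      eapply Rle_trans; [ apply (CI_bound_abs _ _ _ (W * M / X) Ix) |].
      - intros y Hy. eapply Rle_trans; [ now apply Bq' |]. apply Rmult_le_compat_l; [ nra |].
        apply Rinv_le_contravar; [ lra |]. rewrite <- pow2_abs, Hx. nra.
      - rewrite Rminus_0_r. replace (Rabs phi * (W * M / X)) with (G / X) by (unfold G; field; lra).
        apply (Rmult_le_reg_r X); [ lra |]. replace (G / X * X) with G by (field; lra).
        apply (Rmult_le_compat_l (eps / 4)) in L4; [| lra ]. replace (eps / 4 * (4 * G / eps)) with G in L4 by (field; lra). lra. }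
    assert (S1 := Side X ltac:(rewrite Rabs_pos_eq; lra)). assert (S2 := Side (- X) ltac:(rewrite Rabs_Ropp, Rabs_pos_eq; lra)).
    set (a := CI (fun x => q (x, 0)) (- X) X) in *. set (b := CI (fun x => q (x, phi)) (- X) X) in *.
    set (u := CI (fun y => q (X, y)) 0 phi) in *. set (v := CI (fun y => q (- X, y)) 0 phi) in *.
    assert (Eb : b = (a + Ci * u - Ci * v)%C).
    { replace b with (b + 0)%C by ring. rewrite <- GR. ring. }
    replace (l' - l)%C with ((a - l) - (b - l') + (Ci * u - Ci * v))%C by (rewrite Eb; ring).
    eapply Rle_trans; [ apply Cmod_triangle |].
    generalize (Cmod_tri_minus (a - l)%C (b - l')%C) (Cmod_tri_minus (Ci * u)%C (Ci * v)%C).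
    rewrite !Cmod_mult, Cmod_Ci. lra. }
  rewrite El in Hl'.
  eapply isI_ext; [| apply isI_cmult, Hl' ].
  intros x. cbv beta. rewrite Eq, Cmult_assoc, <- Cexp_add.
  replace (- (Ci * RtoC phi * s) + Ci * RtoC phi * s)%C with (RtoC 0) by ring. rewrite Cexp_0. ring.
Qed.

(** * The defect of modularity and its vanishing *)

Definition melpos (g : C -> C) (phi : R) (s : C) : C := IntR (cut (mel g phi s)).

Lemma exI_cut_ccont (q : R -> C) : (forall x, ccont q x) -> forall a b, exI (cut q) a b.
Proof. intros H. apply exI_cut. intros. now apply ccont_exI_all. Qed.

(** Over t > 1 the exponential decay of [g] beats every power, so [Re s] needs no lower bound; this
    is what makes [melpos] entire and bounded in left half-planes. *)
Lemma melpos_spec g K N c sig : 0 <= K -> rhp_holo g -> rhp_bounded g K N -> 0 < c -> exists M, 0 <= M /\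
  forall phi s, c <= cos phi -> Re s <= sig ->
    isI (cut (mel g phi s)) (melpos g phi s) /\ Cmod (melpos g phi s) <= M * PI /\
    forall x, Cmod (cut (mel g phi s) x) <= M / (1 + x ^ 2).
Proof.
  intros HK Hh Hg Hc. destruct (mel_bound_pos g K N c sig HK Hg Hc) as (M & HM & B).
  exists (4 * M). split; [ lra |]. intros phi s Hp Hs.
  assert (D := dominator_cauchy (4 * M) ltac:(lra)).
  assert (Bx : forall x, Cmod (cut (mel g phi s) x) <= 4 * M / (1 + x ^ 2)).
  { intros x. eapply Rle_trans; [| apply exp_abs_le_cauchy; auto ]. unfold cut. destruct (Rlt_dec x 0).
    - rewrite Cmod_0. apply Rmult_le_pos; auto. left; apply exp_pos.
    - rewrite Rabs_pos_eq by lra. apply B; auto; lra. }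
  assert (J : isI (cut (mel g phi s)) (melpos g phi s)).
  { apply (isI_Int _ _ _ (exI_cut_ccont _ (fun x => ccont_mel g phi s x Hh ltac:(lra))) D Bx). }
  split; [ auto | split; [| auto ] ].
  apply (isI_bound _ _ _ _ J D Bx).
Qed.

Lemma melpos_entire g K N phi s : 0 <= K -> rhp_holo g -> rhp_bounded g K N -> 0 < cos phi -> cdiff (melpos g phi) s.
Proof.
  intros HK Hh Hg Hc. destruct (melpos_spec g K N (cos phi) (Re s + 1) HK Hh Hg Hc) as (M & HM & B).
  assert (Hu : forall u, Cmod (u - s)%C <= 1 -> Re u <= Re s + 1).
  { intros u Hu. generalize (re_le_Cmod (u - s)%C). rewrite Re_minus. intros R. apply Rabs_le_between in R. lra. }
  apply (isI_cdiff (fun x u => cut (mel g phi u) x) _ s 1 (fun x => M / (1 + x ^ 2)) (M * PI)); [ lra | now apply dominator_cauchy | |].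
  - intros x u H. split.
    + unfold cut. destruct (Rlt_dec x 0); [ apply cdiff_const |]. unfold mel. cd.
    + apply (B phi u); [ lra | auto ].
  - intros u H. apply (B phi u); [ lra | auto ].
Qed.

(* For Re s large this is the Mellin transform over (0,1) of g(tω) - η (tω)^{-1} g(1/(tω)), with ω = e^{iφ}. *)
Definition defect (g Lam : C -> C) (eta phi : R) (s : C) : C :=
  (Cexp (- (Ci * RtoC phi * s)) * Lam s - melpos g phi s
   - RtoC eta * Cexp (- (Ci * RtoC phi)) * melpos g (- phi) (1 - s))%C.

(** The subtracted integrals are arranged so that the defect inherits the functional equation, with
    the angle reversed; estimates on the right thus pass to the left. *)
Lemma defect_flip g Lam eta phi s : eta * eta = 1 -> (forall s, Lam (1 - s)%C = (RtoC eta * Lam s)%C) ->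
  defect g Lam eta phi (1 - s)%C = (RtoC eta * Cexp (- (Ci * RtoC phi)) * defect g Lam eta (- phi) s)%C.
Proof.
  intros He HL. unfold defect. rewrite HL, Ropp_involutive.
  replace (1 - (1 - s))%C with s by ring.
  set (w := Cexp (- (Ci * RtoC phi))).
  replace (Cexp (- (Ci * RtoC phi * (1 - s)))) with (w * Cexp (- (Ci * RtoC (- phi) * s)))%C.
  2:{ unfold w. rewrite <- Cexp_add. f_equal. rewrite RtoC_opp. ring. }
  assert (Ew : (w * Cexp (- (Ci * RtoC (- phi))) = 1)%C).
  { unfold w. rewrite <- Cexp_add, RtoC_opp.
    replace (- (Ci * RtoC phi) + - (Ci * - RtoC phi))%C with (RtoC 0) by ring. apply Cexp_0. }
  assert (E2 : (RtoC eta * RtoC eta = 1)%C) by (rewrite <- RtoC_mult, He; reflexivity).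
  set (w' := Cexp (- (Ci * RtoC (- phi)))) in *.
  replace (RtoC eta * w * (Cexp (- (Ci * RtoC (- phi) * s)) * Lam s - melpos g (- phi) s
    - RtoC eta * w' * melpos g phi (1 - s)))%C with
   (RtoC eta * w * (Cexp (- (Ci * RtoC (- phi) * s)) * Lam s - melpos g (- phi) s)
    - (RtoC eta * RtoC eta) * (w * w') * melpos g phi (1 - s))%C by ring.
  rewrite Ew, E2. ring.
Qed.

(** With v = e^(x + i phi) this is g v - eta v^(-1) g(1/v), the failure of the inversion formula. *)
Definition hdef (g : C -> C) (eta phi x : R) : C :=
  (g (Cexp (x, phi)) - RtoC eta * Cexp (- (x, phi)) * g (Cexp (- (x, phi))))%C.

(** For large [Re s] the defect is a Laplace transform of [hdef]: removing the part t > 1 leaves 0 <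
    t < 1, the second cut integral is carried there by t -> 1/t, and -log t becomes the variable. *)
Lemma defect_right g K N Lam eta phi s : 0 <= K -> rhp_holo g -> rhp_bounded g K N -> Rabs phi < PI / 2 ->
  INR N + 1 <= Re s -> isI (mel g 0 s) (Lam s) ->
  isI (cut (fun x => hdef g eta phi (- x) * Cexp (- (s * RtoC x)))%C) (defect g Lam eta phi s).
Proof.
  intros HK Hh Hg Hphi Hs HL.
  destruct (cos_pos_between phi phi Hphi (proj2 (minmax_bounds 0 phi))) as [_ Hc].
  assert (Hc' : 0 < cos (- phi)) by now rewrite cos_neg.
  assert (M := mel_rotate g K N phi s (Lam s) HK Hh Hg Hphi Hs HL).
  destruct (melpos_spec g K N (cos phi) (Re s) HK Hh Hg Hc) as (M1 & _ & B1).
  destruct (B1 phi s (Rle_refl _) (Rle_refl _)) as [I1 _].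
  destruct (melpos_spec g K N (cos (- phi)) (Re (1 - s)%C) HK Hh Hg Hc') as (M2 & _ & B2).
  destruct (B2 (- phi) (1 - s)%C (Rle_refl _) (Rle_refl _)) as [I2 _].
  unfold defect.
  apply (isI_ext0 (fun x => (mel g phi s (- x) - cut (mel g phi s) (- x)) - RtoC eta * Cexp (- (Ci * RtoC phi)) * cut (mel g (- phi) (1 - s)) x)%C).
  - intros x Hx. unfold cut. destruct (Rlt_dec (- x) 0); destruct (Rlt_dec x 0); try lra; [| ring ].
    unfold mel, hdef.
    replace (- (((- x)%R, phi) : C))%C with ((x, - phi) : C) by Csolve.
    replace (s * RtoC (- x))%C with (- (s * RtoC x))%C by (rewrite RtoC_opp; ring).
    set (G := g (Cexp (x, - phi))).
    replace (Cexp (x, - phi)) with (Cexp (- (Ci * RtoC phi)) * Cexp (RtoC x))%C.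
    2:{ rewrite <- Cexp_add. f_equal. Csolve. }
    replace (Cexp ((1 - s) * RtoC x)) with (Cexp (RtoC x) * Cexp (- (s * RtoC x)))%C.
    2:{ rewrite <- Cexp_add. f_equal. ring. }
    ring.
  - apply isI_minus; [| now apply isI_cmult ].
    apply (isI_reflect (fun x => mel g phi s x - cut (mel g phi s) x)%C). now apply isI_minus.
Qed.

Lemma hdef_bound g K N c : 0 <= K -> rhp_bounded g K N -> 0 < c -> exists B, 0 <= B /\
  forall eta phi x, eta * eta = 1 -> c <= cos phi -> 0 <= x -> Cmod (hdef g eta phi (- x)) <= B * exp (INR N * x).
Proof.
  intros HK Hg Hc.
  destruct (double_exp_decay (c / 2) 1 ltac:(lra)) as (M & HM & BM).
  set (K' := rayc K N c).
  assert (PK : 0 <= K') by now apply rayc_pos.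
  exists (K' + K' * M). split; [ nra |]. intros eta phi x He Hp Hx.
  destruct (ray_bound g K N c (- x) phi HK Hg Hc Hp) as [R1 _]. specialize (R1 ltac:(lra)).
  destruct (ray_bound g K N c x (- phi) HK Hg Hc ltac:(rewrite cos_neg; auto)) as [_ R2]. specialize (R2 Hx).
  fold K' in R1, R2.
  replace (- (INR N * - x)) with (INR N * x) in R1 by ring.
  unfold hdef. replace (- (((- x)%R, phi) : C))%C with ((x, - phi) : C) by Csolve.
  eapply Rle_trans; [ apply Cmod_tri_minus |]. rewrite !Cmod_mult, Cmod_R, Cmod_Cexp. simpl Re.
  assert (Ea : Rabs eta = 1).
  { unfold Rabs. destruct (Rcase_abs eta); nra. }
  rewrite Ea, Rmult_1_l, Rmult_plus_distr_r. apply Rplus_le_compat; auto.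
  assert (1 <= exp (INR N * x)) by (rewrite <- exp_0; apply exp_le; generalize (pos_INR N); nra).
  specialize (BM x Hx). rewrite Rmult_1_l in BM.
  assert (exp (- x) <= 1) by (rewrite <- exp_0; apply exp_le; lra).
  assert (Px := exp_pos x).
  apply Rle_trans with (K' * (exp (- (c / 2 * exp x)) * exp x)).
  - replace (K' * (exp (- (c / 2 * exp x)) * exp x)) with (exp x * (K' * exp (- (c / 2 * exp x)))) by ring.
    apply Rmult_le_compat_l; lra.
  - rewrite Rmult_assoc. apply Rmult_le_compat_l; auto. nra.
Qed.

Lemma defect_bound g K N Lam eta phi s B : 0 <= K -> rhp_holo g -> rhp_bounded g K N -> Rabs phi < PI / 2 ->
  INR N + 1 <= Re s -> isI (mel g 0 s) (Lam s) -> 0 <= B ->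
  (forall x, 0 <= x -> Cmod (hdef g eta phi (- x)) <= B * exp (INR N * x)) ->
  Cmod (defect g Lam eta phi s) <= B / (Re s - INR N).
Proof.
  intros HK Hh Hg Hphi Hs HL HB Hb.
  apply (isI_bound _ _ _ _ (defect_right g K N Lam eta phi s HK Hh Hg Hphi Hs HL)
    (dominator_exp_cut B (Re s - INR N) HB ltac:(lra))).
  intros x. unfold cut. destruct (Rlt_dec x 0); [ rewrite Cmod_0; lra |].
  rewrite Cmod_mult, Cmod_Cexp.
  replace (exp (- ((Re s - INR N) * x))) with (exp (INR N * x) * exp (- (Re s * x))).
  2:{ rewrite <- exp_plus. f_equal. ring. }
  replace (Re (- (s * RtoC x))%C) with (- (Re s * x)) by (reim; ring).
  rewrite <- Rmult_assoc. apply Rmult_le_compat_r; [ left; apply exp_pos |]. apply Hb. lra.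
Qed.

(** A real order is rounded up to a natural exponent; in the strip |s| <= X + |y| <= X (1 + |y|)
    because X >= 1. *)
Lemma finite_order_growth Lam X : finite_order Lam -> 1 <= X -> exists n T0, (1 <= n)%nat /\
  forall x y, Rabs x <= X -> T0 <= Rabs y -> Cmod (Lam (x, y)) <= exp (X ^ n * (1 + Rabs y) ^ n).
Proof.
  intros (rho & R0 & H) HX.
  destruct (INR_unbounded (Rmax rho 1)) as [n Hn].
  assert (rho < INR n /\ 1 < INR n) as [N1 N2].
  { generalize (Rmax_l rho 1) (Rmax_r rho 1). lra. }
  exists n, (Rmax (R0 + 1) 1). split.
  { destruct n; [ simpl in N2; lra | lia ]. }
  intros x y Hx Hy.
  assert (R0 + 1 <= Rabs y /\ 1 <= Rabs y) as [Y1 Y2].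
  { generalize (Rmax_l (R0 + 1) 1) (Rmax_r (R0 + 1) 1). lra. }
  assert (Hs := im_le_Cmod (x, y)). simpl Im in Hs.
  assert (Hs' := Cmod_le_ReIm (x, y)). simpl Im in Hs'. simpl Re in Hs'.
  eapply Rle_trans; [ apply H; lra |]. apply exp_le.
  apply Rle_trans with (Rpower (Cmod (x, y)) (INR n)).
  - apply Rle_Rpower; lra.
  - rewrite Rpower_pow by lra. rewrite <- Rpow_mult_distr. apply pow_incr. nra.
Qed.

(** The Laplace bound [defect_bound] gives B / (X - N) on Re s = X, and [defect_flip] gives it on Re
    s = 1 - X. In between [Lam] grows at most like the exponential of a power and [melpos] is
    bounded, so Phragmen-Lindelof carries the bound to [s]; then X goes to infinity. *)
Lemma defect_zero g K N Lam eta phi sig0 s : 0 <= K -> rhp_holo g -> rhp_bounded g K N -> Rabs phi < PI / 2 ->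
  eta * eta = 1 -> (forall z, cdiff Lam z) -> finite_order Lam -> (forall s, Lam (1 - s)%C = (RtoC eta * Lam s)%C) ->
  (forall s, sig0 < Re s -> isI (mel g 0 s) (Lam s)) -> defect g Lam eta phi s = 0.
Proof.
  intros HK Hh Hg Hphi He Hent Hord HL HM.
  destruct (cos_pos_between phi phi Hphi (proj2 (minmax_bounds 0 phi))) as [_ Hc].
  assert (Hphi' : Rabs (- phi) < PI / 2) by now rewrite Rabs_Ropp.
  assert (Ec : cos (- phi) = cos phi) by apply cos_neg.
  destruct (hdef_bound g K N (cos phi) HK Hg Hc) as (B & HB & Hb).
  assert (Cdf : forall z, cdiff (defect g Lam eta phi) z).
  { intros z. unfold defect. cd.
    - apply Hent.
    - apply (melpos_entire g K N); auto.
    - apply (cdiff_comp (melpos g (- phi)) (fun u => 1 - u)%C); [ cd |].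
      apply (melpos_entire g K N); auto. now rewrite Ec. }
  assert (Main : forall X, INR N + 2 <= X -> sig0 < X -> 1 - X <= Re s <= X -> Cmod (defect g Lam eta phi s) <= B / (X - INR N)).
  { intros X HX HX0 Hs. assert (PN := pos_INR N).
    destruct (finite_order_growth Lam X Hord ltac:(lra)) as (n & T0 & Hn & Hgr).
    destruct (melpos_spec g K N (cos phi) X HK Hh Hg Hc) as (M & HMp & Bm).
    generalize PI_RGT_0 PI2_3_2 PI_4. intros PP PP1 PP2.
    assert (PMpi : 0 <= M * PI) by nra.
    assert (PXn : 0 <= X ^ n) by (apply pow_le; lra).
    rewrite (surjective_pairing s). change (fst s) with (Re s). change (snd s) with (Im s).
    apply (phragmen_lindelof (defect g Lam eta phi) (1 - X) X (B / (X - INR N)) (1 + 2 * (M * PI)) (2 + X ^ n) n T0); auto; try lra.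
    - apply Rmult_le_pos; auto. left. apply Rinv_0_lt_compat. lra.
    - intros x y Hx Hy.
      assert (Hx' : Rabs x <= X) by (apply Rabs_le; lra).
      specialize (Hgr x y Hx' Hy).
      destruct (Bm phi (x, y) (Rle_refl _)) as (_ & B1 & _); [ simpl; lra |].
      destruct (Bm (- phi) (1 - (x, y))%C) as (_ & B2 & _); [ lra | reim; lra |].
      unfold defect.
      eapply Rle_trans; [ apply Cmod_tri_minus |].
      eapply Rle_trans; [ apply Rplus_le_compat_r, Cmod_tri_minus |].
      rewrite !Cmod_mult, !Cmod_Cexp, Cmod_R.
      assert (Ea : Rabs eta = 1) by (unfold Rabs; destruct (Rcase_abs eta); nra).
      rewrite Ea. reim.
      replace (- (0 * phi - 1 * 0)) with 0 by ring.
      replace (- ((0 * phi - 1 * 0) * x - (0 * 0 + 1 * phi) * y)) with (phi * y) by ring.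
      rewrite exp_0, !Rmult_1_l.
      set (Y := (1 + Rabs y) ^ n).
      assert (PY : 1 + Rabs y <= Y).
      { unfold Y. rewrite <- (pow_1 (1 + Rabs y)) at 1. apply Rle_pow; auto. generalize (Rabs_pos y). lra. }
      assert (Ph : phi * y <= 2 * Y).
      { eapply Rle_trans; [ apply Rle_abs |]. rewrite Rabs_mult. apply Rmult_le_compat; try apply Rabs_pos; lra. }
      assert (T : exp (phi * y) * Cmod (Lam (x, y)) <= exp ((2 + X ^ n) * Y)).
      { rewrite Rmult_plus_distr_r, exp_plus. apply Rmult_le_compat; auto using Cmod_ge_0.
        - left; apply exp_pos.
        - now apply exp_le. }
      assert (One : 1 <= exp ((2 + X ^ n) * Y)).
      { rewrite <- exp_0. apply exp_le. generalize (Rabs_pos y). nra. }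
      assert (2 * (M * PI) * 1 <= 2 * (M * PI) * exp ((2 + X ^ n) * Y)) by (apply Rmult_le_compat_l; lra).
      lra.
    - intros y. split.
      + replace ((1 - X, y) : C) with (1 - (X, (- y)%R))%C by Csolve.
        rewrite defect_flip by auto. rewrite !Cmod_mult, Cmod_Cexp, Cmod_R.
        assert (Ea : Rabs eta = 1) by (unfold Rabs; destruct (Rcase_abs eta); nra).
        rewrite Ea. reim. replace (- (0 * phi - 1 * 0)) with 0 by ring. rewrite exp_0, !Rmult_1_l.
        apply (defect_bound g K N Lam eta (- phi) (X, - y) B); auto; simpl Re; try lra; auto.
        intros x Hx. apply Hb; auto. lra.
      + apply (defect_bound g K N Lam eta phi (X, y) B); auto; simpl Re; try lra; auto.
        intros x Hx. apply Hb; auto. lra. }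
  apply Cmod_eq_0. apply Rle_antisym; [| apply Cmod_ge_0 ].
  apply le_epsilon. intros e Hep. rewrite Rplus_0_l.
  set (X := INR N + 2 + Rabs sig0 + Rabs (Re s) + B / e).
  assert (Q : 0 <= B / e) by (apply Rmult_le_pos; auto; left; now apply Rinv_0_lt_compat).
  assert (PN := pos_INR N).
  generalize (Rabs_pos sig0) (Rabs_pos (Re s)) (Rle_abs sig0) (Rle_abs (Re s)) (Rle_abs (- Re s)). rewrite Rabs_Ropp. intros.
  eapply Rle_trans; [ apply (Main X); unfold X; lra |].
  assert (PD : 0 < X - INR N) by (unfold X; lra).
  apply (Rmult_le_reg_r (X - INR N)); auto. replace (B / (X - INR N) * (X - INR N)) with B by (field; lra).
  apply Rle_trans with (e * (B / e)); [ right; field; lra |]. apply Rmult_le_compat_l; unfold X; lra.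
Qed.

Lemma polar_form (v : C) : 0 < Re v -> exists x phi, Rabs phi < PI / 2 /\ v = Cexp (x, phi).
Proof.
  intros Hv. exists (ln (Cmod v)), (atan (Im v / Re v)).
  assert (B := atan_bound (Im v / Re v)). split; [ apply Rabs_def1; lra |].
  assert (Pm : 0 < Cmod v) by (apply Cmod_neq0, Re_neq0; lra).
  set (t := atan (Im v / Re v)).
  assert (Pc : 0 < cos t) by (apply cos_gt_0; unfold t; lra).
  assert (Et : tan t = Im v / Re v) by apply tan_atan. unfold tan in Et.
  assert (Es : sin t * Re v = Im v * cos t).
  { apply (f_equal (fun u => u * cos t * Re v)) in Et. 
    replace (sin t / cos t * cos t * Re v) with (sin t * Re v) in Et by (field; lra).
    replace (Im v / Re v * cos t * Re v) with (Im v * cos t) in Et by (field; lra). auto. }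
  assert (Em : Cmod v * Cmod v = Re v * Re v + Im v * Im v).
  { generalize (Cmod2_alt v). simpl. lra. }
  assert (SC := sin2_cos2 t). unfold Rsqr in SC.
  assert (E1 : Cmod v * cos t = Re v).
  { assert ((Cmod v * cos t) * (Cmod v * cos t) = Re v * Re v).
    { replace ((Cmod v * cos t) * (Cmod v * cos t)) with ((Cmod v * Cmod v) * (cos t * cos t)) by ring.
      rewrite Em. replace ((Re v * Re v + Im v * Im v) * (cos t * cos t)) with
        (Re v * Re v * (cos t * cos t) + (Im v * cos t) * (Im v * cos t)) by ring.
      rewrite <- Es. transitivity (Re v * Re v * (sin t * sin t + cos t * cos t)); [ ring | rewrite SC; ring ]. }
    assert (0 < Cmod v * cos t) by now apply Rmult_lt_0_compat. nra. }
  apply Ceq.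
  - rewrite Re_Cexp_pair, exp_ln by auto. lra.
  - unfold Cexp. simpl. rewrite exp_ln by auto.
    apply (Rmult_eq_reg_r (cos t)); [| lra ]. rewrite <- Es, <- E1. ring.
Qed.

(** Vanishing of the defect at the points S0 + k makes all moments of [hdef] against e^(-k y) zero,
    so [lerch] gives hdef = 0 for x <= 0, that is |v| <= 1, at every angle; larger |v| follow by
    exchanging v and 1/v. *)
Lemma converse_lemma g K N Lam eta sig0 : 0 <= K -> rhp_holo g -> rhp_bounded g K N ->
  eta * eta = 1 -> (forall z, cdiff Lam z) -> finite_order Lam -> (forall s, Lam (1 - s)%C = (RtoC eta * Lam s)%C) ->
  (forall s, sig0 < Re s -> isI (mel g 0 s) (Lam s)) ->
  forall v, 0 < Re v -> g (/ v)%C = (RtoC eta * v * g v)%C.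
Proof.
  intros HK Hh Hg He Hent Hord HL HM.
  assert (Z : forall phi, Rabs phi < PI / 2 -> forall y, 0 <= y -> hdef g eta phi (- y) = 0).
  { intros phi Hphi.
    destruct (cos_pos_between phi phi Hphi (proj2 (minmax_bounds 0 phi))) as [_ Hc].
    destruct (hdef_bound g K N (cos phi) HK Hg Hc) as (B & HB & Hb).
    (* The weight e^(-S0 y) turns the growth e^(N y) of [hdef] into the decay e^(-y) that [lerch]
       requires, and puts all the points S0 + k into the region where the Mellin transform is
       known. *)
    set (S0 := Rmax (INR N + 1) (sig0 + 1)).
    assert (INR N + 1 <= S0 /\ sig0 + 1 <= S0) as [S1 S2] by (split; [ apply Rmax_l | apply Rmax_r ]).
    intros y0 Hy0.
    assert (L : (hdef g eta phi (- y0) * RtoC (exp (- (S0 * y0))))%C = 0).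
    { apply (lerch (fun y => hdef g eta phi (- y) * RtoC (exp (- (S0 * y))))%C B); auto.
      - intros y. cc. unfold hdef.
        assert (Cp : ccont (fun t => (- t, phi) : C) y).
        { apply (ccont_ext (fun t => RtoC (- t) + (0, phi))%C); [ intros; Csolve | cc ]. }
        assert (HR : forall a b, 0 < cos b -> 0 < Re (Cexp (a, b))).
        { intros. rewrite Re_Cexp_pair. apply Rmult_lt_0_compat; auto. apply exp_pos. }
        apply (ccont_minus (fun t => g (Cexp (- t, phi))) (fun t => RtoC eta * Cexp (- (((- t)%R, phi) : C)) * g (Cexp (- (((- t)%R, phi) : C))))%C).
        + apply (ccont_comp_cdiff g (fun t => Cexp (- t, phi))); [ now apply ccont_Cexp |]. apply Hh. now apply HR.
        + apply (ccont_mult (fun t => RtoC eta * Cexp (- (((- t)%R, phi) : C)))%C (fun t => g (Cexp (- (((- t)%R, phi) : C))))).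
          * cc.
          * apply (ccont_comp_cdiff g (fun t => Cexp (- (((- t)%R, phi) : C))%C)); [ cc |].
            apply Hh. change (- (((- y)%R, phi) : C))%C with (((- - y)%R, (- phi)%R) : C). apply HR. now rewrite cos_neg.
      - intros y Hy. rewrite Cmod_mult, Cmod_RtoC_pos by (left; apply exp_pos).
        apply Rle_trans with (B * exp (INR N * y) * exp (- (S0 * y))).
        + apply Rmult_le_compat_r; [ left; apply exp_pos |]. apply Hb; auto. lra.
        + rewrite Rmult_assoc, <- exp_plus. apply Rmult_le_compat_l; auto. apply exp_le. nra.
      - intros k. assert (Pk := pos_INR k).
        set (s := RtoC (S0 + INR k)).
        assert (Hs : INR N + 1 <= Re s) by (unfold s; simpl; lra).
        assert (J := defect_right g K N Lam eta phi s HK Hh Hg Hphi Hs (HM s ltac:(unfold s; simpl; lra))).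
        rewrite (defect_zero g K N Lam eta phi sig0) in J by auto.
        eapply isI_ext; [| apply J ]. intros x. unfold cut. destruct (Rlt_dec x 0); auto.
        rewrite <- Cmult_assoc, <- RtoC_mult, <- exp_plus, <- Cexp_RtoC. do 2 f_equal.
        unfold s. rewrite <- RtoC_mult, <- RtoC_opp. f_equal. ring. }
    assert (Ne : RtoC (exp (- (S0 * y0))) <> 0) by (apply RtoC_neq0, Rgt_not_eq, exp_pos).
    replace (hdef g eta phi (- y0)) with (hdef g eta phi (- y0) * RtoC (exp (- (S0 * y0))) / RtoC (exp (- (S0 * y0))))%C by (field; auto).
    rewrite L. field. auto. }
  assert (E2 : (RtoC eta * RtoC eta = 1)%C) by (rewrite <- RtoC_mult, He; reflexivity).
  intros v Hv. destruct (polar_form v Hv) as (x & phi & Hphi & Ev).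
  assert (Nv : v <> 0) by (apply Re_neq0; lra).
  assert (Ei : (/ v)%C = Cexp (- (x, phi))) by (rewrite Cexp_opp, <- Ev; auto).
  destruct (Rle_dec x 0) as [L | L].
  - specialize (Z phi Hphi (- x) ltac:(lra)). rewrite Ropp_involutive in Z. unfold hdef in Z.
    rewrite <- Ei, <- Ev in Z.
    assert (Gv : g v = (RtoC eta * / v * g (/ v))%C).
    { replace (g v) with (g v - RtoC eta * / v * g (/ v) + RtoC eta * / v * g (/ v))%C by ring. rewrite Z. ring. }
    rewrite Gv. replace (RtoC eta * v * (RtoC eta * / v * g (/ v)))%C with ((RtoC eta * RtoC eta) * (v * / v) * g (/ v))%C by ring.
    rewrite E2, Cinv_r by auto. ring.
  (* For |v| > 1 the relation is read at 1/v, whose argument is [- phi]. *)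
  - assert (Hphi' : Rabs (- phi) < PI / 2) by now rewrite Rabs_Ropp.
    specialize (Z (- phi) Hphi' x ltac:(lra)). unfold hdef in Z.
    replace (- (((- x)%R, (- phi)%R) : C))%C with ((x, phi) : C) in Z by Csolve.
    replace ((- x, - phi) : C) with (- ((x, phi) : C))%C in Z by Csolve.
    rewrite <- Ei, <- Ev in Z.
    replace (g (/ v)%C) with (g (/ v) - RtoC eta * v * g v + RtoC eta * v * g v)%C by ring. rewrite Z. ring.
Qed.

(** * Bessel functions *)

Lemma cosh_ge b : 1 + b ^ 2 / 2 <= cosh b.
Proof.
  assert (P : forall t, 0 <= t -> 1 + t ^ 2 / 2 <= cosh t).
  { intros t Ht.
    assert (Sh : forall s, 0 <= s -> s <= sinh s).
    { intros s Hs. destruct (MVT_gen (fun x => sinh x - x) 0 s (fun x => cosh x - 1)) as [c [_ E]].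
      - intros x _. unfold sinh, cosh. auto_derive; auto. field.
      - intros x _. apply derivable_continuous_pt. apply ex_derive_Reals_0. unfold sinh. auto_derive. auto.
      - unfold sinh at 2 in E. rewrite Ropp_0, exp_0 in E.
        assert (1 <= cosh c).
        { unfold cosh. generalize (exp_pos c) (exp_pos (- c)). intros.
          assert (exp c * exp (- c) = 1) by (rewrite <- exp_plus, Rplus_opp_r; apply exp_0).
          generalize (pow2_ge_0 (exp c - exp (- c))). nra. }
        nra. }
    destruct (MVT_gen (fun x => cosh x - x ^ 2 / 2) 0 t (fun x => sinh x - x)) as [c [Hc E]].
    - intros x _. unfold sinh, cosh. auto_derive; auto. field.
    - intros x _. apply derivable_continuous_pt. apply ex_derive_Reals_0. unfold cosh. auto_derive. auto.
    - unfold cosh at 2 in E. rewrite Ropp_0, exp_0 in E. rewrite Rmin_left in Hc by lra.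
      specialize (Sh c ltac:(lra)). nra. }
  destruct (Rle_dec 0 b); auto.
  replace (cosh b) with (cosh (- b)) by (unfold cosh; rewrite Ropp_involutive; field).
  replace (b ^ 2) with ((- b) ^ 2) by ring. apply P. lra.
Qed.

Lemma cosh_ge1 b : 1 <= cosh b.
Proof. generalize (cosh_ge b). nra. Qed.

Lemma cosh_even b : cosh (- b) = cosh b.
Proof. unfold cosh. rewrite Ropp_involutive. field. Qed.

(** From cosh b >= 1 + b^2/2 the kernel is compared with a Cauchy density. The loss 1 + 2/x for
    small x is kept explicit because it becomes the singularity allowed in [K0_bound]. *)
Lemma exp_quad_bound x b : 0 < x -> exp (- (x * cosh b)) <= exp (- x) * (1 + 2 / x) / (1 + b ^ 2).
Proof.
  intros Hx. assert (Pb : 0 < 1 + b ^ 2) by nra.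
  assert (Px : 0 < / x) by now apply Rinv_0_lt_compat.
  apply Rle_trans with (exp (- x) * exp (- (x * (b ^ 2 / 2)))).
  - rewrite <- exp_plus. apply exp_le. generalize (cosh_ge b). nra.
  - unfold Rdiv at 2. rewrite Rmult_assoc. apply Rmult_le_compat_l; [ left; apply exp_pos |].
    assert (E : 1 + x * (b ^ 2 / 2) <= exp (x * (b ^ 2 / 2))) by apply exp_ineq1_le.
    rewrite exp_Ropp.
    apply Rle_trans with (/ (1 + x * (b ^ 2 / 2))); [ apply Rinv_le_contravar; auto; nra |].
    assert (Q : 0 < 1 + x * (b ^ 2 / 2)) by nra.
    apply (Rmult_le_reg_l ((1 + x * (b ^ 2 / 2)) * (1 + b ^ 2))); [ now apply Rmult_lt_0_compat |].
    replace ((1 + x * (b ^ 2 / 2)) * (1 + b ^ 2) * / (1 + x * (b ^ 2 / 2))) with (1 + b ^ 2) by (field; lra).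
    replace ((1 + x * (b ^ 2 / 2)) * (1 + b ^ 2) * ((1 + 2 / x) * / (1 + b ^ 2))) with ((1 + x * (b ^ 2 / 2)) * (1 + 2 * / x)) by (field; split; lra).
    assert (x * / x = 1) by (field; lra). nra.
Qed.

Lemma cosh_exp_quad_bound x b : 0 < x -> cosh b * exp (- (x * cosh b)) <= (2 / x) * (exp (- (x / 2)) * (1 + 4 / x) / (1 + b ^ 2)).
Proof.
  intros Hx. assert (Px : 0 < / x) by now apply Rinv_0_lt_compat.
  generalize (cosh_ge1 b). intros.
  assert (A := mul_exp_le1 (x / 2 * cosh b) ltac:(nra)).
  assert (B := exp_quad_bound (x / 2) b ltac:(lra)).
  replace (2 / (x / 2)) with (4 / x) in B by (field; lra).
  replace (- (x * cosh b)) with (- (x / 2 * cosh b) + - (x / 2 * cosh b)) by field. rewrite exp_plus.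
  generalize (exp_pos (- (x / 2 * cosh b))). intros.
  replace (cosh b * (exp (- (x / 2 * cosh b)) * exp (- (x / 2 * cosh b)))) with
    (2 / x * ((x / 2 * cosh b * exp (- (x / 2 * cosh b))) * exp (- (x / 2 * cosh b)))) by (field; lra).
  apply Rmult_le_compat_l; [ unfold Rdiv; lra |]. nra.
Qed.

Lemma cosh_pow_dom x k : 0 < x -> exists M, 0 <= M /\ forall b, cosh b ^ k * exp (- (x * cosh b)) <= M / (1 + b ^ 2).
Proof.
  intros Hx. set (c := x / INR (S k)).
  assert (PS : 0 < INR (S k)) by (apply lt_0_INR; lia).
  assert (Pc : 0 < c) by now apply Rdiv_lt_0_compat.
  assert (Pcn : 0 < c ^ S k) by now apply pow_lt.
  exists (2 / c ^ S k). split; [ left; apply Rdiv_lt_0_compat; lra |]. intros b.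
  assert (H1 := cosh_ge1 b). assert (H2 := cosh_ge b).
  assert (E : (c * cosh b) ^ S k <= exp (x * cosh b)).
  { eapply Rle_trans; [| apply exp_pow_le; nra ]. apply pow_incr. split; [ nra |].
    replace (x * cosh b / INR (S k)) with (c * cosh b) by (unfold c; field; lra). lra. }
  rewrite Rpow_mult_distr in E.
  assert (Pk : 0 < cosh b ^ k) by (apply pow_lt; lra).
  rewrite exp_Ropp. assert (Pe := exp_pos (x * cosh b)).
  apply Rle_trans with (/ c ^ S k * / cosh b).
  - apply (Rmult_le_reg_r (exp (x * cosh b))); auto. rewrite Rmult_assoc, Rinv_l, Rmult_1_r by lra.
    replace (cosh b ^ k) with (/ c ^ S k * / cosh b * (c ^ S k * cosh b ^ S k)).
    2:{ simpl. field. repeat split; try apply pow_nonzero; lra. }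
    apply Rmult_le_compat_l; auto. left. apply Rmult_lt_0_compat; apply Rinv_0_lt_compat; lra.
  - replace (2 / c ^ S k / (1 + b ^ 2)) with (/ c ^ S k * / ((1 + b ^ 2) / 2)) by (field; split; nra).
    apply Rmult_le_compat_l; [ left; now apply Rinv_0_lt_compat |]. apply Rinv_le_contravar; nra.
Qed.

Lemma ccont_cosh x : ccont (fun b => RtoC (cosh b)) x.
Proof. apply ccont_RtoC. unfold cosh. rcont. Qed.

Definition bk (k : nat) (z : C) (b : R) : C := (RtoC (cosh b ^ k) * Cexp (- (z * RtoC (cosh b))))%C.

(** The modified Bessel functions of the second kind, as halves of integrals over the whole line:
    [bk k z] is the integrand of (-d/dz)^k applied to 2 K_0(z). *)
Definition K0 (z : C) : C := (IntR (bk 0 z) / RtoC 2)%C.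

Definition K1 (z : C) : C := (IntR (bk 1 z) / RtoC 2)%C.

Lemma Cmod_bk k z b : Cmod (bk k z b) = cosh b ^ k * exp (- (Re z * cosh b)).
Proof.
  unfold bk. rewrite Cmod_mult, Cmod_Cexp, Cmod_RtoC_pos.
  - do 2 f_equal. reim. ring.
  - apply pow_le. generalize (cosh_ge1 b). lra.
Qed.

Lemma ccont_bk k z x : ccont (bk k z) x.
Proof.
  unfold bk. cc; unfold cosh; rcont.
Qed.

Lemma bk_mono k z b x : x <= Re z -> Cmod (bk k z b) <= cosh b ^ k * exp (- (x * cosh b)).
Proof.
  intros H. rewrite Cmod_bk. generalize (cosh_ge1 b). intros. apply Rmult_le_compat_l; [ apply pow_le; lra |].
  apply exp_le. nra.
Qed.

Lemma isI_bk k z : 0 < Re z -> isI (bk k z) (IntR (bk k z)).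
Proof.
  intros Hz. destruct (cosh_pow_dom (Re z) k Hz) as (M & HM & B).
  apply (isI_Int _ _ _ (fun a b => ccont_exI_all _ a b (ccont_bk k z)) (dominator_cauchy M HM)).
  intros x. rewrite Cmod_bk. apply B.
Qed.

Lemma isI_bk_half k z : 0 < Re z -> isI (fun b => / RtoC 2 * bk k z b)%C (IntR (bk k z) / RtoC 2)%C.
Proof. intros. unfold Cdiv. rewrite Cmult_comm. now apply isI_cmult, isI_bk. Qed.

Lemma cder_scal c f z l : cder f z l -> cder (fun u => c * f u)%C z (c * l)%C.
Proof.
  intros H. replace (c * l)%C with (0 * f z + c * l)%C by ring.
  apply (cder_mult (fun _ => c) f); [ apply cder_const | auto ].
Qed.

Lemma bk_cder k z b : cder (fun u => bk k u b) z (- bk (S k) z b)%C.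
Proof.
  unfold bk.
  replace (- (RtoC (cosh b ^ S k) * Cexp (- (z * RtoC (cosh b)))))%C with
    (0 * Cexp (- (z * RtoC (cosh b))) + RtoC (cosh b ^ k) * (Cexp (- (z * RtoC (cosh b))) * (- RtoC (cosh b))))%C.
  2:{ simpl. rewrite RtoC_mult. ring. }
  apply (cder_mult (fun _ => RtoC (cosh b ^ k)) (fun u => Cexp (- (u * RtoC (cosh b))))); [ apply cder_const |].
  apply (cder_comp Cexp (fun u => - (u * RtoC (cosh b)))%C); [| apply cder_Cexp ].
  apply (cder_ext (fun u => (- RtoC (cosh b)) * u)%C); [ intros; ring |].
  assert (H := cder_scal (- RtoC (cosh b))%C (fun u => u) z 1 (cder_id z)). now rewrite Cmult_1_r in H.
Qed.

Lemma Re_near u z : Cmod (u - z)%C <= Re z / 2 -> Re z / 2 <= Re u.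
Proof.
  intros H. generalize (re_le_Cmod (u - z)%C). rewrite Re_minus. intros R. apply Rabs_le_between in R. lra.
Qed.

Lemma IntR_bk_cder k z : 0 < Re z -> cder (fun u => IntR (bk k u)) z (- IntR (bk (S k) z))%C.
Proof.
  intros Hz. destruct (cosh_pow_dom (Re z / 2) k ltac:(lra)) as (M & HM & B).
  apply (isI_cder (fun x u => bk k u x) (fun x => - bk (S k) z x)%C _ z _ (Re z / 2) (fun x => M / (1 + x ^ 2)) (M * PI)).
  - lra.
  - now apply dominator_cauchy.
  - intros x u Hu. split.
    + eexists. apply bk_cder.
    + eapply Rle_trans; [ apply bk_mono, Re_near, Hu | apply B ].
  - intros u Hu. apply isI_bk. apply Re_near in Hu. lra.
  - intros x. apply bk_cder.
  - replace (- IntR (bk (S k) z))%C with ((- (1)) * IntR (bk (S k) z))%C by ring.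
    apply (isI_ext (fun x => (- (1)) * bk (S k) z x)%C); [ intros; ring |]. now apply isI_cmult, isI_bk.
Qed.

Lemma cder_comp_scal c f z l : cder f (c * z)%C l -> cder (fun u => f (c * u)%C) z (c * l)%C.
Proof.
  intros H. replace (c * l)%C with (l * (c * 1))%C by ring.
  apply (cder_comp f (fun u => c * u)%C); auto. apply cder_scal, cder_id.
Qed.

Lemma K0_cder z : 0 < Re z -> cder K0 z (- K1 z)%C.
Proof.
  intros Hz. unfold K0, K1.
  apply (cder_ext (fun u => / RtoC 2 * IntR (bk 0 u))%C); [ intros; unfold Cdiv; ring |].
  replace (- (IntR (bk 1 z) / RtoC 2))%C with (/ RtoC 2 * - IntR (bk 1 z))%C by (unfold Cdiv; ring).
  apply cder_scal. now apply IntR_bk_cder.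
Qed.

Lemma K1_cdiff z : 0 < Re z -> cdiff K1 z.
Proof.
  intros Hz. eexists.
  apply (cder_ext (fun u => / RtoC 2 * IntR (bk 1 u))%C); [ intros; unfold K1, Cdiv; ring |].
  apply cder_scal. now apply IntR_bk_cder.
Qed.

Lemma K0_bound z : 0 < Re z -> Cmod (K0 z) <= PI / 2 * ((1 + 2 / Re z) * exp (- Re z)).
Proof.
  intros Hz. assert (0 < 2 / Re z) by (apply Rdiv_lt_0_compat; lra). assert (Pe := exp_pos (- Re z)).
  assert (B : Cmod (IntR (bk 0 z)) <= exp (- Re z) * (1 + 2 / Re z) * PI).
  { apply (isI_bound _ _ _ _ (isI_bk 0 z Hz) (dominator_cauchy (exp (- Re z) * (1 + 2 / Re z)) ltac:(nra))).
    intros x. rewrite Cmod_bk. simpl pow at 1. rewrite Rmult_1_l. now apply exp_quad_bound. }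
  unfold K0. rewrite Cmod_div, Cmod_RtoC_pos by (lra || (apply RtoC_neq0; lra)). lra.
Qed.

Lemma K1_bound z : 0 < Re z -> Cmod (K1 z) <= PI / 2 * (2 / Re z * (1 + 4 / Re z) * exp (- (Re z / 2))).
Proof.
  intros Hz. assert (0 < 2 / Re z) by (apply Rdiv_lt_0_compat; lra). assert (0 < 4 / Re z) by (apply Rdiv_lt_0_compat; lra).
  assert (Pe := exp_pos (- (Re z / 2))).
  set (W := 2 / Re z * (1 + 4 / Re z) * exp (- (Re z / 2))).
  assert (PW : 0 <= W) by (unfold W; repeat apply Rmult_le_pos; lra).
  assert (B : Cmod (IntR (bk 1 z)) <= W * PI).
  { apply (isI_bound _ _ _ _ (isI_bk 1 z Hz) (dominator_cauchy W PW)).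
    intros x. rewrite Cmod_bk. rewrite pow_1. eapply Rle_trans; [ now apply cosh_exp_quad_bound |].
    right. unfold W. field. split; nra. }
  unfold K1. rewrite Cmod_div, Cmod_RtoC_pos by (lra || (apply RtoC_neq0; lra)). lra.
Qed.

(** * Integrals of a function along w cosh b *)

Lemma Re_scal_cosh w b : Re (w * RtoC (cosh b))%C = Re w * cosh b.
Proof. reim. ring. Qed.

Lemma Re_scal_cosh_ge w b : 0 < Re w -> Re w <= Re (w * RtoC (cosh b))%C.
Proof. intros. rewrite Re_scal_cosh. generalize (cosh_ge1 b). nra. Qed.

Lemma pow_cosh_K_dom (f : C -> C) A d x : 0 < x -> 0 < d -> 0 <= A ->
  (forall z, x <= Re z -> Cmod (f z) <= A * exp (- (d * Re z))) -> forall k, exists M, 0 <= M /\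
  forall w b, x <= Re w -> Cmod (RtoC (cosh b ^ k) * f (w * RtoC (cosh b)))%C <= M / (1 + b ^ 2).
Proof.
  intros Hx Hd HA Hf k. destruct (cosh_pow_dom (d * x) k ltac:(nra)) as (M & HM & B).
  exists (A * M). split; [ nra |]. intros w b Hw. assert (H1 := cosh_ge1 b).
  assert (Hwb : x <= Re (w * RtoC (cosh b))%C) by (rewrite Re_scal_cosh; nra).
  rewrite Cmod_mult, Cmod_RtoC_pos by (apply pow_le; lra).
  specialize (Hf _ Hwb). rewrite Re_scal_cosh in Hf.
  replace (A * M / (1 + b ^ 2)) with (A * (M / (1 + b ^ 2))) by (field; nra).
  apply Rle_trans with (A * (cosh b ^ k * exp (- (d * x * cosh b)))).
  - replace (A * (cosh b ^ k * exp (- (d * x * cosh b)))) with (cosh b ^ k * (A * exp (- (d * x * cosh b)))) by ring.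
    apply Rmult_le_compat_l; [ apply pow_le; lra |]. eapply Rle_trans; [ apply Hf |].
    apply Rmult_le_compat_l; auto. apply exp_le. apply Ropp_le_contravar. rewrite Rmult_assoc. apply Rmult_le_compat_l; nra.
  - apply Rmult_le_compat_l; auto.
Qed.

Lemma K0_exp_bound x : 0 < x -> exists A, 0 <= A /\ forall z, x <= Re z -> Cmod (K0 z) <= A * exp (- (1 * Re z)).
Proof.
  intros Hx. exists (PI / 2 * (1 + 2 / x)). generalize PI_RGT_0. intros.
  assert (0 < 2 / x) by (apply Rdiv_lt_0_compat; lra).
  split; [ nra |]. intros z Hz. rewrite Rmult_1_l. eapply Rle_trans; [ apply K0_bound; lra |].
  rewrite Rmult_assoc. apply Rmult_le_compat_l; [ lra |]. apply Rmult_le_compat_r; [ left; apply exp_pos |].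
  assert (/ Re z <= / x) by (apply Rinv_le_contravar; lra). unfold Rdiv. lra.
Qed.

Lemma K1_exp_bound x : 0 < x -> exists A, 0 <= A /\ forall z, x <= Re z -> Cmod (K1 z) <= A * exp (- (/ 2 * Re z)).
Proof.
  intros Hx. exists (PI / 2 * (2 / x * (1 + 4 / x))). generalize PI_RGT_0. intros.
  assert (0 < / x) by (now apply Rinv_0_lt_compat).
  assert (0 <= 2 / x * (1 + 4 / x)) by (unfold Rdiv; nra).
  split; [ nra |]. intros z Hz. eapply Rle_trans; [ apply K1_bound; lra |].
  rewrite (Rmult_assoc (PI / 2)). apply Rmult_le_compat_l; [ lra |].
  replace (/ 2 * Re z) with (Re z / 2) by field.
  apply Rmult_le_compat_r; [ left; apply exp_pos |].
  assert (0 < / Re z) by (apply Rinv_0_lt_compat; lra).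
  assert (/ Re z <= / x) by (apply Rinv_le_contravar; lra). unfold Rdiv. apply Rmult_le_compat; lra.
Qed.

Lemma ccont_scal_cosh (f : C -> C) w k b : cdiff f (w * RtoC (cosh b))%C -> ccont (fun b => RtoC (cosh b ^ k) * f (w * RtoC (cosh b)))%C b.
Proof.
  intros H. apply (ccont_mult (fun b => RtoC (cosh b ^ k)) (fun b => f (w * RtoC (cosh b))%C)).
  - apply ccont_RtoC. unfold cosh. rcont.
  - apply (ccont_comp_cdiff f (fun b => w * RtoC (cosh b))%C); auto. apply (ccont_mult (fun _ => w)); [ apply ccont_const | apply ccont_cosh ].
Qed.

Lemma isI_cosh_f (f : C -> C) A d x : 0 < x -> 0 < d -> 0 <= A -> rhp_holo f ->
  (forall z, x <= Re z -> Cmod (f z) <= A * exp (- (d * Re z))) -> forall k w, x <= Re w ->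
  isI (fun b => RtoC (cosh b ^ k) * f (w * RtoC (cosh b)))%C (IntR (fun b => RtoC (cosh b ^ k) * f (w * RtoC (cosh b)))%C).
Proof.
  intros Hx Hd HA Hh Hf k w Hw. destruct (pow_cosh_K_dom f A d x Hx Hd HA Hf k) as (M & HM & B).
  apply (isI_Int _ (fun b => M / (1 + b ^ 2)) (M * PI)).
  - intros. apply ccont_exI_all. intros y. apply ccont_scal_cosh. apply Hh. generalize (Re_scal_cosh_ge w y). lra.
  - now apply dominator_cauchy.
  - intros b. now apply B.
Qed.

Lemma IntR_cosh_cder (f df : C -> C) A d A' d' w k : 0 < Re w -> 0 < d -> 0 <= A -> 0 < d' -> 0 <= A' -> rhp_holo df ->
  (forall z, 0 < Re z -> cder f z (df z)) ->
  (forall z, Re w / 2 <= Re z -> Cmod (f z) <= A * exp (- (d * Re z))) ->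
  (forall z, Re w / 2 <= Re z -> Cmod (df z) <= A' * exp (- (d' * Re z))) ->
  cder (fun u => IntR (fun b => RtoC (cosh b ^ k) * f (u * RtoC (cosh b)))%C) w
       (IntR (fun b => RtoC (cosh b ^ S k) * df (w * RtoC (cosh b)))%C).
Proof.
  intros Hw Hd HA Hd' HA' Hdf Hf Bf Bdf.
  assert (Hfh : rhp_holo f) by (intros z Hz; eexists; now apply Hf).
  destruct (pow_cosh_K_dom f A d (Re w / 2) ltac:(lra) Hd HA Bf k) as (M & HM & B).
  assert (Cd : forall x u, 0 < Re u -> cder (fun u => RtoC (cosh x ^ k) * f (u * RtoC (cosh x)))%C u (RtoC (cosh x ^ S k) * df (u * RtoC (cosh x)))%C).
  { intros x u Hu.
    replace (RtoC (cosh x ^ S k) * df (u * RtoC (cosh x)))%C with (RtoC (cosh x ^ k) * (RtoC (cosh x) * df (u * RtoC (cosh x))))%C.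
    2:{ simpl. rewrite RtoC_mult. ring. }
    apply cder_scal. apply (cder_ext (fun u => f (RtoC (cosh x) * u)%C)); [ intros; f_equal; ring |].
    apply (cder_comp_scal (RtoC (cosh x)) f u). rewrite Cmult_comm. apply Hf. generalize (Re_scal_cosh_ge u x). lra. }
  apply (isI_cder (fun x u => RtoC (cosh x ^ k) * f (u * RtoC (cosh x)))%C (fun x => RtoC (cosh x ^ S k) * df (w * RtoC (cosh x)))%C
     _ w _ (Re w / 2) (fun x => M / (1 + x ^ 2)) (M * PI)).
  - lra.
  - now apply dominator_cauchy.
  - intros x u Hu. apply Re_near in Hu. split; [ eexists; apply Cd; lra | now apply B ].
  - intros u Hu. apply Re_near in Hu. apply (isI_cosh_f f A d (Re w / 2)); auto; lra.
  - intros x. now apply Cd.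
  - apply (isI_cosh_f df A' d' (Re w / 2)); auto; lra.
Qed.

Definition Ccosh (z : C) : C := ((Cexp z + Cexp (- z)) / RtoC 2)%C.

Definition Csinh (z : C) : C := ((Cexp z - Cexp (- z)) / RtoC 2)%C.

Lemma Ccosh_RtoC x : Ccosh (RtoC x) = RtoC (cosh x).
Proof. unfold Ccosh, cosh. rewrite <- RtoC_opp, !Cexp_RtoC, RtoC_div, RtoC_plus by lra. reflexivity. Qed.

Lemma Csinh_RtoC x : Csinh (RtoC x) = RtoC (sinh x).
Proof. unfold Csinh, sinh. rewrite <- RtoC_opp, !Cexp_RtoC, RtoC_div, RtoC_minus by lra. reflexivity. Qed.

Lemma cder_eq f z l l' : l = l' -> cder f z l -> cder f z l'.
Proof. now intros ->. Qed.

Lemma cder_Cexp_opp z : cder (fun u => Cexp (- u)) z (- Cexp (- z))%C.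
Proof.
  apply (cder_eq _ _ (Cexp (- z) * (- (1) * 1))%C); [ ring |].
  apply (cder_comp Cexp (fun u => - u)%C); [| apply cder_Cexp ].
  apply (cder_ext (fun u => (- (1)) * u)%C); [ intros; ring |]. apply cder_scal, cder_id.
Qed.

Lemma cder_Ccosh z : cder Ccosh z (Csinh z).
Proof.
  apply (cder_ext (fun u => / RtoC 2 * (Cexp u + Cexp (- u)))%C); [ intros; unfold Ccosh, Cdiv; ring |].
  apply (cder_eq _ _ (/ RtoC 2 * (Cexp z + - Cexp (- z)))%C); [ unfold Csinh, Cdiv; ring |].
  apply cder_scal. apply (cder_plus Cexp (fun u => Cexp (- u))); [ apply cder_Cexp | apply cder_Cexp_opp ].
Qed.

Lemma cder_Csinh z : cder Csinh z (Ccosh z).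
Proof.
  apply (cder_ext (fun u => / RtoC 2 * (Cexp u + (- (1)) * Cexp (- u)))%C); [ intros; unfold Csinh, Cdiv; ring |].
  apply (cder_eq _ _ (/ RtoC 2 * (Cexp z + (- (1)) * (- Cexp (- z))))%C); [ unfold Ccosh, Cdiv; ring |].
  apply cder_scal. apply (cder_plus Cexp (fun u => - (1) * Cexp (- u))%C); [ apply cder_Cexp |].
  apply cder_scal, cder_Cexp_opp.
Qed.

Lemma sinh_sq b : sinh b ^ 2 = cosh b ^ 2 - 1.
Proof.
  unfold sinh, cosh. assert (exp b * exp (- b) = 1) by (rewrite <- exp_plus, Rplus_opp_r; apply exp_0). nra.
Qed.

Lemma sinh_le_cosh b : Rabs (sinh b) <= cosh b.
Proof. unfold sinh, cosh. generalize (exp_pos b) (exp_pos (- b)). intros. apply Rabs_le. lra. Qed.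

Lemma cauchy_density_small M eps : 0 <= M -> 0 < eps -> exists X, forall b, X <= Rabs b -> M / (1 + b ^ 2) <= eps.
Proof.
  intros HM He. exists (M / eps + 1). intros b Hb.
  assert (Q : 0 <= M / eps) by (apply Rmult_le_pos; auto; left; now apply Rinv_0_lt_compat).
  rewrite <- pow2_abs. assert (P : 0 < 1 + Rabs b ^ 2) by nra.
  apply (Rmult_le_reg_r (1 + Rabs b ^ 2)); auto. replace (M / (1 + Rabs b ^ 2) * (1 + Rabs b ^ 2)) with M by (field; lra).
  assert (M / eps <= Rabs b ^ 2) by nra. apply (Rmult_le_compat_l eps) in H; [| lra ].
  replace (eps * (M / eps)) with M in H by (field; lra). nra.
Qed.

(* Integration by parts: d/db [f(w cosh b) sinh b]. *)
Lemma cosh_by_parts f df A d w J0 J2 J1 : 0 < Re w -> 0 < d -> 0 <= A -> rhp_holo df ->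
  (forall z, 0 < Re z -> cder f z (df z)) ->
  (forall z, Re w <= Re z -> Cmod (f z) <= A * exp (- (d * Re z))) ->
  isI (fun b => RtoC (cosh b) * f (w * RtoC (cosh b)))%C J1 ->
  isI (fun b => RtoC (cosh b ^ 2) * df (w * RtoC (cosh b)))%C J2 ->
  isI (fun b => df (w * RtoC (cosh b)))%C J0 ->
  (J1 + w * (J2 - J0) = 0)%C.
Proof.
  intros Hw Hd HA Hdf Hf Bf H1 H2 H0.
  apply (isI_unique (fun b => RtoC (cosh b) * f (w * RtoC (cosh b)) + w * (RtoC (cosh b ^ 2) * df (w * RtoC (cosh b)) - df (w * RtoC (cosh b))))%C).
  { apply isI_plus; auto. apply isI_cmult, isI_minus; auto. }
  destruct (pow_cosh_K_dom f A d (Re w) Hw Hd HA Bf 1) as (M & HM & B).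
  apply (isI_FTC (fun b => RtoC (sinh b) * f (w * RtoC (cosh b)))%C).
  - intros b.
    assert (D : cder (fun z => Csinh z * f (w * Ccosh z))%C (b, 0)
        (Ccosh (b, 0) * f (w * Ccosh (b, 0)) + Csinh (b, 0) * (df (w * Ccosh (b, 0)) * (w * Csinh (b, 0))))%C).
    { apply (cder_mult Csinh (fun z => f (w * Ccosh z)%C)); [ apply cder_Csinh |].
      apply (cder_comp f (fun z => w * Ccosh z)%C).
      - apply cder_scal, cder_Ccosh.
      - apply Hf. change ((b, 0) : C) with (RtoC b). rewrite Ccosh_RtoC. generalize (Re_scal_cosh_ge w b). lra. }
    apply rder_hor in D. change ((b, 0) : C) with (RtoC b) in D. rewrite Ccosh_RtoC, Csinh_RtoC in D.
    intros eps He. destruct (D eps He) as [dl [Hdl K]]. exists dl. split; auto. intros h Hh. specialize (K h Hh).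
    change (((b + h)%R, 0) : C) with (RtoC (b + h)) in K. change ((b, 0) : C) with (RtoC b) in K.
    rewrite !Ccosh_RtoC, !Csinh_RtoC in K.
    match goal with |- Cmod (_ - _ - _ * ?X)%C <= _ => match type of K with Cmod (_ - _ - _ * ?Y)%C <= _ => replace X with Y end end; auto.
    replace (RtoC (cosh b ^ 2)) with (RtoC (sinh b) * RtoC (sinh b) + 1)%C.
    + ring.
    + rewrite <- RtoC_mult. replace (cosh b ^ 2) with (sinh b * sinh b + 1) by (generalize (sinh_sq b); lra).
      now rewrite RtoC_plus.
  - intros b. assert (Hwb : 0 < Re (w * RtoC (cosh b))%C) by (generalize (Re_scal_cosh_ge w b); lra).
    assert (C1 := ccont_scal_cosh f w 1 b ltac:(eexists; now apply Hf)).
    assert (C2 := ccont_scal_cosh df w 2 b ltac:(now apply Hdf)).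
    assert (C0 := ccont_scal_cosh df w 0 b ltac:(now apply Hdf)).
    apply (ccont_plus (fun b => RtoC (cosh b) * f (w * RtoC (cosh b)))%C (fun b => w * (RtoC (cosh b ^ 2) * df (w * RtoC (cosh b)) - df (w * RtoC (cosh b))))%C).
    + apply (ccont_ext (fun b => RtoC (cosh b ^ 1) * f (w * RtoC (cosh b)))%C); auto. intros. now rewrite pow_1.
    + apply (ccont_mult (fun _ => w)); [ apply ccont_const |].
      apply (ccont_minus (fun b => RtoC (cosh b ^ 2) * df (w * RtoC (cosh b)))%C (fun b => df (w * RtoC (cosh b))%C)); auto.
      apply (ccont_ext (fun b => RtoC (cosh b ^ 0) * df (w * RtoC (cosh b)))%C); auto. intros. simpl. ring.
  - intros eps He. destruct (cauchy_density_small M eps HM He) as [X HX]. exists X. intros b Hb.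
    eapply Rle_trans; [| apply (HX b Hb) ]. eapply Rle_trans; [| apply (B w b (Rle_refl _)) ].
    rewrite !Cmod_mult, !Cmod_R, pow_1. apply Rmult_le_compat_r; [ apply Cmod_ge_0 |].
    rewrite (Rabs_pos_eq (cosh b)); [ apply sinh_le_cosh | generalize (cosh_ge1 b); lra ].
Qed.

Lemma isI_Re_lower q l m : isI q l -> (forall x, 0 <= Re (q x)) -> (forall x, 0 <= x <= 1 -> m <= Re (q x)) -> m <= Re l.
Proof.
  intros [H1 H2] H0 Hm. apply le_epsilon. intros e He. destruct (H2 e He) as [X HX].
  set (a := Rmin 0 (- X)). set (b := Rmax 1 X).
  specialize (HX a b (Rmin_r _ _) (Rmax_r _ _)).
  assert (Ex : forall s t, ex_RInt (fun x => Re (q x)) s t) by (intros; eexists; apply Re_CI; auto).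
  assert (L := RInt_lower (fun x => Re (q x)) a b 0 1 m (Rmin_l _ _) ltac:(lra) (Rmax_l _ _) Ex (fun x _ => H0 x) Hm).
  rewrite (is_RInt_unique _ _ _ _ (Re_CI q a b (H1 _ _))) in L.
  generalize (re_le_Cmod (CI q a b - l)%C). rewrite Re_minus. intros R. apply Rabs_le_between in R. lra.
Qed.

Lemma cosh_le3 b : 0 <= b <= 1 -> cosh b <= 3.
Proof.
  intros Hb. unfold cosh. assert (exp b <= exp 1) by (apply exp_le; lra). generalize exp_le_3. intros.
  assert (exp (- b) <= 1) by (rewrite <- exp_0; apply exp_le; lra). lra.
Qed.

(** Quantitative positivity, which makes the constant of [bessel_abel] nonzero; the 3 is the bound
    of cosh on [0, 1]. *)
Lemma Re_K0_lower x : 0 < x -> exp (- (3 * x)) / 2 <= Re (K0 (RtoC x)) /\ 0 <= Re (K0 (RtoC x)).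
Proof.
  intros Hx. assert (Pe := exp_pos (- (3 * x))).
  assert (L : exp (- (3 * x)) <= Re (IntR (bk 0 (RtoC x)))).
  { assert (R : forall b, Re (bk 0 (RtoC x) b) = exp (- (x * cosh b))).
    { intros b. unfold bk. simpl pow. rewrite <- RtoC_mult, <- RtoC_opp, Cexp_RtoC, <- RtoC_mult, Re_RtoC. ring. }
    apply (isI_Re_lower (bk 0 (RtoC x))).
    - apply isI_bk. auto.
    - intros b. rewrite R. left; apply exp_pos.
    - intros b Hb. rewrite R. apply exp_le. generalize (cosh_le3 b Hb). nra. }
  unfold K0, Cdiv. rewrite <- RtoC_inv, Re_mult, Re_RtoC, Im_RtoC by lra. lra.
Qed.

Lemma Lip2_cosh_l : Lip2 (fun x _ => RtoC (cosh x)).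
Proof.
  assert (H : Lip2 (fun x y => / RtoC 2 * (Cexp (RtoC (1 * x + 0 * y)) + Cexp (RtoC ((-1) * x + 0 * y))))%C).
  { apply (Lip2_mult (fun _ _ => / RtoC 2)%C (fun x y => Cexp (RtoC (1 * x + 0 * y)) + Cexp (RtoC ((-1) * x + 0 * y)))%C); [ apply Lip2_const |].
    apply (Lip2_plus (fun x y => Cexp (RtoC (1 * x + 0 * y))) (fun x y => Cexp (RtoC ((-1) * x + 0 * y))));
    apply (Lip2_Cexp (fun x y => RtoC _)), Lip2_lin. }
  assert (E : forall x y, (/ RtoC 2 * (Cexp (RtoC (1 * x + 0 * y)) + Cexp (RtoC ((-1) * x + 0 * y))))%C = RtoC (cosh x)).
  { intros. rewrite <- Ccosh_RtoC. unfold Ccosh, Cdiv. rewrite <- RtoC_opp.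
    replace (1 * x + 0 * y) with x by ring. replace (-1 * x + 0 * y) with (- x) by ring. ring. }
  intros X HX. destruct (H X HX) as (L & HL & B). exists L. split; auto. intros x x' y y' Hx Hx' Hy Hy'.
  rewrite <- (E x y), <- (E x' y'). now apply B.
Qed.

(** Both sides are the double integral of (1/2) cosh b e^(-w cosh b cosh c), taken in the two
    orders: integrating over c first produces K_0, over b first K_1. *)
Lemma K0_K1_swap w : 0 < Re w ->
  IntR (fun b => RtoC (cosh b ^ 1) * K0 (w * RtoC (cosh b)))%C = IntR (fun b => RtoC (cosh b ^ 0) * K1 (w * RtoC (cosh b)))%C.
Proof.
  intros Hw.
  set (q := fun b c => (/ RtoC 2 * (RtoC (cosh b) * Cexp ((- w) * (RtoC (cosh b) * RtoC (cosh c)))))%C).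
  assert (L : Lip2 q).
  { unfold q. apply (Lip2_mult (fun _ _ => / RtoC 2)%C (fun b c => RtoC (cosh b) * Cexp ((- w) * (RtoC (cosh b) * RtoC (cosh c))))%C); [ apply Lip2_const |].
    apply (Lip2_mult (fun b c => RtoC (cosh b)) (fun b c => Cexp ((- w) * (RtoC (cosh b) * RtoC (cosh c))))); [ apply Lip2_cosh_l |].
    apply (Lip2_Cexp (fun b c => (- w) * (RtoC (cosh b) * RtoC (cosh c)))%C).
    apply (Lip2_mult (fun _ _ => - w)%C (fun b c => RtoC (cosh b) * RtoC (cosh c))%C); [ apply Lip2_const |].
    apply (Lip2_mult (fun b c => RtoC (cosh b)) (fun b c => RtoC (cosh c))); [ apply Lip2_cosh_l |].
    apply (Lip2_flip (fun c b => RtoC (cosh c))). apply Lip2_cosh_l. }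
  destruct (cosh_pow_dom (Re w / 2) 0 ltac:(lra)) as (M0 & HM0 & B0).
  destruct (cosh_pow_dom (Re w / 2) 1 ltac:(lra)) as (M1 & HM1 & B1).
  destruct (fubini q (fun b => RtoC (cosh b ^ 1) * K0 (w * RtoC (cosh b)))%C (fun c => RtoC (cosh c ^ 0) * K1 (w * RtoC (cosh c)))%C (M1 * M0)) as [l [Hl Hl']]; [ exact L | nra | | | | ].
  - intros b c. specialize (B0 c). specialize (B1 b).
    assert (H1 := cosh_ge1 b). assert (H2 := cosh_ge1 c).
    unfold q. rewrite !Cmod_mult, Cmod_inv, !Cmod_RtoC_pos, Cmod_Cexp by (lra || (apply RtoC_neq0; lra)).
    replace (Re (- w * (RtoC (cosh b) * RtoC (cosh c)))%C) with (- (Re w * (cosh b * cosh c))) by (reim; ring).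
    rewrite pow_1 in B1. simpl pow in B0. rewrite Rmult_1_l in B0.
    apply Rle_trans with ((cosh b * exp (- (Re w / 2 * cosh b))) * exp (- (Re w / 2 * cosh c))).
    + rewrite Rmult_assoc, <- exp_plus.
      assert (exp (- (Re w * (cosh b * cosh c))) <= exp (- (Re w / 2 * cosh b) + - (Re w / 2 * cosh c))).
      { apply exp_le. assert (cosh b + cosh c <= 2 * (cosh b * cosh c)) by nra. nra. }
      generalize (exp_pos (- (Re w * (cosh b * cosh c)))). intros. nra.
    + replace (M1 * M0 / (1 + b ^ 2) * / (1 + c ^ 2)) with ((M1 / (1 + b ^ 2)) * (M0 / (1 + c ^ 2))) by (field; split; nra).
      apply Rmult_le_compat; auto; [| left; apply exp_pos ]. apply Rmult_le_pos; [ lra | left; apply exp_pos ].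
  - intros b. rewrite pow_1. unfold K0.
    assert (Hwb : 0 < Re (w * RtoC (cosh b))%C) by (generalize (Re_scal_cosh_ge w b); lra).
    eapply isI_ext; [| apply isI_cmult, isI_bk_half, Hwb ].
    intros c. unfold q, bk. simpl pow. replace (- (w * RtoC (cosh b) * RtoC (cosh c)))%C with (- w * (RtoC (cosh b) * RtoC (cosh c)))%C by ring. ring.
  - intros c. simpl pow. unfold K1.
    assert (Hwb : 0 < Re (w * RtoC (cosh c))%C) by (generalize (Re_scal_cosh_ge w c); lra).
    eapply isI_ext; [| apply isI_cmult, isI_bk_half, Hwb ].
    intros b. unfold q, bk. rewrite pow_1. replace (- (w * RtoC (cosh c) * RtoC (cosh b)))%C with (- w * (RtoC (cosh b) * RtoC (cosh c)))%C by ring. ring.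
  - now rewrite (Int_eq _ l Hl), (Int_eq _ l Hl').
Qed.

(* Abel transform: ∫ K_0(w cosh b) w cosh b db is a multiple of e^{-w}; it solves E' = -E. *)
Lemma bessel_abel : exists c0 : C, c0 <> 0 /\ forall w, 0 < Re w ->
  isI (fun b => w * (RtoC (cosh b) * K0 (w * RtoC (cosh b))))%C (c0 * Cexp (- w))%C /\
  isI (fun b => w * K1 (w * RtoC (cosh b)))%C (c0 * Cexp (- w))%C.
Proof.
  set (J0 := fun k w => IntR (fun b => RtoC (cosh b ^ k) * K0 (w * RtoC (cosh b)))%C).
  set (J1 := fun k w => IntR (fun b => RtoC (cosh b ^ k) * K1 (w * RtoC (cosh b)))%C).
  assert (H0 : rhp_holo K0) by (intros z Hz; eexists; now apply K0_cder).
  assert (H1 : rhp_holo K1) by (intros z Hz; now apply K1_cdiff).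
  assert (I0 : forall k w, 0 < Re w -> isI (fun b => RtoC (cosh b ^ k) * K0 (w * RtoC (cosh b)))%C (J0 k w)).
  { intros k w Hw. destruct (K0_exp_bound (Re w) Hw) as (A & HA & B).
    apply (isI_cosh_f K0 A 1 (Re w)); auto; lra. }
  assert (I1 : forall k w, 0 < Re w -> isI (fun b => RtoC (cosh b ^ k) * K1 (w * RtoC (cosh b)))%C (J1 k w)).
  { intros k w Hw. destruct (K1_exp_bound (Re w) Hw) as (A & HA & B).
    apply (isI_cosh_f K1 A (/ 2) (Re w)); auto; lra. }
  set (E := fun w => (w * J0 1%nat w)%C).
  assert (Sw : forall w, 0 < Re w -> J0 1%nat w = J1 0%nat w) by (intros; now apply K0_K1_swap).
  assert (Neg : forall z : C, 0 < Re z -> cder K0 z ((fun z => - K1 z)%C z)) by (intros; now apply K0_cder).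
  assert (Hn : rhp_holo (fun z => - K1 z)%C) by (intros z Hz; apply cdiff_opp; now apply H1).
  assert (NI : forall k w, 0 < Re w -> isI (fun b => RtoC (cosh b ^ k) * - K1 (w * RtoC (cosh b)))%C (- J1 k w)%C).
  { intros k w Hw. replace (- J1 k w)%C with (- (1) * J1 k w)%C by ring.
    eapply isI_ext; [| apply isI_cmult, (I1 k w Hw) ]. intros; simpl; ring. }
  assert (DE : forall w, 0 < Re w -> cder E w (- E w)%C).
  { intros w Hw.
    destruct (K0_exp_bound (Re w / 2) ltac:(lra)) as (A & HA & B).
    destruct (K1_exp_bound (Re w / 2) ltac:(lra)) as (A' & HA' & B').
    assert (D := IntR_cosh_cder K0 (fun z => - K1 z)%C A 1 A' (/ 2) w 1 Hw ltac:(lra) HA ltac:(lra) HA' Hn Neg B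
      ltac:(intros z Hz; cbv beta; rewrite Cmod_opp; auto)).
    cbv beta in D. rewrite (Int_eq _ _ (NI 2%nat w Hw)) in D.
    (* Parts give J0_1 - w J1_2 = - w J1_0. The left side is the derivative of E, and the exchange
       J1_0 = J0_1 makes the right side - E. *)
    assert (P : (J0 1%nat w + w * ((- J1 2%nat w) - (- J1 0%nat w)) = 0)%C).
    { apply (cosh_by_parts K0 (fun z => - K1 z)%C A 1 w); auto; try lra.
      - intros z Hz. apply B. lra.
      - eapply isI_ext; [| apply (I0 1%nat w Hw) ]. intros; simpl. now rewrite Rmult_1_r.
      - eapply isI_ext; [| apply (NI 0%nat w Hw) ]. intros; simpl. ring. }
    apply (cder_eq _ _ (1 * J0 1%nat w + w * (- J1 2%nat w))%C).
    - unfold E. rewrite Sw by auto.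
      assert (P' : (1 * J0 1%nat w + w * - J1 2%nat w = (J0 1%nat w + w * (- J1 2%nat w - - J1 0%nat w)) - w * J1 0%nat w)%C) by ring.
      rewrite Sw in P' by auto. rewrite P'. rewrite Sw in P by auto. rewrite P. ring.
    - apply (cder_mult (fun w => w) (J0 1%nat)); [ apply cder_id | exact D ]. }
  set (c0 := (E 1 * Cexp 1)%C).
  assert (EE : forall w, 0 < Re w -> E w = (c0 * Cexp (- w))%C).
  { intros w Hw.
    set (G := fun u => (E u * Cexp u)%C).
    assert (Q : G w = G 1).
    { apply Cmod_le_eps_eq. intros eps He.
      (* The product E u e^u has derivative zero on the segment from 1 to [w], so the mean value
         inequality with constant 0 applies. *)
      assert (B := mean_value_ineq G 1 (w - 1)%C 0). replace (1 + (w - 1))%C with w in B by ring.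
      rewrite Rmult_0_l in B. apply Rle_trans with 0; [ apply B | lra ].
      intros t Ht. exists 0. rewrite Cmod_0. split; [| lra ].
      set (u := (1 + RtoC t * (w - 1))%C).
      assert (Hu : 0 < Re u) by (unfold u; reim; nra).
      apply (cder_eq _ _ (- E u * Cexp u + E u * Cexp u)%C); [ ring |].
      apply (cder_mult E Cexp); [ now apply DE | apply cder_Cexp ]. }
    unfold G in Q. fold c0 in Q. rewrite <- Q, <- Cmult_assoc, <- Cexp_add.
    replace (w + - w)%C with (RtoC 0) by ring. rewrite Cexp_0. ring. }
  exists c0. split.
  - unfold c0. apply Cmult_neq_0; [| apply Cexp_neq0 ].
    (* On [0, 1] one has cosh b <= 3, hence Re K_0(cosh b) >= exp(-3 cosh b) / 2 >= exp(-9) / 2. *)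
    assert (L : exp (- 9) / 2 <= Re (J0 1%nat 1)).
    { apply (isI_Re_lower _ _ _ (I0 1%nat 1 ltac:(simpl; lra))).
      - intros b. rewrite Cmult_1_l, pow_1, Re_mult, Re_RtoC, Im_RtoC.
        destruct (Re_K0_lower (cosh b)); [ generalize (cosh_ge1 b); lra |]. generalize (cosh_ge1 b). nra.
      - intros b Hb. rewrite Cmult_1_l, pow_1, Re_mult, Re_RtoC, Im_RtoC.
        assert (C3 := cosh_le3 b Hb). assert (C1 := cosh_ge1 b).
        destruct (Re_K0_lower (cosh b)) as [L1 L2]; [ lra |].
        assert (exp (- 9) <= exp (- (3 * cosh b))) by (apply exp_le; lra). nra. }
    apply Re_neq0. unfold E. rewrite Cmult_1_l. generalize (exp_pos (- 9)). lra.
  - intros w Hw. rewrite <- EE by auto. split.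
    + unfold E. eapply isI_ext; [| apply isI_cmult, (I0 1%nat w Hw) ]. intros. simpl. now rewrite Rmult_1_r.
    + unfold E. rewrite Sw by auto. eapply isI_ext; [| apply isI_cmult, (I1 0%nat w Hw) ]. intros. simpl. ring.
Qed.

(** * Mellin transform of K_0 *)

(** The Euler integrand of the Gamma function after the substitution of e^t for the variable of
    integration. *)
Definition gk (z : C) (t : R) : C := (Cexp (z * RtoC t) * Cexp (- Cexp (RtoC t)))%C.

Lemma Cmod_gk z t : Cmod (gk z t) = exp (- exp t) * exp (Re z * t).
Proof.
  unfold gk. rewrite Cmod_mult, Cmod_Cexp_sx, Cexp_RtoC, <- RtoC_opp, Cexp_RtoC, Cmod_RtoC_pos by (left; apply exp_pos). ring.
Qed.

Lemma ccont_gk z t : ccont (gk z) t.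
Proof. unfold gk. cc; rcont. Qed.

Lemma exp_decay_cauchy sig : 0 < sig -> exists M, 0 <= M /\ forall t, 0 <= t -> exp (- (sig * t)) <= M / (1 + t ^ 2).
Proof.
  intros Hs. assert (P : 0 < / sig ^ 2) by (apply Rinv_0_lt_compat; nra).
  exists (4 * (1 + / sig ^ 2)). split; [ lra |]. intros t Ht.
  eapply Rle_trans; [ apply exp_neg_le_inv; nra |].
  assert (Q : 0 < 1 + (sig * t) ^ 2) by nra. assert (Q' : 0 < 1 + t ^ 2) by nra.
  apply (Rmult_le_reg_r ((1 + (sig * t) ^ 2) * (1 + t ^ 2))); [ nra |].
  replace (4 / (1 + (sig * t) ^ 2) * ((1 + (sig * t) ^ 2) * (1 + t ^ 2))) with (4 * (1 + t ^ 2)) by (field; lra).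
  replace (4 * (1 + / sig ^ 2) / (1 + t ^ 2) * ((1 + (sig * t) ^ 2) * (1 + t ^ 2))) with
    (4 * ((1 + / sig ^ 2) * (1 + (sig * t) ^ 2))) by (field; split; lra).
  replace ((1 + / sig ^ 2) * (1 + (sig * t) ^ 2)) with (1 + / sig ^ 2 + sig ^ 2 * t ^ 2 + t ^ 2) by (field; lra).
  assert (0 <= sig ^ 2 * t ^ 2) by (apply Rmult_le_pos; nra). lra.
Qed.

Lemma gamma_kernel_decay c sig : 0 < c -> 0 < sig -> exists M, 0 <= M /\
  forall t, exp (- (c * exp t)) * exp (sig * t) <= M / (1 + t ^ 2).
Proof.
  intros Hc Hs.
  destruct (double_exp_decay c sig Hc) as (M1 & H1 & B1).
  destruct (exp_decay_cauchy sig Hs) as (M2 & H2 & B2).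
  exists (4 * M1 + M2). split; [ lra |]. intros t.
  assert (Q : 0 < / (1 + t ^ 2)) by (apply Rinv_0_lt_compat; nra).
  destruct (Rle_dec 0 t) as [L | L].
  - eapply Rle_trans; [ now apply B1 |].
    assert (E := exp_abs_le_cauchy M1 t H1). rewrite (Rabs_pos_eq t) in E by auto. unfold Rdiv in *. nra.
  - specialize (B2 (- t) ltac:(lra)). replace (- (sig * - t)) with (sig * t) in B2 by ring.
    replace ((- t) ^ 2) with (t ^ 2) in B2 by ring.
    assert (exp (- (c * exp t)) <= 1) by (rewrite <- exp_0; apply exp_le; generalize (exp_pos t); nra).
    assert (Pe := exp_pos (sig * t)). unfold Rdiv in *. nra.
Qed.

Lemma isI_gk z : 0 < Re z -> isI (gk z) (IntR (gk z)).
Proof.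
  intros Hz. destruct (gamma_kernel_decay 1 (Re z) Rlt_0_1 Hz) as (M & HM & B).
  apply (isI_Int _ (fun t => M / (1 + t ^ 2)) (M * PI)).
  - intros. apply ccont_exI_all. intros. apply ccont_gk.
  - now apply dominator_cauchy.
  - intros t. rewrite Cmod_gk. specialize (B t). now rewrite Rmult_1_l in B.
Qed.

(** The substitution t = e^x sends the two one-sided limits, at 0 from the right and at infinity, to
    the two independent ends in [isI]. *)
Lemma CGamma_eq z : 0 < Re z -> CGamma z = IntR (gk z).
Proof.
  intros Hz. assert (J := isI_gk z Hz). set (l := IntR (gk z)) in *.
  unfold CGamma.
  apply (@is_RInt_gen_unique C_R_CompleteNormedModule (at_right 0) (Rbar_locally p_infty));
    [ apply Proper_StrongProper, at_right_proper_filter | apply Proper_StrongProper, Rbar_locally_filter |].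
  set (f := fun t => (Cpow_pos t (z - RtoC 1) * RtoC (exp (- t)))%C).
  assert (Cv : forall a b, isCI f (exp a) (exp b) (CI (gk z) a b)).
  { intros a b.
    assert (Cf : forall x, 0 < x -> ccont f x).
    { intros x Hx. unfold f, Cpow_pos. cc. }
    assert (Pos : forall x, Rmin (exp a) (exp b) <= x -> 0 < x).
    { intros x Hx. eapply Rlt_le_trans; [| apply Hx ]. unfold Rmin. destruct (Rle_dec _ _); apply exp_pos. }
    assert (Ex : exI f (exp a) (exp b)).
    { apply ccont_exI. intros x [Hx _]. apply Cf. now apply Pos. }
    replace (CI (gk z) a b) with (CI f (exp a) (exp b)); [ now apply CI_correct |].
    symmetry. apply CI_unique.
    assert (K := @is_RInt_comp C_R_CompleteNormedModule f exp exp a b).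
    apply (@is_RInt_ext C_R_NormedModule (fun y => @scal _ C_R_NormedModule (exp y) (f (exp y)))); [| apply K ].
    - intros x _. rewrite scal_R_Cmult. unfold f, gk, Cpow_pos. rewrite ln_exp.
      rewrite Cexp_RtoC, <- RtoC_opp, Cexp_RtoC.
      rewrite <- (Cexp_RtoC x).
      replace (Cexp (z * RtoC x)) with (Cexp (RtoC x) * Cexp ((z - RtoC 1) * RtoC x))%C.
      + rewrite Cexp_RtoC. generalize (Cexp ((z - RtoC 1) * RtoC x)). intros u.
        change ((RtoC (exp x) * (u * RtoC (exp (- exp x))))%C = (RtoC (exp x) * u * RtoC (exp (- exp x)))%C). ring.
      + rewrite <- Cexp_add. f_equal. ring.
    - intros x _. apply Cf, exp_pos.
    - intros x _. split; [ auto_derive; auto; ring | rcont ]. }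
  unfold is_RInt_gen, filterlimi, filter_le, filtermapi. intros P [eps HP].
  destruct (proj2 J (eps / 2)) as [X HX]; [ apply is_pos_div_2 |].
  exists (fun a => 0 < a <= exp (- X)) (fun b => exp X <= b).
  - exists (mkposreal _ (exp_pos (- X))). intros y Hy Hpos. split; auto.
    assert (Rabs (y - 0) < exp (- X)) by apply Hy. rewrite Rminus_0_r, Rabs_pos_eq in H by lra. lra.
  - exists (exp X). intros b Hb. lra.
  - intros a b [Ha1 Ha2] Hb. simpl. assert (Hb0 : 0 < b) by (generalize (exp_pos X); lra).
    exists (CI (gk z) (ln a) (ln b)). split.
    + rewrite <- (exp_ln a Ha1) at 1. rewrite <- (exp_ln b Hb0) at 1. apply Cv.
    + apply HP. apply C_NormedModule_mixin_compat1.
      assert (Cmod (CI (gk z) (ln a) (ln b) - l)%C <= eps / 2).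
      { apply HX.
        - rewrite <- (ln_exp (- X)). destruct Ha2 as [Ha2 | Ha2]; [ left; now apply ln_increasing | rewrite Ha2; lra ].
        - rewrite <- (ln_exp X). destruct Hb as [Hb | Hb]; [ left; apply ln_increasing; auto; apply exp_pos | rewrite Hb; lra ]. }
      generalize (cond_pos eps). intros. eapply Rle_lt_trans; [ exact H | lra ].
Qed.

Lemma Lip2_gk z k m : Lip2 (fun x y => gk z (k * x + m * y)).
Proof.
  unfold gk.
  apply (Lip2_mult (fun x y => Cexp (z * RtoC (k * x + m * y))) (fun x y => Cexp (- Cexp (RtoC (k * x + m * y))))).
  - apply (Lip2_Cexp (fun x y => z * RtoC (k * x + m * y))%C).
    apply (Lip2_mult (fun _ _ => z) (fun x y => RtoC (k * x + m * y))); [ apply Lip2_const | apply Lip2_lin ].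
  - apply (Lip2_Cexp (fun x y => - Cexp (RtoC (k * x + m * y)))%C).
    intros X HX. destruct (Lip2_Cexp _ (Lip2_lin k m) X HX) as (L & HL & B). exists L. split; auto.
    intros x x' y y' Hx Hx' Hy Hy'. specialize (B x x' y y' Hx Hx' Hy Hy').
    rewrite <- Cmod_opp. eapply Rle_trans; [| apply B ]. right. f_equal. ring.
Qed.

(* Γ(s/2)^2 as a double integral over (t,u), in the variables X = (t+u)/2 and u. *)
Lemma gamma_square s : 0 < Re s ->
  isI (fun x => RtoC 4 * (Cexp (s * RtoC x) * K0 (RtoC (2 * exp x))))%C (IntR (gk (s / RtoC 2)%C) * IntR (gk (s / RtoC 2)%C))%C.
Proof.
  intros Hs. set (z := (s / RtoC 2)%C).
  assert (Hz : Re z = Re s / 2).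
  { unfold z, Cdiv. rewrite <- RtoC_inv, Re_mult, Re_RtoC, Im_RtoC by lra. lra. }
  assert (Hz0 : 0 < Re z) by lra.
  assert (G := isI_gk z Hz0). set (Gam := IntR (gk z)) in *.
  set (q := fun x u => (RtoC 2 * gk z (2 * x + (-1) * u) * gk z (0 * x + 1 * u))%C).
  destruct (gamma_kernel_decay (/ 2) (Re z / 2)) as (M & HM & B); [ lra | lra |].
  (* Each kernel is given two Cauchy factors by halving its exponents. One factor from each kernel
     is spent on decay in x through P * U <= Xi, valid since x = (p + u) / 2, and a factor U remains
     for u. *)
  assert (B2 : forall t, Cmod (gk z t) <= M / (1 + t ^ 2) * (M / (1 + t ^ 2))).
  { intros t. rewrite Cmod_gk. specialize (B t).
    replace (exp (- exp t) * exp (Re z * t)) with ((exp (- (/ 2 * exp t)) * exp (Re z / 2 * t)) * (exp (- (/ 2 * exp t)) * exp (Re z / 2 * t))).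
    - assert (0 <= exp (- (/ 2 * exp t)) * exp (Re z / 2 * t)) by (apply Rmult_le_pos; left; apply exp_pos).
      apply Rmult_le_compat; auto.
    - replace (- exp t) with (- (/ 2 * exp t) + - (/ 2 * exp t)) by field.
      replace (Re z * t) with (Re z / 2 * t + Re z / 2 * t) by field. rewrite !exp_plus. ring. }
  destruct (fubini q (fun x => RtoC 4 * (Cexp (s * RtoC x) * K0 (RtoC (2 * exp x))))%C (fun u => gk z u * Gam)%C (2 * (M * M * (M * M)))) as [l [Hl Hl']].
  - unfold q. apply (Lip2_mult (fun x u => RtoC 2 * gk z (2 * x + (-1) * u))%C (fun x u => gk z (0 * x + 1 * u))); [| apply Lip2_gk ].
    apply (Lip2_mult (fun _ _ => RtoC 2) (fun x u => gk z (2 * x + (-1) * u))); [ apply Lip2_const | apply Lip2_gk ].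
  - assert (0 <= M * M) by nra. nra.
  - intros x u. unfold q. rewrite !Cmod_mult, Cmod_RtoC_pos by lra.
    set (p := 2 * x + -1 * u). replace (0 * x + 1 * u) with u by ring.
    assert (Bp := B2 p). assert (Bu := B2 u).
    set (P := / (1 + p ^ 2)). set (U := / (1 + u ^ 2)). set (Xi := / (1 + x ^ 2)).
    assert (P0 : 0 < P <= 1).
    { unfold P. split; [ apply Rinv_0_lt_compat; nra |]. rewrite <- Rinv_1. apply Rinv_le_contravar; nra. }
    assert (U0 : 0 < U) by (unfold U; apply Rinv_0_lt_compat; nra).
    assert (PU : P * U <= Xi).
    { unfold P, U, Xi. rewrite <- Rinv_mult. apply Rinv_le_contravar; [ nra |].
      assert (x = (p + u) / 2) by (unfold p; lra). rewrite H. nra. }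
    unfold Rdiv in Bp, Bu. fold P in Bp. fold U in Bu.
    apply Rle_trans with (2 * (M * P * (M * P)) * (M * U * (M * U))).
    + apply Rmult_le_compat; auto using Cmod_ge_0; [| lra ]. apply Rmult_le_pos; [ lra | apply Cmod_ge_0 ].
    + replace (2 * (M * P * (M * P)) * (M * U * (M * U))) with (2 * (M * M * (M * M)) * ((P * (P * U)) * U)) by ring.
      unfold Rdiv. fold Xi. rewrite (Rmult_assoc (2 * (M * M * (M * M))) Xi U). apply Rmult_le_compat_l.
      * assert (0 <= M * M) by nra. nra.
      * apply Rmult_le_compat_r; [ lra |]. assert (0 < P * U) by (apply Rmult_lt_0_compat; lra). nra.
  - intros x. unfold q.
    assert (Hx : 0 < Re (RtoC (2 * exp x))) by (rewrite Re_RtoC; generalize (exp_pos x); lra).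
    assert (J := isI_shift _ _ (- x) (isI_bk 0 (RtoC (2 * exp x)) Hx)).
    replace (RtoC 4 * (Cexp (s * RtoC x) * K0 (RtoC (2 * exp x))))%C with
      (RtoC 2 * Cexp (s * RtoC x) * IntR (bk 0 (RtoC (2 * exp x))))%C.
    2:{ unfold K0. replace (RtoC 4) with (RtoC 2 * RtoC 2)%C by (rewrite <- RtoC_mult; f_equal; ring). field. }
    eapply isI_ext; [| apply isI_cmult, J ]. intros u. cbv beta. unfold gk, bk. simpl pow.
    replace (0 * x + 1 * u) with u by ring. replace (2 * x + -1 * u) with (2 * x - u) by ring.
    transitivity (RtoC 2 * (Cexp (z * RtoC (2 * x - u)) * Cexp (z * RtoC u)) * (Cexp (- Cexp (RtoC (2 * x - u))) * Cexp (- Cexp (RtoC u))))%C; [| ring ].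
    rewrite <- !Cexp_add.
    replace (z * RtoC (2 * x - u) + z * RtoC u)%C with (s * RtoC x)%C.
    2:{ unfold z. rewrite RtoC_minus, RtoC_mult. field. }
    rewrite Cmult_1_l. f_equal. f_equal.
    rewrite !Cexp_RtoC, <- RtoC_mult, <- !RtoC_opp, <- RtoC_plus. f_equal.
    unfold cosh.
    replace (2 * exp x * ((exp (u + - x) + exp (- (u + - x))) / 2)) with (exp x * exp (u + - x) + exp x * exp (- (u + - x))) by field.
    rewrite <- !exp_plus. replace (x + (u + - x)) with u by ring. replace (x + - (u + - x)) with (2 * x - u) by ring. ring.
  - intros u. unfold q.
    assert (J := isI_lin _ _ 2 (- u) ltac:(lra) G).
    eapply isI_ext; [| apply isI_cmult, J ]. intros x. cbv beta.
    replace (0 * x + 1 * u) with u by ring. replace (2 * x + -1 * u) with (2 * x + - u) by ring. ring.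
  - replace (Gam * Gam)%C with l; auto. apply (isI_unique _ _ _ Hl').
    eapply isI_ext; [| apply (isI_cmult Gam _ _ G) ]. intros. cbv beta. ring.
Qed.

(** Shifting by ln PI turns 2 e^x into 2 PI e^x and produces the factor PI^s of [gammaFactor]; the 4
    comes from [gamma_square]. *)
Lemma mellin_K0 s : 0 < Re s ->
  isI (fun x => K0 (RtoC (2 * PI) * Cexp (RtoC x)) * Cexp (s * RtoC x))%C (gammaFactor s).
Proof.
  intros Hs. assert (PP := PI_RGT_0).
  assert (J := isI_shift _ _ (ln PI) (gamma_square s Hs)).
  assert (Hz : 0 < Re (s / RtoC 2)%C).
  { unfold Cdiv. rewrite <- RtoC_inv, Re_mult, Re_RtoC, Im_RtoC by lra. lra. }
  unfold gammaFactor. rewrite CGamma_eq by auto. set (Gam := IntR (gk (s / RtoC 2)%C)) in *.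
  set (W := Cpow_pos PI s). assert (NW : W <> 0) by apply Cexp_neq0.
  replace (/ (RtoC 4 * W) * Cpown Gam 2)%C with (/ (RtoC 4 * W) * (Gam * Gam))%C by (simpl; ring).
  eapply isI_ext; [| apply isI_cmult, J ]. intros x. cbv beta.
  rewrite RtoC_plus. replace (s * (RtoC x + RtoC (ln PI)))%C with (s * RtoC x + s * RtoC (ln PI))%C by ring.
  rewrite Cexp_add. change (Cexp (s * RtoC (ln PI))) with W.
  rewrite exp_plus, exp_ln by auto. rewrite Cexp_RtoC, <- RtoC_mult.
  replace (2 * PI * exp x) with (2 * (exp x * PI)) by ring. field. auto.
Qed.

(** * Series of kernels *)

Lemma CSeries_eq u l : isS u l -> CSeries u = l.
Proof.
  intros H. rewrite isS_psum in H.
  assert (ER : forall n, sum_n (fun n => Re (u n)) n = Re (psum u (S n))).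
  { induction n; [ rewrite sum_O; symmetry; apply Rplus_0_l | rewrite sum_Sn, IHn; reflexivity ]. }
  assert (EI : forall n, sum_n (fun n => Im (u n)) n = Im (psum u (S n))).
  { induction n; [ rewrite sum_O; symmetry; apply Rplus_0_l | rewrite sum_Sn, IHn; reflexivity ]. }
  unfold CSeries. apply Ceq; reim; apply is_series_unique;
    [ change (is_lim_seq (sum_n (fun n => Re (u n))) (Re l)) | change (is_lim_seq (sum_n (fun n => Im (u n))) (Im l)) ];
    apply is_lim_seq_spec; intros eps;
    (destruct (H (eps / 2)) as [N HN]; [ apply is_pos_div_2 |]); exists N; intros n Hn; specialize (HN (S n) ltac:(lia));
    generalize (cond_pos eps); intros; [ rewrite ER | rewrite EI ].
  - change (Rabs (Re (psum u (S n)) - Re l) < eps). rewrite <- Re_minus. eapply Rle_lt_trans; [ apply re_le_Cmod | lra ].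
  - change (Rabs (Im (psum u (S n)) - Im l) < eps). rewrite <- Im_minus. eapply Rle_lt_trans; [ apply im_le_Cmod | lra ].
Qed.

(** A comparison sequence for inverse squares whose sum telescopes exactly to 1. *)
Definition tele (n : nat) : R := / (INR (S n) * INR (S (S n))).

Lemma tele_pos n : 0 < tele n.
Proof. apply Rinv_0_lt_compat, Rmult_lt_0_compat; apply lt_0_INR; lia. Qed.

Lemma summable_tele : summable tele 1.
Proof.
  split; [ intros; left; apply tele_pos |].
  assert (E : forall n, psumR tele n = 1 - / INR (S n)).
  { induction n; [ simpl; field |]. simpl psumR. rewrite IHn. unfold tele.
    assert (INR (S n) <> 0) by (apply not_0_INR; lia). rewrite (S_INR (S n)).
    assert (INR (S n) + 1 <> 0) by (generalize (pos_INR (S n)); lra). field. auto. }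
  intros eps He. destruct (INR_inv_small 1 eps Rle_0_1 He) as [N HN]. exists N. intros n Hn. specialize (HN n Hn).
  rewrite E. replace (1 - / INR (S n) - 1) with (- / INR (S n)) by ring. rewrite Rabs_Ropp, Rabs_pos_eq.
  - unfold Rdiv in HN. lra.
  - left. apply Rinv_0_lt_compat, lt_0_INR. lia.
Qed.

Definition mu (n : nat) : R := 2 * PI * INR (S n).

Lemma INR_S_ge1 n : 1 <= INR (S n).
Proof. rewrite S_INR. generalize (pos_INR n). lra. Qed.

Lemma mu_bounds n : 6 * INR (S n) <= mu n <= 8 * INR (S n).
Proof. generalize PI2_3_2 PI_4 (INR_S_ge1 n). unfold mu. nra. Qed.

Lemma mu_pos n : 0 < mu n.
Proof. generalize (mu_bounds n) (INR_S_ge1 n). lra. Qed.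

Lemma Re_mu n v : Re (RtoC (mu n) * v)%C = mu n * Re v.
Proof. reim. ring. Qed.

Definition ks (c : nat -> C) (k : C -> C) (v : C) (n : nat) : C := (c n * k (RtoC (mu n) * v))%C.

Definition KS (c : nat -> C) (k : C -> C) (v : C) : C := CSeries (ks c k v).

Definition poly_bounded (c : nat -> C) (B : R) (nu : nat) : Prop := 0 <= B /\ forall n, Cmod (c n) <= B * INR (S n) ^ nu.

(** The rate is halved because [K1_bound] spends half of its exponential on the factor cosh b. As
    [mu n] is at least 6 (n + 1), the sums still decay like exp(- Re v). *)
Definition kernel_bounded (k : C -> C) (A : R) (p : nat) : Prop :=
  0 <= A /\ forall z, 0 < Re z -> Cmod (k z) <= A * (1 + / Re z) ^ p * (1 + Cmod z) * exp (- (Re z / 2)).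

Lemma ks_bound c k B nu A p : poly_bounded c B nu -> kernel_bounded k A p -> exists W N, 0 <= W /\
  forall v n, 0 < Re v -> Cmod (ks c k v n) <= W * (1 + / Re v) ^ N * (1 + Cmod v) * exp (- Re v) * tele n.
Proof.
  intros [HB Hc] [HA Hk].
  (* q = nu + 3: [nu] for the coefficients, one for the factor 1 + Cmod (mu n * v), two for
     summability. The power (n + 1)^q is absorbed by exp(- 2 (n + 1) Re v) at the price of (1 + 1 /
     Re v)^q. *)
  set (q := S (nu + 2)).
  assert (Pq : 0 < INR q) by (apply lt_0_INR; unfold q; lia).
  exists (B * A * 8 * 2 * INR q ^ q), (p + q)%nat.
  split.
  { repeat apply Rmult_le_pos; auto; try lra; apply pow_le; lra. }
  intros v n Hv.
  set (M := INR (S n)). set (x := Re v) in *.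
  assert (HM : 1 <= M) by apply INR_S_ge1.
  destruct (mu_bounds n) as [m1 m2]. fold M in m1, m2. set (m := mu n) in *.
  assert (Pix : 0 < / x) by now apply Rinv_0_lt_compat.
  unfold ks. rewrite Cmod_mult.
  assert (Rm : Re (RtoC m * v)%C = m * x) by apply Re_mu.
  assert (K := Hk (RtoC m * v)%C). rewrite Rm in K. specialize (K ltac:(nra)).
  assert (E1 : (1 + / (m * x)) ^ p <= (1 + / x) ^ p).
  { apply pow_incr. assert (0 < / (m * x)) by (apply Rinv_0_lt_compat; nra).
    assert (/ (m * x) <= / x) by (apply Rinv_le_contravar; nra). lra. }
  assert (E2 : 1 + Cmod (RtoC m * v)%C <= 8 * M * (1 + Cmod v)).
  { rewrite Cmod_mult, Cmod_RtoC_pos by lra. generalize (Cmod_ge_0 v). nra. }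
  assert (E3 : exp (- (m * x / 2)) <= exp (- x) * exp (- (2 * M * x))).
  { rewrite <- exp_plus. apply exp_le. nra. }
  assert (E4 : M ^ q * exp (- (2 * M * x)) <= INR q ^ q * (1 + / x) ^ q).
  { assert (G : (2 * M * x / INR q) ^ q <= exp (2 * M * x)).
    { eapply Rle_trans; [| apply (exp_pow_le (2 * M * x) (nu + 2)); nra ].
      fold q. apply pow_incr. assert (0 <= 2 * M * x / INR q) by (apply Rmult_le_pos; [ nra | left; now apply Rinv_0_lt_compat ]). lra. }
    rewrite exp_Ropp. assert (Pe := exp_pos (2 * M * x)).
    apply (Rmult_le_reg_r (exp (2 * M * x))); auto. rewrite Rmult_assoc, Rinv_l, Rmult_1_r by lra.
    apply Rle_trans with (INR q ^ q * (1 + / x) ^ q * (2 * M * x / INR q) ^ q).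
    - rewrite <- !Rpow_mult_distr. apply pow_incr. split; [ lra |].
      replace (INR q * (1 + / x) * (2 * M * x / INR q)) with (2 * M * (x + 1)) by (field; split; lra). nra.
    - apply Rmult_le_compat_l; auto. apply Rmult_le_pos; apply pow_le; lra. }
  assert (E5 : / (M * M) <= 2 * tele n).
  { unfold tele. fold M. replace (INR (S (S n))) with (M + 1) by (unfold M; now rewrite (S_INR (S n))).
    replace (2 * / (M * (M + 1))) with (/ (M * (M + 1) / 2)) by (field; lra). apply Rinv_le_contravar; nra. }
  specialize (Hc n). fold M in Hc.
  assert (Pn1 : 0 <= (1 + / (m * x)) ^ p) by (apply pow_le; assert (0 < / (m * x)) by (apply Rinv_0_lt_compat; nra); lra).
  assert (Pn2 : 0 <= (1 + / x) ^ p) by (apply pow_le; lra).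
  assert (Pn3 : 0 <= (1 + / x) ^ q) by (apply pow_le; lra).
  assert (PM : 0 <= M ^ nu) by (apply pow_le; lra).
  assert (Pv := Cmod_ge_0 v). assert (Pmv := Cmod_ge_0 (RtoC m * v)%C).
  assert (Pe1 := exp_pos (- x)). assert (Pe2 := exp_pos (- (2 * M * x))). assert (Pe3 := exp_pos (- (m * x / 2))).
  apply Rle_trans with ((B * M ^ nu) * (A * (1 + / x) ^ p * (8 * M * (1 + Cmod v)) * (exp (- x) * exp (- (2 * M * x))))).
  { apply Rmult_le_compat; auto using Cmod_ge_0.
    eapply Rle_trans; [ apply K |]. apply Rmult_le_compat; auto; [| lra |].
    - repeat apply Rmult_le_pos; auto; lra.
    - apply Rmult_le_compat; auto; [ now apply Rmult_le_pos | lra | now apply Rmult_le_compat_l ]. }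
  replace ((B * M ^ nu) * (A * (1 + / x) ^ p * (8 * M * (1 + Cmod v)) * (exp (- x) * exp (- (2 * M * x))))) with
    ((B * A * 8 * (1 + / x) ^ p * (1 + Cmod v) * exp (- x)) * ((M ^ q * exp (- (2 * M * x))) * / (M * M))).
  2:{ unfold q. replace (S (nu + 2)) with (nu + 3)%nat by lia. rewrite pow_add. simpl. field. lra. }
  assert (P0 : 0 <= B * A * 8 * (1 + / x) ^ p * (1 + Cmod v) * exp (- x)).
  { repeat apply Rmult_le_pos; auto; lra. }
  apply Rle_trans with ((B * A * 8 * (1 + / x) ^ p * (1 + Cmod v) * exp (- x)) * ((INR q ^ q * (1 + / x) ^ q) * (2 * tele n))).
  - apply Rmult_le_compat_l; auto. apply Rmult_le_compat; auto.
    + apply Rmult_le_pos; [ apply pow_le; lra | lra ].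
    + left. apply Rinv_0_lt_compat. nra.
  - right. rewrite pow_add. ring.
Qed.

Lemma KS_isS c k B nu A p : poly_bounded c B nu -> kernel_bounded k A p -> forall v, 0 < Re v -> isS (ks c k v) (KS c k v).
Proof.
  intros Hc Hk v Hv. destruct (ks_bound c k B nu A p Hc Hk) as (W & N & HW & Hb).
  set (G := W * (1 + / Re v) ^ N * (1 + Cmod v) * exp (- Re v)).
  assert (PG : 0 <= G).
  { assert (0 < / Re v) by now apply Rinv_0_lt_compat. unfold G. repeat apply Rmult_le_pos; auto.
    - apply pow_le. lra.
    - generalize (Cmod_ge_0 v). lra.
    - left; apply exp_pos. }
  destruct (isS_exists (ks c k v) (fun n => G * tele n) (G * 1)) as [l Hl].
  - apply summable_scal; auto. apply summable_tele.
  - intros n. now apply Hb.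
  - unfold KS. now rewrite (CSeries_eq _ _ Hl).
Qed.

(** The last clause says that the terms, weighted by the inverse of [tele], obey one common bound;
    it feeds [mel_bound_unif] when the Mellin transform is taken term by term. *)
Lemma KS_bounded c k B nu A p : poly_bounded c B nu -> kernel_bounded k A p -> exists W N, 0 <= W /\ rhp_bounded (KS c k) W N /\
  forall n, rhp_bounded (fun v => RtoC (/ tele n) * ks c k v n)%C W N.
Proof.
  intros Hc Hk. destruct (ks_bound c k B nu A p Hc Hk) as (W & N & HW & Hb). exists W, N. split; [ auto | split ].
  - intros v Hv. set (G := W * (1 + / Re v) ^ N * (1 + Cmod v) * exp (- Re v)).
    assert (PG : 0 <= G).
    { assert (0 < / Re v) by now apply Rinv_0_lt_compat. unfold G. repeat apply Rmult_le_pos; auto.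
      - apply pow_le. lra.
      - generalize (Cmod_ge_0 v). lra.
      - left; apply exp_pos. }
    rewrite <- (Rmult_1_r G).
    apply (isS_bound _ _ _ _ (KS_isS c k B nu A p Hc Hk v Hv) (summable_scal tele 1 G PG summable_tele)).
    intros n. now apply Hb.
  - intros n v Hv. specialize (Hb v n Hv). assert (T := tele_pos n).
    rewrite Cmod_mult, Cmod_RtoC_pos by (left; now apply Rinv_0_lt_compat).
    apply (Rmult_le_reg_r (tele n)); auto.
    replace (/ tele n * Cmod (ks c k v n) * tele n) with (Cmod (ks c k v n)) by (field; lra). auto.
Qed.

Lemma KS_cder c k dk B nu A p v : poly_bounded c B nu -> kernel_bounded k A p -> (forall z, 0 < Re z -> cder k z (dk z)) ->
  0 < Re v -> exists L, isS (fun n => c n * (RtoC (mu n) * dk (RtoC (mu n) * v)))%C L /\ cder (KS c k) v L.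
Proof.
  intros Hc Hk Hd Hv. destruct (ks_bound c k B nu A p Hc Hk) as (W & N & HW & Hb).
  set (x := Re v) in *.
  set (G := W * (1 + / (x / 2)) ^ N * (1 + (Cmod v + x / 2)) * 1).
  assert (Px2 : 0 < / (x / 2)) by (apply Rinv_0_lt_compat; lra).
  assert (PG : 0 <= G).
  { unfold G. repeat apply Rmult_le_pos; auto; try lra.
    - apply pow_le. lra.
    - generalize (Cmod_ge_0 v). lra. }
  assert (D : forall n u, 0 < Re u -> cder (fun u => ks c k u n) u (c n * (RtoC (mu n) * dk (RtoC (mu n) * u)))%C).
  { intros n u Hu. unfold ks. apply cder_scal. apply (cder_comp_scal (RtoC (mu n)) k u).
    apply Hd. rewrite Re_mu. generalize (mu_pos n). nra. }
  apply (isS_cder (fun n u => ks c k u n) (fun n => c n * (RtoC (mu n) * dk (RtoC (mu n) * v)))%C (KS c k) v (x / 2) (fun n => G * tele n) (G * 1)).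
  - lra.
  - apply summable_scal; auto. apply summable_tele.
  - intros n u Hu. assert (Ru := Re_near u v Hu). fold x in Ru. split; [ eexists; apply D; lra |].
    eapply Rle_trans; [ apply Hb; lra |]. apply Rmult_le_compat_r; [ left; apply tele_pos |].
    assert (0 < / Re u) by (apply Rinv_0_lt_compat; lra).
    assert (/ Re u <= / (x / 2)) by (apply Rinv_le_contravar; lra).
    assert (Cmod u <= Cmod v + x / 2).
    { replace u with (v + (u - v))%C by ring. eapply Rle_trans; [ apply Cmod_triangle |]. unfold x in *. lra. }
    assert (0 <= Cmod u) by apply Cmod_ge_0.
    assert (0 <= (1 + / Re u) ^ N) by (apply pow_le; lra).
    unfold G. apply Rmult_le_compat; [ repeat apply Rmult_le_pos; lra | left; apply exp_pos | | rewrite <- exp_0; apply exp_le; lra ].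
    apply Rmult_le_compat; [ repeat apply Rmult_le_pos; lra | lra | | lra ].
    apply Rmult_le_compat_l; auto. apply pow_incr. lra.
  - intros u Hu. assert (Ru := Re_near u v Hu). fold x in Ru. apply (KS_isS c k B nu A p); auto. lra.
  - intros n. now apply D.
Qed.

Lemma KS_holo c k B nu A p : poly_bounded c B nu -> kernel_bounded k A p -> rhp_holo k -> rhp_holo (KS c k).
Proof.
  intros Hc Hk Hh v Hv.
  destruct (functional_choice (fun z l => 0 < Re z -> cder k z l)) as [dk Hdk].
  { intros z. destruct (classic (0 < Re z)) as [P | P]; [ destruct (Hh z P) as [l Hl]; now exists l | exists 0; tauto ]. }
  destruct (KS_cder c k dk B nu A p v Hc Hk Hdk Hv) as [L [_ HL]]. now exists L.
Qed.

(** * The exponential and Bessel kernels *)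

Definition kexp (z : C) : C := Cexp (- z).

(** For [eps = true] the factor z / (2 PI), which is (n + 1) v at z = mu n * v, moves the Mellin
    variable by one: this yields [gammaFactor (s + 1)] while leaving the Dirichlet series at s. *)
Definition kmel (eps : bool) (z : C) : C := if eps then (z * / RtoC (2 * PI) * K0 z)%C else K0 z.

Lemma kexp_bounded : kernel_bounded kexp 1 0.
Proof.
  split; [ lra |]. intros z Hz. unfold kexp. rewrite Cmod_Cexp, Re_opp. simpl pow.
  assert (exp (- Re z) <= exp (- (Re z / 2))) by (apply exp_le; lra). generalize (Cmod_ge_0 z) (exp_pos (- (Re z / 2))). nra.
Qed.

Lemma K0_kernel_bounded : kernel_bounded K0 4 1.
Proof.
  split; [ lra |]. intros z Hz. eapply Rle_trans; [ now apply K0_bound |].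
  assert (0 < / Re z) by now apply Rinv_0_lt_compat.
  assert (exp (- Re z) <= exp (- (Re z / 2))) by (apply exp_le; lra).
  assert (P1 := exp_pos (- Re z)). assert (P2 := exp_pos (- (Re z / 2))).
  assert (Pz := Cmod_ge_0 z). generalize PI_4 PI_RGT_0. intros.
  rewrite pow_1. unfold Rdiv at 2.
  apply Rle_trans with (2 * ((1 + 2 * / Re z) * exp (- (Re z / 2)))).
  - apply Rmult_le_compat; try lra; [ apply Rmult_le_pos; lra | apply Rmult_le_compat_l; lra ].
  - rewrite <- Rmult_assoc. apply Rmult_le_compat_r; [ lra |]. nra.
Qed.

Lemma K1_kernel_bounded : kernel_bounded K1 16 2.
Proof.
  split; [ lra |]. intros z Hz. eapply Rle_trans; [ now apply K1_bound |].
  assert (0 < / Re z) by now apply Rinv_0_lt_compat.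
  assert (P2 := exp_pos (- (Re z / 2))).
  assert (Pz := Cmod_ge_0 z). generalize PI_4 PI_RGT_0. intros.
  rewrite <- Rmult_assoc. apply Rmult_le_compat_r; [ lra |]. unfold Rdiv.
  set (i := / Re z) in *.
  apply Rle_trans with (2 * (2 * i * (1 + 4 * i))).
  - apply Rmult_le_compat_r; [ | lra ]. apply Rmult_le_pos; lra.
  - assert (16 * (1 + i) ^ 2 * 1 <= 16 * (1 + i) ^ 2 * (1 + Cmod z)) by (apply Rmult_le_compat_l; nra). nra.
Qed.

Lemma kmel_bounded eps : kernel_bounded (kmel eps) 4 1.
Proof.
  destruct eps; [| apply K0_kernel_bounded ].
  split; [ lra |]. intros z Hz. unfold kmel.
  generalize PI_4 PI2_3_2. intros.
  rewrite !Cmod_mult, Cmod_inv, Cmod_RtoC_pos by (lra || (apply RtoC_neq0; lra)).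
  assert (Kb := K0_bound z Hz).
  assert (0 < / Re z) by now apply Rinv_0_lt_compat.
  assert (exp (- Re z) <= exp (- (Re z / 2))) by (apply exp_le; lra).
  assert (P1 := exp_pos (- Re z)). assert (P2 := exp_pos (- (Re z / 2))).
  assert (Pz := Cmod_ge_0 z).
  assert (Kb2 : Cmod (K0 z) <= 4 * (1 + / Re z) * exp (- (Re z / 2))).
  { eapply Rle_trans; [ apply Kb |]. unfold Rdiv at 2.
    apply Rle_trans with (2 * ((1 + 2 * / Re z) * exp (- (Re z / 2)))).
    - apply Rmult_le_compat; try lra; [ apply Rmult_le_pos; lra | apply Rmult_le_compat_l; lra ].
    - rewrite <- Rmult_assoc. apply Rmult_le_compat_r; lra. }
  assert (/ (2 * PI) <= 1) by (rewrite <- Rinv_1; apply Rinv_le_contravar; lra).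
  assert (0 < / (2 * PI)) by (apply Rinv_0_lt_compat; lra).
  rewrite pow_1.
  apply Rle_trans with ((1 + Cmod z) * (4 * (1 + / Re z) * exp (- (Re z / 2)))).
  - apply Rmult_le_compat; auto using Cmod_ge_0; [ apply Rmult_le_pos; lra | nra ].
  - right. ring.
Qed.

Lemma kexp_holo : rhp_holo kexp.
Proof. intros z _. unfold kexp. cd. Qed.

Lemma K0_holo : rhp_holo K0.
Proof. intros z Hz. eexists. now apply K0_cder. Qed.

Lemma kmel_holo eps : rhp_holo (kmel eps).
Proof.
  intros z Hz. destruct eps; [| now apply K0_holo ]. unfold kmel. cd. now apply K0_holo.
Qed.

Lemma Cpow_pos_mul_neg M s : (Cpow_pos M (- s) * Cpow_pos M s = 1)%C.
Proof. unfold Cpow_pos. rewrite <- Cexp_add. replace (- s * RtoC (ln M) + s * RtoC (ln M))%C with (RtoC 0) by ring. apply Cexp_0. Qed.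

Lemma mel_kmel eps c s n : 0 < Re s ->
  isI (fun x => c * (kmel eps (RtoC (mu n) * Cexp (x, 0)) * Cexp (s * RtoC x)))%C
      (gammaFactor (s + epsC eps) * (c * Cpow_pos (INR (S n)) (- s)))%C.
Proof.
  intros Hs. set (M := INR (S n)). assert (HM : 1 <= M) by apply INR_S_ge1.
  assert (PP := PI_RGT_0).
  assert (Hse : 0 < Re (s + epsC eps)%C) by (unfold epsC; reim; destruct eps; lra).
  assert (J := isI_shift _ _ (ln M) (mellin_K0 (s + epsC eps)%C Hse)).
  assert (Ez : forall x, (RtoC (mu n) * Cexp (x, 0) = RtoC (2 * PI) * Cexp (RtoC (x + ln M)))%C).
  { intros x. change ((x, 0) : C) with (RtoC x). rewrite !Cexp_RtoC, exp_plus, exp_ln by lra. unfold mu. fold M. rewrite !RtoC_mult. ring. }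
  replace (gammaFactor (s + epsC eps) * (c * Cpow_pos M (- s)))%C with (c * Cpow_pos M (- s) * gammaFactor (s + epsC eps))%C by ring.
  eapply isI_ext; [| apply isI_cmult, J ]. intros x. cbv beta. rewrite Ez.
  set (Z := (RtoC (2 * PI) * Cexp (RtoC (x + ln M)))%C).
  assert (E : Cexp ((s + epsC eps) * RtoC (x + ln M)) = (Cpow_pos M s * Cexp (s * RtoC x) * Cexp (epsC eps * RtoC (x + ln M)))%C).
  { unfold Cpow_pos. rewrite <- !Cexp_add. f_equal. rewrite RtoC_plus. ring. }
  rewrite E.
  replace (c * Cpow_pos M (- s) * (K0 Z * (Cpow_pos M s * Cexp (s * RtoC x) * Cexp (epsC eps * RtoC (x + ln M)))))%C with
    (c * (Cpow_pos M (- s) * Cpow_pos M s) * (Cexp (epsC eps * RtoC (x + ln M)) * K0 Z) * Cexp (s * RtoC x))%C by ring.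
  rewrite Cpow_pos_mul_neg.
  replace (kmel eps Z) with (Cexp (epsC eps * RtoC (x + ln M)) * K0 Z)%C; [ ring |].
  unfold kmel, epsC. destruct eps.
  - rewrite Cmult_1_l. unfold Z. field. apply RtoC_neq0. lra.
  - rewrite Cmult_0_l, Cexp_0. ring.
Qed.

Lemma mel_series eps c B nu : poly_bounded c B nu -> exists sig0, 0 <= sig0 /\ forall s, sig0 < Re s ->
  exists L, isS (fun n => gammaFactor (s + epsC eps) * (c n * Cpow_pos (INR (S n)) (- s)))%C L /\ isI (mel (KS c (kmel eps)) 0 s) L.
Proof.
  intros Hc. assert (Hk := kmel_bounded eps). assert (Hh := kmel_holo eps).
  destruct (KS_bounded c (kmel eps) B nu 4 1 Hc Hk) as (W & N & HW & Hb & Hbn).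
  exists (INR N + 1). assert (PN := pos_INR N). split; [ lra |]. intros s Hs.
  destruct (mel_bound_unif W N 1 (Re s) HW Rlt_0_1) as (M & HM & Bm).
  apply (isI_series (fun n x => c n * (kmel eps (RtoC (mu n) * Cexp (x, 0)) * Cexp (s * RtoC x)))%C _ _ tele 1 (fun x => M / (1 + x ^ 2)) (M * PI)).
  - intros n. apply mel_kmel. lra.
  - apply summable_tele.
  - now apply dominator_cauchy.
  - intros n x. specialize (Bm _ x 0 s (Hbn n)). rewrite cos_0 in Bm. specialize (Bm (Rle_refl 1) ltac:(lra)).
    unfold mel, ks in Bm. rewrite !Cmod_mult, Cmod_RtoC_pos in Bm by (left; apply Rinv_0_lt_compat, tele_pos).
    rewrite !Cmod_mult. assert (T := tele_pos n).
    apply (Rmult_le_reg_l (/ tele n)); [ now apply Rinv_0_lt_compat |].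
    replace (/ tele n * (tele n * (M / (1 + x ^ 2)))) with (M / (1 + x ^ 2)) by (field; split; nra).
    eapply Rle_trans; [| apply Bm ]. right. ring.
  - intros x. unfold mel. rewrite (Cmult_comm (KS _ _ _)).
    eapply isS_ext; [| apply isS_cmult, (KS_isS c (kmel eps) B nu 4 1 Hc Hk) ].
    + intros n. unfold ks. ring.
    + rewrite Re_Cexp_pair, cos_0, Rmult_1_r. apply exp_pos.
  - intros a b. apply ccont_exI_all. intros x. apply ccont_mel.
    + now apply (KS_holo c (kmel eps) B nu 4 1).
    + rewrite cos_0. lra.
Qed.

(** * Functional equations and decay in sectors *)

Definition coef (A : Z -> C) (eps : bool) (n : nat) : C :=
  (A (Z.of_nat (S n)) + epsSign eps * A (- Z.of_nat (S n))%Z)%C.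

Lemma isS_terms_bounded u l : isS u l -> exists B, 0 <= B /\ forall n, Cmod (u n) <= B.
Proof.
  intros H. rewrite isS_psum in H. destruct (H 1 Rlt_0_1) as [N HN].
  assert (P : forall k, exists B, 0 <= B /\ forall n, (n < k)%nat -> Cmod (u n) <= B).
  { induction k as [| k [B [HB IH]]]; [ exists 0; split; [ lra | lia ] |].
    exists (B + Cmod (u k)). generalize (Cmod_ge_0 (u k)); intros. split; [ lra |].
    intros n Hn. destruct (Nat.eq_dec n k) as [-> | Hk]; [ lra |]. specialize (IH n ltac:(lia)). lra. }
  destruct (P N) as [B [HB Hs]]. exists (B + 2). split; [ lra |]. intros n.
  destruct (le_lt_dec N n) as [L | L]; [| specialize (Hs n L); lra ].
  assert (E : u n = ((psum u (S n) - l) - (psum u n - l))%C) by (simpl; ring).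
  rewrite E. eapply Rle_trans; [ apply Cmod_tri_minus |]. generalize (HN n L) (HN (S n) ltac:(lia)). lra.
Qed.

Lemma Cmod_Cpow_pos_nat M nu : 0 < M -> Cmod (Cpow_pos M (- RtoC (INR nu))) = / M ^ nu.
Proof.
  intros HM. unfold Cpow_pos. rewrite Cmod_Cexp. reim.
  replace (- INR nu * ln M - - 0 * 0) with (- (INR nu * ln M)) by ring.
  rewrite exp_Ropp, <- exp_pow_nat, exp_ln; auto.
Qed.

(** The terms of a convergent series are bounded; evaluating the L-series at an integer larger than
    [alpha] turns this into polynomial growth of the coefficients. *)
Lemma coef_poly_bounded A eps alpha : (forall s, Re s > alpha -> exists L, isS (Lterm A eps s) L) ->
  exists B nu, poly_bounded (coef A eps) B nu.
Proof.
  intros H. destruct (nfloor_ex (Rabs alpha) (Rabs_pos _)) as [k Hk].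
  set (nu := S k).
  assert (Hs : Re (RtoC (INR nu)) > alpha).
  { reim. unfold nu. rewrite S_INR. generalize (Rle_abs alpha). lra. }
  destruct (H _ Hs) as [L HL]. destruct (isS_terms_bounded _ _ HL) as [B [HB Hb]].
  exists B, nu. split; auto. intros n. specialize (Hb n). unfold Lterm in Hb. cbv zeta in Hb.
  change (Cmod (coef A eps n * Cpow_pos (INR (S n)) (- RtoC (INR nu)))%C <= B) in Hb.
  assert (P : 0 < INR (S n)) by (apply lt_0_INR; lia).
  rewrite Cmod_mult, Cmod_Cpow_pos_nat in Hb by auto.
  assert (Q : 0 < INR (S n) ^ nu) by now apply pow_lt.
  apply Rmult_le_reg_r with (/ INR (S n) ^ nu); [ now apply Rinv_0_lt_compat |].
  rewrite Rmult_assoc, Rinv_r, Rmult_1_r by lra. exact Hb.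
Qed.

(** [Lam] is known as a multiple of the L-series for Re s > alpha, and the Mellin transform of the
    kernel series for Re s > sig0. By uniqueness of sums they agree to the right of both bounds,
    which is all that [converse_lemma] asks. *)
Lemma theta_inversion A eps alpha Lam B nu : poly_bounded (coef A eps) B nu ->
  (forall z, cdiff Lam z) -> finite_order Lam ->
  (forall s : C, Re s > alpha -> exists L, isS (Lterm A eps s) L /\ Lam s = (gammaFactor (s + epsC eps) * L)%C) ->
  (forall s, Lam (1 - s)%C = (epsSign eps * Lam s)%C) ->
  forall v, 0 < Re v -> KS (coef A eps) (kmel eps) (/ v)%C = (epsSign eps * v * KS (coef A eps) (kmel eps) v)%C.
Proof.
  intros Hc Hd Hf HL HE. destruct (KS_bounded _ _ _ _ _ _ Hc (kmel_bounded eps)) as (W & N & HW & Hb & _).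
  destruct (mel_series eps _ _ _ Hc) as [sig0 [Hsig Hm]].
  apply (converse_lemma _ W N Lam (if eps then -1 else 1) (Rmax alpha sig0)); auto.
  - apply (KS_holo _ _ _ _ _ _ Hc (kmel_bounded eps)), kmel_holo.
  - destruct eps; ring.
  - intros s Hs. assert (M1 := Rmax_l alpha sig0). assert (M2 := Rmax_r alpha sig0).
    destruct (HL s ltac:(lra)) as (L & SL & ->). destruct (Hm s ltac:(lra)) as (L' & SL' & IL').
    replace (gammaFactor (s + epsC eps) * L)%C with L'; auto.
    eapply isS_unique; [ exact SL' |]. now apply isS_cmult.
Qed.

(** The linear bound controls the vertex of a sector and the quadratic one its infinite end; the
    constant depends on the opening, since nothing uniform holds up to the imaginary axis. *)
Definition decays (G : C -> C) : Prop := forall c, 0 < c -> exists M, 0 <= M /\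
  forall v, 0 < Re v -> c * Cmod v <= Re v -> Cmod (G v) <= M * Cmod v /\ Cmod (G v) <= M / (1 + Cmod v ^ 2).

Lemma sector_decay H K N k c : 0 <= K -> rhp_bounded H K N -> 0 < c -> exists M, 0 <= M /\
  forall u, 1 <= Cmod u -> c * Cmod u <= Re u -> Cmod u ^ k * Cmod (H u) <= M.
Proof.
  intros HK Hb Hc. set (q := S k). assert (Pq : 0 < INR q) by (apply lt_0_INR; unfold q; lia).
  destruct (double_exp_decay c (INR q) Hc) as (M & HM & Hd).
  assert (Pc : 0 < / c) by now apply Rinv_0_lt_compat.
  exists (K * (1 + / c) ^ N * 2 * M).
  assert (P1 : 0 <= (1 + / c) ^ N) by (apply pow_le; lra).
  split; [ repeat apply Rmult_le_pos; auto; lra |].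
  intros u Hu Hs. assert (Hr : 0 < Re u) by nra. specialize (Hb u Hr).
  set (t := Cmod u) in *.
  assert (E : exp (- Re u) * t ^ q <= M).
  { assert (Ht : 0 <= ln t) by (rewrite <- ln_1; destruct Hu as [Hu | <-]; [ left; apply ln_increasing; lra | lra ]).
    specialize (Hd (ln t) Ht). rewrite <- exp_pow_nat, exp_ln in Hd by lra.
    assert (exp (- Re u) <= exp (- (c * t))) by (apply exp_le; lra).
    assert (exp (- ln t) <= 1) by (rewrite <- exp_0; apply exp_le; lra).
    assert (0 < t ^ q) by (apply pow_lt; lra). nra. }
  assert (Q : (1 + / Re u) ^ N <= (1 + / c) ^ N).
  { apply pow_incr. split; [ assert (0 < / Re u) by (now apply Rinv_0_lt_compat); lra |].
    assert (/ Re u <= / c) by (apply Rinv_le_contravar; nra). lra. }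
  apply Rle_trans with (t ^ k * (K * (1 + / c) ^ N * (2 * t) * exp (- Re u))).
  - apply Rmult_le_compat_l; [ apply pow_le; lra |]. eapply Rle_trans; [ exact Hb |].
    apply Rmult_le_compat_r; [ left; apply exp_pos |].
    apply Rmult_le_compat; try lra; [ | apply Rmult_le_compat_l; auto ].
    apply Rmult_le_pos; auto. apply pow_le. assert (0 < / Re u) by (now apply Rinv_0_lt_compat). lra.
  - replace (t ^ k * (K * (1 + / c) ^ N * (2 * t) * exp (- Re u))) with (K * (1 + / c) ^ N * 2 * (exp (- Re u) * t ^ q))
      by (unfold q; simpl; ring).
    apply Rmult_le_compat_l; auto. repeat apply Rmult_le_pos; auto; lra.
Qed.

Lemma Cmod_pow2 v : Cmod v ^ 2 = Re v ^ 2 + Im v ^ 2.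
Proof. unfold Cmod, Re, Im. rewrite pow2_sqrt; [ reflexivity | nra ]. Qed.

Lemma Re_inv_sector v c : 0 < Re v -> c * Cmod v <= Re v -> 0 < Re (/ v)%C /\ c * Cmod (/ v)%C <= Re (/ v)%C.
Proof.
  intros Hv Hs. assert (Hn : v <> 0) by (apply Re_neq0; lra).
  assert (Hp := Cmod_neq0 v Hn). rewrite Re_inv, Cmod_inv by auto. split.
  - apply Rdiv_lt_0_compat; auto. now apply pow_lt.
  - replace (c * / Cmod v) with (c * Cmod v / Cmod v ^ 2) by (field; lra).
    apply Rmult_le_compat_r; auto. left. apply Rinv_0_lt_compat. now apply pow_lt.
Qed.

(** Near 0 the value at v is traded for values at 1/v, where [sector_decay] with exponent 4 beats
    the cube in the hypothesis and leaves one power of |v|. Two functions are allowed because the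
    inversion of a derivative involves the function as well. *)
Lemma decays_of_inversion G H1 H2 K K1 K2 N N1 N2 : 0 <= K -> 0 <= K1 -> 0 <= K2 ->
  rhp_bounded G K N -> rhp_bounded H1 K1 N1 -> rhp_bounded H2 K2 N2 ->
  (forall v, 0 < Re v -> Cmod v <= 1 -> Cmod (G v) <= Cmod (/ v)%C ^ 3 * (Cmod (H1 (/ v)%C) + Cmod (H2 (/ v)%C))) ->
  decays G.
Proof.
  intros HK HK1 HK2 B B1 B2 Hi c Hc.
  destruct (sector_decay G K N 2 c HK B Hc) as (M0 & HM0 & D0).
  destruct (sector_decay H1 K1 N1 4 c HK1 B1 Hc) as (M1 & HM1 & D1).
  destruct (sector_decay H2 K2 N2 4 c HK2 B2 Hc) as (M2 & HM2 & D2).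
  exists (2 * (M0 + M1 + M2)). split; [ lra |]. intros v Hv Hs.
  assert (Hn : v <> 0) by (apply Re_neq0; lra).
  assert (Hp := Cmod_neq0 v Hn). set (t := Cmod v) in *.
  assert (Pt : 0 < 1 + t ^ 2) by nra.
  destruct (Rle_lt_dec 1 t) as [L | L].
  - specialize (D0 v L Hs). fold t in D0. assert (G0 := Cmod_ge_0 (G v)).
    assert (Cmod (G v) <= t ^ 2 * Cmod (G v)) by (rewrite <- (Rmult_1_l (Cmod (G v))) at 1; apply Rmult_le_compat_r; [ lra | simpl; nra ]).
    split.
    + assert (2 * (M0 + M1 + M2) * 1 <= 2 * (M0 + M1 + M2) * t) by (apply Rmult_le_compat_l; lra). lra.
    + apply Rmult_le_reg_r with (1 + t ^ 2); auto. unfold Rdiv.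
      rewrite (Rmult_assoc _ (/ _)), Rinv_l, Rmult_1_r by lra. lra.
  - destruct (Re_inv_sector v c Hv Hs) as [Ru Su].
    assert (Eu : Cmod (/ v)%C = / t) by now apply Cmod_inv.
    assert (Lu : 1 <= Cmod (/ v)%C) by (rewrite Eu, <- Rinv_1; apply Rinv_le_contravar; lra).
    specialize (D1 _ Lu Su). specialize (D2 _ Lu Su). specialize (Hi v Hv ltac:(fold t; lra)).
    rewrite Eu in *.
    assert (X : Cmod (G v) <= (M1 + M2) * t).
    { eapply Rle_trans; [ exact Hi |].
      replace ((/ t) ^ 3 * (Cmod (H1 (/ v)%C) + Cmod (H2 (/ v)%C)))
        with (((/ t) ^ 4 * Cmod (H1 (/ v)%C) + (/ t) ^ 4 * Cmod (H2 (/ v)%C)) * t) by (field; lra).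
      apply Rmult_le_compat_r; lra. }
    split; [ nra |].
    apply Rmult_le_reg_r with (1 + t ^ 2); auto. unfold Rdiv.
    rewrite (Rmult_assoc _ (/ _)), Rinv_l, Rmult_1_r by lra.
    apply Rle_trans with ((M1 + M2) * t * (1 + t ^ 2)); [ apply Rmult_le_compat_r; lra |].
    assert (t * (1 + t ^ 2) <= 2) by nra. nra.
Qed.

(* For decaying G the extension by 0 is continuous at the vertex of every sector inside the half-plane. *)
Definition gext (G : C -> C) (v : C) : C := if Rlt_dec 0 (Re v) then G v else 0.

Lemma gext_pos G v : 0 < Re v -> gext G v = G v.
Proof. intros H. unfold gext. destruct Rlt_dec; tauto. Qed.

Lemma gext_neg G v : Re v <= 0 -> gext G v = 0.
Proof. intros H. unfold gext. destruct Rlt_dec; auto; lra. Qed.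

Lemma Re_close u v : Re v - Cmod (u - v)%C <= Re u.
Proof. generalize (re_le_Cmod (u - v)%C). rewrite Re_minus. intros H. apply Rabs_le_between in H. lra. Qed.

Lemma gext_cdiff G v : rhp_holo G -> 0 < Re v -> cdiff (gext G) v.
Proof.
  intros H Hv. apply (cdiff_ext_loc G _ v (Re v) Hv); [| now apply H ].
  intros u Hu. rewrite gext_pos; auto. generalize (Re_close u v). lra.
Qed.

Lemma gext_cdiff_neg G v : Re v < 0 -> cdiff (gext G) v.
Proof.
  intros Hv. apply (cdiff_ext_loc (fun _ => RtoC 0) _ v (- Re v)); [ lra | | apply cdiff_const ].
  intros u Hu. rewrite gext_neg; auto. generalize (re_le_Cmod (u - v)%C). rewrite Re_minus. intros H. apply Rabs_le_between in H. lra.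
Qed.

Definition in_sector (c : R) (v : C) : Prop := Re v <= 0 \/ 0 < Re v /\ c * Cmod v <= Re v.

Lemma gext_bound G c : decays G -> 0 < c -> exists M, 0 <= M /\
  forall v, in_sector c v -> Cmod (gext G v) <= M * Cmod v /\ Cmod (gext G v) <= M / (1 + Cmod v ^ 2).
Proof.
  intros HG Hc. destruct (HG c Hc) as (M & HM & H). exists M. split; auto. intros v [Hv | [Hv Hs]].
  - rewrite gext_neg, Cmod_0 by auto. assert (P := Cmod_ge_0 v). split; [ nra |].
    apply Rmult_le_pos; auto. left. apply Rinv_0_lt_compat. nra.
  - rewrite gext_pos by auto. now apply H.
Qed.

(** A path inside a sector can meet the imaginary axis only at the vertex, where the linear bound
    forces the limit 0. *)
Lemma ccont_gext G c (p : R -> C) t : rhp_holo G -> decays G -> 0 < c -> (forall s, in_sector c (p s)) -> ccont p t ->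
  (Re (p t) = 0 -> p t = 0) -> ccont (fun s => gext G (p s)) t.
Proof.
  intros HG Hd Hc Hs Hp H0. destruct (Rtotal_order (Re (p t)) 0) as [L | [E | L]].
  - apply ccont_comp_cdiff; auto. now apply gext_cdiff_neg.
  - specialize (H0 E). destruct (gext_bound G c Hd Hc) as (M & HM & Hb).
    apply ccont_eps. intros eps He. assert (Pe : 0 < eps / (M + 1)) by (apply Rdiv_lt_0_compat; lra).
    destruct (ccont_elim _ _ Hp _ Pe) as (d & Hd0 & Hdel). exists d. split; auto. intros s Hsd.
    specialize (Hdel s Hsd). destruct (Hb _ (Hs s)) as [X _].
    rewrite (gext_neg G (p t)) by lra. replace (gext G (p s) - 0)%C with (gext G (p s)) by ring.
    rewrite H0 in Hdel. replace (p s - 0)%C with (p s) in Hdel by ring.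
    eapply Rle_lt_trans; [ exact X |].
    apply Rmult_lt_compat_r with (r := M + 1) in Hdel; [| lra ].
    replace (eps / (M + 1) * (M + 1)) with eps in Hdel by (field; lra). generalize (Cmod_ge_0 (p s)). nra.
  - apply ccont_comp_cdiff; auto. now apply gext_cdiff.
Qed.

(** For Re y > 0 and a <= 0 the point y sinh a lies outside the right half-plane, so the extension
    by zero makes the integral over the line an integral over a > 0. *)
Definition ray (G : C -> C) (y : C) (a : R) : C := gext G (y * RtoC (sinh a))%C.

Lemma sinh_ge a : 0 <= a -> a <= sinh a.
Proof.
  intros Ha. destruct Ha as [Ha | <-]; [| rewrite sinh_0; lra ].
  destruct (MVT_cor2 sinh cosh 0 a Ha) as [c [E _]]; [ intros; apply derivable_pt_lim_sinh |].
  rewrite sinh_0 in E. generalize (cosh_ge1 c). nra.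
Qed.

Lemma sinh_opp a : sinh (- a) = - sinh a.
Proof. unfold sinh. rewrite Ropp_involutive. lra. Qed.

Lemma sinh_le_0 a : a <= 0 -> sinh a <= 0.
Proof. intros H. generalize (sinh_ge (- a) ltac:(lra)). rewrite sinh_opp. lra. Qed.

Lemma ray_sector y a c : 0 < Re y -> c * Cmod y <= Re y -> in_sector c (y * RtoC (sinh a))%C.
Proof.
  intros Hy Hc. unfold in_sector. reim. rewrite Cmod_mult. destruct (Rle_lt_dec a 0) as [L | L].
  - left. generalize (sinh_le_0 a L). nra.
  - right. assert (X := sinh_ge a ltac:(lra)). rewrite Cmod_RtoC_pos by lra. split; nra.
Qed.

Lemma ccont_ray G y a : rhp_holo G -> decays G -> 0 < Re y -> ccont (ray G y) a.
Proof.
  intros HG Hd Hy. assert (Hn : y <> 0) by (apply Re_neq0; lra). assert (Hp := Cmod_neq0 y Hn).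
  unfold ray. apply (ccont_gext G (Re y / Cmod y) (fun a => y * RtoC (sinh a))%C); auto.
  - now apply Rdiv_lt_0_compat.
  - intros s. apply ray_sector; auto. right. field. lra.
  - cc.
  - reim. intros E. assert (E' : sinh a = 0) by nra. rewrite E'. ring.
Qed.

Lemma ray_bound_unif G c r : decays G -> 0 < c -> 0 < r -> exists M, 0 <= M /\
  forall y a, r <= Cmod y -> 0 < Re y -> c * Cmod y <= Re y -> Cmod (ray G y a) <= M / (1 + a ^ 2).
Proof.
  intros Hd Hc Hr. destruct (gext_bound G c Hd Hc) as (M & HM & Hb).
  assert (Pr : 0 < / r ^ 2) by (apply Rinv_0_lt_compat; nra).
  exists (M * (1 + / r ^ 2)). split; [ apply Rmult_le_pos; lra |]. intros y a Hy Hre Hs.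
  assert (Pa : 0 < 1 + a ^ 2) by nra.
  destruct (Rle_lt_dec a 0) as [L | L].
  { unfold ray. rewrite gext_neg, Cmod_0.
    - apply Rmult_le_pos; [ apply Rmult_le_pos; lra | left; now apply Rinv_0_lt_compat ].
    - reim. generalize (sinh_le_0 a L). nra. }
  destruct (Hb _ (ray_sector y a c Hre Hs)) as [_ X]. unfold ray. eapply Rle_trans; [ exact X |].
  unfold Rdiv. rewrite Rmult_assoc. apply Rmult_le_compat_l; auto.
  assert (Hsh := sinh_ge a ltac:(lra)). rewrite Cmod_mult, Cmod_RtoC_pos by lra.
  assert (Z : r * a <= Cmod y * sinh a) by (apply Rmult_le_compat; lra).
  assert (Z2 : (r * a) ^ 2 <= (Cmod y * sinh a) ^ 2) by (apply pow_incr; split; [ nra | auto ]).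
  assert (Pm : 0 < 1 + (Cmod y * sinh a) ^ 2) by nra.
  apply Rmult_le_reg_r with ((1 + (Cmod y * sinh a) ^ 2) * (1 + a ^ 2)); [ now apply Rmult_lt_0_compat |].
  replace (/ (1 + (Cmod y * sinh a) ^ 2) * ((1 + (Cmod y * sinh a) ^ 2) * (1 + a ^ 2))) with (1 + a ^ 2) by (field; lra).
  replace ((1 + / r ^ 2) * / (1 + a ^ 2) * ((1 + (Cmod y * sinh a) ^ 2) * (1 + a ^ 2)))
    with ((1 + / r ^ 2) * (1 + (Cmod y * sinh a) ^ 2)) by (field; split; nra).
  apply Rle_trans with ((1 + / r ^ 2) * (1 + (r * a) ^ 2)); [| apply Rmult_le_compat_l; lra ].
  replace ((1 + / r ^ 2) * (1 + (r * a) ^ 2)) with (1 + a ^ 2 + / r ^ 2 + (r * a) ^ 2) by (field; lra). nra.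
Qed.

Lemma isI_ray G y : rhp_holo G -> decays G -> 0 < Re y -> isI (ray G y) (IntR (ray G y)).
Proof.
  intros HG Hd Hy. assert (Hn : y <> 0) by (apply Re_neq0; lra). assert (Hp := Cmod_neq0 y Hn).
  destruct (ray_bound_unif G (Re y / Cmod y) (Cmod y) Hd) as (M & HM & Hb); auto; [ now apply Rdiv_lt_0_compat |].
  apply (isI_Int _ (fun x => M / (1 + x ^ 2)) (M * PI)).
  - intros a b. apply ccont_exI_all. intros. now apply ccont_ray.
  - now apply dominator_cauchy.
  - intros x. apply Hb; auto; try lra. right. field. lra.
Qed.

Lemma IntR_ray_cdiff G y : rhp_holo G -> decays G -> 0 < Re y -> cdiff (fun u => IntR (ray G u)) y.
Proof.
  intros HG Hd Hy. assert (Hn : y <> 0) by (apply Re_neq0; lra). assert (Hp := Cmod_neq0 y Hn).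
  assert (Hrm := re_le_Cmod y). rewrite Rabs_pos_eq in Hrm by lra.
  (* A sector containing the disc of radius Re y / 2 about [y]: there Re u >= Re y / 2 and Cmod u <=
     2 Cmod y. *)
  set (c := Re y / (4 * Cmod y)). assert (Hc : 0 < c) by (apply Rdiv_lt_0_compat; lra).
  destruct (ray_bound_unif G c (Re y / 2) Hd Hc) as (M & HM & Hb); [ lra |].
  assert (K : forall u, Cmod (u - y)%C <= Re y / 2 -> Re y / 2 <= Re u /\ Re y / 2 <= Cmod u /\ c * Cmod u <= Re u).
  { intros u Hu. assert (R1 := Re_near u y Hu). assert (R2 := re_le_Cmod u).
    rewrite Rabs_pos_eq in R2 by lra. split; [ auto | split; [ lra |] ].
    assert (R3 : Cmod u <= 2 * Cmod y) by (generalize (Cmod_tri_rev u y); lra).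
    apply Rle_trans with (c * (2 * Cmod y)); [ apply Rmult_le_compat_l; lra |].
    unfold c. replace (Re y / (4 * Cmod y) * (2 * Cmod y)) with (Re y / 2) by (field; lra). auto. }
  apply (isI_cdiff (fun a u => ray G u a) _ y (Re y / 2) (fun x => M / (1 + x ^ 2)) (M * PI)); [ lra | | | ].
  - now apply dominator_cauchy.
  - intros a u Hu. destruct (K u Hu) as (K1 & K2 & K3). split; [| apply Hb; auto; lra ].
    destruct (Rle_lt_dec a 0) as [L | L].
    + apply (cdiff_ext_loc (fun _ => RtoC 0) _ u (Re u)); [ lra | | apply cdiff_const ].
      intros z Hz. unfold ray. rewrite gext_neg; auto. reim. generalize (Re_close z u) (sinh_le_0 a L). nra.
    + unfold ray. apply (cdiff_comp (gext G)); [ cd |]. apply gext_cdiff; auto.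
      reim. generalize (sinh_ge a ltac:(lra)). nra.
  - intros u Hu. destruct (K u Hu) as (K1 & K2 & K3). apply isI_ray; auto. lra.
Qed.

(** * Rotating a ray of integration by a right angle *)

Lemma rect_ccont_seg_int f a b c d : a <= b -> c <= d -> rect_ccont f a b c d -> seg_int f a b c d.
Proof.
  intros Ha Hc H. split; intros t Ht; apply ccont_exI; intros s Hs;
    rewrite Rmin_left, Rmax_right in Ht, Hs by lra; now apply H.
Qed.

Lemma rect_ccont_sub f a b c d a' b' c' d' : a <= a' -> b' <= b -> c <= c' -> d' <= d -> rect_ccont f a b c d -> rect_ccont f a' b' c' d'.
Proof. intros Ha Hb Hc Hd H x y Hx Hy. apply H; lra. Qed.

Lemma exists_min3 a b c : 0 < a -> 0 < b -> 0 < c -> exists h, 0 < h /\ h <= a /\ h <= b /\ h <= c.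
Proof.
  intros. exists (Rmin a (Rmin b c)). split; [ repeat apply Rmin_glb_lt; auto |].
  generalize (Rmin_l a (Rmin b c)) (Rmin_r a (Rmin b c)) (Rmin_l b c) (Rmin_r b c). lra.
Qed.

Lemma pow_incr_inv x y : 0 <= y -> x ^ 2 <= y ^ 2 -> x <= y.
Proof. intros. nra. Qed.

(** A square of side h is cut off at the bad vertex: its boundary integral is at most 4 h M and the
    other three rectangles fall under [goursat]. The two choices of [y0] correspond to the two
    directions of rotation. *)
Lemma goursat_corner f a b c d y0 M : a < b -> c < d -> y0 = c \/ y0 = d -> rect_ccont f a b c d ->
  (forall x y, a <= x <= b -> c <= y <= d -> Cmod (f (x, y)) <= M) ->
  (forall x y, a <= x <= b -> c <= y <= d -> x <> a \/ y <> y0 -> cdiff f (x, y)) ->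
  Rct f a b c d = 0.
Proof.
  intros Hab Hcd Hy0 Hcc HM Hd. apply Cmod_le_eps_eq. intros eps He.
  assert (PM : 0 <= M) by (eapply Rle_trans; [ apply Cmod_ge_0 | apply (HM a c); lra ]).
  destruct (exists_min3 (b - a) (d - c) (eps / (4 * M + 1))) as (h & Ph & H1 & H2 & H3); try lra.
  { apply Rdiv_lt_0_compat; lra. }
  assert (Z : forall a' b' c' d', a <= a' -> a' <= b' -> b' <= b -> c <= c' -> c' <= d' -> d' <= d ->
    (forall x y, a' <= x <= b' -> c' <= y <= d' -> x <> a \/ y <> y0) -> Rct f a' b' c' d' = 0).
  { intros a' b' c' d' ? ? ? ? ? ? Hn. apply goursat. intros x y Hx Hy.
    rewrite Rmin_left, Rmax_right in Hx, Hy by lra. apply Hd; try lra. now apply Hn. }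
  assert (S : forall a' b' c' d', a <= a' -> a' <= b' -> b' <= b -> c <= c' -> c' <= d' -> d' <= d ->
    b' - a' = h -> d' - c' = h -> Cmod (Rct f a' b' c' d') <= eps).
  { intros a' b' c' d' ? ? ? ? ? ? E1 E2.
    eapply Rle_trans; [ apply (Rct_bound f a' b' c' d' M) |].
    - apply rect_ccont_seg_int; auto. apply (rect_ccont_sub f a b c d); auto.
    - intros x y Hx Hy. rewrite Rmin_left, Rmax_right in Hx, Hy by lra. apply HM; lra.
    - rewrite E1, E2, Rabs_pos_eq by lra. replace (2 * (h + h) * M) with (h * (4 * M)) by ring.
      apply Rle_trans with (eps / (4 * M + 1) * (4 * M + 1)); [| right; field; lra ].
      apply Rmult_le_compat; lra. }
  replace (Rct f a b c d - 0)%C with (Rct f a b c d) by ring.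
  destruct Hy0 as [-> | ->].
  - rewrite (Rct_split f a b c d (a + h) (c + h)) by (auto; lra).
    rewrite (Z (a + h) b c (c + h)), (Z a (a + h) (c + h) d), (Z (a + h) b (c + h) d)
      by (try lra; intros; first [ left; lra | right; lra ]).
    replace (Rct f a (a + h) c (c + h) + 0 + (0 + 0))%C with (Rct f a (a + h) c (c + h)) by ring.
    apply S; lra.
  - rewrite (Rct_split f a b c d (a + h) (d - h)) by (auto; lra).
    rewrite (Z a (a + h) c (d - h)), (Z (a + h) b c (d - h)), (Z (a + h) b (d - h) d)
      by (try lra; intros; first [ left; lra | right; lra ]).
    replace (0 + 0 + (Rct f a (a + h) (d - h) d + 0))%C with (Rct f a (a + h) (d - h) d) by ring.
    apply S; lra.
Qed.

Lemma CI_reflect q b : exI q (- b) 0 -> CI q (- b) 0 = CI (fun y => q (- y)) 0 b.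
Proof.
  intros H. assert (H' : exI q 0 (- b)) by now apply ex_RInt_swap.
  assert (E := CI_lin q (-1) 0 0 b). replace (-1 * 0 + 0) with 0 in E by ring. replace (-1 * b + 0) with (- b) in E by ring.
  specialize (E H'). rewrite (CI_swap q (- b) 0) in E by auto.
  rewrite (CI_ext (fun y => q (-1 * y + 0)%R) (fun y => q (- y)%R)) in E by (intros; f_equal; ring).
  replace (RtoC (-1)) with (- RtoC 1)%C in E by (rewrite <- RtoC_opp; reflexivity).
  replace (CI q (- b) 0) with (- (- CI q (- b) 0))%C by ring. rewrite <- E. ring.
Qed.

(** The path [0, X] moves to height -sg PI / 2, below the axis for sg = 1 and above it for sg = -1;
    the exceptional point 0 is then the upper or the lower left vertex. *)
Lemma quarter_contour f X sg M : 0 < X -> sg = 1 \/ sg = -1 ->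
  (forall x t, 0 <= x <= X -> 0 <= t <= PI / 2 ->
     (ccont (fun x => f (x, (- sg * t)%R)) x /\ ccont (fun t => f (x, t)) (- sg * t)) /\ Cmod (f (x, (- sg * t)%R)) <= M /\
     (x <> 0 \/ t <> 0 -> cdiff f (x, (- sg * t)%R))) ->
  CI (fun x => f (x, 0%R)) 0 X =
  (CI (fun x => f (x, (- sg * (PI / 2))%R)) 0 X - Ci * RtoC sg * CI (fun t => f (0%R, (- sg * t)%R)) 0 (PI / 2)
   + Ci * RtoC sg * CI (fun t => f (X, (- sg * t)%R)) 0 (PI / 2))%C.
Proof.
  intros HX Hsg H. assert (PP := PI_RGT_0).
  assert (A : forall x t, 0 <= x <= X -> 0 <= - sg * t <= PI / 2 ->
     (ccont (fun x => f (x, t)) x /\ ccont (fun t => f (x, t)) t) /\ Cmod (f (x, t)) <= M /\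
     (x <> 0 \/ t <> 0 -> cdiff f (x, t))).
  { intros x t Hx Ht. specialize (H x (- sg * t) Hx Ht).
    replace (- sg * (- sg * t)) with t in H by (destruct Hsg as [-> | ->]; ring).
    destruct H as (H1 & H2 & H3). repeat split; try tauto. intros Hn. apply H3.
    destruct Hn as [Hn | Hn]; [ now left | right; destruct Hsg as [-> | ->]; lra ]. }
  destruct Hsg as [-> | ->].
  - assert (E : Rct f 0 X (- (PI / 2)) 0 = 0).
    { apply (goursat_corner f 0 X (- (PI / 2)) 0 0 M); try lra.
      - intros x y Hx Hy. apply A; lra.
      - intros x y Hx Hy. apply A; lra.
      - intros x y Hx Hy. apply A; lra. }
    unfold Rct in E.
    rewrite (CI_reflect (fun y => f (X, y))) in E by (apply ccont_exI; intros t; rewrite Rmin_left, Rmax_right by lra; intros; apply A; lra).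
    rewrite (CI_reflect (fun y => f (0, y))) in E by (apply ccont_exI; intros t; rewrite Rmin_left, Rmax_right by lra; intros; apply A; lra).
    rewrite (CI_ext (fun t => f (0, (- (1) * t)%R)) (fun t => f (0, (- t)%R))) by (intros; do 2 f_equal; ring).
    rewrite (CI_ext (fun t => f (X, (- (1) * t)%R)) (fun t => f (X, (- t)%R))) by (intros; do 2 f_equal; ring).
    replace (- (1) * (PI / 2)) with (- (PI / 2)) by ring.
    match type of E with (?a + ?b - ?c - ?d)%C = _ => replace c with (a + b - d - (a + b - c - d))%C by ring end.
    rewrite E. ring.
  - assert (E : Rct f 0 X 0 (PI / 2) = 0).
    { apply (goursat_corner f 0 X 0 (PI / 2) 0 M); try lra.
      - intros x y Hx Hy. apply A; lra.
      - intros x y Hx Hy. apply A; lra.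
      - intros x y Hx Hy. apply A; lra. }
    unfold Rct in E.
    rewrite (CI_ext (fun t => f (0, (- -1 * t)%R)) (fun t => f (0, t))) by (intros; do 2 f_equal; ring).
    rewrite (CI_ext (fun t => f (X, (- -1 * t)%R)) (fun t => f (X, t))) by (intros; do 2 f_equal; ring).
    replace (- -1 * (PI / 2)) with (PI / 2) by ring.
    replace (RtoC (-1)) with (- RtoC 1)%C by (rewrite <- RtoC_opp; reflexivity).
    match type of E with (?a + ?b - ?c - ?d)%C = _ => replace a with (c + d - b + (a + b - c - d))%C by ring end.
    rewrite E. ring.
Qed.

Lemma isI_even_half q l : isI q l -> (forall x, q (- x) = q x) -> forall eps, 0 < eps ->
  exists X, forall b, X <= b -> Cmod (CI q 0 b - l / RtoC 2)%C <= eps.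
Proof.
  intros [Hx H] He eps Hp. destruct (H eps Hp) as [X HX]. exists X. intros b Hb.
  specialize (HX (- b) b ltac:(lra) Hb).
  rewrite <- (CI_Chasles q (- b) 0 b), CI_reflect, (CI_ext (fun y => q (- y)) q) in HX by auto.
  assert (E : (CI q 0 b + CI q 0 b - l = RtoC 2 * (CI q 0 b - l / RtoC 2))%C) by field.
  rewrite E, Cmod_mult, Cmod_RtoC_pos in HX by lra. generalize (Cmod_ge_0 (CI q 0 b - l / RtoC 2)%C). lra.
Qed.

(** The substitution t = angle b satisfies sin t = 1 / cosh b and dt = - db / cosh b. It carries b
    from 0 to infinity onto t from PI / 2 to 0 and so turns the vertical side of the contour into an
    integral against sech. *)
Definition angle (b : R) : R := 2 * atan (exp (- b)).

Lemma sin_angle b : sin (angle b) = / cosh b.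
Proof.
  unfold angle. rewrite sin_2a. set (t := exp (- b)). assert (Pt : 0 < t) by apply exp_pos.
  assert (Ha := atan_bound t). assert (Hc := cos_gt_0 (atan t) ltac:(lra) ltac:(lra)).
  assert (E : sin (atan t) = t * cos (atan t)).
  { assert (T := tan_atan t). unfold tan in T. rewrite <- T at 2. field. lra. }
  assert (S := sin2_cos2 (atan t)). unfold Rsqr in S. rewrite E in S |- *.
  assert (C2 : cos (atan t) * cos (atan t) = / (1 + t * t)).
  { apply Rmult_eq_reg_r with (1 + t * t); [| nra ]. rewrite Rinv_l by nra. lra. }
  replace (2 * (t * cos (atan t)) * cos (atan t)) with (2 * t * (cos (atan t) * cos (atan t))) by ring.
  rewrite C2. unfold cosh. fold t. assert (Eb : exp b = / t) by (unfold t; rewrite exp_Ropp, Rinv_inv; reflexivity).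
  rewrite Eb. field. split; nra.
Qed.

Lemma angle_bound b : 0 <= angle b <= 2 * exp (- b).
Proof.
  unfold angle. set (t := exp (- b)). assert (Pt : 0 < t) by apply exp_pos.
  destruct (MVT_cor2 atan (fun x => / (1 + x ^ 2)) 0 t Pt) as [c [E _]].
  { intros x _. generalize (derivable_pt_lim_atan x). unfold Rsqr, pow. now rewrite Rmult_1_r. }
  rewrite atan_0 in E. assert (0 < / (1 + c ^ 2) <= 1).
  { split; [ apply Rinv_0_lt_compat; nra | rewrite <- Rinv_1; apply Rinv_le_contravar; nra ]. }
  nra.
Qed.

Lemma CI_sech (p : R -> C) X : (forall x, ccont p x) ->
  CI p (angle X) (PI / 2) = CI (fun b => RtoC (/ cosh b) * p (angle b))%C 0 X.
Proof.
  intros Hp. assert (E0 : angle 0 = PI / 2) by (unfold angle; rewrite Ropp_0, exp_0, atan_1; field).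
  rewrite <- E0, CI_swap by (apply ccont_exI_all; auto).
  unfold CI. rewrite <- (RInt_comp (V := C_R_CompleteNormedModule) p angle (fun b => - / cosh b)).
  - fold (CI (fun y => scal (V := C_R_CompleteNormedModule) (- / cosh y) (p (angle y))) 0 X).
    rewrite (CI_ext _ (fun b => - RtoC 1 * (RtoC (/ cosh b) * p (angle b)))%C).
    + rewrite CI_cmult; [ fold (CI (fun b => RtoC (/ cosh b) * p (angle b))%C 0 X); ring |].
      apply ccont_exI_all. intros b. apply (ccont_mult (fun b => RtoC (/ cosh b)) (fun b => p (angle b))).
      * apply ccont_RtoC. generalize (cosh_ge1 b). unfold cosh. intros. rcont; lra.
      * apply continuous_comp; [| apply Hp ]. unfold angle. rcont.
    + intros x _. change (scal (V := C_R_ModuleSpace) (- / cosh x) (p (angle x)) = (- RtoC 1 * (RtoC (/ cosh x) * p (angle x)))%C).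
      rewrite scal_R_Cmult, RtoC_opp. match goal with |- @eq _ ?a ?b => change (@eq C a b) end. ring.
  - intros. apply Hp.
  - intros b _. assert (C1 := cosh_ge1 b). split.
    + unfold angle. auto_derive; auto. unfold cosh in *. assert (Eb : exp b = / exp (- b)) by (rewrite exp_Ropp, Rinv_inv; reflexivity).
      assert (Pe := exp_pos (- b)). rewrite Eb. unfold Rsqr. field. split; nra.
    + unfold cosh in *. rcont; lra.
Qed.

Lemma Csinh_pair x t : Csinh (x, t) = ((sinh x * cos t)%R, (cosh x * sin t)%R).
Proof.
  unfold Csinh, Cdiv. rewrite <- RtoC_inv by lra. unfold Cexp, sinh, cosh. apply Ceq; reim; rewrite ?cos_neg, ?sin_neg; field.
Qed.

Lemma cdiff_Csinh z : cdiff Csinh z.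
Proof. eexists. apply cder_Csinh. Qed.

Definition strip (G : C -> C) (y z : C) : C := gext G (y * Csinh z)%C.

(** With A = sinh x cos t and B = cosh x sin t, the real part of v is Re y * A + sg Im y * B.
    Matching the direction of rotation with the sign of Im y makes both terms nonnegative, so Re v
    >= m (A + B) while |v| <= |y| (A + B): a fixed sector contains the whole half strip. *)
Lemma strip_sector y sg : sg = 1 \/ sg = -1 -> 0 < Re y -> 0 < sg * Im y -> exists c, 0 < c /\
  forall x t, 0 <= x -> 0 <= t <= PI / 2 -> let v := (y * Csinh (x, (- sg * t)%R))%C in
    in_sector c v /\ (x <> 0 \/ t <> 0 -> 0 < Re v) /\ Cmod y * sinh x <= Cmod v.
Proof.
  intros Hsg Hx1 Hy1. assert (Hn : y <> 0) by (apply Re_neq0; lra). assert (Hp := Cmod_neq0 y Hn).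
  set (m := Rmin (Re y) (sg * Im y)). assert (Pm : 0 < m) by now apply Rmin_glb_lt.
  assert (M1 : m <= Re y) by apply Rmin_l. assert (M2 : m <= sg * Im y) by apply Rmin_r.
  exists (m / Cmod y). split; [ now apply Rdiv_lt_0_compat |].
  intros x t Hx Ht v.
  assert (Hc : 0 <= cos t) by (apply cos_ge_0; lra). assert (Hs : 0 <= sin t) by (apply sin_ge_0; lra).
  assert (Hsh := sinh_ge x Hx). assert (Hch := cosh_ge1 x). assert (Hq := sinh_sq x).
  assert (Ec : cos (- sg * t) = cos t) by (destruct Hsg as [-> | ->]; rewrite ?Ropp_involutive; [ rewrite <- (cos_neg t) |]; f_equal; ring).
  assert (Es : sin (- sg * t) = - sg * sin t).
  { destruct Hsg as [-> | ->]; [ rewrite <- (Ropp_involutive (sin t)), <- sin_neg |]; try (replace (- (1) * t) with (- t) by ring; ring).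
    replace (- -1 * t) with t by ring. ring. }
  set (A := sinh x * cos t). set (B := cosh x * sin t).
  assert (PA : 0 <= A) by (apply Rmult_le_pos; lra). assert (PB : 0 <= B) by (apply Rmult_le_pos; lra).
  assert (Ev : v = (y * (A, (- sg * B)%R))%C) by (unfold v; rewrite Csinh_pair, Ec, Es; do 2 f_equal; unfold B; ring).
  assert (Rv : Re v = Re y * A + sg * Im y * B) by (rewrite Ev; reim; ring).
  assert (L : m * (A + B) <= Re v) by (rewrite Rv; nra).
  assert (sg2 : sg * sg = 1) by (destruct Hsg as [-> | ->]; ring).
  assert (U : Cmod v <= Cmod y * (A + B)).
  { rewrite Ev, Cmod_mult. apply Rmult_le_compat_l; [ lra |]. eapply Rle_trans; [ apply Cmod_le_ReIm |]. reim.
    rewrite Rabs_mult, (Rabs_pos_eq A), (Rabs_pos_eq B) by lra. replace (Rabs (- sg)) with 1; [ lra |].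
    destruct Hsg as [-> | ->]; unfold Rabs; destruct Rcase_abs; lra. }
  assert (Pos : x <> 0 \/ t <> 0 -> 0 < Re v).
  { intros D. destruct (Rle_lt_dec t 0) as [T | T].
    - assert (t = 0) by lra. subst t. assert (0 < x) by (destruct D; lra).
      assert (0 < A) by (unfold A; rewrite cos_0; lra). nra.
    - assert (0 < sin t) by (apply sin_gt_0; lra). assert (0 < B) by (apply Rmult_lt_0_compat; lra). nra. }
  split; [| split; [ exact Pos |] ].
  - unfold in_sector. destruct (Rle_lt_dec (Re v) 0) as [Z | Z]; [ now left | right ]. split; auto.
    apply Rle_trans with (m / Cmod y * (Cmod y * (A + B))).
    + apply Rmult_le_compat_l; auto. left. now apply Rdiv_lt_0_compat.
    + replace (m / Cmod y * (Cmod y * (A + B))) with (m * (A + B)) by (field; lra). auto.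
  - rewrite Ev, Cmod_mult. apply Rmult_le_compat_l; [ lra |].
    (* Here |sinh(x - i sg t)|^2 = sinh^2 x + sin^2 t. *)
    apply pow_incr_inv; [ apply Cmod_ge_0 |]. rewrite Cmod_pow2. reim.
    replace ((- sg * B) ^ 2) with (sg * sg * B ^ 2) by ring. rewrite sg2. unfold A, B.
    assert (C2 := sin2_cos2 t). unfold Rsqr in C2.
    replace ((sinh x * cos t) ^ 2 + 1 * (cosh x * sin t) ^ 2) with (sinh x ^ 2 * (cos t * cos t) + cosh x ^ 2 * (sin t * sin t)) by ring.
    replace (cos t * cos t) with (1 - sin t * sin t) by lra. rewrite Hq. nra.
Qed.

Lemma cosh_inv_le1 b : 0 < / cosh b <= 1.
Proof. assert (C := cosh_ge1 b). split; [ apply Rinv_0_lt_compat; lra | rewrite <- Rinv_1; apply Rinv_le_contravar; lra ]. Qed.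

Lemma exp_neg_small eps : 0 < eps -> exists X, forall b, X <= b -> exp (- b) <= eps.
Proof.
  intros He. exists (- ln eps). intros b Hb. rewrite <- (exp_ln eps) by auto. apply exp_le. lra.
Qed.

(** On the shifted horizontal y sinh(x - i sg PI/2) = w cosh x, and on the vertical side at 0 the
    argument is w sin t, which [angle] rewrites as w / cosh b. Both integrands are even in b, whence
    the halves of the full-line integrals [l1] and [l2]. *)
Lemma rotate G y sg l1 l2 : rhp_holo G -> decays G -> sg = 1 \/ sg = -1 -> 0 < Re y -> 0 < sg * Im y ->
  isI (fun b => G (- Ci * RtoC sg * y * RtoC (cosh b)))%C l1 ->
  isI (fun b => RtoC (/ cosh b) * G (- Ci * RtoC sg * y * RtoC (/ cosh b)))%C l2 ->
  IntR (ray G y) = (l1 / RtoC 2 - Ci * RtoC sg * (l2 / RtoC 2))%C.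
Proof.
  intros HG Hd Hsg Hy1 Hy2 I1 I2. set (w := (- Ci * RtoC sg * y)%C) in *.
  assert (sg2 : sg * sg = 1) by (destruct Hsg as [-> | ->]; ring).
  assert (PP := PI_RGT_0). assert (PP4 := PI_4).
  assert (Rw : Re w = sg * Im y) by (unfold w; reim; ring). assert (Rw0 : 0 < Re w) by lra.
  assert (Hny : y <> 0) by (apply Re_neq0; lra). assert (Py := Cmod_neq0 y Hny).
  assert (Hnw : w <> 0) by (apply Re_neq0; lra). assert (Pw := Cmod_neq0 w Hnw).
  destruct (strip_sector y sg Hsg Hy1 Hy2) as (c & Hc & Hsec).
  destruct (gext_bound G c Hd Hc) as (M & HM & Hb).
  set (p := fun t => gext G (w * RtoC (sin t))%C).
  assert (Ep : forall t, strip G y (0, (- sg * t)%R) = p t).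
  { intros t. unfold strip, p. rewrite Csinh_pair, sinh_0, cosh_0. f_equal.
    assert (Es : sin (- sg * t) = - sg * sin t).
    { destruct Hsg as [-> | ->]; [ replace (- (1) * t) with (- t) by ring; rewrite sin_neg; ring | replace (- -1 * t) with t by ring; ring ]. }
    rewrite Es. unfold w. Csolve. }
  assert (Cp : forall t, ccont p t).
  { intros t. unfold p. apply (ccont_gext G (Re w / Cmod w) (fun t => w * RtoC (sin t))%C); auto.
    - now apply Rdiv_lt_0_compat.
    - intros s. unfold in_sector. reim. rewrite Cmod_mult. destruct (Rle_lt_dec (sin s) 0) as [L | L]; [ left; nra | right ].
      rewrite Cmod_RtoC_pos by lra. split; [ nra |]. right. field. lra.
    - cc.
    - reim. intros E. assert (E' : sin t = 0) by nra. rewrite E'. ring. }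
  assert (Etop : forall x, strip G y (x, 0) = ray G y x).
  { intros x. unfold strip, ray. f_equal. rewrite Csinh_pair, sin_0, cos_0. Csolve. }
  assert (Ebot : forall x, strip G y (x, (- sg * (PI / 2))%R) = G (w * RtoC (cosh x))%C).
  { intros x. assert (Ev : (y * Csinh (x, (- sg * (PI / 2))%R) = w * RtoC (cosh x))%C).
    { rewrite Csinh_pair. assert (Ec : cos (- sg * (PI / 2)) = 0).
      { destruct Hsg as [-> | ->]; [ replace (- (1) * (PI / 2)) with (- (PI / 2)) by ring; rewrite cos_neg | replace (- -1 * (PI / 2)) with (PI / 2) by ring ]; apply cos_PI2. }
      assert (Es : sin (- sg * (PI / 2)) = - sg).
      { destruct Hsg as [-> | ->]; [ replace (- (1) * (PI / 2)) with (- (PI / 2)) by ring; rewrite sin_neg | replace (- -1 * (PI / 2)) with (PI / 2) by ring ]; rewrite sin_PI2; ring. }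
      rewrite Ec, Es. unfold w. Csolve. }
    unfold strip. rewrite Ev, gext_pos; auto. rewrite Re_scal_cosh. generalize (cosh_ge1 x). nra. }
  assert (Contour : forall X, 0 < X -> CI (ray G y) 0 X =
    (CI (fun x => G (w * RtoC (cosh x))%C) 0 X - Ci * RtoC sg * CI p 0 (PI / 2)
     + Ci * RtoC sg * CI (fun t => strip G y (X, (- sg * t)%R)) 0 (PI / 2))%C).
  { intros X HX. assert (Q := quarter_contour (strip G y) X sg M HX Hsg).
    rewrite (CI_ext _ (ray G y)), (CI_ext (fun x => strip G y (x, (- sg * (PI / 2))%R)) (fun x => G (w * RtoC (cosh x))%C)),
      (CI_ext (fun t => strip G y (0, (- sg * t)%R)) p) in Q by auto.
    apply Q. intros x t Hx Ht. destruct (Hsec x t ltac:(lra) Ht) as (S1 & S2 & S3).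
    assert (D : x <> 0 \/ t <> 0 -> cdiff (strip G y) (x, (- sg * t)%R)).
    { intros Hn. unfold strip. apply (cdiff_comp (gext G)); [ cd; apply cdiff_Csinh |]. apply gext_cdiff; auto. }
    split; [| split; [| exact D ] ].
    - destruct (classic (x <> 0 \/ t <> 0)) as [N | N].
      + specialize (D N). split; [ apply (ccont_comp_cdiff (strip G y) (fun x => (x, (- sg * t)%R))); [ apply ccont_hor | auto ]
         | apply (ccont_comp_cdiff (strip G y) (fun t => (x, t))); [ apply ccont_ver | auto ] ].
      (* At the vertex continuity holds along the two axes only, through [ray] and [p]; this is
         exactly what [rect_ccont] demands. *)
      + assert (x = 0) by (apply NNPP; tauto). assert (t = 0) by (apply NNPP; tauto). subst x t.
        rewrite Rmult_0_r. split.
        * apply (ccont_ext (ray G y)); [ intros; now rewrite Etop | now apply ccont_ray ].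
        * apply (ccont_ext (fun s => p (- sg * s))).
          { intros s. rewrite <- Ep. replace (- sg * (- sg * s)) with (sg * sg * s) by ring. now rewrite sg2, Rmult_1_l. }
          apply (continuous_comp (fun s => - sg * s) p); [ rcont | apply Cp ].
    - eapply Rle_trans; [ apply (Hb _ S1) |]. apply Rmult_le_reg_r with (1 + Cmod (y * Csinh (x, (- sg * t)%R))%C ^ 2); [ nra |].
      unfold Rdiv. rewrite Rmult_assoc, Rinv_l by nra. nra. }
  apply Cmod_le_eps_eq. intros eps He. set (e := eps / 6). assert (Pe : 0 < e) by (unfold e; lra).
  destruct (isI_ray G y HG Hd Hy1) as [Xr Hr]. destruct (Hr e Pe) as [X1 HX1].
  destruct (isI_even_half _ _ I1 ltac:(intros; cbv beta; now rewrite cosh_even) e Pe) as [X2 HX2].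
  destruct (isI_even_half _ _ I2 ltac:(intros; cbv beta; now rewrite cosh_even) e Pe) as [X3 HX3].
  destruct (exp_neg_small (e / (2 * M + 1))) as [X4 HX4]; [ apply Rdiv_lt_0_compat; lra |].
  (* [X4] makes the leftover piece [0, angle X] of the vertical side negligible, its length being at
     most 2 e^(-X); [X5] does the same for the far side, where the integrand is at most M / (|y|
     X). *)
  set (X5 := 2 * M / (e * Cmod y)).
  assert (P5 : 0 <= X5) by (apply Rmult_le_pos; [ lra | left; apply Rinv_0_lt_compat; nra ]).
  set (X := Rmax 1 (Rmax X1 (Rmax X2 (Rmax X3 (Rmax X4 X5))))).
  assert (B1 : 1 <= X) by apply Rmax_l.
  assert (BB : X1 <= X /\ X2 <= X /\ X3 <= X /\ X4 <= X /\ X5 <= X).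
  { unfold X. generalize (Rmax_r 1 (Rmax X1 (Rmax X2 (Rmax X3 (Rmax X4 X5)))))
      (Rmax_l X1 (Rmax X2 (Rmax X3 (Rmax X4 X5)))) (Rmax_r X1 (Rmax X2 (Rmax X3 (Rmax X4 X5))))
      (Rmax_l X2 (Rmax X3 (Rmax X4 X5))) (Rmax_r X2 (Rmax X3 (Rmax X4 X5)))
      (Rmax_l X3 (Rmax X4 X5)) (Rmax_r X3 (Rmax X4 X5)) (Rmax_l X4 X5) (Rmax_r X4 X5). lra. }
  destruct BB as (B2 & B3 & B4 & B5 & B6).
  specialize (HX1 (- X) X ltac:(lra) ltac:(lra)). specialize (HX2 X B3). specialize (HX3 X B4). specialize (HX4 X B5).
  rewrite <- (CI_Chasles (ray G y) (- X) 0 X), (CI_ext (ray G y) (fun _ => RtoC 0) (- X) 0), CI_const, (Contour X) in HX1; auto; [| lra |].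
  2: { intros x. rewrite Rmin_left, Rmax_right by lra. intros Hx. unfold ray. rewrite gext_neg; auto.
       reim. generalize (sinh_le_0 x ltac:(lra)). nra. }
  (* Cutting the vertical side at [angle X] makes its upper piece correspond to 0 <= b <= X. *)
  assert (Eip : CI p 0 (PI / 2) = (CI p 0 (angle X) + CI p (angle X) (PI / 2))%C) by (symmetry; apply CI_Chasles; apply ccont_exI_all; auto).
  rewrite Eip, CI_sech in HX1 by auto.
  rewrite (CI_ext (fun b => RtoC (/ cosh b) * p (angle b))%C (fun b => RtoC (/ cosh b) * G (w * RtoC (/ cosh b)))%C) in HX1.
  2: { intros x _. unfold p. rewrite sin_angle, gext_pos; auto. reim. generalize (cosh_inv_le1 x). nra. }
  assert (Bp : forall t, 0 <= t <= PI / 2 -> Cmod (p t) <= M).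
  { intros t Ht. rewrite <- Ep. destruct (Hsec 0 t ltac:(lra) Ht) as (S1 & _). unfold strip. eapply Rle_trans; [ apply (Hb _ S1) |].
    apply Rmult_le_reg_r with (1 + Cmod (y * Csinh (0, (- sg * t)%R))%C ^ 2); [ nra |].
    unfold Rdiv. rewrite Rmult_assoc, Rinv_l by nra. nra. }
  destruct (angle_bound X) as [A0 A1].
  assert (Api : angle X <= PI / 2) by (unfold angle; generalize (atan_bound (exp (- X))); intros; assert (atan (exp (- X)) <= atan 1); [| rewrite atan_1 in *; lra ];
    assert (exp (- X) < 1) by (rewrite <- exp_0; apply exp_increasing; lra); left; now apply atan_increasing).
  assert (T1 : Cmod (CI p 0 (angle X)) <= e).
  { eapply Rle_trans; [ apply (CI_bound p 0 (angle X) M); auto; [ apply ccont_exI_all; auto | intros; apply Bp; lra ] |].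
    apply Rle_trans with (2 * (e / (2 * M + 1)) * M); [ apply Rmult_le_compat_r; lra |].
    replace (2 * (e / (2 * M + 1)) * M) with (e * (2 * M / (2 * M + 1))) by (field; lra).
    rewrite <- (Rmult_1_r e) at 2. apply Rmult_le_compat_l; [ lra |].
    apply Rmult_le_reg_r with (2 * M + 1); [ lra |]. unfold Rdiv. rewrite Rmult_assoc, Rinv_l; lra. }
  assert (T2 : Cmod (CI (fun t => strip G y (X, (- sg * t)%R)) 0 (PI / 2)) <= e).
  { eapply Rle_trans; [ apply (CI_bound _ 0 (PI / 2) (M / (Cmod y * X))); [ lra | | ] |].
    - apply ccont_exI. intros t. rewrite Rmin_left, Rmax_right by lra. intros Ht.
      destruct (Hsec X t ltac:(lra) Ht) as (S1 & S2 & S3).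
      assert (D : cdiff (strip G y) (X, (- sg * t)%R)).
      { unfold strip. apply (cdiff_comp (gext G)); [ cd; apply cdiff_Csinh |]. apply gext_cdiff; auto. apply S2. left. lra. }
      apply (ccont_comp_cdiff (strip G y) (fun t => (X, (- sg * t)%R))); auto.
      apply (continuous_comp (fun s => - sg * s) (fun t => (X, t))); [ rcont | apply ccont_ver ].
    - intros t Ht. destruct (Hsec X t ltac:(lra) Ht) as (S1 & S2 & S3). unfold strip. eapply Rle_trans; [ apply (Hb _ S1) |].
      apply Rmult_le_compat_l; auto. apply Rinv_le_contravar; [ apply Rmult_lt_0_compat; lra |].
      assert (Hsh := sinh_ge X ltac:(lra)). set (V := Cmod (y * Csinh (X, (- sg * t)%R))%C) in *.
      assert (Cmod y * X <= V) by nra. nra.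
    - assert (E5 : 2 * M = X5 * (e * Cmod y)) by (unfold X5; field; split; lra).
      assert (L5 : 2 * M <= X * (e * Cmod y)) by (rewrite E5; apply Rmult_le_compat_r; [ nra | auto ]).
      apply Rle_trans with (2 * (M / (Cmod y * X))).
      + apply Rmult_le_compat_r; [ apply Rmult_le_pos; [ auto | left; apply Rinv_0_lt_compat; nra ] | lra ].
      + apply Rmult_le_reg_r with (Cmod y * X); [ nra |].
        replace (2 * (M / (Cmod y * X)) * (Cmod y * X)) with (2 * M) by (field; split; lra). lra. }
  assert (Cs : forall z, Cmod (Ci * RtoC sg * z)%C = Cmod z).
  { intros z. rewrite !Cmod_mult, Cmod_Ci, Cmod_R. replace (Rabs sg) with 1; [ ring |].
    destruct Hsg as [-> | ->]; unfold Rabs; destruct Rcase_abs; lra. }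
  set (bot := CI (fun x => G (w * RtoC (cosh x))%C) 0 X) in *.
  set (h := CI (fun b => RtoC (/ cosh b) * G (w * RtoC (/ cosh b)))%C 0 X) in *.
  set (cp0 := CI p 0 (angle X)) in *. set (vR := CI (fun t => strip G y (X, (- sg * t)%R)) 0 (PI / 2)) in *.
  match type of HX1 with Cmod ?u <= _ => set (U := u) in * end.
  replace (IntR (ray G y) - (l1 / RtoC 2 - Ci * RtoC sg * (l2 / RtoC 2)))%C
    with (((bot - l1 / RtoC 2) - Ci * RtoC sg * (h - l2 / RtoC 2)) - (U + Ci * RtoC sg * cp0 - Ci * RtoC sg * vR))%C
    by (unfold U; ring).
  eapply Rle_trans; [ apply Cmod_tri_minus |].
  eapply Rle_trans; [ apply Rplus_le_compat; [ apply Cmod_tri_minus | apply Cmod_tri_minus ] |].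
  generalize (Cmod_triangle U (Ci * RtoC sg * cp0)%C). rewrite !Cs. intros. unfold e in *. lra.
Qed.

(** * Period integrals *)

Lemma cder_unique f z l l' : cder f z l -> cder f z l' -> l = l'.
Proof.
  intros H H'. apply Cmod_le_eps_eq. intros eps He. destruct (H (eps / 2)) as (d & Hd & D); [ lra |].
  destruct (H' (eps / 2)) as (d' & Hd' & D'); [ lra |].
  set (r := Rmin d d' / 2). assert (0 < Rmin d d') by now apply Rmin_glb_lt.
  assert (Hr : 0 < r /\ r < d /\ r < d') by (unfold r; generalize (Rmin_l d d') (Rmin_r d d'); lra).
  specialize (D (RtoC r)). specialize (D' (RtoC r)). rewrite Cmod_RtoC_pos in D, D' by lra.
  specialize (D ltac:(lra)). specialize (D' ltac:(lra)).
  assert (E : Cmod ((l - l') * RtoC r)%C <= eps * r).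
  { replace ((l - l') * RtoC r)%C with ((f (z + RtoC r) - f z - l' * RtoC r) - (f (z + RtoC r) - f z - l * RtoC r))%C by ring.
    eapply Rle_trans; [ apply Cmod_tri_minus |]. lra. }
  rewrite Cmod_mult, Cmod_RtoC_pos in E by lra. apply Rmult_le_reg_r with r; lra.
Qed.

Lemma Cinv_invol (z : C) : z <> 0 -> (/ / z = z)%C.
Proof. intros. field. auto. Qed.

Lemma KS_cosh c k B nu A p m T w : poly_bounded c B nu -> kernel_bounded k A p -> rhp_holo k -> 0 < Re w ->
  (forall u, 0 < Re u -> isI (fun b => RtoC (cosh b ^ m) * k (u * RtoC (cosh b)))%C (T u)) ->
  exists L, isS (fun n => c n * T (RtoC (mu n) * w))%C L /\
    isI (fun b => RtoC (cosh b ^ m) * KS c k (w * RtoC (cosh b)))%C L.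
Proof.
  intros Hc Hk Hh Hw HT. destruct (ks_bound c k B nu A p Hc Hk) as (W & N & HW & Hb).
  (* The extra power of cosh b pays for the factor 1 + Cmod (w cosh b) in [ks_bound]. *)
  destruct (cosh_pow_dom (Re w) (S m) Hw) as (M & HM & Hd).
  assert (Pi : 0 < / Re w) by now apply Rinv_0_lt_compat.
  assert (PN : 0 <= (1 + / Re w) ^ N) by (apply pow_le; lra).
  assert (Pw := Cmod_ge_0 w).
  set (V := W * (1 + / Re w) ^ N * (1 + Cmod w)).
  assert (PV : 0 <= V) by (unfold V; repeat apply Rmult_le_pos; auto; lra).
  assert (Rwb : forall b, 0 < Re (w * RtoC (cosh b))%C) by (intros b; generalize (Re_scal_cosh_ge w b Hw); lra).
  apply (isI_series (fun n b => c n * (RtoC (cosh b ^ m) * k (RtoC (mu n) * w * RtoC (cosh b))))%C _ _ tele 1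
    (fun b => V * (M / (1 + b ^ 2))) (V * (M * PI))).
  - intros n. apply isI_cmult, HT. rewrite Re_mu. generalize (mu_pos n). nra.
  - apply summable_tele.
  - apply dominator_scal; auto. now apply dominator_cauchy.
  - intros n b. specialize (Hb (w * RtoC (cosh b))%C n (Rwb b)). specialize (Hd b).
    assert (C1 := cosh_ge1 b). assert (Pc : 0 <= cosh b ^ m) by (apply pow_le; lra).
    replace (c n * (RtoC (cosh b ^ m) * k (RtoC (mu n) * w * RtoC (cosh b))))%C
      with (RtoC (cosh b ^ m) * ks c k (w * RtoC (cosh b)) n)%C.
    2: { unfold ks. rewrite <- (Cmult_assoc (RtoC (mu n))). ring. }
    rewrite Cmod_mult, Cmod_RtoC_pos by auto. rewrite Re_scal_cosh in Hb. rewrite Cmod_mult, (Cmod_RtoC_pos (cosh b)) in Hb by lra.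
    set (e := exp (- (Re w * cosh b))) in *. assert (Pe : 0 < e) by apply exp_pos.
    assert (Pt := tele_pos n).
    assert (X : (1 + / (Re w * cosh b)) ^ N <= (1 + / Re w) ^ N).
    { apply pow_incr. assert (0 < Re w * cosh b) by nra. assert (0 < / (Re w * cosh b)) by now apply Rinv_0_lt_compat.
      assert (/ (Re w * cosh b) <= / Re w) by (apply Rinv_le_contravar; nra). lra. }
    assert (X0 : 0 <= (1 + / (Re w * cosh b)) ^ N).
    { apply pow_le. assert (0 < Re w * cosh b) by nra. assert (0 < / (Re w * cosh b)) by now apply Rinv_0_lt_compat. lra. }
    apply Rle_trans with (cosh b ^ m * (W * (1 + / Re w) ^ N * ((1 + Cmod w) * cosh b) * e * tele n)).
    + apply Rmult_le_compat_l; auto. eapply Rle_trans; [ exact Hb |].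
      apply Rmult_le_compat_r; [ lra |]. apply Rmult_le_compat_r; [ lra |].
      apply Rmult_le_compat; [ apply Rmult_le_pos; auto | nra | apply Rmult_le_compat_l; auto | nra ].
    + replace (cosh b ^ m * (W * (1 + / Re w) ^ N * ((1 + Cmod w) * cosh b) * e * tele n)) with (tele n * (V * (cosh b ^ S m * e)))
        by (unfold V; simpl; ring).
      apply Rmult_le_compat_l; [ lra |]. apply Rmult_le_compat_l; auto.
  - intros b. assert (J := KS_isS c k B nu A p Hc Hk _ (Rwb b)).
    apply (isS_ext (fun n => RtoC (cosh b ^ m) * ks c k (w * RtoC (cosh b)) n)%C).
    + intros n. unfold ks. rewrite <- (Cmult_assoc (RtoC (mu n))). ring.
    + now apply isS_cmult.
  - intros a b. apply ccont_exI_all. intros x. apply (ccont_scal_cosh (KS c k)).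
    apply (KS_holo c k B nu A p Hc Hk Hh). apply Rwb.
Qed.

Lemma decays_KS_odd c B nu : poly_bounded c B nu ->
  (forall v, 0 < Re v -> KS c (kmel true) (/ v)%C = (epsSign true * v * KS c (kmel true) v)%C) -> decays (KS c (kmel true)).
Proof.
  intros Hc Hi. destruct (KS_bounded _ _ _ _ _ _ Hc (kmel_bounded true)) as (W & N & HW & Hb & _).
  apply (decays_of_inversion _ _ _ W W W N N N HW HW HW Hb Hb Hb).
  intros v Hv Hv1. assert (Hn : v <> 0) by (apply Re_neq0; lra). assert (Pv := Cmod_neq0 v Hn).
  assert (Ru : 0 < Re (/ v)%C) by (rewrite Re_inv by auto; apply Rdiv_lt_0_compat; auto; now apply pow_lt).
  specialize (Hi _ Ru). rewrite Cinv_invol in Hi by auto. rewrite Hi. unfold epsSign.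
  rewrite !Cmod_mult, Cmod_R. set (u := Cmod (/ v)%C).
  assert (Pu : 1 <= u) by (unfold u; rewrite Cmod_inv by auto; rewrite <- Rinv_1; apply Rinv_le_contravar; lra).
  assert (Gp := Cmod_ge_0 (KS c (kmel true) (/ v)%C)). replace (Rabs (-1)) with 1 by (unfold Rabs; destruct Rcase_abs; lra).
  assert (u <= u ^ 3) by (simpl; nra). nra.
Qed.

Lemma Ci_sg_inv (sg : R) (y : C) : sg = 1 \/ sg = -1 -> y <> 0 -> (Ci * RtoC sg * / (- Ci * RtoC sg * y) = - / y)%C.
Proof.
  intros Hsg Hy. assert (Hs : RtoC sg <> 0) by (apply RtoC_neq0; destruct Hsg; lra).
  assert (Ci <> 0) by (apply Im_neq0; rewrite Im_Ci; lra). field. repeat split; auto.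
Qed.

(** The first integral of [rotate] is evaluated by [bessel_abel] term by term. In the second, the
    inversion formula replaces the value at w / cosh b by -(cosh b / w) times the value at cosh b /
    w: the weight sech cancels and the same evaluation applies at 1/w. The constant does not depend
    on the coefficients. *)
Lemma bessel_odd : exists kap : C, kap <> 0 /\ forall c B nu, poly_bounded c B nu ->
  (forall v, 0 < Re v -> KS c (kmel true) (/ v)%C = (epsSign true * v * KS c (kmel true) v)%C) ->
  forall y sg, sg = 1 \/ sg = -1 -> 0 < Re y -> 0 < sg * Im y -> let w := (- Ci * RtoC sg * y)%C in
  IntR (ray (KS c (kmel true)) y) = (kap * (KS c kexp w - / y * KS c kexp (/ w)))%C.
Proof.
  destruct bessel_abel as (c0 & Hc0 & HB). assert (PP := PI_RGT_0).
  assert (H2pi : RtoC (2 * PI) <> 0) by (apply RtoC_neq0; lra).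
  exists (c0 / RtoC (2 * PI) / RtoC 2)%C. split.
  { intros E. apply Hc0. replace c0 with (c0 / RtoC (2 * PI) / RtoC 2 * RtoC (2 * PI) * RtoC 2)%C by (field; auto). rewrite E. ring. }
  intros c B nu Hc Hi y sg Hsg Hy1 Hy2 w.
  assert (Hny : y <> 0) by (apply Re_neq0; lra).
  assert (Rw : Re w = sg * Im y) by (unfold w; reim; ring). assert (Rw0 : 0 < Re w) by lra.
  assert (Hnw : w <> 0) by (apply Re_neq0; lra). assert (Pw := Cmod_neq0 w Hnw).
  assert (Ru : 0 < Re (/ w)%C) by (rewrite Re_inv by auto; apply Rdiv_lt_0_compat; auto; now apply pow_lt).
  assert (K : forall u, 0 < Re u -> isI (fun b => KS c (kmel true) (u * RtoC (cosh b)))%C (c0 / RtoC (2 * PI) * KS c kexp u)%C).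
  { intros u Hu. destruct (KS_cosh c (kmel true) B nu 4 1 0 (fun u => c0 / RtoC (2 * PI) * kexp u)%C u Hc (kmel_bounded true) (kmel_holo true) Hu) as (L & SL & IL).
    { intros z Hz. apply (isI_ext (fun b => / RtoC (2 * PI) * (z * (RtoC (cosh b) * K0 (z * RtoC (cosh b)))))%C).
      - intros b. unfold kmel. simpl pow. ring.
      - replace (c0 / RtoC (2 * PI) * kexp z)%C with (/ RtoC (2 * PI) * (c0 * Cexp (- z)))%C by (unfold kexp, Cdiv; ring).
        apply isI_cmult. apply (proj1 (HB z Hz)). }
    assert (E : L = (c0 / RtoC (2 * PI) * KS c kexp u)%C).
    { eapply isS_unique; [ exact SL |]. apply (isS_ext (fun n => c0 / RtoC (2 * PI) * ks c kexp u n)%C); [ intros; unfold ks; ring |].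
      apply isS_cmult, (KS_isS c kexp B nu 1 0 Hc kexp_bounded u Hu). }
    rewrite <- E. apply (isI_ext _ _ _ ltac:(intros b; simpl pow; apply Cmult_1_l) IL). }
  rewrite (rotate (KS c (kmel true)) y sg (c0 / RtoC (2 * PI) * KS c kexp w)%C (- / w * (c0 / RtoC (2 * PI) * KS c kexp (/ w)))%C); auto.
  - assert (Q := Ci_sg_inv sg y Hsg Hny). fold w in Q.
    replace (Ci * RtoC sg * (- / w * (c0 / RtoC (2 * PI) * KS c kexp (/ w)) / RtoC 2))%C
      with (- (Ci * RtoC sg * / w) * (c0 / RtoC (2 * PI) / RtoC 2 * KS c kexp (/ w)))%C by (unfold Cdiv; ring).
    rewrite Q. unfold Cdiv. ring.
  - apply (KS_holo _ _ _ _ _ _ Hc (kmel_bounded true)), kmel_holo.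
  - eapply decays_KS_odd; eauto.
  - fold w. apply (isI_ext (fun b => - / w * KS c (kmel true) (/ w * RtoC (cosh b)))%C).
    + intros b. assert (C1 := cosh_ge1 b). assert (Hcb : RtoC (cosh b) <> 0) by (apply RtoC_neq0; lra).
      rewrite RtoC_inv by lra.
      replace (w * / RtoC (cosh b))%C with (/ (/ w * RtoC (cosh b)))%C by (field; auto).
      rewrite Hi by (rewrite Re_scal_cosh; nra). unfold epsSign. replace (RtoC (-1)) with (- RtoC 1)%C by (rewrite <- RtoC_opp; reflexivity).
      field. auto.
    + apply isI_cmult. exact (K _ Ru).
Qed.

(** The derivative of the K_0-series is the K_1-series with these coefficients; the sign is that of
    K_0' = - K_1. *)
Definition dcoef (c : nat -> C) (n : nat) : C := (- (c n * RtoC (mu n)))%C.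

Lemma dcoef_bounded c B nu : poly_bounded c B nu -> poly_bounded (dcoef c) (8 * B) (S nu).
Proof.
  intros [HB H]. split; [ lra |]. intros n. unfold dcoef. rewrite Cmod_opp, Cmod_mult, Cmod_RtoC_pos by (left; apply mu_pos).
  destruct (mu_bounds n). assert (M0 := mu_pos n). specialize (H n). assert (Q := INR_S_ge1 n).
  assert (0 <= INR (S n) ^ nu) by (apply pow_le; lra). rewrite <- tech_pow_Rmult.
  replace (8 * B * (INR (S n) * INR (S n) ^ nu)) with ((B * INR (S n) ^ nu) * (8 * INR (S n))) by ring.
  apply Rmult_le_compat; [ apply Cmod_ge_0 | lra | auto | exact (proj2 (mu_bounds n)) ].
Qed.

Lemma K1_holo : rhp_holo K1.
Proof. intros z Hz. now apply K1_cdiff. Qed.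

Lemma KS_K0_cder c B nu v : poly_bounded c B nu -> 0 < Re v -> cder (KS c K0) v (KS (dcoef c) K1 v).
Proof.
  intros Hc Hv. destruct (KS_cder c K0 (fun z => - K1 z)%C B nu 4 1 v Hc K0_kernel_bounded ltac:(intros; now apply K0_cder) Hv) as (L & SL & DL).
  replace (KS (dcoef c) K1 v) with L; auto. eapply isS_unique; [ exact SL |].
  apply (isS_ext (ks (dcoef c) K1 v)); [ intros n; unfold ks, dcoef; ring |].
  apply (KS_isS _ _ _ _ _ _ (dcoef_bounded _ _ _ Hc) K1_kernel_bounded v Hv).
Qed.

(** Both sides of g(1/v) = v g(v) are differentiated and compared by uniqueness of the
    derivative. *)
Lemma KS_K1_inversion c B nu : poly_bounded c B nu ->
  (forall v, 0 < Re v -> KS c K0 (/ v)%C = (v * KS c K0 v)%C) ->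
  forall v, 0 < Re v -> KS (dcoef c) K1 (/ v)%C = (- (v * v) * (KS c K0 v + v * KS (dcoef c) K1 v))%C.
Proof.
  intros Hc Hi v Hv. assert (Hn : v <> 0) by (apply Re_neq0; lra). assert (Pv := Cmod_neq0 v Hn).
  assert (Ru : 0 < Re (/ v)%C) by (rewrite Re_inv by auto; apply Rdiv_lt_0_compat; auto; now apply pow_lt).
  assert (D1 := cder_comp (KS c K0) Cinv v _ _ (cder_inv v Hn) (KS_K0_cder c B nu (/ v)%C Hc Ru)).
  assert (D2 := cder_mult (fun u => u) (KS c K0) v _ _ (cder_id v) (KS_K0_cder c B nu v Hc Hv)).
  assert (D3 : cder (fun u => KS c K0 (/ u)%C) v (1 * KS c K0 v + v * KS (dcoef c) K1 v)%C).
  { apply (cder_ext_loc (fun u => u * KS c K0 u)%C _ v _ (Re v) Hv); auto. intros u Hu. symmetry. apply Hi.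
    generalize (Re_close u v). lra. }
  assert (E := cder_unique _ _ _ _ D1 D3).
  replace (KS (dcoef c) K1 (/ v)%C) with (- (v * v) * (KS (dcoef c) K1 (/ v) * - / (v * v)))%C by (field; auto).
  rewrite E. ring.
Qed.

Lemma decays_KS_K1 c B nu : poly_bounded c B nu ->
  (forall v, 0 < Re v -> KS c K0 (/ v)%C = (v * KS c K0 v)%C) -> decays (KS (dcoef c) K1).
Proof.
  intros Hc Hi. destruct (KS_bounded _ _ _ _ _ _ Hc K0_kernel_bounded) as (W & N & HW & Hb & _).
  destruct (KS_bounded _ _ _ _ _ _ (dcoef_bounded _ _ _ Hc) K1_kernel_bounded) as (W' & N' & HW' & Hb' & _).
  apply (decays_of_inversion _ _ _ W' W W' N' N N' HW' HW HW' Hb' Hb Hb').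
  intros v Hv Hv1. assert (Hn : v <> 0) by (apply Re_neq0; lra). assert (Pv := Cmod_neq0 v Hn).
  assert (Ru : 0 < Re (/ v)%C) by (rewrite Re_inv by auto; apply Rdiv_lt_0_compat; auto; now apply pow_lt).
  assert (E := KS_K1_inversion c B nu Hc Hi _ Ru). rewrite Cinv_invol in E by auto. rewrite E.
  rewrite Cmod_mult, Cmod_opp, Cmod_mult. set (u := Cmod (/ v)%C).
  assert (Pu : 1 <= u) by (unfold u; rewrite Cmod_inv by auto; rewrite <- Rinv_1; apply Rinv_le_contravar; lra).
  assert (T := Cmod_triangle (KS c K0 (/ v)%C) (/ v * KS (dcoef c) K1 (/ v))%C). rewrite Cmod_mult in T. fold u in T.
  assert (G1 := Cmod_ge_0 (KS c K0 (/ v)%C)). assert (G2 := Cmod_ge_0 (KS (dcoef c) K1 (/ v)%C)).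
  set (a := Cmod (KS c K0 (/ v)%C)) in *. set (b := Cmod (KS (dcoef c) K1 (/ v)%C)) in *.
  apply Rle_trans with (u * u * (a + u * b)); [ apply Rmult_le_compat_l; nra |].
  replace (u ^ 3 * (a + b)) with (u * u * (u * a + u * b)) by ring. apply Rmult_le_compat_l; nra.
Qed.

(** As for the other parity, but the inverted derivative contains the function and its derivative,
    weighted by cosh b and cosh^2 b; the moment with cosh^2 comes from integration by parts. The
    factor [RtoC sg] is the one that the odd part of f carries in [fA_formula]. *)
Lemma bessel_even : exists kap : C, kap <> 0 /\ forall c B nu, poly_bounded c B nu ->
  (forall v, 0 < Re v -> KS c K0 (/ v)%C = (v * KS c K0 v)%C) ->
  forall y sg, sg = 1 \/ sg = -1 -> 0 < Re y -> 0 < sg * Im y -> let w := (- Ci * RtoC sg * y)%C in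
  (Ci * y * IntR (ray (KS (dcoef c) K1) y))%C = (kap * (RtoC sg * (KS c kexp w - / y * KS c kexp (/ w))))%C.
Proof.
  destruct bessel_abel as (c0 & Hc0 & HB).
  exists (c0 / RtoC 2)%C. split.
  { intros E. apply Hc0. replace c0 with (c0 / RtoC 2 * RtoC 2)%C by field. rewrite E. ring. }
  intros c B nu Hc Hi y sg Hsg Hy1 Hy2 w.
  assert (Hc' := dcoef_bounded _ _ _ Hc).
  assert (Hny : y <> 0) by (apply Re_neq0; lra).
  assert (Rw : Re w = sg * Im y) by (unfold w; reim; ring). assert (Rw0 : 0 < Re w) by lra.
  assert (Hnw : w <> 0) by (apply Re_neq0; lra). assert (Pw := Cmod_neq0 w Hnw).
  assert (Ru : 0 < Re (/ w)%C) by (rewrite Re_inv by auto; apply Rdiv_lt_0_compat; auto; now apply pow_lt).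
  assert (T1 : forall u, 0 < Re u -> isI (fun b => RtoC (cosh b ^ 1) * K0 (u * RtoC (cosh b)))%C (/ u * (c0 * kexp u))%C).
  { intros u Hu. assert (Hnu : u <> 0) by (apply Re_neq0; lra).
    apply (isI_ext (fun b => / u * (u * (RtoC (cosh b) * K0 (u * RtoC (cosh b)))))%C).
    - intros b. rewrite pow_1. field. auto.
    - apply isI_cmult. apply (proj1 (HB u Hu)). }
  assert (T0 : forall u, 0 < Re u -> isI (fun b => RtoC (cosh b ^ 0) * K1 (u * RtoC (cosh b)))%C (/ u * (c0 * kexp u))%C).
  { intros u Hu. assert (Hnu : u <> 0) by (apply Re_neq0; lra).
    apply (isI_ext (fun b => / u * (u * K1 (u * RtoC (cosh b))))%C).
    - intros b. simpl pow. field. auto.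
    - apply isI_cmult. apply (proj2 (HB u Hu)). }
  assert (T2 : forall u, 0 < Re u -> isI (fun b => RtoC (cosh b ^ 2) * K1 (u * RtoC (cosh b)))%C
     (/ u * (c0 * kexp u) + / u * (/ u * (c0 * kexp u)))%C).
  { intros u Hu. assert (Hnu : u <> 0) by (apply Re_neq0; lra).
    destruct (K1_exp_bound (Re u) Hu) as (A1 & HA1 & B1). destruct (K0_exp_bound (Re u) Hu) as (A0 & HA0 & B0).
    assert (I2 := isI_cosh_f K1 A1 (/ 2) (Re u) Hu ltac:(lra) HA1 K1_holo B1 2 u ltac:(lra)).
    match type of I2 with isI _ ?l => set (J2 := l) in * end.
    assert (E := cosh_by_parts K0 (fun z => - K1 z)%C A0 1 u (- (/ u * (c0 * kexp u))) (- J2) (/ u * (c0 * kexp u)) Hu ltac:(lra) HA0).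
    assert (E' : (/ u * (c0 * kexp u) + u * (- J2 - - (/ u * (c0 * kexp u))) = 0)%C).
    { apply E; auto.
      - intros z Hz. apply cdiff_opp. now apply K1_cdiff.
      - intros z Hz. now apply K0_cder.
      - apply (isI_ext (fun b => RtoC (cosh b ^ 1) * K0 (u * RtoC (cosh b)))%C); [ intros; now rewrite pow_1 | auto ].
      - apply (isI_ext (fun b => - RtoC 1 * (RtoC (cosh b ^ 2) * K1 (u * RtoC (cosh b))))%C); [ intros; ring |].
        replace (- J2)%C with (- RtoC 1 * J2)%C by ring. now apply isI_cmult.
      - apply (isI_ext (fun b => - RtoC 1 * (RtoC (cosh b ^ 0) * K1 (u * RtoC (cosh b))))%C); [ intros; simpl pow; ring |].
        replace (- (/ u * (c0 * kexp u)))%C with (- RtoC 1 * (/ u * (c0 * kexp u)))%C by ring. now apply isI_cmult, T0. }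
    replace (/ u * (c0 * kexp u) + / u * (/ u * (c0 * kexp u)))%C with J2; auto.
    replace J2 with (/ u * (c0 * kexp u) + / u * (/ u * (c0 * kexp u)) - / u * (/ u * (c0 * kexp u) + u * (- J2 - - (/ u * (c0 * kexp u)))))%C
      at 1 by (field; auto).
    rewrite E'. ring. }
  assert (SF : forall u, 0 < Re u -> isS (ks c kexp u) (KS c kexp u)).
  { intros u Hu. apply (KS_isS c kexp B nu 1 0 Hc kexp_bounded u Hu). }
  assert (Mu : forall n, RtoC (mu n) <> 0) by (intros n; apply RtoC_neq0; generalize (mu_pos n); lra).
  assert (L0 : isI (fun b => KS (dcoef c) K1 (w * RtoC (cosh b)))%C (- (/ w * (c0 * KS c kexp w)))%C).
  { destruct (KS_cosh _ K1 _ _ 16 2 0 _ w Hc' K1_kernel_bounded K1_holo Rw0 T0) as (L & SL & IL).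
    assert (E : L = (- (/ w * (c0 * KS c kexp w)))%C).
    { eapply isS_unique; [ exact SL |]. apply (isS_ext (fun n => - (/ w * c0) * ks c kexp w n)%C).
      - intros n. unfold ks, dcoef. field. auto.
      - replace (- (/ w * (c0 * KS c kexp w)))%C with (- (/ w * c0) * KS c kexp w)%C by ring. now apply isS_cmult, SF. }
    rewrite <- E. apply (isI_ext _ _ _ ltac:(intros b; simpl pow; apply Cmult_1_l) IL). }
  set (u := (/ w)%C) in *.
  assert (L2 : isI (fun b => - (u * u) * (RtoC (cosh b ^ 1) * KS c K0 (u * RtoC (cosh b)))
       (* Termwise the K_0 part gives -(u / mu n) and the K_1 part u^2 + u / mu n, up to the same
          factor: the terms with 1 / mu n cancel, and a pure exponential series at u remains. *)
       + - (u * u * u) * (RtoC (cosh b ^ 2) * KS (dcoef c) K1 (u * RtoC (cosh b))))%C (u * u * (c0 * KS c kexp u))%C).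
  { destruct (KS_cosh _ K1 _ _ 16 2 2 _ u Hc' K1_kernel_bounded K1_holo Ru T2) as (L & SL & IL).
    destruct (KS_cosh _ K0 _ _ 4 1 1 _ u Hc K0_kernel_bounded K0_holo Ru T1) as (L' & SL' & IL').
    assert (Hnu : u <> 0) by (apply Re_neq0; lra).
    replace (u * u * (c0 * KS c kexp u))%C with (- (u * u) * L' + - (u * u * u) * L)%C.
    - apply isI_plus; now apply isI_cmult.
    - eapply isS_unique; [ apply isS_plus; [ apply (isS_cmult (- (u * u))%C), SL' | apply (isS_cmult (- (u * u * u))%C), SL ] |].
      apply (isS_ext (fun n => (u * u * c0) * ks c kexp u n)%C).
      + intros n. unfold ks, dcoef. field. auto.
      + replace (u * u * (c0 * KS c kexp u))%C with ((u * u * c0) * KS c kexp u)%C by ring. now apply isS_cmult, SF. }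
  rewrite (rotate (KS (dcoef c) K1) y sg (- (/ w * (c0 * KS c kexp w)))%C (u * u * (c0 * KS c kexp u))%C); auto.
  - assert (Hs : RtoC sg <> 0) by (apply RtoC_neq0; destruct Hsg; lra).
    assert (Hci : Ci <> 0) by (apply Im_neq0; rewrite Im_Ci; lra).
    assert (s2 : (RtoC sg * RtoC sg = 1)%C) by (rewrite <- RtoC_mult; f_equal; destruct Hsg as [-> | ->]; ring).
    assert (Eu : u = (Ci * RtoC sg * / y)%C).
    { unfold u, w. replace (/ (- Ci * RtoC sg * y))%C with (- (Ci * Ci) * (RtoC sg * RtoC sg) * / (- Ci * RtoC sg * y))%C.
      - field. auto.
      - rewrite s2. assert (c2 : (Ci * Ci = - RtoC 1)%C) by Csolve. rewrite c2. ring. }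
    set (X := KS c kexp w). set (Y := KS c kexp u).
    assert (c2 : (Ci * Ci = - RtoC 1)%C) by Csolve.
    fold u. rewrite Eu.
    replace (Ci * y * (- (Ci * RtoC sg * / y * (c0 * X)) / RtoC 2 -
       Ci * RtoC sg * (Ci * RtoC sg * / y * (Ci * RtoC sg * / y) * (c0 * Y) / RtoC 2)))%C
      with (- (Ci * Ci) * (c0 / RtoC 2 * (RtoC sg * (X + (Ci * Ci) * (RtoC sg * RtoC sg) * / y * Y))))%C by (field; auto).
    rewrite s2, c2. ring.
  - apply (KS_holo _ _ _ _ _ _ Hc' K1_kernel_bounded), K1_holo.
  - eapply decays_KS_K1; eauto.
  - fold w. refine (isI_ext _ _ _ _ L2). intros b. cbv beta.
    assert (C1 := cosh_ge1 b). assert (Hcb : RtoC (cosh b) <> 0) by (apply RtoC_neq0; lra).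
    assert (Hnu : u <> 0) by (apply Re_neq0; lra).
    rewrite RtoC_inv by lra.
    replace (w * / RtoC (cosh b))%C with (/ (u * RtoC (cosh b)))%C by (unfold u; field; auto).
    rewrite (KS_K1_inversion c B nu Hc Hi) by (rewrite Re_scal_cosh; nra).
    rewrite pow_1. replace (RtoC (cosh b ^ 2)) with (RtoC (cosh b) * RtoC (cosh b))%C by (rewrite <- RtoC_mult; f_equal; ring).
    field. auto.
Qed.

(** * The functions of the two half-planes *)

Lemma Cexp_2pi_nat (sg : R) k : sg = 1 \/ sg = -1 -> Cexp (Ci * RtoC (sg * (2 * PI * INR k)))%C = 1.
Proof.
  intros Hsg. rewrite Cexp_Im.
  assert (C1 : cos (2 * PI * INR k) = 1) by (rewrite <- cos_0, <- (cos_period 0 k); f_equal; ring).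
  assert (S1 : sin (2 * PI * INR k) = 0) by (rewrite <- sin_0, <- (sin_period 0 k); f_equal; ring).
  destruct Hsg as [-> | ->].
  - rewrite Rmult_1_l, C1, S1. reflexivity.
  - replace (-1 * (2 * PI * INR k)) with (- (2 * PI * INR k)) by ring. rewrite cos_neg, sin_neg, C1, S1, Ropp_0. reflexivity.
Qed.

Lemma kexp_isS c B nu w : poly_bounded c B nu -> 0 < Re w -> isS (ks c kexp w) (KS c kexp w).
Proof. intros Hc Hw. apply (KS_isS c kexp B nu 1 0 Hc kexp_bounded w Hw). Qed.

Lemma kexp_period c B nu w sg : poly_bounded c B nu -> sg = 1 \/ sg = -1 -> 0 < Re w ->
  KS c kexp (w - Ci * RtoC sg)%C = KS c kexp w.
Proof.
  intros Hc Hsg Hw. apply CSeries_eq. apply (isS_ext (ks c kexp w)); [| eapply kexp_isS; eauto ].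
  intros n. unfold ks, kexp. replace (- (RtoC (mu n) * (w - Ci * RtoC sg)))%C
    with (- (RtoC (mu n) * w) + Ci * RtoC (sg * mu n))%C by (rewrite RtoC_mult; ring).
  rewrite Cexp_add. unfold mu at 3. rewrite Cexp_2pi_nat by auto. ring.
Qed.

Section Eichler.

Variables (A : Z -> C) (B0 B1 : R) (n0 n1 : nat).

Hypothesis Heven : poly_bounded (coef A false) B0 n0.

Hypothesis Hodd : poly_bounded (coef A true) B1 n1.

(** The point w = - Ci sg y is unchanged under y -> -y, because sg changes too. Hence [Fe] carries
    the part of f that is even in y, although its coefficients A_m - A_(-m) belong to eps = 1, and
    [Fo], built on A_m + A_(-m), carries the odd part. *)
Let Fe := KS (coef A true) kexp.

Let Fo := KS (coef A false) kexp.

Lemma upTerm_isS y : 0 < Im y -> isS (upTerm A y) (/ RtoC 2 * (Fe (- Ci * y) + Fo (- Ci * y)))%C.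
Proof.
  intros Hy. assert (Hw : 0 < Re (- Ci * y)%C) by (reim; lra).
  apply (isS_ext (fun n => / RtoC 2 * (ks (coef A true) kexp (- Ci * y) n + ks (coef A false) kexp (- Ci * y) n))%C).
  - intros n. unfold ks, upTerm, coef, epsSign, kexp, e2pi, mu.
    replace (- (RtoC (2 * PI * INR (S n)) * (- Ci * y)))%C with ((0, (2 * PI)%R) * (RtoC (INR (S n)) * y))%C by Csolve.
    replace (RtoC (-1)) with (- RtoC 1)%C by (rewrite <- RtoC_opp; reflexivity). field.
  - apply isS_cmult, isS_plus; eapply kexp_isS; eauto.
Qed.

Lemma lowTerm_isS y : Im y < 0 -> isS (lowTerm A y) (/ RtoC 2 * (Fo (Ci * y) - Fe (Ci * y)))%C.
Proof.
  intros Hy. assert (Hw : 0 < Re (Ci * y)%C) by (reim; lra).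
  apply (isS_ext (fun n => / RtoC 2 * (ks (coef A false) kexp (Ci * y) n - ks (coef A true) kexp (Ci * y) n))%C).
  - intros n. unfold ks, lowTerm, coef, epsSign, kexp, e2pi, mu.
    replace (- (RtoC (2 * PI * INR (S n)) * (Ci * y)))%C with ((0, (2 * PI)%R) * (RtoC (- INR (S n)) * y))%C by Csolve.
    replace (RtoC (-1)) with (- RtoC 1)%C by (rewrite <- RtoC_opp; reflexivity). field.
  - apply isS_cmult, isS_minus; eapply kexp_isS; eauto.
Qed.

Lemma fA_formula y sg : sg = 1 \/ sg = -1 -> 0 < sg * Im y ->
  fA A y = (/ RtoC 2 * (Fe (- Ci * RtoC sg * y) + RtoC sg * Fo (- Ci * RtoC sg * y)))%C.
Proof.
  intros [-> | ->] Hy; unfold fA; destruct Rlt_dec; try lra.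
  - rewrite (CSeries_eq _ _ (upTerm_isS y ltac:(lra))).
    replace (- Ci * RtoC 1 * y)%C with (- Ci * y)%C by ring. ring.
  - rewrite (CSeries_eq _ _ (lowTerm_isS y ltac:(lra))).
    replace (RtoC (-1)) with (- RtoC 1)%C by (rewrite <- RtoC_opp; reflexivity).
    replace (- Ci * - RtoC 1 * y)%C with (Ci * y)%C by ring. ring.
Qed.

Lemma sign_cases (x : R) : x <> 0 -> exists sg, (sg = 1 \/ sg = -1) /\ 0 < sg * x.
Proof.
  intros H. destruct (Rlt_dec 0 x); [ exists 1; split; [ now left | lra ] | exists (-1); split; [ now right | lra ] ].
Qed.

Lemma fA_neg_formula y sg : sg = 1 \/ sg = -1 -> 0 < sg * Im y ->
  fA A (- y) = (/ RtoC 2 * (Fe (- Ci * RtoC sg * y) - RtoC sg * Fo (- Ci * RtoC sg * y)))%C.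
Proof.
  intros Hsg Hy. rewrite (fA_formula (- y) (- sg)).
  - replace (- Ci * RtoC (- sg) * - y)%C with (- Ci * RtoC sg * y)%C by (rewrite RtoC_opp; ring). rewrite RtoC_opp. ring.
  - destruct Hsg as [-> | ->]; [ right | left ]; ring.
  - reim. lra.
Qed.

Lemma Re_rot sg (y : C) : Re (- Ci * RtoC sg * y)%C = sg * Im y.
Proof. reim. ring. Qed.

Lemma Im_close (u v : C) : Rabs (Im u - Im v) <= Cmod (u - v)%C.
Proof. rewrite <- Im_minus. apply im_le_Cmod. Qed.

Lemma KS_kexp_cdiff c B nu (g : C -> C) z : poly_bounded c B nu -> cdiff g z -> 0 < Re (g z) -> cdiff (fun u => KS c kexp (g u)) z.
Proof.
  intros Hc Hg Hz. apply (cdiff_comp (KS c kexp)); auto. apply (KS_holo _ _ _ _ _ _ Hc kexp_bounded kexp_holo). auto.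
Qed.

Lemma fA_cdiff y : Im y <> 0 -> cdiff (fA A) y.
Proof.
  intros Hy. destruct (sign_cases _ Hy) as (sg & Hsg & Hp).
  apply (cdiff_ext_loc (fun u => / RtoC 2 * (Fe (- Ci * RtoC sg * u) + RtoC sg * Fo (- Ci * RtoC sg * u)))%C _ y (sg * Im y) Hp).
  - intros u Hu. symmetry. apply fA_formula; auto. generalize (Im_close u y). intros H.
    apply Rabs_le_between in H. destruct Hsg as [-> | ->]; lra.
  - cd; unfold Fe, Fo.
    + apply (KS_kexp_cdiff _ _ _ (fun u => - Ci * RtoC sg * u)%C y Hodd); [ cd | rewrite Re_rot; auto ].
    + apply (KS_kexp_cdiff _ _ _ (fun u => - Ci * RtoC sg * u)%C y Heven); [ cd | rewrite Re_rot; auto ].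
Qed.

Lemma fA_period y : Im y <> 0 -> fA A (y + 1) = fA A y.
Proof.
  intros Hy. destruct (sign_cases _ Hy) as (sg & Hsg & Hp).
  rewrite (fA_formula y sg), (fA_formula (y + 1) sg); auto; [| reim; lra ].
  replace (- Ci * RtoC sg * (y + 1))%C with (- Ci * RtoC sg * y - Ci * RtoC sg)%C by ring.
  unfold Fe, Fo. rewrite (kexp_period _ _ _ _ sg Hodd), (kexp_period _ _ _ _ sg Heven); auto; rewrite Re_rot; auto.
Qed.

Hypothesis Ieven : forall v, 0 < Re v -> KS (coef A false) K0 (/ v)%C = (v * KS (coef A false) K0 v)%C.

Hypothesis Iodd : forall v, 0 < Re v -> KS (coef A true) (kmel true) (/ v)%C = (epsSign true * v * KS (coef A true) (kmel true) v)%C.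

(** One formula holds for both signs of Im y: the integrals in [bessel_odd] and [bessel_even] do not
    involve sg, and the sg in the evaluation of the latter matches the sign in front of [Fo]. Taking
    eta = -1 gives the period function of y -> f(-y), used when the lower left entry is negative. *)
Lemma period_function (eta : R) : eta = 1 \/ eta = -1 -> exists Psi, (forall y, 0 < Re y -> cdiff Psi y) /\
  forall y, 0 < Re y -> Im y <> 0 -> Psi y = (fA A (RtoC eta * y) - / y * fA A (RtoC eta * - / y))%C.
Proof.
  intros Heta. destruct bessel_odd as (k1 & Hk1 & H1). destruct bessel_even as (k0 & Hk0 & H0).
  specialize (H1 _ _ _ Hodd Iodd). specialize (H0 _ _ _ Heven Ieven).
  set (G1 := KS (coef A true) (kmel true)) in *. set (G0 := KS (dcoef (coef A false)) K1) in *.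
  assert (R1 : rhp_holo G1) by (apply (KS_holo _ _ _ _ _ _ Hodd (kmel_bounded true)), kmel_holo).
  assert (R0 : rhp_holo G0) by (apply (KS_holo _ _ _ _ _ _ (dcoef_bounded _ _ _ Heven) K1_kernel_bounded), K1_holo).
  assert (D1 : decays G1) by (eapply decays_KS_odd; eauto).
  assert (D0 : decays G0) by (eapply decays_KS_K1; eauto).
  exists (fun y => / RtoC 2 * (/ k1 * IntR (ray G1 y) + RtoC eta * / k0 * (Ci * y * IntR (ray G0 y))))%C. split.
  - intros y Hy. assert (E1 := IntR_ray_cdiff G1 y R1 D1 Hy). assert (E0 := IntR_ray_cdiff G0 y R0 D0 Hy). cd.
  - intros y Hy Him. destruct (sign_cases _ Him) as (sg & Hsg & Hp).
    cbv zeta in H1, H0. rewrite (H1 y sg Hsg Hy Hp), (H0 y sg Hsg Hy Hp). fold Fe Fo.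
    assert (Hny : y <> 0) by (apply Re_neq0; lra). assert (Py := Cmod_neq0 y Hny).
    set (w := (- Ci * RtoC sg * y)%C).
    assert (Q : forall z, 0 < sg * Im z -> fA A (RtoC eta * z) = (/ RtoC 2 * (Fe (- Ci * RtoC sg * z) + RtoC eta * (RtoC sg * Fo (- Ci * RtoC sg * z))))%C).
    { intros z Hz. destruct Heta as [-> | ->].
      - replace (RtoC 1 * z)%C with z by ring. rewrite (fA_formula z sg Hsg Hz). ring.
      - replace (RtoC (-1)) with (- RtoC 1)%C by (rewrite <- RtoC_opp; reflexivity).
        replace (- RtoC 1 * z)%C with (- z)%C by ring. rewrite (fA_neg_formula z sg Hsg Hz). ring. }
    rewrite (Q y Hp), (Q (- / y)%C).
    + fold w. replace (- Ci * RtoC sg * - / y)%C with (/ w)%C.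
      * field. auto.
      * assert (Hs : RtoC sg <> 0) by (apply RtoC_neq0; destruct Hsg; lra).
        assert (Hci : Ci <> 0) by (apply Im_neq0; rewrite Im_Ci; lra).
        assert (s2 : (RtoC sg * RtoC sg = 1)%C) by (rewrite <- RtoC_mult; f_equal; destruct Hsg as [-> | ->]; ring).
        assert (c2 : (Ci * Ci = - RtoC 1)%C) by Csolve.
        unfold w. replace (/ (- Ci * RtoC sg * y))%C with (- (Ci * Ci) * (RtoC sg * RtoC sg) * / (- Ci * RtoC sg * y))%C
          by (rewrite s2, c2; ring).
        field. auto.
    + rewrite Im_opp, Im_inv by auto. replace (sg * - (- Im y / Cmod y ^ 2)) with (sg * Im y / Cmod y ^ 2) by (field; lra).
      apply Rdiv_lt_0_compat; auto. now apply pow_lt.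
Qed.

End Eichler.

(** * Cocycles of the full modular group *)

Definition slash (f : C -> C) (a b c d : Z) (y : C) : C :=
  (/ (RtoC (IZR c) * y + RtoC (IZR d)) * f ((RtoC (IZR a) * y + RtoC (IZR b)) / (RtoC (IZR c) * y + RtoC (IZR d))))%C.

Lemma cocycle_slash a b c d f y : cocycle 1 a b c d f y = (slash f a b c d y - f y)%C.
Proof.
  unfold cocycle, slash. cbv zeta. change (- (1))%Z with (-1)%Z. cbn [Cpowz]. change (Pos.to_nat 1) with 1%nat. cbn [Cpown]. now rewrite Cmult_1_r.
Qed.

Lemma Im_aff c d (y : C) : Im (RtoC (IZR c) * y + RtoC (IZR d))%C = IZR c * Im y.
Proof. reim. ring. Qed.

Lemma Re_aff c d (y : C) : Re (RtoC (IZR c) * y + RtoC (IZR d))%C = IZR c * Re y + IZR d.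
Proof. reim. ring. Qed.

Lemma Cgamma_spec c d (y : C) : Cgamma c d y <-> (IZR c * Im y <> 0 \/ 0 < IZR c * Re y + IZR d).
Proof.
  unfold Cgamma. cbv zeta. rewrite Im_aff, Re_aff. split.
  - intros H. destruct (classic (IZR c * Im y = 0)) as [E | E]; [ right | now left ].
    apply Rnot_le_lt. tauto.
  - intros [H | H] [H1 H2]; [ tauto | lra ].
Qed.

Definition slit (y : C) : Prop := Im y <> 0 \/ 0 < Re y.

Section Cocycles.

Variables (f Psi : C -> C).

Hypothesis f_holo : forall y, Im y <> 0 -> cdiff f y.

Hypothesis f_per : forall y, Im y <> 0 -> f (y + 1)%C = f y.

Hypothesis Psi_holo : forall y, 0 < Re y -> cdiff Psi y.

Hypothesis Psi_eq : forall y, 0 < Re y -> Im y <> 0 -> Psi y = (f y - / y * f (- / y))%C.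

Lemma f_per_nat n y : Im y <> 0 -> f (y + RtoC (INR n))%C = f y.
Proof.
  intros Hy. induction n; [ simpl; f_equal; ring |]. rewrite S_INR, RtoC_plus, Cplus_assoc, f_per; auto. reim. lra.
Qed.

Lemma f_per_Z k y : Im y <> 0 -> f (y + RtoC (IZR k))%C = f y.
Proof.
  intros Hy. destruct (Z_le_gt_dec 0 k) as [L | L].
  - rewrite <- (Z2Nat.id k) by auto. rewrite <- INR_IZR_INZ. now apply f_per_nat.
  - rewrite <- (f_per_nat (Z.to_nat (- k)) (y + RtoC (IZR k))%C) by (reim; lra).
    rewrite INR_IZR_INZ, Z2Nat.id by lia. rewrite <- Cplus_assoc, <- RtoC_plus, <- plus_IZR.
    replace (k + - k)%Z with 0%Z by lia. f_equal. ring.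
Qed.

(** [Psi] supplies the values on the real axis only: near a positive real point the function agrees
    with [Psi], and off the axis it is the expression in f, holomorphic there. *)
Definition glue (y : C) : C := if Req_EM_T (Im y) 0 then Psi y else (f y - / y * f (- / y))%C.

Lemma glue_eq y : Im y <> 0 -> glue y = (f y - / y * f (- / y))%C.
Proof. intros H. unfold glue. destruct Req_EM_T; tauto. Qed.

Lemma Im_neg_inv (y : C) : Im y <> 0 -> Im (- / y)%C <> 0.
Proof.
  intros H. assert (Hn : y <> 0) by now apply Im_neq0. rewrite Im_opp, Im_inv by auto. assert (P := Cmod_neq0 y Hn).
  intros E. apply H. replace (Im y) with (- (- Im y / Cmod y ^ 2) * Cmod y ^ 2) by (field; lra). rewrite E. ring.
Qed.

Lemma Im_near (u y : C) : Cmod (u - y)%C < Rabs (Im y) -> Im u <> 0.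
Proof.
  intros H E. assert (X := im_le_Cmod (u - y)%C). rewrite Im_minus, E in X. replace (0 - Im y) with (- Im y) in X by ring.
  rewrite Rabs_Ropp in X. lra.
Qed.

Lemma glue_holo y : slit y -> cdiff glue y.
Proof.
  intros H. destruct (classic (Im y = 0)) as [E | E].
  - destruct H as [H | H]; [ tauto |]. apply (cdiff_ext_loc Psi _ y (Re y) H); [| now apply Psi_holo ].
    intros u Hu. unfold glue. destruct Req_EM_T; auto. apply Psi_eq; auto. generalize (Re_close u y). lra.
  - apply (cdiff_ext_loc (fun y => f y - / y * f (- / y))%C _ y (Rabs (Im y))); [ now apply Rabs_pos_lt | |].
    + intros u Hu. symmetry. apply glue_eq. eapply Im_near; eauto.
    + assert (Hn : y <> 0) by now apply Im_neq0.
      assert (D1 := f_holo y E). assert (D2 : cdiff (fun y => f (- / y)%C) y).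
      { apply (cdiff_comp f); [ cd; auto | apply f_holo, Im_neg_inv; auto ]. }
      cd.
Qed.

(* Euclid: with d = k c - r, the matrix is (-b1 a; r c) S T^k, so the lower left entry drops from c to r. *)
Lemma cocycle_extends_pos : forall n : nat, forall a b c d, (0 < c)%Z -> (c < Z.of_nat n)%Z -> SL2Z a b c d ->
  exists g, (forall y, Cgamma c d y -> cdiff g y) /\ forall y, Im y <> 0 -> g y = cocycle 1 a b c d f y.
Proof.
  induction n as [| n IH]; intros a b c d Hc Hn Hdet; [ lia |]. unfold SL2Z in Hdet.
  assert (Pc : 0 < IZR c) by now apply IZR_lt.
  (* [k] is the ceiling of d / c, so that r = k c - d lies in [0, c). *)
  set (k := (- ((- d) / c))%Z). set (r := ((- d) mod c)%Z).
  assert (Hr : (0 <= r < c)%Z) by (apply Z.mod_pos_bound; lia).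
  assert (Hd : d = (k * c - r)%Z) by (unfold k, r; generalize (Z.div_mod (- d) c); lia).
  set (b1 := (b - k * a)%Z).
  assert (Hdet1 : (b1 * c + a * r = -1)%Z) by (unfold b1; nia).
  assert (Sh : forall y, (RtoC (IZR c) * y + RtoC (IZR d) = RtoC (IZR c) * (y + RtoC (IZR k)) - RtoC (IZR r))%C).
  { intros y. rewrite Hd, minus_IZR, mult_IZR, RtoC_minus, RtoC_mult. ring. }
  assert (Nh : forall y, (RtoC (IZR a) * y + RtoC (IZR b) = RtoC (IZR a) * (y + RtoC (IZR k)) + RtoC (IZR b1))%C).
  { intros y. unfold b1. rewrite minus_IZR, mult_IZR, RtoC_minus, RtoC_mult. ring. }
  (* In the variable z = y + k the matrix becomes (a b1; c -r), and the real condition c y + d > 0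
     reads c z > r. *)
  assert (Key : exists g, (forall z, IZR c * Im z <> 0 \/ IZR r < IZR c * Re z -> cdiff g z) /\
    forall z, Im z <> 0 -> g z = (/ (RtoC (IZR c) * z - RtoC (IZR r)) *
      f ((RtoC (IZR a) * z + RtoC (IZR b1)) / (RtoC (IZR c) * z - RtoC (IZR r))) - f z)%C).
  { destruct (Z.eq_dec r 0) as [R0 | R0].
    (* Here the determinant relation is b1 c = -1, which forces c = 1 and b1 = -1: up to a
       translation only S is left. *)
    - exists (fun z => - glue z)%C. rewrite R0 in *. assert (b1 <= -1)%Z by nia. assert (Hc1 : c = 1%Z) by nia. assert (Hb1 : b1 = (-1)%Z) by nia.
      rewrite Hc1, Hb1. split.
      + intros z Hz. apply cdiff_opp, glue_holo. unfold slit. rewrite !Rmult_1_l in Hz. auto.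
      + intros z Hz. rewrite glue_eq by auto. assert (Hnz : z <> 0) by now apply Im_neq0.
        replace ((RtoC (IZR a) * z + RtoC (-1)) / (RtoC 1 * z - RtoC 0))%C with (- / z + RtoC (IZR a))%C.
        2: { replace (RtoC (-1)) with (- RtoC 1)%C by (rewrite <- RtoC_opp; reflexivity). field. auto. }
        rewrite f_per_Z by now apply Im_neg_inv.
        replace (RtoC 1 * z - RtoC 0)%C with z by ring. ring.
    - assert (Pr : 0 < IZR r) by (apply IZR_lt; lia).
      destruct (IH (- b1)%Z a r c ltac:(lia) ltac:(lia)) as (g1 & G1 & E1); [ unfold SL2Z; nia |].
      (* The cocycle relation for a product with S: the cocycle of the smaller matrix (-b1 a; r c),
         slashed by S, plus the cocycle of S, which is - glue. *)
      exists (fun z => / z * g1 (- / z) - glue z)%C. split.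
      (* The domains match: for real z the inequality c z > r gives z > 0 and r (-1/z) + c = (c z -
         r) / z > 0. *)
      + intros z Hz. assert (Hsl : slit z /\ Cgamma r c (- / z)%C).
        { destruct (classic (Im z = 0)) as [Z0 | Z0].
          - destruct Hz as [Hz | Hz]; [ rewrite Z0, Rmult_0_r in Hz; tauto |].
            assert (Rz : 0 < Re z) by nra. split; [ now right |].
            apply Cgamma_spec. right. assert (Hnz : z <> 0) by (apply Re_neq0; lra).
            assert (Pz := Cmod_neq0 z Hnz). assert (M2 : Cmod z ^ 2 = Re z ^ 2) by (rewrite Cmod_pow2, Z0; ring).
            rewrite Re_opp, Re_inv, M2 by auto.
            replace (IZR r * - (Re z / Re z ^ 2) + IZR c) with ((IZR c * Re z - IZR r) / Re z) by (field; lra).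
            apply Rdiv_lt_0_compat; lra.
          - split; [ now left |]. apply Cgamma_spec. left. generalize (Im_neg_inv z Z0). intros.
            apply Rmult_integral_contrapositive; split; auto; lra. }
        destruct Hsl as [Hsl Hg].
        assert (Hnz : z <> 0) by (destruct Hsl; [ now apply Im_neq0 | apply Re_neq0; lra ]).
        assert (D1 : cdiff (fun z => g1 (- / z)%C) z) by (apply (cdiff_comp g1); [ cd; auto | now apply G1 ]).
        assert (D2 := glue_holo z Hsl). cd. auto.
      + intros z Hz. assert (Hnz : z <> 0) by now apply Im_neq0.
        rewrite glue_eq, E1, cocycle_slash by (auto; now apply Im_neg_inv). unfold slash.
        assert (Hden : (RtoC (IZR c) * z - RtoC (IZR r))%C <> 0).
        { apply Im_neq0. reim. nra. }
        rewrite opp_IZR, RtoC_opp.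
        replace (RtoC (IZR r) * - / z + RtoC (IZR c))%C with ((RtoC (IZR c) * z - RtoC (IZR r)) * / z)%C by (field; auto).
        revert Hden. generalize (RtoC (IZR c) * z - RtoC (IZR r))%C. intros D HD.
        replace ((- RtoC (IZR b1) * - / z + RtoC (IZR a)) / (D * / z))%C with ((RtoC (IZR a) * z + RtoC (IZR b1)) / D)%C
          by (field; auto).
        field. auto. }
  destruct Key as (g & Hg & Eg). exists (fun y => g (y + RtoC (IZR k))%C). split.
  - intros y Hy. apply Cgamma_spec in Hy. apply (cdiff_comp g); [ cd |]. apply Hg. reim.
    rewrite Rplus_0_r. destruct Hy as [Hy | Hy]; [ now left | right ].
    rewrite Hd, minus_IZR, mult_IZR in Hy. lra.
  - intros y Hy. rewrite Eg by (reim; lra). rewrite cocycle_slash. unfold slash. rewrite Sh, Nh.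
    rewrite f_per_Z by auto. reflexivity.
Qed.

End Cocycles.

(** A negative lower left entry is reduced to a positive one by the reflection y -> -y, which
    replaces f by f(-y) and (a b; c d) by (a -b; -c d), while c y + d and hence the domain are
    preserved. *)
Lemma cocycle_extends f Psi Psi' : (forall y, Im y <> 0 -> cdiff f y) -> (forall y, Im y <> 0 -> f (y + 1)%C = f y) ->
  (forall y, 0 < Re y -> cdiff Psi y) -> (forall y, 0 < Re y -> Im y <> 0 -> Psi y = (f y - / y * f (- / y))%C) ->
  (forall y, 0 < Re y -> cdiff Psi' y) -> (forall y, 0 < Re y -> Im y <> 0 -> Psi' y = (f (- y) - / y * f (- - / y))%C) ->
  forall a b c d, SL2Z a b c d -> exists g, holo_on (Cgamma c d) g /\
    forall y, Im y <> 0 -> Cgamma c d y -> g y = cocycle 1 a b c d f y.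
Proof.
  intros Hf Hp HP EP HP' EP' a b c d Hdet.
  destruct (Z.lt_total 0 c) as [L | [L | L]].
  - destruct (cocycle_extends_pos f Psi Hf Hp HP EP (S (Z.to_nat c)) a b c d L ltac:(lia) Hdet) as (g & Hg & Eg).
    exists g. split; [ intros y Hy; now apply cdiff_ex_derive, Hg | auto ].
  (* For c = 0 the domain is empty when d = -1, and when d = 1 the matrix is a translation with zero
     cocycle; the zero function serves both. *)
  - subst c. unfold SL2Z in Hdet. exists (fun _ => RtoC 0). split; [ intros y _; apply cdiff_ex_derive, cdiff_const |].
    intros y Hy Hc. apply Cgamma_spec in Hc. destruct Hc as [Hc | Hc]; [ lra |].
    assert (Hd : (0 < d)%Z) by (apply lt_IZR; lra). assert (Had : (a * d = 1)%Z) by lia. assert (0 < a)%Z by nia.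
    assert (d = 1%Z) by nia. assert (a = 1%Z) by nia. subst a d.
    rewrite cocycle_slash. unfold slash.
    replace ((RtoC 1 * y + RtoC (IZR b)) / (RtoC 0 * y + RtoC 1))%C with (y + RtoC (IZR b))%C by field.
    rewrite (f_per_Z f Hp) by auto. field.
  - destruct (cocycle_extends_pos (fun y => f (- y)%C) Psi') with (n := S (Z.to_nat (- c))) (a := a) (b := (- b)%Z) (c := (- c)%Z) (d := d)
      as (g & Hg & Eg); auto; try lia.
    + intros y Hy. apply (cdiff_comp f (fun y => - y)%C); [ cd | apply Hf; reim; lra ].
    + intros y Hy. rewrite <- (Hp (- (y + 1))%C) by (reim; lra). f_equal. ring.
    + unfold SL2Z in *. lia.
    + exists (fun y => g (- y)%C). split.
      * intros y Hy. apply cdiff_ex_derive. apply (cdiff_comp g (fun y => - y)%C); [ cd |]. apply Hg. apply Cgamma_spec. apply Cgamma_spec in Hy.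
        reim. rewrite opp_IZR. destruct Hy as [Hy | Hy]; [ left | right ]; lra.
      * intros y Hy _. rewrite Eg by (reim; lra). rewrite !cocycle_slash. unfold slash.
        rewrite !opp_IZR, !RtoC_opp.
        replace (- RtoC (IZR c) * - y + RtoC (IZR d))%C with (RtoC (IZR c) * y + RtoC (IZR d))%C by ring.
        replace (- ((RtoC (IZR a) * - y + - RtoC (IZR b)) / (RtoC (IZR c) * y + RtoC (IZR d))))%C
          with ((RtoC (IZR a) * y + RtoC (IZR b)) / (RtoC (IZR c) * y + RtoC (IZR d)))%C by (unfold Cdiv; ring).
        replace (- - y)%C with y by ring. reflexivity.
Qed.

Theorem mainTheorem6 (A : Z -> C) (alpha : R) :
  (0 <= alpha)%R ->
  (exists Lam : bool -> C -> C, forall eps : bool,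
     entire (Lam eps) /\ finite_order (Lam eps) /\
     (forall s : C, (Re s > alpha)%R ->
        exists L : C, @is_series C_AbsRing C_NormedModule (Lterm A eps s) L /\
          Lam eps s = Cmult (gammaFactor (Cplus s (epsC eps))) L) /\
     (forall s : C, Lam eps (Cminus (RtoC 1) s) = Cmult (epsSign eps) (Lam eps s))) ->
  (forall y, UHP y -> ex_Cseries (upTerm A y)) /\
  (forall y, LHP y -> ex_Cseries (lowTerm A y)) /\
  holQMF UHP 1 SL2Z (fA A) /\
  holQMF LHP 1 SL2Z (fA A).
Proof.
  intros _ [Lam HLam].
  assert (P : forall eps, exists B nu, poly_bounded (coef A eps) B nu).
  { intros eps. destruct (HLam eps) as (_ & _ & HL & _). apply (coef_poly_bounded A eps alpha).
    intros s Hs. destruct (HL s Hs) as (L & SL & _). now exists L. }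
  destruct (P false) as (B0 & n0 & P0). destruct (P true) as (B1 & n1 & P1).
  assert (I : forall eps B nu, poly_bounded (coef A eps) B nu -> forall v, 0 < Re v ->
    KS (coef A eps) (kmel eps) (/ v)%C = (epsSign eps * v * KS (coef A eps) (kmel eps) v)%C).
  { intros eps B nu Hc. destruct (HLam eps) as (HE & HF & HL & HS).
    apply (theta_inversion A eps alpha (Lam eps) B nu Hc); auto.
    intros z. apply cdiff_ex_derive. now apply HE. }
  assert (I1 := I true _ _ P1). assert (I0 := I false _ _ P0).
  assert (I0' : forall v, 0 < Re v -> KS (coef A false) K0 (/ v)%C = (v * KS (coef A false) K0 v)%C).
  { intros v Hv. specialize (I0 v Hv). unfold epsSign in I0. rewrite Cmult_1_l in I0. exact I0. }
  assert (Hol := fA_cdiff A B0 B1 n0 n1 P0 P1). assert (Per := fA_period A B0 B1 n0 n1 P0 P1).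
  destruct (period_function A B0 B1 n0 n1 P0 P1 I0' I1 1 ltac:(now left)) as (Psi & HP & EP).
  destruct (period_function A B0 B1 n0 n1 P0 P1 I0' I1 (-1) ltac:(now right)) as (Psi' & HP' & EP').
  assert (Q : forall a b c d, SL2Z a b c d -> exists g, holo_on (Cgamma c d) g /\
    forall y, Im y <> 0 -> Cgamma c d y -> g y = cocycle 1 a b c d (fA A) y).
  { assert (M1 : forall z, (RtoC (-1) * z = - z)%C) by (intros z; replace (RtoC (-1)) with (- RtoC 1)%C by (rewrite <- RtoC_opp; reflexivity); ring).
    apply (cocycle_extends (fA A) Psi Psi'); auto.
    - intros y Hy Hi. rewrite EP, !Cmult_1_l by auto. reflexivity.
    - intros y Hy Hi. rewrite EP', !M1 by auto. reflexivity. }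
  split; [| split; [| split; split ] ].
  - intros y Hy. eexists. apply (upTerm_isS A B0 B1 n0 n1 P0 P1 y Hy).
  - intros y Hy. eexists. apply (lowTerm_isS A B0 B1 n0 n1 P0 P1 y Hy).
  - intros y Hy. apply cdiff_ex_derive, Hol. unfold UHP in Hy. lra.
  - intros a b c d Hg. destruct (Q a b c d Hg) as (g & Hh & Eg). exists g. split; auto.
    intros y Hy. apply Eg. unfold UHP in Hy. lra.
  - intros y Hy. apply cdiff_ex_derive, Hol. unfold LHP in Hy. lra.
  - intros a b c d Hg. destruct (Q a b c d Hg) as (g & Hh & Eg). exists g. split; auto.
    intros y Hy. apply Eg. unfold LHP in Hy. lra.
Qed.
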